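(* Let $\Gamma_0$ be a cofinite Fuchsian group, let $Y_0$ be a compact subset of $\Gamma_0\backslash\mathbf{H}$, and let $\delta>1$ and $\eta>0$ be real numbers. There exist real numbers $A$ and $B$ such that the following holds. Let $\Gamma$ be a subgroup of finite index in $\Gamma_0$ such that all non-zero eigenvalues of $-\Delta_\Gamma$ are at least $\eta$. Then for all $z,w\in\mathbf{H}$ whose images in $\Gamma_0\backslash\mathbf{H}$ lie in $Y_0$, we have $$A\le \mathrm{gr}_\Gamma(z,w)+\sum_{\gamma\in\Gamma,\ u(z,\gamma w)\le\delta}\bigl(L(u(z,\gamma w))-L(\delta)\bigr)\le B.$$
   Context: $\mathbf{H}$ is the complex upper half-plane with the hyperbolic metric $(dx^2+dy^2)/y^2$, volume form $\mu_{\mathbf H}=dx\wedge dy/y^2$ and Laplace operator $\Delta=y^2(\partial_x^2+\partial_y^2)$; $\mathrm{SL}_2(\mathbf{R})$ acts by Möbius transformations. For $z,w\in\mathbf{H}$, $u(z,w)=1+\frac{|z-w|^2}{2(\Im z)(\Im w)}$ (the hyperbolic cosine of the distance), and $L(u)=\frac{1}{4\pi}\log\frac{u+1}{u-1}$ for $u>1$. A cofinite Fuchsian group is a discrete subgroup $\Gamma\subset\mathrm{SL}_2(\mathbf{R})$ such that $\Gamma\backslash\mathbf{H}$ has finite volume. Integration over $\Gamma\backslash\mathbf{H}$ is stack-like: it is $1/\#(\Gamma\cap\{\pm1\})$ times the usual integral over the Riemann surface (or a fundamental domain). Put $\mathrm{vol}_\Gamma=\int_{\Gamma\backslash\mathbf{H}}\mu_{\mathbf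 H}$. $\Delta_\Gamma$ is the self-adjoint extension to $L^2(\Gamma\backslash\mathbf{H})$ of $\Delta$ restricted to smooth bounded $\Gamma$-invariant functions. There is a unique bounded self-adjoint operator $G_\Gamma$ on $L^2(\Gamma\backslash\mathbf{H},\mu_{\mathbf H})$ such that for all smooth bounded functions $f$ on $\Gamma\backslash\mathbf{H}$, $\Delta_\Gamma G_\Gamma f=f-\frac{1}{\mathrm{vol}_\Gamma}\int_{\Gamma\backslash\mathbf{H}}f\mu_{\mathbf H}$ and $\int_{\Gamma\backslash\mathbf{H}}G_\Gamma f\,\mu_{\mathbf H}=0$. The Green function $\mathrm{gr}_\Gamma$ is the unique function on $\mathbf{H}\times\mathbf{H}$ that is $\Gamma$-invariant in both variables separately, symmetric, smooth except for logarithmic singularities at points $(z,\gamma z)$ ($\gamma\in\Gamma$), and satisfies $G_\Gamma f(z)=\int_{w\in\Gamma\backslash\mathbf{H}}\mathrm{gr}_\Gamma(z,w)f(w)\mu_{\mathbf H}(w)$ for all smooth bounded $\Gamma$-invariant $f$. At points with $z\in\Gamma w$ the logarithmic singularities of $\mathrm{gr}_\Gamma(z,w)$ and of the terms $L(u(z,\gamma w))$ cancel, and the expression is understood by continuous extension. *)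

(* Defs.v *)
From HB Require Import structures.
From mathcomp Require Import all_boot all_order all_algebra finmap.
From mathcomp Require Import generic_quotient.
From mathcomp Require Import all_classical all_reals all_analysis.
From mathcomp Require Import measurable_realfun.
From mathcomp Require Import complex.
Set Implicit Arguments.
Unset Strict Implicit.
Unset Printing Implicit Defensive.
Import Order.TTheory GRing.Theory Num.Theory.
Import numFieldNormedType.Exports.
Local Open Scope classical_set_scope.
Local Open Scope ring_scope.
Local Open Scope complex_scope.

(* The point x + iy is the pair (x, y). Functions on the half-plane are total
   functions on [R * R]; only their values on [upper_half R] matter. *)
Definition upper_half (R : realType) : set (R * R) := [set z | 0 < z.2].
Arguments upper_half : clear implicits.

Definition mobius (R : realType) (g : 'M[R]_2) (z : R * R) : R * R :=
  let z' : R[i] := z.1 +i* z.2 in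
  let w' := ((g 0 0)%:C * z' + (g 0 1)%:C) / ((g 1 0)%:C * z' + (g 1 1)%:C) in
  (complex.Re w', complex.Im w').

(* Squared Euclidean distance: the library norm on [R * R] is the sup norm. *)
Definition sqdist (R : realType) (z w : R * R) : R :=
  (z.1 - w.1) ^+ 2 + (z.2 - w.2) ^+ 2.

Definition hypu (R : realType) (z w : R * R) : R :=
  1 + sqdist z w / (2 * z.2 * w.2).

Definition hypL (R : realType) (u : R) : R :=
  (4 * pi)^-1 * ln ((u + 1) / (u - 1)).

(* The volume form dx dy / y^2, extended by zero outside the half-plane. *)
Definition hyp_density (R : realType) (z : R * R) : \bar R :=
  (if 0 < z.2 then (z.2 ^+ 2)^-1 else 0)%:E.

Definition hyp_measure (R : realType) (A : set (R * R)) : \bar R :=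
  (\int[(lebesgue_measure \x lebesgue_measure)%E]_(z in A) hyp_density z)%E.

Lemma hyp_density_ge0 (R : realType) (z : R * R) : (0 <= hyp_density z)%E.
Proof. by rewrite lee_fin; case: ifP => // z0; rewrite invr_ge0 exprn_ge0 ?ltW. Qed.

Lemma measurable_hyp_density (R : realType) :
  measurable_fun [set: R * R] (@hyp_density R).
Proof.
apply/measurable_EFinP.
suff mh : measurable_fun setT (fun y : R => if 0 < y then (y ^+ 2)^-1 else 0).
  exact: (measurableT_comp mh measurable_snd).
have -> : (fun y : R => if 0 < y then (y ^+ 2)^-1 else 0) =
          (fun y : R => if 0 < y then y `^ (-2) else 0).
  by apply/funext => y; case: ifPn => // y0; rewrite powRN powR_mulrn ?ltW.
by apply: measurable_fun_ifT => //; exact: measurable_fun_ltr.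
Qed.

Section HypMeasure.
Variable R : realType.

Let hyp_measure0 : @hyp_measure R set0 = 0%E.
Proof. exact: integral_set0. Qed.

Let hyp_measure_ge0 (A : set (R * R)) : (0 <= hyp_measure A)%E.
Proof. by apply: integral_ge0 => z _; exact: hyp_density_ge0. Qed.

Let hyp_measure_sigma_additive : semi_sigma_additive (@hyp_measure R).
Proof.
exact: (@semi_sigma_additive_nng_induced _ _ R
  (lebesgue_measure \x lebesgue_measure)%E (@hyp_density R)
  (@measurable_hyp_density R) (@hyp_density_ge0 R)).
Qed.

HB.instance Definition _ := isMeasure.Build _ _ _ (@hyp_measure R)
  hyp_measure0 hyp_measure_ge0 hyp_measure_sigma_additive.

End HypMeasure.
Arguments hyp_measure : clear implicits.

Definition SL2_subgroup (R : realType) (G : set 'M[R]_2) : Prop :=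
  [/\ G `<=` [set g | \det g = 1], G 1%:M,
      forall g h, G g -> G h -> G (g *m h) &
      forall g, G g -> G (invmx g)].

Definition fuchsian (R : realType) (G : set 'M[R]_2) : Prop :=
  SL2_subgroup G /\ G `<=` isolated G.

Definition finite_index_in (R : realType) (G0 G : set 'M[R]_2) : Prop :=
  G `<=` G0 /\ finite_set [set [set g *m h | h in G] | g in G0].

Definition mobius_orbit (R : realType) (G : set 'M[R]_2) (z : R * R) : set (R * R) :=
  [set mobius g z | g in G].

Definition same_orbit (R : realType) (G : set 'M[R]_2) (z w : upper_half R) :
  bool := `[< mobius_orbit G (\val z) = mobius_orbit G (\val w) >].

Lemma same_orbit_refl (R : realType) (G : set 'M[R]_2) :
  reflexive (same_orbit G).
Proof. by move=> z; exact/asboolP. Qed.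

Lemma same_orbit_sym (R : realType) (G : set 'M[R]_2) :
  symmetric (same_orbit G).
Proof. by move=> z w; apply/asboolP/asboolP => ->. Qed.

Lemma same_orbit_trans (R : realType) (G : set 'M[R]_2) :
  transitive (same_orbit G).
Proof.
by move=> w z t /asboolP zw /asboolP wt; apply/asboolP; rewrite zw wt.
Qed.

Definition same_orbit_equiv (R : realType) (G : set 'M[R]_2) :=
  EquivRel (same_orbit G) (same_orbit_refl G) (same_orbit_sym G)
    (@same_orbit_trans R G).

Definition orbit_space (R : realType) (G : set 'M[R]_2) :=
  quotient_topology {eq_quot same_orbit_equiv G}%qT.

HB.instance Definition _ (R : realType) (G : set 'M[R]_2) :=
  Topological.on (orbit_space G).
HB.instance Definition _ (R : realType) (G : set 'M[R]_2) :=
  Quotient.on (orbit_space G).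

Definition to_orbit_space (R : realType) (G : set 'M[R]_2)
  (z : upper_half R) : orbit_space G := (\pi_(orbit_space G) z)%qT.

(* The points z for which (u(z, i), Re z, Im z) is lexicographically minimal in
   the orbit of z: the Dirichlet polygon centred at i with its boundary
   identifications resolved. When G is discrete, minima exist and the set is a
   Borel set containing exactly one point of each orbit in the half-plane. *)
Definition fundom (R : realType) (G : set 'M[R]_2) : set (R * R) :=
  [set z | upper_half R z /\ forall w, mobius_orbit G z w ->
    hypu z (0, 1) < hypu w (0, 1) \/
    hypu z (0, 1) = hypu w (0, 1) /\
    (z.1 < w.1 \/ z.1 = w.1 /\ z.2 <= w.2)].

Definition cofinite_fuchsian (R : realType) (G : set 'M[R]_2) : Prop :=
  fuchsian G /\ (hyp_measure R (fundom G) < +oo)%E.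

(* The factor 1 / #(G `&` {1, -1}) of stack-like integration. *)
Definition stack_factor (R : realType) (G : set 'M[R]_2) : R :=
  (#|` fset_set (G `&` [set 1%:M; - 1%:M])|%fset%:R)^-1.

Definition qint (R : realType) (G : set 'M[R]_2) (f : R * R -> R) : R :=
  stack_factor G * \int[hyp_measure R]_(z in fundom G) f z.

Definition qintC (R : realType) (G : set 'M[R]_2) (f : R * R -> R[i]) : R[i] :=
  qint G (fun z => complex.Re (f z)) +i* qint G (fun z => complex.Im (f z)).

Definition vol (R : realType) (G : set 'M[R]_2) : R := qint G (fun=> 1).

(* Existence and continuity on U of all iterated directional derivatives of
   order at most n, which for open U in finite dimension is C^n. *)
Fixpoint Cn (R : realType) (V : normedModType R) (n : nat) (U : set V)
    (f : V -> R^o) : Prop :=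
  (forall p, U p -> {for p, continuous f}) /\
  if n is m.+1 then
    forall v, (forall p, U p -> derivable f p v) /\ Cn m U ('D_v f)
  else True.

Definition smooth (R : realType) (V : normedModType R) (U : set V)
  (f : V -> R^o) : Prop := forall n, Cn n U f.

Definition mobius_invariant (R : realType) (T : Type) (G : set 'M[R]_2)
    (f : R * R -> T) : Prop :=
  forall g z, G g -> upper_half R z -> f (mobius g z) = f z.

Definition smooth_bounded (R : realType) (G : set 'M[R]_2)
    (f : R * R -> R[i]) : Prop :=
  [/\ mobius_invariant G f,
      smooth (upper_half R) (fun z => complex.Re (f z)),
      smooth (upper_half R) (fun z => complex.Im (f z)) &
      exists M : R, forall z, upper_half R z -> `|f z| <= M%:C].

Definition lap (R : realType) (f : R * R -> R^o) (z : R * R) : R :=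
  z.2 ^+ 2 * ('D_(1, 0) ('D_(1, 0) f) z + 'D_(0, 1) ('D_(0, 1) f) z).

Definition lapC (R : realType) (f : R * R -> R[i]) (z : R * R) : R[i] :=
  lap (fun z => complex.Re (f z)) z +i* lap (fun z => complex.Im (f z)) z.

(* Elements of L^2 are given by invariant representatives, equal up to [aeeq]. *)
Definition L2 (R : realType) (G : set 'M[R]_2) (f : R * R -> R[i]) : Prop :=
  [/\ mobius_invariant G f,
      measurable_fun (upper_half R) (fun z => complex.Re (f z)),
      measurable_fun (upper_half R) (fun z => complex.Im (f z)) &
      (\int[hyp_measure R]_(z in fundom G)
         (complex.Re (f z) ^+ 2 + complex.Im (f z) ^+ 2)%:E < +oo)%E].

Definition aeeq (R : realType) (f g : R * R -> R[i]) : Prop :=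
  {ae hyp_measure R, forall z, f z = g z}.

Definition inner (R : realType) (G : set 'M[R]_2) (f g : R * R -> R[i]) : R[i] :=
  qintC G (fun z => f z * (g z)^*).

Definition normsq (R : realType) (G : set 'M[R]_2) (f : R * R -> R[i]) : R :=
  qint G (fun z => complex.Re (f z) ^+ 2 + complex.Im (f z) ^+ 2).

(* A possibly unbounded operator T on L^2 is given by its graph: [T f k] means
   that f is in the domain of T and T f = k. *)
Definition adjoint (R : realType) (G : set 'M[R]_2)
    (T : (R * R -> R[i]) -> (R * R -> R[i]) -> Prop)
    (f k : R * R -> R[i]) : Prop :=
  [/\ L2 G f, L2 G k & forall f' k', T f' k' -> inner G k' f = inner G f' k].

(* Equality with the adjoint forces T to be linear, contained in L^2 x L^2 and
   stable under [aeeq]. *)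
Definition selfadjoint (R : realType) (G : set 'M[R]_2)
    (T : (R * R -> R[i]) -> (R * R -> R[i]) -> Prop) : Prop :=
  [/\ forall f k k', T f k -> T f k' -> aeeq k k',
      forall f (e : R), L2 G f -> 0 < e ->
        exists h k, T h k /\ normsq G (fun z => f z - h z) < e &
      forall f k, T f k <-> adjoint G T f k].

(* T is the self-adjoint extension of the Laplace operator on those smooth
   bounded invariant functions that it maps into L^2. *)
Definition laplacian (R : realType) (G : set 'M[R]_2)
    (T : (R * R -> R[i]) -> (R * R -> R[i]) -> Prop) : Prop :=
  selfadjoint G T /\
  forall f, smooth_bounded G f -> L2 G (lapC f) -> T f (lapC f).

Definition eigenvalue_opp (R : realType)
    (T : (R * R -> R[i]) -> (R * R -> R[i]) -> Prop) (l : R[i]) : Prop :=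
  exists f, T f (fun z => - l * f z) /\ ~ aeeq f (fun=> 0).

Definition bounded_selfadjoint (R : realType) (G : set 'M[R]_2)
    (S : (R * R -> R[i]) -> R * R -> R[i]) : Prop :=
  [/\ forall f, L2 G f -> L2 G (S f),
      forall (a : R[i]) f g, L2 G f -> L2 G g ->
        aeeq (S (fun z => a * f z + g z)) (fun z => a * S f z + S g z),
      exists M : R, forall f, L2 G f -> normsq G (S f) <= M * normsq G f &
      forall f g, L2 G f -> L2 G g -> inner G (S f) g = inner G f (S g)].

(* S is the operator G_Gamma attached to the Laplacian T. *)
Definition green_operator (R : realType) (G : set 'M[R]_2)
    (T : (R * R -> R[i]) -> (R * R -> R[i]) -> Prop)
    (S : (R * R -> R[i]) -> R * R -> R[i]) : Prop :=
  bounded_selfadjoint G S /\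
  forall f, smooth_bounded G f ->
    T (S f) (fun z => f z - ((vol G)^-1)%:C * qintC G f) /\
    qintC G (S f) = 0.

Definition off_diagonal (R : realType) (G : set 'M[R]_2) :
    set ((R * R) * (R * R)) :=
  [set p | [/\ upper_half R p.1, upper_half R p.2 & ~ mobius_orbit G p.2 p.1]].

(* Near (z, w) with z in the orbit of w, the singular locus of f is the union of
   the graphs z' = g w' for the finitely many g in G such that z = g w. *)
Definition log_singularity (R : realType) (G : set 'M[R]_2)
    (f : R * R -> R * R -> R) (z w : R * R) : Prop :=
  exists (c : R) (U : set ((R * R) * (R * R))) (h : (R * R) * (R * R) -> R),
    [/\ open_nbhs (z, w) U, smooth U h &
      forall z' w', U (z', w') -> off_diagonal G (z', w') ->
        f z' w' = h (z', w') +
          c * \sum_(g \in [set g | G g /\ z = mobius g w])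
                ln (sqdist z' (mobius g w'))].

(* gr is the integral kernel of the operator S; its values at pairs of points in
   the same orbit are irrelevant. *)
Definition green_function (R : realType) (G : set 'M[R]_2)
    (S : (R * R -> R[i]) -> R * R -> R[i]) (gr : R * R -> R * R -> R) : Prop :=
  [/\ (forall g z w, G g -> off_diagonal G (z, w) ->
         gr (mobius g z) w = gr z w /\ gr z (mobius g w) = gr z w),
      (forall z w, off_diagonal G (z, w) -> gr z w = gr w z),
      smooth (off_diagonal G) (fun p => gr p.1 p.2),
      (forall g w, G g -> upper_half R w ->
         log_singularity G gr (mobius g w) w) &
      (forall z, upper_half R z ->
         (hyp_measure R).-integrable (fundom G) (fun w => (gr z w)%:E)) /\
      (forall f, smooth_bounded G f ->
         aeeq (S f) (fun z => qintC G (fun w => (gr z w)%:C * f w)))].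

Definition green_sum (R : realType) (G : set 'M[R]_2)
    (gr : R * R -> R * R -> R) (d : R) (p : (R * R) * (R * R)) : R :=
  gr p.1 p.2 +
  \sum_(g \in [set g | G g /\ hypu p.1 (mobius g p.2) <= d])
     (hypL (hypu p.1 (mobius g p.2)) - hypL d).

(* Continuous extension across the pairs of points in the same orbit. *)
Definition green_sum_ext (R : realType) (G : set 'M[R]_2)
    (gr : R * R -> R * R -> R) (d : R) (z w : R * R) : R :=
  if `[< off_diagonal G (z, w) >] then green_sum G gr d (z, w)
  else lim (green_sum G gr d p @[p --> within (off_diagonal G) (nbhs (z, w))]).

(* Main.v *)
(* Let G be the subgroup and let k, k_n, b_n be smooth radial kernels with
   Delta b_n = k - k_n, where k_n concentrates at the diagonal and b_n tends to
   L up to a bounded function. Write phi_z, chi_z, psi_z for the automorphic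
   kernels of k_n, k, b_n and S for the Green operator. Applying S to
   chi_z - phi_z = Delta psi_z twice gives
     (phi_z, S phi_w) + (phi_z, psi_w)
       = (chi_z, S chi_w) - (psi_z, chi_w) + (mean psi_z + mean psi_w),
   whose left side tends to gr(z, w) plus the sum of the b_n(u(z, gamma w)). The
   right side is bounded by the norm of S, by the mass of b_n and by the number
   of gamma that move z or w by a bounded distance; that number is bounded on
   the lift of a compact set by the one for G0.

   It remains to bound the norm of S in terms of eta only. For f = S g the
   equation gives |f| <= |K f| + |g|, where K is convolution with k. Where the
   minimal noncentral gamma is small, K contracts by a universal factor: nearby
   points share the same gamma, and a negative power of the squared displacement
   Q of gamma is a strict supersolution for K, so Schur's test applies. Elsewhere
   K is bounded pointwise, and as the volume is finite, it is approximated by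
   finitely many functionals. Hence |S g| <= beta |g| + finitely many functionals
   of g, with beta universal, so that either |S| <= max(beta, 1 / eta) or S has an
   eigenvalue l with |l| above this maximum; then -1/l is an eigenvalue of -Delta
   of absolute value less than eta. *)

Require Import Defs.
From HB Require Import structures.
From mathcomp Require Import all_boot all_order all_algebra finmap.
From mathcomp Require Import all_classical all_reals all_analysis.
From mathcomp Require Import measurable_realfun.
From mathcomp Require Import complex.
From mathcomp Require Import ring lra.
Set Implicit Arguments.
Unset Strict Implicit.
Unset Printing Implicit Defensive.
Import Order.TTheory GRing.Theory Num.Theory.
Import numFieldNormedType.Exports.
Local Open Scope classical_set_scope.
Local Open Scope ring_scope.

(** * Smooth functions *)

(** The hypothesis controls eigenvalues only, while the norm of S involves its whole spectrum. No
    spectral decomposition is used: cusps, short geodesics and small rotations are treated alike,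
    since Q does not see the type of gamma, and what is left outside the thin part is compact. The
    number of functionals and their coefficients depend on Gamma. This is harmless: they only serve
    to make a maximising sequence converge and leave no trace in the bound. The contraction comes
    from a gain in the mean of log Q over the vertices of a square about z. The support 2 <= u <= 3
    of k is far enough from the centre for a definite gain and near enough for Q to change by a
    factor of at most 36. S is described on smooth bounded functions only and S g is merely
    square-integrable, so the equation is used weakly, against automorphic kernels; these separate
    square-integrable functions up to null functions. No limit in n is taken in the pairing
    identity: its bound does not depend on n, and for given (z, w) outside the singular locus some n
    makes both terms on the left accurate to within 1. *)

Section SmoothCalculus.
Variables (R : realType) (V : normedModType R).
Implicit Types (U : set V) (f g : V -> R).

Lemma Cn_sub n U U' f : U' `<=` U -> Cn n U f -> Cn n U' f.
Proof.
elim: n f => [|n IH] f sU /=.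
  by move=> [fc _]; split=> // p /sU; exact: fc.
move=> [fc fd]; split=> [p /sU|v]; first exact: fc.
by have [d1 d2] := fd v; split=> [p /sU|]; [exact: d1|exact: IH].
Qed.

Lemma Cn_eq n U f g : open U -> (forall p, U p -> f p = g p) ->
  Cn n U f -> Cn n U g.
Proof.
elim: n f g => [|n IH] f g oU fg /=.
  move=> [fc _]; split=> // p Up.
  have nfg : {near p, f =1 g}.
    by apply: filterS (open_nbhs_nbhs (conj oU Up)) => q /fg.
  move: (fc p Up); rewrite /prop_for /continuous_at -(fg p Up).
  by apply: cvg_trans; exact: near_eq_cvg.
move=> [fc fd]; split=> [p Up|v].
  have nfg : {near p, f =1 g}.
    by apply: filterS (open_nbhs_nbhs (conj oU Up)) => q /fg.
  move: (fc p Up); rewrite /prop_for /continuous_at -(fg p Up).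
  by apply: cvg_trans; exact: near_eq_cvg.
have [d1 d2] := fd v.
have nfg p : U p -> {near p, f =1 g}.
  by move=> Up; apply: filterS (open_nbhs_nbhs (conj oU Up)) => q /fg.
split=> [p Up|]; first exact: near_eq_derivable (nfg p Up) (d1 p Up).
apply: IH d2 => // p Up; exact/near_eq_derive/nfg.
Qed.

(** The conditions in [Cn] are pointwise, so they glue over a union; smoothness can be checked on
    pieces that carry different formulas. *)
Lemma Cn_setU n U U' f : Cn n U f -> Cn n U' f -> Cn n (U `|` U') f.
Proof.
elim: n f => [|n IH] f /= [c1 d1] [c2 d2].
  by split=> // p [/c1|/c2].
split=> [p [/c1|/c2] //|v].
have [a1 b1] := d1 v; have [a2 b2] := d2 v.
by split=> [p [/a1|/a2] //|]; exact: IH.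
Qed.

Lemma CnW n U f : Cn n.+1 U f -> Cn n U f.
Proof.
elim: n f => [|n IH] f; first by case.
by move=> [c d]; split=> // v; have [? ?] := d v; split=> //; exact: IH.
Qed.

Lemma Cn_cst n U (a : R) : Cn n U (fun=> a).
Proof.
have c b p : U p -> {for p, continuous (fun=> b : R)}.
  by move=> _; exact: cst_continuous.
elim: n a => [|n IH] a; first exact: (conj (c a) I).
split; first exact: c.
move=> v; split=> [p _|]; first exact: derivable_cst.
rewrite (_ : 'D_v _ = fun=> 0); first exact: IH.
by apply/funext => x; exact: derive_cst.
Qed.

Lemma CnD n U f g : open U -> Cn n U f -> Cn n U g ->
  Cn n U (fun p => f p + g p).
Proof.
elim: n f g => [|n IH] f g oU [cf df] [cg dg].
  by split=> // p Up; apply: continuousD; [exact: cf|exact: cg].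
split=> [p Up|v]; first by apply: continuousD; [exact: cf|exact: cg].
have [df1 df2] := df v; have [dg1 dg2] := dg v.
split=> [p Up|]; first exact: derivableD (df1 p Up) (dg1 p Up).
apply: Cn_eq (IH _ _ oU df2 dg2) => // p Up.
by rewrite (deriveD (df1 p Up) (dg1 p Up)).
Qed.

Lemma CnM n U f g : open U -> Cn n U f -> Cn n U g ->
  Cn n U (fun p => f p * g p).
Proof.
elim: n f g => [|n IH] f g oU.
  move=> [cf _] [cg _]; split=> // p Up.
  by apply: (@continuousM R); [exact: cf|exact: cg].
move=> Sf Sg; have [cf df] := Sf; have [cg dg] := Sg.
split=> [p Up|v]; first by apply: (@continuousM R); [exact: cf|exact: cg].
have [df1 df2] := df v; have [dg1 dg2] := dg v.
split=> [p Up|]; first exact: (@derivableM R _ f g) (df1 p Up) (dg1 p Up).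
have := CnD oU (IH _ _ oU (CnW Sf) dg2) (IH _ _ oU (CnW Sg) df2).
apply: Cn_eq => // p Up.
by rewrite (@deriveM R _ f g _ _ (df1 p Up) (dg1 p Up)).
Qed.

Lemma CnZ n U (a : R) f : open U -> Cn n U f -> Cn n U (fun p => a * f p).
Proof. by move=> oU; apply: CnM => //; exact: Cn_cst. Qed.

Lemma CnV n U f : open U -> (forall p, U p -> f p != 0) -> Cn n U f ->
  Cn n U (fun p => (f p)^-1).
Proof.
move=> oU f0; elim: n => [|n IH].
  move=> [cf _]; split=> // p Up.
  by apply: (@continuousV R); [exact: f0|exact: cf].
move=> Sf; have [cf df] := Sf.
split=> [p Up|v].
  by apply: (@continuousV R); [exact: f0|exact: cf].
have [df1 df2] := df v.
split=> [p Up|]; first exact: (@derivableV R _ f) (f0 p Up) (df1 p Up).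
have iV := IH (CnW Sf).
have := CnZ (-1) oU (CnM oU (CnM oU iV iV) df2).
apply: Cn_eq => // p Up.
rewrite (@deriveV R _ f _ _ (f0 p Up) (df1 p Up)).
by rewrite /GRing.scale /= mulN1r expr2 invfM mulNr.
Qed.

Lemma Cn_sum n U m (F : nat -> V -> R) : open U ->
  (forall i, (i < m)%N -> Cn n U (F i)) -> Cn n U (fun p => \sum_(i < m) F i p).
Proof.
move=> oU; elim: m => [|m IH] FC.
  apply: Cn_eq (Cn_cst n U 0) => // p _; by rewrite big_ord0.
have := CnD oU (IH (fun i im => FC i (ltnW im))) (FC m (ltnSn m)).
by apply: Cn_eq => // p _; rewrite big_ord_recr.
Qed.

Lemma derive_line f (p v : V) :
  'D_1 (fun h : R => f (h *: v + p)) 0 = 'D_v f p.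
Proof.
suff E : (fun h : R => h^-1 *: (((fun h : R => f (h *: v + p)) \o shift 0) (h *: 1)
    - f (0 *: v + p))) = (fun h => h^-1 *: ((f \o shift p) (h *: v) - f p)).
  by rewrite /derive E.
apply/funext => h /=.
by rewrite addr0 scale0r add0r [h *: 1](_ : _ = h) // /GRing.scale /= mulr1.
Qed.

(** Only a directional derivative of [f] is assumed, so the one-variable chain rule is applied to
    the restriction of [f] to the line through [p] in direction [v]. *)
Lemma is_derive_compR (phi : R -> R) f (p v : V) (d : R) :
  derivable f p v -> is_derive (f p) (1 : R) phi d ->
  is_derive p v (phi \o f) (d * 'D_v f p).
Proof.
move=> df dphi.
have fE : f p = (f \o (fun h : R => h *: v + p)) 0 by rewrite /= scale0r add0r.
have h1 : is_derive (0 : R) (1 : R) (f \o (fun h : R => h *: v + p)) ('D_v f p).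
  apply: DeriveDef; first exact: ((derivable1P f p v).1 df).
  exact: derive_line.
rewrite fE in dphi.
have [h2 h3] := is_derive1_comp dphi h1.
apply: DeriveDef; first by apply: (derivable1P (phi \o f) p v).2; exact: h2.
by rewrite -h3 -[LHS]derive_line.
Qed.

End SmoothCalculus.

Section SmoothComposition.
Variables (R : realType) (V : normedModType R).

Lemma Cn_comp n (U : set V) (I : set R) (phi : R -> R) (f : V -> R) :
  open U -> (forall p, U p -> I (f p)) ->
  Cn n (I : set (GRing.regular R)) phi -> Cn n U f -> Cn n U (phi \o f).
Proof.
move=> oU UI; elim: n phi => [|n IH] phi.
  move=> [cp _] [cf _]; split=> // p Up.
  by apply: (@continuous_comp _ _ _ f phi); [exact: cf|exact/cp/UI].
move=> [cp dp] Sf; have [cf df] := Sf.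
have ccomp p : U p -> {for p, continuous (phi \o f)}.
  move=> Up.
  by apply: (@continuous_comp _ _ _ f phi); [exact: cf|exact/cp/UI].
split=> // v.
have [df1 df2] := df v; have [dp1 dp2] := dp 1.
have dphi p : U p -> is_derive p v (phi \o f) (('D_1 phi) (f p) * 'D_v f p).
  move=> Up; apply: is_derive_compR; first exact: df1.
  by split=> //; exact/dp1/UI.
split=> [p Up|]; first by case: (dphi p Up).
have := CnM oU (IH _ dp2 (CnW Sf)) df2.
by apply: Cn_eq => // p Up; case: (dphi p Up).
Qed.

End SmoothComposition.

Section SmoothPlane.
Variable R : realType.
Implicit Types (U : set (R * R)).

Lemma is_derive_fst (p v : R * R) : is_derive p v (fst : R * R -> R) v.1.
Proof.
apply: DeriveDef.
  apply: cvgP; apply: (@cvg_trans _ ((fun=> v.1) @ (0:R)^')); last exact: cvg_cst.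
  apply: near_eq_cvg; near=> h => /=.
  by rewrite addrK /GRing.scale /= mulKf //; near: h; exact: nbhs_dnbhs_neq.
apply: cvg_lim => //.
apply: (@cvg_trans _ ((fun=> v.1) @ (0:R)^')); last exact: cvg_cst.
apply: near_eq_cvg; near=> h => /=.
by rewrite addrK /GRing.scale /= mulKf //; near: h; exact: nbhs_dnbhs_neq.
Unshelve. all: by end_near. Qed.

Lemma is_derive_snd (p v : R * R) : is_derive p v (snd : R * R -> R) v.2.
Proof.
apply: DeriveDef.
  apply: cvgP; apply: (@cvg_trans _ ((fun=> v.2) @ (0:R)^')); last exact: cvg_cst.
  apply: near_eq_cvg; near=> h => /=.
  by rewrite addrK /GRing.scale /= mulKf //; near: h; exact: nbhs_dnbhs_neq.
apply: cvg_lim => //.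
apply: (@cvg_trans _ ((fun=> v.2) @ (0:R)^')); last exact: cvg_cst.
apply: near_eq_cvg; near=> h => /=.
by rewrite addrK /GRing.scale /= mulKf //; near: h; exact: nbhs_dnbhs_neq.
Unshelve. all: by end_near. Qed.

Lemma Cn_fst n U : Cn n U (fst : R * R -> R).
Proof.
have c p : U p -> {for p, continuous (fst : R * R -> R)}.
  by move=> _; exact: cvg_fst.
case: n => [|n]; first exact: (conj c I).
split; first exact: c.
move=> v; split=> [p _|]; first by case: (is_derive_fst p v).
rewrite (_ : 'D_v _ = fun=> v.1); first exact: Cn_cst.
by apply/funext => p; case: (is_derive_fst p v).
Qed.

Lemma Cn_snd n U : Cn n U (snd : R * R -> R).
Proof.
have c p : U p -> {for p, continuous (snd : R * R -> R)}.
  by move=> _; exact: cvg_snd.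
case: n => [|n]; first exact: (conj c I).
split; first exact: c.
move=> v; split=> [p _|]; first by case: (is_derive_snd p v).
rewrite (_ : 'D_v _ = fun=> v.2); first exact: Cn_cst.
by apply/funext => p; case: (is_derive_snd p v).
Qed.

Lemma open_upper_half : open (upper_half R).
Proof.
have -> : upper_half R = snd @^-1` [set y : R | 0 < y] by [].
by apply: open_comp; [move=> p _; exact: cvg_snd|exact: open_gt].
Qed.

End SmoothPlane.

Section OneVariable.
Variable R : realType.

Lemma is_derive_continuous (f : R -> R) (x d : R) :
  is_derive x (1 : R) f d -> {for x, continuous f}.
Proof. by move=> [df _]; exact/differentiable_continuous/derivable1_diffP. Qed.

Lemma is_derive_direction (f : R -> R) (x v d : R) :
  is_derive x (1 : R) f d -> is_derive x v f (v * d).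
Proof.
move=> df; have di : derivable (id : R -> R) x v by exact: derivable_id.
have h := is_derive_compR di df.
by rewrite derive_id mulrC in h.
Qed.

(** The induction on the order replaces a function by its derivative, so it has to run over a class
    closed under differentiation rather than over one function. *)
Lemma Cn_derive_stable (P : (R -> R) -> Prop) :
  (forall f, P f -> exists2 g, P g & forall x, is_derive x (1 : R) f (g x)) ->
  forall n f, P f -> Cn n (setT : set (GRing.regular R)) f.
Proof.
move=> stab; elim=> [|n IH] f /stab[g Pg df].
  by split=> // x _; exact: is_derive_continuous (df x).
split=> [x _|v]; first exact: is_derive_continuous (df x).
split=> [x _|]; first by case: (is_derive_direction v (df x)).
apply: Cn_eq (CnZ v openT (IH _ Pg)); first exact: openT.
by move=> x _; case: (is_derive_direction v (df x)).
Qed.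

Lemma Cn_primitive n (F f : R -> R) : (forall x, is_derive x (1 : R) F (f x)) ->
  Cn n (setT : set (GRing.regular R)) f -> Cn n (setT : set (GRing.regular R)) F.
Proof.
move=> dF; case: n => [|n] Cf.
  by split=> // x _; exact: is_derive_continuous (dF x).
split=> [x _|v]; first exact: is_derive_continuous (dF x).
split=> [x _|]; first by case: (is_derive_direction v (dF x)).
apply: Cn_eq (CnZ v openT (CnW Cf)); first exact: openT.
by move=> x _; case: (is_derive_direction v (dF x)).
Qed.

Lemma is_derive_affine (a b x : R) : is_derive x (1 : R) (fun y => a * y + b) a.
Proof.
have h := is_deriveD (is_deriveZ a (is_derive_id x (1 : R))) (is_derive_cst b x (1 : R)).
by rewrite addr0 [a *: 1]mulr1 in h.
Qed.

Lemma Cn_affine n (a b : R) :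
  Cn n (setT : set (GRing.regular R)) (fun y => a * y + b).
Proof.
apply: (@Cn_derive_stable (fun f => exists a b, f = fun y => a * y + b)).
  move=> _ [c [d ->]]; exists (fun y => 0 * y + c); first by exists 0, c.
  by move=> x; rewrite mul0r add0r; exact: is_derive_affine.
by exists a, b.
Qed.

Lemma derive_ge0_homo (F f : R -> R) (a b : R) : a <= b ->
  (forall x, a <= x <= b -> is_derive x (1 : R) F (f x)) ->
  (forall x, a <= x <= b -> 0 <= f x) -> F a <= F b.
Proof.
move=> ab dF f0.
have [x xab|x|c cab E] := @MVT_segment R F f a b ab.
- by apply: dF; move: xab; rewrite in_itv /= => /andP[/ltW -> /ltW ->].
- apply: derivable_within_continuous => y; rewrite in_itv /= => yab.
  by case: (dF y yab).
- rewrite -subr_ge0 E mulr_ge0 ?subr_ge0 //; apply: f0.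
  by move: cab; rewrite in_itv.
Qed.

Lemma derive0_const (F : R -> R) (a b : R) : a <= b ->
  (forall x, a <= x <= b -> is_derive x (1 : R) F 0) -> F a = F b.
Proof.
move=> ab dF; apply/eqP; rewrite eq_le; apply/andP; split.
  exact: (@derive_ge0_homo F (fun=> 0)).
rewrite -lerN2; apply: (@derive_ge0_homo (- F) (fun=> 0)) => // x /dF h.
by have := is_deriveN h; rewrite oppr0.
Qed.

Lemma compact_support_integrable (f : R -> R) (a b : R) (D : set R) :
  measurable D -> continuous f -> (forall x, ~~ (a <= x <= b) -> f x = 0) ->
  (@lebesgue_measure R).-integrable D (EFin \o f).
Proof.
move=> mD cf f0; apply: (@integrableS _ _ _ _ setT) => //.
have h : (@lebesgue_measure R).-integrable `[a, b]%classic (EFin \o f).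
  apply: continuous_compact_integrable; first exact: segment_compact.
  exact: continuous_subspaceT.
have mI : measurable (`[a, b]%classic : set (measurableTypeR R)) by exact: measurable_itv.
have := (@integrable_mkcond _ _ _ (@lebesgue_measure R) _ (EFin \o f) mI).1 h.
apply: eq_integrable => // x _; rewrite patchE; case: ifPn => //.
by rewrite mem_setE in_itv /= => /f0 /= ->.
Qed.

(** The primitive is the integral from [-oo]; the compact support makes it finite. *)
Lemma primitive_exists (f : R -> R) (a b : R) :
  continuous f -> (forall x, ~~ (a <= x <= b) -> f x = 0) ->
  exists F : R -> R, forall x, is_derive x (1 : R) F (f x).
Proof.
move=> cf f0.
exists (fun x => \int[lebesgue_measure]_(t in `]-oo, x]) f t) => x.
have [|||//|d1 d2] := @continuous_FTC1 R f -oo%O x (x + 1).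
- by rewrite ltrDl.
- exact: compact_support_integrable f0.
- by rewrite ltNyr.
- exact: cf.
- by apply: DeriveDef; [exact: d1|rewrite -derive1E].
Qed.

End OneVariable.

(** * A smooth step function *)

Section Bump.
Variable R : realType.

(* The functions p(1/t) exp(-1/t) extended by zero to t <= 0 form a class
   that is stable under differentiation. *)
Definition flat (p : {poly R}) (t : R) : R :=
  if 0 < t then p.[t^-1] * expR (- t^-1) else 0.

(** The exponential beats the polynomial with two powers of [t] to spare, so that the difference
    quotient of [flat p] at 0 tends to 0. *)
Lemma flat_bound (p : {poly R}) :
  exists C : R, forall t, 0 < t <= 1 -> `|flat p t| <= C * t ^+ 2.
Proof.
pose d := (size p).+1.
exists ((\sum_(i < size p) `|p`_i|) * (d.+1)`!%:R) => t /andP[t0 t1].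
rewrite /flat t0 normrM (ger0_norm (expR_ge0 _)) expRN.
have x1 : 1 <= t^-1 by rewrite invf_ge1.
have x0 : 0 <= t^-1 by rewrite (le_trans _ x1).
have hp : `|p.[t^-1]| <= (\sum_(i < size p) `|p`_i|) * t^-1 ^+ (size p).
  rewrite horner_coef (le_trans (ler_norm_sum _ _ _)) // mulr_suml.
  apply: ler_sum => i _; rewrite normrM normrX (ger0_norm x0).
  by rewrite ler_wpM2l // ler_weXn2l // ltnW.
have he : t^-1 ^+ d.+1 / (d.+1)`!%:R <= expR t^-1.
  by apply: le_trans (expR_ge1Dxn d x0); rewrite lerDr.
have f0 : 0 < (d.+1)`!%:R :> R by rewrite ltr0n fact_gt0.
have E0 := expR_gt0 t^-1.
have S0 : 0 <= \sum_(i < size p) `|p`_i| by apply: sumr_ge0.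
rewrite ler_pdivrMr // (le_trans hp) // -!mulrA ler_wpM2l //.
move: he; rewrite ler_pdivrMr // mulrC => he.
have -> : t^-1 ^+ size p = t ^+ 2 * t^-1 ^+ d.+1.
  rewrite /d !(exprS t^-1); move: (t^-1 ^+ size p) => y.
  by field; rewrite gt_eqF.
have -> : (d.+1)`!%:R * (t * (t * expR t^-1)) = t ^+ 2 * ((d.+1)`!%:R * expR t^-1).
  by ring.
by rewrite ler_wpM2l ?sqr_ge0.
Qed.

Lemma is_derive_flat (p : {poly R}) (t : R) :
  is_derive t (1 : R) (flat p) (flat ('X ^+ 2 * (p - p^`())) t).
Proof.
have [t0|t0|->] := ltgtP t 0.
- rewrite /(flat _ t) ltNge (ltW t0) /=.
  apply: (@near_eq_is_derive _ _ _ (fun=> 0)).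
  near=> s; rewrite /flat ltNge ltW //; near: s; exact: lt_nbhsl.
- have dV := is_deriveV (lt0r_neq0 t0) (is_derive_id t (1 : R)).
  have d1 := is_derive1_comp (is_derive_poly p t^-1) dV.
  have dN : is_derive t (1 : R) (fun t : R => - t^-1) (- (- t ^- 2)%:A).
    exact: is_deriveN dV.
  have d2 := @is_derive1_comp _ expR (fun t : R => - t^-1) _ _ _ (is_derive_expR (- t^-1)) dN.
  have := is_deriveM d1 d2.
  move=> h; have : is_derive t (1 : R) (fun t : R => p.[t^-1] * expR (- t^-1))
      (flat ('X ^+ 2 * (p - p^`())) t).
    apply: is_derive_eq h _.
    rewrite /flat t0 hornerM hornerXn hornerD hornerN /GRing.scale /=.
    by field; rewrite gt_eqF.
  apply: near_eq_is_derive; near=> s.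
  by rewrite /flat; case: ltP => // s0; have := s0; rewrite leNgt => /negP[]; near: s; exact: lt_nbhsr.
- rewrite [flat _ 0]/flat ltxx.
  have [C hC] := flat_bound p.
  have C0 : 0 <= C by have := hC 1; rewrite ltr01 lexx expr1n mulr1 => /(_ isT); apply: le_trans.
  have cv : h^-1 *: ((flat p \o shift 0) (h *: 1) - flat p 0) @[h --> (0:R)^'] --> (0 : R).
    apply/cvgr0Pnorm_lt => e e0; near=> h.
    rewrite /= addr0 [h *: 1]mulr1 /(flat p 0) ltxx subr0.
    rewrite /flat; case: ifPn => h0; last by rewrite scaler0 normr0.
    have := hC h; rewrite h0 /flat h0 /= => /(_ _) hb.
    have h1 : `|h| <= 1 by near: h; apply: dnbhs0_le.
    have h2 : `|h| < e / (C + 1).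
      by near: h; apply: dnbhs0_lt; rewrite divr_gt0 // ltr_wpDl.
    rewrite (ger0_norm (ltW h0)) in h1 h2.
    rewrite normrZ normfV (ger0_norm (ltW h0)) mulrC ltr_pdivrMr //.
    apply: le_lt_trans (hb h1) _; rewrite expr2 mulrA ltr_pM2r //.
    rewrite (@le_lt_trans _ _ ((C + 1) * h)) // ?ler_pM2r // ?lerDl //.
    by rewrite mulrC -ltr_pdivlMr // ltr_wpDl.
  by apply: DeriveDef; [apply/cvg_ex; exists 0|exact: cvg_lim].
Unshelve. all: by end_near. Qed.

Lemma Cn_flat n (p : {poly R}) : Cn n (setT : set (GRing.regular R)) (flat p).
Proof.
apply: (@Cn_derive_stable _ (fun f => exists p, f = flat p)); last by exists p.
move=> _ [q ->]; exists (flat ('X ^+ 2 * (q - q^`()))); first by eexists.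
exact: is_derive_flat.
Qed.

Definition bump (t : R) : R := flat 1 t * flat 1 (1 - t).

Lemma bump_ge0 t : 0 <= bump t.
Proof.
by rewrite mulr_ge0 // /flat; case: ifP => // _; rewrite hornerC mul1r expR_ge0.
Qed.

Lemma bump_gt0 t : 0 < t < 1 -> 0 < bump t.
Proof.
move=> /andP[t0 t1]; rewrite /bump /flat t0 subr_gt0 t1 !hornerC !mul1r.
by rewrite mulr_gt0 ?expR_gt0.
Qed.

Lemma bump_eq0 t : ~~ (0 < t < 1) -> bump t = 0.
Proof.
rewrite negb_and /bump /flat subr_gt0 => /orP[] /negbTE ->; first by rewrite mul0r.
by rewrite mulr0.
Qed.

Lemma Cn_bump n : Cn n (setT : set (GRing.regular R)) bump.
Proof.
apply: CnM; [exact: openT|exact: Cn_flat|].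
have : Cn n (setT : set (GRing.regular R)) (flat 1 \o (fun y : R => -1 * y + 1)).
  by apply: Cn_comp; [exact: openT| |exact: Cn_flat|exact: Cn_affine].
by apply: Cn_eq; [exact: openT|move=> t _ /=; rewrite mulN1r addrC].
Qed.

Lemma bump_continuous : continuous bump.
Proof. by move=> t; case: (Cn_bump 0) => /(_ t I). Qed.

(** The step is the normalised primitive of [bump]. Its derivative is returned with it: the kernels
    are built from the derivative, and their masses are read off from the step. *)
Lemma smooth_step_exists : exists s s' : R -> R,
  [/\ (forall t, is_derive t (1 : R) s (s' t)),
      (forall n, Cn n (setT : set (GRing.regular R)) s'),
      (forall t, 0 <= s' t) /\ (forall t, ~~ (0 < t < 1) -> s' t = 0),
      (forall t, t <= 0 -> s t = 0) &
      (forall t, 1 <= t -> s t = 1)].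
Proof.
have [|F dF] := @primitive_exists R bump 0 1 bump_continuous.
  move=> x x01; apply: bump_eq0; apply: contra x01 => /andP[/ltW -> /ltW ->].
  by [].
have F01 : F 0 < F 1.
  have cF : {within `[0, 1 : R], continuous F}.
    by apply: derivable_within_continuous => y _; case: (dF y).
  have [c] := @MVT R F bump 0 1 ltr01 (fun x _ => dF x) cF.
  by rewrite in_itv /= subr0 mulr1 => /bump_gt0 b0 E; rewrite -subr_gt0 E.
have F0 t : t <= 0 -> F t = F 0.
  move=> t0; apply: derive0_const => // x /andP[_ x0].
  have := dF x; rewrite bump_eq0 //; by rewrite ltNge x0.
have F1 t : 1 <= t -> F t = F 1.
  move=> t1; apply/esym/derive0_const => // x /andP[x0 _].
  have := dF x; rewrite bump_eq0 //; by rewrite andbC ltNge x0.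
pose c := (F 1 - F 0)^-1.
have c0 : 0 < c by rewrite invr_gt0 subr_gt0.
exists (fun t => c * (F t - F 0)), (fun t => c * bump t); split.
- move=> t; have := is_deriveZ c (is_deriveB (dF t) (is_derive_cst (F 0) t (1 : R))).
  by rewrite subr0.
- by move=> n; apply: CnZ; [exact: openT|exact: Cn_bump].
- split=> t; first by rewrite mulr_ge0 ?bump_ge0 // ltW.
  by move=> /bump_eq0 ->; rewrite mulr0.
- by move=> t /F0 ->; rewrite subrr mulr0.
- by move=> t /F1 ->; rewrite mulVf // subr_eq0 gt_eqF.
Qed.

End Bump.

(** * Hyperbolic geometry *)

Section HyperbolicPlane.
Variable R : realType.
Implicit Types (g h : 'M[R]_2) (z w : R * R).

Definition SL2 g : Prop := \det g = 1.

Lemma mulmx2E g h (i j : 'I_2) : (g *m h) i j = g i 0 * h 0 j + g i 1 * h 1 j.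
Proof.
by rewrite mxE big_ord_recl big_ord_recl big_ord0 addr0; congr (_ + g _ _ * h _ _); apply/val_inj.
Qed.

Lemma det2E g : \det g = g 0 0 * g 1 1 - g 0 1 * g 1 0.
Proof.
rewrite (expand_det_row _ 0) !big_ord_recl big_ord0 addr0 /cofactor /=.
rewrite !det_mx11 !mxE /= expr0 mul1r expr1 mulN1r mulrN.
by congr (g _ _ * g _ _ - g _ _ * g _ _); apply/val_inj.
Qed.

Lemma matrix2P g h : g 0 0 = h 0 0 -> g 0 1 = h 0 1 -> g 1 0 = h 1 0 ->
  g 1 1 = h 1 1 -> g = h.
Proof.
move=> h00 h01 h10 h11; apply/matrixP => i j.
have I2 (k : 'I_2) : k = 0 \/ k = 1.
  by case: k => [[|[|//]] ki]; [left|right]; apply/val_inj.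
by case: (I2 i) => ->; case: (I2 j) => ->.
Qed.

Definition mx2 (a b c d : R) : 'M[R]_2 :=
  \matrix_(i, j) if i == 0 then (if j == 0 then a else b)
                 else (if j == 0 then c else d).

Lemma mx2E a b c d : (mx2 a b c d 0 0 = a) * (mx2 a b c d 0 1 = b) *
  (mx2 a b c d 1 0 = c) * (mx2 a b c d 1 1 = d).
Proof. by rewrite !mxE. Qed.

(** The squared modulus of the denominator [c z + d]. *)
Definition mobden g z : R := (g 1 0 * z.1 + g 1 1) ^+ 2 + (g 1 0 * z.2) ^+ 2.

Lemma mobiusE g z : mobius g z =
  (((g 0 0 * z.1 + g 0 1) * (g 1 0 * z.1 + g 1 1) + g 0 0 * g 1 0 * z.2 ^+ 2)
     / mobden g z,
   (g 0 0 * g 1 1 - g 0 1 * g 1 0) * z.2 / mobden g z).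
Proof.
rewrite /mobius /mobden /=; move: (g 0 0) (g 0 1) (g 1 0) (g 1 1) => a b c d.
rewrite !mul0r !subr0 !addr0.
by congr (_, _); ring.
Qed.

Lemma mobden_gt0 g z : SL2 g -> 0 < z.2 -> 0 < mobden g z.
Proof.
rewrite /SL2 det2E /mobden => dg z0.
rewrite lt_def addr_ge0 ?sqr_ge0 // andbT; apply/eqP => /eqP.
rewrite paddr_eq0 ?sqr_ge0 // !sqrf_eq0 mulf_eq0 (gt_eqF z0) orbF => /andP[h1 /eqP h2].
move: h1 dg; rewrite h2 mul0r add0r => /eqP ->; rewrite !mulr0 subr0 => /eqP.
by rewrite eq_sym oner_eq0.
Qed.

Lemma mobius2 g z : SL2 g -> (mobius g z).2 = z.2 / mobden g z.
Proof. by rewrite /SL2 mobiusE /= -det2E => ->; rewrite mul1r. Qed.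

Lemma mobius_upper g z : SL2 g -> 0 < z.2 -> 0 < (mobius g z).2.
Proof. by move=> dg z0; rewrite mobius2 // divr_gt0 // mobden_gt0. Qed.

(** Identities for Möbius maps are verified in the field [R[i]] and brought back to real coordinates
    by the multiplicative squared modulus [nsq]. *)
Definition toC z : R[i] := Complex z.1 z.2.
Definition nsq (z : R[i]) : R := complex.Re z ^+ 2 + complex.Im z ^+ 2.

Lemma toC_inj : injective toC.
Proof. by move=> [x y] [x' y'] [] /= -> ->. Qed.

Lemma nsqM (z w : R[i]) : nsq (z * w) = nsq z * nsq w.
Proof. by case: z => a b; case: w => c d; rewrite /nsq /=; ring. Qed.

Lemma nsq_eq0 (z : R[i]) : (nsq z == 0) = (z == 0).
Proof.
by case: z => a b; rewrite /nsq /= paddr_eq0 ?sqr_ge0 // !sqrf_eq0 eq_complex.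
Qed.

Lemma toC_sqdist z w : nsq (toC z - toC w) = sqdist z w.
Proof. by []. Qed.

Lemma toC_mobden g z : nsq ((g 1 0)%:C%C * toC z + (g 1 1)%:C%C) = mobden g z.
Proof. by rewrite /nsq /mobden /= !mul0r subr0 !addr0. Qed.

Lemma toC_den_neq0 g z : SL2 g -> 0 < z.2 ->
  (g 1 0)%:C%C * toC z + (g 1 1)%:C%C != 0.
Proof.
by move=> dg z0; rewrite -nsq_eq0 toC_mobden gt_eqF // mobden_gt0.
Qed.

Lemma toC_mobius g z : toC (mobius g z) =
  ((g 0 0)%:C%C * toC z + (g 0 1)%:C%C) / ((g 1 0)%:C%C * toC z + (g 1 1)%:C%C).
Proof. by rewrite /mobius /toC; cbv zeta; case: (_ / _). Qed.

Lemma mobiusM g h z : SL2 g -> SL2 h -> 0 < z.2 ->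
  mobius (g *m h) z = mobius g (mobius h z).
Proof.
move=> dg dh z0.
have D1 := toC_den_neq0 dh z0.
have D2 := toC_den_neq0 dg (mobius_upper dh z0).
have dgh : SL2 (g *m h) by rewrite /SL2 det_mulmx dg dh mulr1.
have D3 := toC_den_neq0 dgh z0.
apply: toC_inj; rewrite !toC_mobius; rewrite toC_mobius in D2.
move: D3; rewrite !mulmx2E !rmorphD !rmorphM /= => D3.
have D4 : (g 1 0)%:C%C * ((h 0 0)%:C%C * toC z + (h 0 1)%:C%C) +
    (g 1 1)%:C%C * ((h 1 0)%:C%C * toC z + (h 1 1)%:C%C) != 0.
  by move: D3; congr (_ != 0); ring.
field.
by apply/andP; split; [exact: D1|exact: D4].
Qed.

Lemma mobius1 z : mobius 1%:M z = z.
Proof.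
apply: toC_inj; rewrite toC_mobius !mxE /=.
by rewrite rmorph1 rmorph0 mul0r mul1r addr0 add0r divr1.
Qed.

Lemma mobiusN g z : mobius (- g) z = mobius g z.
Proof.
apply: toC_inj; rewrite !toC_mobius !mxE !rmorphN /= !mulNr -!opprD.
by rewrite invrN mulrNN.
Qed.

Lemma SL2M g h : SL2 g -> SL2 h -> SL2 (g *m h).
Proof. by rewrite /SL2 det_mulmx => -> ->; rewrite mulr1. Qed.

Lemma SL2_unit g : SL2 g -> g \in unitmx.
Proof. by rewrite unitmxE => ->; exact: unitr1. Qed.

Lemma SL2V g : SL2 g -> SL2 (invmx g).
Proof. by rewrite /SL2 det_inv => ->; rewrite invr1. Qed.

Lemma mobiusK g z : SL2 g -> 0 < z.2 -> mobius (invmx g) (mobius g z) = z.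
Proof.
by move=> dg z0; rewrite -mobiusM ?mulVmx ?mobius1 // ?SL2_unit //; exact: SL2V.
Qed.

Lemma mobiusVK g z : SL2 g -> 0 < z.2 -> mobius g (mobius (invmx g) z) = z.
Proof.
by move=> dg z0; rewrite -mobiusM ?mulmxV ?mobius1 // ?SL2_unit //; exact: SL2V.
Qed.

Lemma invmx2 g : SL2 g -> invmx g = mx2 (g 1 1) (- g 0 1) (- g 1 0) (g 0 0).
Proof.
move=> dg; have := dg; rewrite /SL2 det2E => d1.
rewrite -[RHS]mulmx1 -(mulmxV (SL2_unit dg)) mulmxA -[LHS]mul1mx; congr (_ *m _).
by apply: matrix2P; rewrite mulmx2E !mx2E !mxE /=; rewrite -?d1; ring.
Qed.

(** For determinant 1, [(g z - g w) (c z + d) (c w + d) = z - w]; the claim is the squared modulus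
    of this identity. *)
Lemma sqdist_mobius g z w : SL2 g -> 0 < z.2 -> 0 < w.2 ->
  sqdist (mobius g z) (mobius g w) = sqdist z w / (mobden g z * mobden g w).
Proof.
move=> dg z0 w0; have D1 := toC_den_neq0 dg z0; have D2 := toC_den_neq0 dg w0.
have E : (toC (mobius g z) - toC (mobius g w)) *
   (((g 1 0)%:C%C * toC z + (g 1 1)%:C%C) * ((g 1 0)%:C%C * toC w + (g 1 1)%:C%C))
   = toC z - toC w.
  rewrite !toC_mobius.
  transitivity (((g 0 0 * g 1 1 - g 0 1 * g 1 0)%:C)%C * (toC z - toC w)).
    rewrite rmorphB !rmorphM /=.
    by field; rewrite D1 D2.
  by have := dg; rewrite /SL2 det2E => ->; rewrite rmorph1 mul1r.
rewrite -!toC_sqdist -E !nsqM !toC_mobden.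
by field; rewrite !gt_eqF // mobden_gt0.
Qed.

Lemma hypu_mobius g z w : SL2 g -> 0 < z.2 -> 0 < w.2 ->
  hypu (mobius g z) (mobius g w) = hypu z w.
Proof.
move=> dg z0 w0; rewrite /hypu sqdist_mobius // !mobius2 //.
have := lt0r_neq0 (mobden_gt0 dg z0); have := lt0r_neq0 (mobden_gt0 dg w0).
by move=> h1 h2; congr (1 + _); field; rewrite h1 h2 !gt_eqF.
Qed.

Lemma sqdistC z w : sqdist z w = sqdist w z.
Proof. by rewrite /sqdist; ring. Qed.

Lemma hypuC z w : hypu z w = hypu w z.
Proof. by rewrite /hypu sqdistC mulrAC. Qed.

Lemma sqdist_ge0 z w : 0 <= sqdist z w.
Proof. by rewrite addr_ge0 ?sqr_ge0. Qed.

Lemma sqdist_eq0 z w : (sqdist z w == 0) = (z == w).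
Proof.
rewrite /sqdist paddr_eq0 ?sqr_ge0 // !sqrf_eq0 !subr_eq0.
by case: z => a b; case: w.
Qed.

Lemma hypu_ge1 z w : 0 < z.2 -> 0 < w.2 -> 1 <= hypu z w.
Proof.
by move=> z0 w0; rewrite lerDl divr_ge0 ?sqdist_ge0 // !mulr_ge0 // ltW.
Qed.

Lemma hypu_eq1 z w : 0 < z.2 -> 0 < w.2 -> (hypu z w == 1) = (z == w).
Proof.
move=> z0 w0; rewrite -sqdist_eq0 -subr_eq0 /hypu addrAC subrr add0r mulf_eq0.
have -> : ((2 * z.2 * w.2)^-1 == 0) = false by apply/gt_eqF; rewrite invr_gt0 !mulr_gt0.
by rewrite orbF.
Qed.

Lemma hypu_gt1 z w : 0 < z.2 -> 0 < w.2 -> z != w -> 1 < hypu z w.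
Proof. by move=> z0 w0 zw; rewrite lt_def hypu_ge1 // hypu_eq1 // zw. Qed.

Lemma hypuxx z : hypu z z = 1.
Proof. by rewrite /hypu /sqdist !subrr expr0n /= addr0 mul0r addr0. Qed.

(* With distances normalised at b, the difference of the two sides is the
   square of the modulus of P + Q - i P Q, where P = a - b and Q = c - b. *)
Lemma hypu_triangle_sharp (a b c : R * R) : 0 < a.2 -> 0 < b.2 -> 0 < c.2 ->
  hypu a c - 1 <= 2 * ((hypu a b - 1) + (hypu b c - 1) + (hypu a b - 1) * (hypu b c - 1)).
Proof.
case: a => a1 a2; case: b => b1 b2; case: c => c1 c2 /= a0 b0 c0.
rewrite /hypu /sqdist /= -subr_ge0.
pose p1 := a1 - b1; pose p2 := a2 - b2; pose q1 := c1 - b1; pose q2 := c2 - b2.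
suff -> : 2 *
  (1 + ((a1 - b1) ^+ 2 + (a2 - b2) ^+ 2) / (2 * a2 * b2) - 1 +
   (1 + ((b1 - c1) ^+ 2 + (b2 - c2) ^+ 2) / (2 * b2 * c2) - 1) +
   (1 + ((a1 - b1) ^+ 2 + (a2 - b2) ^+ 2) / (2 * a2 * b2) - 1) *
   (1 + ((b1 - c1) ^+ 2 + (b2 - c2) ^+ 2) / (2 * b2 * c2) - 1)) -
  (1 + ((a1 - c1) ^+ 2 + (a2 - c2) ^+ 2) / (2 * a2 * c2) - 1) =
  ((b2 * (p1 + q1) + (p1 * q2 + p2 * q1)) ^+ 2 +
   (b2 * (p2 + q2) - (p1 * q1 - p2 * q2)) ^+ 2) / (2 * a2 * c2 * b2 ^+ 2).
  by rewrite divr_ge0 ?addr_ge0 ?sqr_ge0 // !mulr_ge0 ?sqr_ge0 // ltW.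
by rewrite /p1 /p2 /q1 /q2; field; rewrite !gt_eqF.
Qed.

(** In terms of distances this is [cosh (r + s) <= 2 cosh r cosh s]. This crude form serves for
    counting; where [u] is close to 1 the sharp form is used. *)
Lemma hypu_triangle (a b c : R * R) : 0 < a.2 -> 0 < b.2 -> 0 < c.2 ->
  hypu a c <= 2 * hypu a b * hypu b c.
Proof.
move=> a0 b0 c0; have := hypu_triangle_sharp a0 b0 c0.
have := hypu_ge1 a0 b0; have := hypu_ge1 b0 c0; nra.
Qed.

Definition aff z : 'M[R]_2 :=
  mx2 (Num.sqrt z.2) (z.1 / Num.sqrt z.2) 0 (Num.sqrt z.2)^-1.

Lemma aff_SL2 z : 0 < z.2 -> SL2 (aff z).
Proof.
move=> z0; rewrite /SL2 det2E !mx2E mulr0 subr0 mulfV // gt_eqF //.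
by rewrite sqrtr_gt0.
Qed.

Lemma mobius_aff z w : 0 < z.2 ->
  mobius (aff z) w = (z.1 + z.2 * w.1, z.2 * w.2).
Proof.
move=> z0; have s0 : 0 < Num.sqrt z.2 by rewrite sqrtr_gt0.
have E := sqr_sqrtr (ltW z0).
rewrite mobiusE /mobden !mx2E; move: s0 E; move: (Num.sqrt z.2) => s s0 E.
have sn := lt0r_neq0 s0.
by congr (_, _); rewrite -E; field.
Qed.

Lemma mobius_aff_i z : 0 < z.2 -> mobius (aff z) (0, 1) = z.
Proof.
by move=> z0; rewrite mobius_aff //= mulr0 addr0 mulr1; case: (z).
Qed.

Definition frob g : R := g 0 0 ^+ 2 + g 0 1 ^+ 2 + g 1 0 ^+ 2 + g 1 1 ^+ 2.

(** The conjugate of [g] by the isometry [aff z], which takes i to z, written without the square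
    root of [z.2]. Its Frobenius norm measures the displacement of z by [g]. *)
Definition conjz z g : 'M[R]_2 :=
  mx2 (g 0 0 - g 1 0 * z.1)
      ((g 0 1 + (g 0 0 - g 1 1) * z.1 - g 1 0 * z.1 ^+ 2) / z.2)
      (g 1 0 * z.2) (g 1 1 + g 1 0 * z.1).

Lemma conjz_aff z g : 0 < z.2 -> conjz z g = invmx (aff z) *m g *m aff z.
Proof.
move=> z0; rewrite (invmx2 (aff_SL2 z0)) /conjz /aff.
have s0 : 0 < Num.sqrt z.2 by rewrite sqrtr_gt0.
have E := sqr_sqrtr (ltW z0).
move: s0 E; move: (Num.sqrt z.2) => s s0 E; rewrite -E.
have sn := lt0r_neq0 s0.
by apply: matrix2P; rewrite !mulmx2E !mx2E; field.
Qed.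

Lemma conjzM z g h : 0 < z.2 -> conjz z (g *m h) = conjz z g *m conjz z h.
Proof.
move=> z0; rewrite !conjz_aff // !mulmxA; congr (_ *m _ *m _).
by rewrite -[RHS]mulmxA mulmxV ?mulmx1 //; exact/SL2_unit/aff_SL2.
Qed.

Lemma conjz1 z : 0 < z.2 -> conjz z 1%:M = 1%:M.
Proof. by move=> z0; rewrite conjz_aff // mulmx1 mulVmx //; exact/SL2_unit/aff_SL2. Qed.

Lemma conjz_SL2 z g : 0 < z.2 -> SL2 g -> SL2 (conjz z g).
Proof.
move=> z0 dg; rewrite conjz_aff //; apply: SL2M (aff_SL2 z0).
by apply: SL2M => //; apply: SL2V; exact: aff_SL2.
Qed.

Lemma conjz_inj z : 0 < z.2 -> injective (conjz z).
Proof.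
move=> z0 g h; rewrite !conjz_aff // => E.
have u := SL2_unit (aff_SL2 z0).
have := congr1 (fun M => aff z *m (M *m invmx (aff z))) E.
by rewrite -!mulmxA mulmxV // !mulmx1 !mulmxA mulmxV // !mul1mx.
Qed.

(** Lagrange's identity turns [(a c + b d)^2] into a product of norms minus the squared determinant,
    which is 1. *)
Lemma frob_hypu_i g : SL2 g -> frob g = 2 * hypu (0, 1) (mobius g (0, 1)).
Proof.
move=> dg; have D := mobden_gt0 dg (@ltr01 R : 0 < (0 : R, 1 : R).2).
rewrite /hypu mobius2 // /sqdist mobiusE /=.
have := dg; rewrite /SL2 det2E => ->; move: D; rewrite /mobden /= => D.
move: dg; rewrite /SL2 det2E /frob.
move: (g 0 0) (g 0 1) (g 1 0) (g 1 1) D => a b c d D dg.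
rewrite mulr0 add0r mulr1 in D *.
rewrite !mulr0 !add0r !mulr1 expr1n !mulr1 mul1r.
have D' := lt0r_neq0 D.
have -> : 2 * (1 + ((- ((b * d + a * c) / (d ^+ 2 + c ^+ 2))) ^+ 2 +
      (1 - (d ^+ 2 + c ^+ 2)^-1) ^+ 2) / (2 * (d ^+ 2 + c ^+ 2)^-1))
  = 2 + ((b * d + a * c) ^+ 2 + (d ^+ 2 + c ^+ 2 - 1) ^+ 2) / (d ^+ 2 + c ^+ 2).
  by field.
have -> : (b * d + a * c) ^+ 2 = (a ^+ 2 + b ^+ 2) * (d ^+ 2 + c ^+ 2) - (a * d - b * c) ^+ 2 by ring.
by rewrite dg; field.
Qed.

Lemma frob_conjz z g : 0 < z.2 -> SL2 g -> frob (conjz z g) = 2 * hypu z (mobius g z).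
Proof.
move=> z0 dg; have da := aff_SL2 z0; have i0 : 0 < (0 : R, 1 : R).2 by [].
rewrite frob_hypu_i; last exact: conjz_SL2.
rewrite conjz_aff // !mobiusM //; try exact: SL2V; try exact: SL2M (SL2V da) dg.
rewrite mobius_aff_i // -{1}(mobiusK da i0) mobius_aff_i //.
  by rewrite hypu_mobius //; [exact: SL2V|exact: mobius_upper].
by do 2! apply: mobius_upper => //.
Qed.

End HyperbolicPlane.

(** * The hyperbolic measure *)

Section DensityIntegral.
Local Open Scope ereal_scope.
Context d (T : measurableType d) (R : realType).
Variables (mu nu : {measure set T -> \bar R}) (p : T -> \bar R).
Hypotheses (mp : measurable_fun setT p) (p0 : forall x, 0 <= p x).
Hypothesis pfin : forall x, p x \is a fin_num.
Hypothesis nuE : forall A, measurable A -> nu A = \int[mu]_(x in A) p x.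

Import HBNNSimple.

(** The density is known on sets, hence on simple functions; monotone convergence does the rest. *)
Lemma integral_density f : (forall x, 0 <= f x) -> measurable_fun setT f ->
  \int[nu]_x f x = \int[mu]_x (f x * p x).
Proof.
move=> f0 mf.
pose h := nnsfun_approx measurableT mf.
have hf x : (EFin \o h n) x @[n --> \oo] --> f x.
  by apply: cvg_nnsfun_approx => //= y _; exact: f0.
have hnd x : {homo (fun n => (h n x)%:E) : n m / (n <= m)%N >-> n <= m}.
  by move=> a b ab; rewrite lee_fin; exact/lefP/nd_nnsfun_approx.
have -> : \int[nu]_x f x = limn (fun n => \int[nu]_x (EFin \o h n) x).
  rewrite -monotone_convergence //.
  - by apply: eq_integral => x _; apply/esym/cvg_lim => //; exact: hf.
  - by move=> n; exact/measurable_EFinP.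
  - by move=> n x _ /=; rewrite lee_fin.
  - by move=> x _; exact: hnd.
have -> : \int[mu]_x (f x * p x) = limn (fun n => \int[mu]_x ((EFin \o h n) x * p x)).
  rewrite -monotone_convergence //.
  - apply: eq_integral => x _; apply/esym/cvg_lim => //.
    by apply: cvgeZr => //; exact: hf.
  - by move=> n; apply: emeasurable_funM => //; exact/measurable_EFinP.
  - by move=> n x _ /=; rewrite mule_ge0 // lee_fin.
  - by move=> x _ a b ab; rewrite lee_wpmul2r //; exact: hnd.
congr (limn _); apply/funext => n.
transitivity (\sum_(k \in range (h n)) (k%:E * nu (h n @^-1` [set k]))).
  by rewrite integralT_nnsfun sintegralE.
under [RHS]eq_integral => x _.
  rewrite /= fimfunE -fsumEFin // ge0_mule_fsuml; last first.
    by move=> r; rewrite EFinM nnfun_muleindic_ge0.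
  over.
rewrite ge0_integral_fsum //; last 2 first.
- move=> r; apply: emeasurable_funM => //; exact/measurable_EFinP/measurable_funM.
- by move=> r x _; rewrite mule_ge0 // EFinM nnfun_muleindic_ge0.
apply: eq_fsbigr => k kn.
have k0 : (0 <= k)%R by move: kn => /[!inE] -[x _ <-].
under [RHS]eq_integral do rewrite EFinM -muleA.
rewrite ge0_integralZl //; last 2 first.
- by apply: emeasurable_funM => //; exact/measurable_EFinP.
- by move=> x _; rewrite mule_ge0 // lee_fin.
congr (_ * _); rewrite nuE // integral_mkcond.
apply: eq_integral => x _; rewrite patchE indicE.
by case: ifPn => _; rewrite ?mul1e ?mul0e.
Qed.

End DensityIntegral.

(** * Substitutions on the line and the Haar measure dy / y *)

Section LebesgueLine.
Variable R : realType.
Local Notation leb := (@lebesgue_measure R).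
Implicit Type f : R -> \bar R.

Lemma measurable_affine (a b : R) :
  measurable_fun setT (fun x : measurableTypeR R => a * x + b : measurableTypeR R).
Proof. by apply: measurable_funD => //; exact: mulrl_measurable. Qed.

(** The scaled pushforward agrees with Lebesgue measure on half-open intervals, hence everywhere by
    uniqueness. *)
Lemma lebesgue_affine (a b : R) (a0 : 0 < a) (A : set R) : measurable A ->
  leb A = (a%:E * leb ((fun x : R => a * x + b)%R @^-1` A))%E.
Proof.
move=> mA.
pose m1 := measure_function_pushforward__canonical__measure_function_Measure leb (measurable_affine a b).
have := @lebesgue_measure_unique R (mscale (NngNum (ltW a0)) m1) _ A mA.
apply=> _ [[c d] _ <-] /=.
rewrite /mscale /= /pushforward /=.
have -> : (fun x : R => a * x + b) @^-1` `]c, d] = `](c - b) / a, (d - b) / a]%classic.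
  apply/seteqP; split=> x /=; rewrite !in_itv /= ltr_pdivrMr // ler_pdivlMr //;
  by rewrite ltrBlDr lerBrDr (mulrC x).
rewrite !lebesgue_measure_itv /= !lte_fin ltr_pM2r ?invr_gt0 // ltrD2r.
case: ifPn => _; last by rewrite mule0.
by rewrite -!EFinD -EFinM -mulrBl opprD addrACA subrr addr0 mulrCA mulfV ?mulr1 // gt_eqF.
Qed.

Lemma ge0_integral_affine (a b : R) f (a0 : 0 < a) : measurable_fun setT f ->
  (forall x, (0 <= f x)%E) ->
  (\int[leb]_x f x = a%:E * \int[leb]_x f (a * x + b)%R)%E.
Proof.
move=> mf f0.
pose m1 := measure_function_pushforward__canonical__measure_function_Measure leb (measurable_affine a b).
transitivity (\int[mscale (NngNum (ltW a0)) m1]_x f x)%E.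
  by apply: eq_measure_integral => A mA _; exact: lebesgue_affine.
rewrite ge0_integral_mscale //; congr (_ * _)%E.
rewrite ge0_integral_pushforward //.
exact: measurable_affine.
Qed.

Lemma ge0_integral_translate (b : R) f : measurable_fun setT f ->
  (forall x, (0 <= f x)%E) ->
  (\int[leb]_x f (x + b)%R = \int[leb]_x f x)%E.
Proof.
move=> mf f0; rewrite (ge0_integral_affine b ltr01 mf f0) mul1e.
by apply: eq_integral => x _; rewrite mul1r.
Qed.

Lemma ge0_integral_opp f : measurable_fun setT f ->
  (forall x, (0 <= f x)%E) ->
  (\int[leb]_x f (- x)%R = \int[leb]_x f x)%E.
Proof.
move=> mf f0.
have mN : measurable_fun setT (-%R : _ -> measurableTypeR R) by exact: oppr_measurable.
pose m1 := measure_function_pushforward__canonical__measure_function_Measure leb mN.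
transitivity (\int[m1]_x f x)%E.
  by rewrite ge0_integral_pushforward.
by apply: eq_measure_integral => A mA _; exact: lebesgue_measureN.
Qed.

Lemma measurable_invr : measurable_fun setT (fun x : R => x^-1).
Proof.
have -> : (fun x : R => x^-1) = (fun x => if 0 < x then x `^ (-1)
    else if x < 0 then - (- x) `^ (-1) else 0).
  apply/funext => x; case: ltP => x0; first by rewrite powR_inv1 // ltW.
  case: ltP => x1; first by rewrite powR_inv1 ?invrN ?opprK // lerNr oppr0.
  have x00 : x = 0 by apply/eqP; rewrite eq_le x0.
  by rewrite x00 invr0.
apply: measurable_fun_ifT; first exact: measurable_fun_ltr.
  exact: measurable_powR.
apply: measurable_fun_ifT => //; first exact: measurable_fun_ltr.
apply: measurable_funN.
have mN : measurable_fun setT (-%R : R -> R) by exact: oppr_measurable.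
have : measurable_fun setT ((fun x : R => x `^ (-1)) \o (-%R : R -> R)).
  by apply: measurableT_comp => //; exact: measurable_powR.
exact.
Qed.

(** The integral over the multiplicative group of positive reals against its Haar measure dy / y. *)
Definition mint f : \bar R :=
  (\int[leb]_y (if (0 < y)%R then f y * (y^-1)%:E else 0))%E.

Let measurable_mint d (T : measurableType d) (g : T -> \bar R) (y : T -> R) :
  measurable_fun setT g -> measurable_fun setT y ->
  measurable_fun setT (fun t => if (0 < y t)%R then g t * ((y t)^-1)%:E else 0)%E.
Proof.
move=> mg my; apply: measurable_fun_ifT; first exact: measurable_fun_ltr.
  apply: emeasurable_funM => //; apply/measurable_EFinP.
  exact: measurableT_comp measurable_invr my.
exact: measurable_cst.
Qed.

Lemma mint_scale (c : R) f : 0 < c -> measurable_fun setT f ->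
  (forall x, (0 <= f x)%E) -> mint (fun y => f (c * y)) = mint f.
Proof.
move=> c0 mf f0; rewrite /mint.
rewrite [in RHS](@ge0_integral_affine c 0) //; last 2 first.
- exact: measurable_mint.
- by move=> y; case: ifPn => // y0; rewrite mule_ge0 // lee_fin invr_ge0 ltW.
rewrite -ge0_integralZl_EFin //; last 3 first.
- by move=> y _; case: ifPn => // y0; rewrite mule_ge0 // lee_fin invr_ge0 ltW.
- apply: (@measurable_mint _ _ (fun y => f (c * y + 0)) (fun y => c * y + 0)).
    apply: (measurableT_comp mf); exact: measurable_affine.
  exact: measurable_affine.
- exact: ltW.
apply: eq_integral => y _; rewrite addr0 pmulr_rgt0 //; case: ifPn => y0; last by rewrite mule0.
rewrite muleCA -EFinM invfM; congr (_ * _%:E)%E.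
by rewrite mulrA mulfV ?mul1r // gt_eqF.
Qed.

Lemma measurable_section1 d3 (T3 : measurableType d3) (F : R * R -> T3) (x : R) :
  measurable_fun setT F -> measurable_fun setT (fun y : R => F (x, y)).
Proof. by move=> mF; exact: measurable_fun_pair2. Qed.

Lemma measurable_section2 d3 (T3 : measurableType d3) (F : R * R -> T3) (y : R) :
  measurable_fun setT F -> measurable_fun setT (fun x : R => F (x, y)).
Proof. by move=> mF; exact: (measurable_fun_pair1 y). Qed.

Lemma mint_tonelli (F : R -> R -> \bar R) :
  measurable_fun setT (fun p : R * R => F p.1 p.2) ->
  (forall x y, (0 <= F x y)%E) ->
  (mint (fun x => \int[leb]_y F x y) = \int[leb]_y mint (F^~ y))%E.
Proof.
move=> mF F0; rewrite /mint.
transitivity (\int[leb]_x \int[leb]_y (if (0 < x)%R then F x y * (x^-1)%:E else 0))%E.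
  apply: eq_integral => x _; case: ifPn => x0; last by rewrite integral0.
  rewrite ge0_integralZr // ?lee_fin ?invr_ge0 1?ltW //.
  exact: (measurable_section1 x mF).
apply: (@fubini_tonelli _ _ _ _ R leb leb (fun p => if (0 < p.1)%R then F p.1 p.2 * (p.1^-1)%:E else 0)%E).
  by apply: (@measurable_mint _ _ (fun p : R * R => F p.1 p.2) fst) => //; exact: measurable_fst.
by move=> p /=; case: ifPn => // p0; rewrite mule_ge0 // lee_fin invr_ge0 ltW.
Qed.

(* Uniqueness of Haar measure: for f with finite nonzero integral,
   (int f)(int g(1/y)) = int int f(x) g(x/y) = int int f(xy) g(x) = (int f)(int g). *)
Lemma mint_inv g : measurable_fun setT g -> (forall x, (0 <= g x)%E) ->
  mint (fun y => g y^-1) = mint g.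
Proof.
move=> mg g0.
(* Any test function with finite non-zero integral would do; for this one the integral lies between
   1/2 and 1. *)
pose f (x : R) : \bar R := (\1_(`[1, 2]%classic : set R) x)%:E.
have f0 x : (0 <= f x)%E by rewrite lee_fin.
have mf : measurable_fun setT f.
  by apply/measurable_EFinP; apply: measurable_indic; exact: measurable_itv.
have fI : (\int[leb]_y f y = 1)%E.
  rewrite /f integral_indic // setIT.
  have -> : (1 = 2%:E - 1%:E :> \bar R)%E by rewrite -EFinD; congr EFin; lra.
  have := @lebesgue_measure_itv R `[1, 2]; rewrite /= lte_fin ltr1n; exact.
have f1 : (mint f <= 1)%E.
  rewrite /mint; apply: (@le_trans _ _ (\int[leb]_y f y)%E).
    apply: ge0_le_integral => //.
    - by move=> y _; case: ifPn => // y0; rewrite mule_ge0 // lee_fin invr_ge0 ltW.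
    - exact: measurable_mint.
    move=> y _; case: ifPn => // y0; rewrite /f indicE.
    case: (boolP (y \in _)) => h; last by rewrite mul0e.
    by rewrite mul1e lee_fin; move: h; rewrite inE /= in_itv /= => /andP[h _]; rewrite invf_le1.
  by rewrite fI.
have f2 : (2^-1%:E <= mint f)%E.
  rewrite /mint; apply: (@le_trans _ _ (\int[leb]_y (2^-1%:E * f y))%E).
    by rewrite ge0_integralZl_EFin // fI mule1.
  apply: ge0_le_integral => //.
  - by move=> y _; rewrite mule_ge0 // lee_fin.
  - by apply: emeasurable_funM.
  - exact: measurable_mint.
  move=> y _; rewrite /f indicE; case: (boolP (y \in _)) => h; last first.
    by rewrite mule0; case: ifPn => // _; rewrite mul0e.
  move: h; rewrite inE /= in_itv /= => /andP[h1 h2].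
  by rewrite (lt_le_trans ltr01 h1) mule1 mul1e lee_fin lef_pV2 // posrE //; lra.
have ff : mint f \is a fin_num.
  rewrite ge0_fin_numE; first exact: le_lt_trans f1 (ltry _).
  by apply: le_trans f2; rewrite lee_fin.
have fn0 : mint f != 0%E.
  by apply/eqP => E; move: f2; rewrite E lee_fin leNgt invr_gt0 ltr0n.
have mint_ge0 h : (forall x, (0 <= h x)%E) -> (0 <= mint h)%E.
  move=> h0; apply: integral_ge0 => y _; case: ifPn => // y0.
  by rewrite mule_ge0 // lee_fin invr_ge0 ltW.
have mgV : measurable_fun setT (fun y : R => g y^-1).
  exact: measurableT_comp mg measurable_invr.
have mintZ c h : (0 <= c)%E -> measurable_fun setT h -> (forall x, (0 <= h x)%E) ->
    (mint (fun y => c * h y) = c * mint h)%E.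
  move=> c0 mh h0; rewrite /mint -ge0_integralZl //.
  - by apply: eq_integral => y _; case: ifPn => // _; rewrite ?muleA ?mule0.
  - exact: measurable_mint.
  - by move=> y _; case: ifPn => // y0; rewrite mule_ge0 // lee_fin invr_ge0 ltW.
have eq_mint h1 h2 : (forall y, 0 < y -> h1 y = h2 y) -> mint h1 = mint h2.
  by move=> h12; apply: eq_integral => y _; case: ifPn => // /h12 ->.
have swap (F : R -> R -> \bar R) :
    measurable_fun setT (fun p : R * R => F p.1 p.2) ->
    (forall x y, (0 <= F x y)%E) ->
    mint (fun x => mint (F x)) = mint (fun y => mint (F^~ y)).
  move=> mF F0; rewrite {2}/mint.
  transitivity (mint (fun x => \int[leb]_y (if (0 < y)%R then F x y * (y^-1)%:E else 0))%E).
    by [].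
  rewrite mint_tonelli; last 2 first.
  - apply: (@measurable_mint _ _ (fun p : R * R => F p.1 p.2) snd) => //; exact: measurable_snd.
  - by move=> x y; case: ifPn => // y0; rewrite mule_ge0 // lee_fin invr_ge0 ltW.
  rewrite /mint; apply: eq_integral => y _; case: ifPn => y0.
    rewrite -ge0_integralZr //; last 3 first.
    - apply: (@measurable_mint _ _ (F^~ y) id) => //.
      exact: (measurable_section2 y mF).
    - by move=> x _; case: ifPn => // x0; rewrite mule_ge0 // lee_fin invr_ge0 ltW.
    - by rewrite lee_fin invr_ge0 ltW.
    by apply: eq_integral => x _; case: ifPn => // _; rewrite ?mul0e // muleAC.
  by apply: integral0_eq => x _; case: ifPn => // _; rewrite mul0e.
have m1 : measurable_fun setT (fst : R * R -> R) by exact: measurable_fst.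
have m2 : measurable_fun setT (snd : R * R -> R) by exact: measurable_snd.
have mV : measurable_fun setT (fun p : R * R => p.2^-1).
  exact: measurableT_comp measurable_invr m2.
have mD : measurable_fun setT (fun p : R * R => p.1 * p.2^-1).
  exact: measurable_funM.
have mP : measurable_fun setT (fun p : R * R => p.1 * p.2).
  exact: measurable_funM.
suff : (mint f * mint (fun y => g (y^-1)%R) = mint f * mint g)%E.
  move=> /(congr1 (fun x => (fine (mint f))^-1%:E * x)%E).
  rewrite !muleA -{2 4}(fineK ff) -EFinM mulVf ?mul1e //.
  by apply: contra fn0 => /eqP h; rewrite -(fineK ff) h.
transitivity (mint (fun x => mint (fun y => f x * g (x * y^-1)%R))%E).
  rewrite muleC -mintZ //; last by apply: (mint_ge0 _) => y.
  apply: (eq_mint _ _) => x x0; rewrite muleC.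
  rewrite mintZ //; last first.
    exact: (measurableT_comp mg (measurable_section1 x mD)).
  congr (_ * _)%E; rewrite -[RHS](@mint_scale x) //=; last first.
    exact: (measurableT_comp mg (measurable_section1 x mD)).
  apply: (eq_mint _ _) => y y0; congr g.
  by rewrite invfM mulrA mulfV ?mul1r // gt_eqF.
rewrite swap; last 2 first.
- apply: emeasurable_funM; first exact: measurableT_comp mf m1.
  exact: measurableT_comp mg mD.
- by move=> x y; rewrite mule_ge0.
transitivity (mint (fun y => mint (fun x => f (x * y)%R * g x))%E).
  apply: (eq_mint _ _) => y y0.
  rewrite -[LHS](@mint_scale y) //; last 2 first.
  - apply: emeasurable_funM => //.
    exact: (measurableT_comp mg (measurable_section2 y mD)).
  - by move=> x; rewrite mule_ge0.
  apply: (eq_mint _ _) => x x0; rewrite (mulrC y x) -mulrA mulfV ?mulr1 // gt_eqF //.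
rewrite swap; last 2 first.
- apply: emeasurable_funM; last exact: measurableT_comp mg m2.
  apply: (measurableT_comp mf).
  exact: measurable_funM.
- by move=> x y; rewrite mule_ge0.
rewrite -mintZ //; last by apply: (mint_ge0 _).
apply: (eq_mint _ _) => x x0; rewrite muleC.
transitivity (mint (fun y => g x * f (x * y)%R))%E.
  by apply: (eq_mint _ _) => y y0; rewrite muleC.
rewrite mintZ //; last first.
  exact: (measurableT_comp mf (measurable_section1 x mP)).
by rewrite mint_scale.
Qed.

End LebesgueLine.

(** * Invariance of the hyperbolic measure *)

Section HyperbolicMeasure.
Variable R : realType.
Local Notation leb := (@lebesgue_measure R).
Local Notation hyp := (@hyp_measure R).
Implicit Type f : R * R -> \bar R.

Lemma measurable_upper_half : measurable (upper_half R).
Proof.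
have -> : upper_half R = setT `&` (fun z : R * R => 0 < z.2) @^-1` [set true].
  by rewrite setTI; apply/seteqP; split.
have m : measurable_fun setT (fun z : R * R => 0 < z.2).
  by apply: measurable_fun_ltr => //; exact: measurable_snd.
exact: m.
Qed.

Lemma integral_hypE f : measurable_fun setT f -> (forall z, (0 <= f z)%E) ->
  (\int[hyp]_z f z = \int[(leb \x leb)]_z (f z * hyp_density z))%E.
Proof.
move=> mf f0.
(* The product measure lives on the product of two copies of [measurableTypeR R], the hyperbolic
   measure on [R * R]; pushing forward along the identity passes from one to the other. *)
pose T2 : measurableType _ := (measurableTypeR R * measurableTypeR R)%type.
pose T1 : measurableType _ := (R * R)%type.
have mid : measurable_fun setT (id : T2 -> T1).
  by move=> _ Y mY; rewrite setTI; exact: mY.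
pose mu := measure_function_pushforward__canonical__measure_function_Measure
  (leb \x leb)%E mid.
transitivity (\int[mu]_z (f z * hyp_density z))%E.
  apply: (@integral_density _ T1 R mu hyp (@hyp_density R)) => //.
  - exact: measurable_hyp_density.
  - exact: hyp_density_ge0.
  - move=> A mA; rewrite /mu ge0_integral_pushforward //.
    + exact: measurable_funS (@measurable_hyp_density R).
    + by move=> z _; exact: hyp_density_ge0.
rewrite /mu ge0_integral_pushforward //.
- by apply: emeasurable_funM => //; exact: measurable_hyp_density.
- by move=> z _; rewrite mule_ge0 ?hyp_density_ge0.
Qed.

Lemma integral_hyp_upper f : measurable_fun setT f -> (forall z, (0 <= f z)%E) ->
  (\int[hyp]_(z in upper_half R) f z = \int[hyp]_z f z)%E.
Proof.
move=> mf f0; rewrite integral_mkcond !integral_hypE //; last 2 first.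
- by apply/(measurable_restrictT _ measurable_upper_half); exact: measurable_funS mf.
- by move=> z; rewrite patchE; case: ifPn.
apply: eq_integral => z _; rewrite patchE /hyp_density.
case: (boolP (z \in upper_half R)) => h; first by [].
suff -> : (0 < z.2) = false by rewrite !mule0.
by apply/negbTE; apply: contra h => h; rewrite inE.
Qed.

Lemma integral_hyp_eq f g : (forall z, 0 < z.2 -> f z = g z) ->
  measurable_fun setT f -> (forall z, (0 <= f z)%E) ->
  measurable_fun setT g -> (forall z, (0 <= g z)%E) ->
  (\int[hyp]_z f z = \int[hyp]_z g z)%E.
Proof.
move=> fg mf f0 mg g0; rewrite !integral_hypE //; apply: eq_integral => z _.
rewrite /hyp_density; case: ifPn => [/fg -> //|_]; by rewrite !mule0.
Qed.

Lemma integral_hyp_rows f : measurable_fun setT f -> (forall z, (0 <= f z)%E) ->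
  (\int[hyp]_z f z = \int[leb]_y (if (0 < y)%R then
     (y ^- 2)%:E * \int[leb]_x f (x, y) else 0))%E.
Proof.
move=> mf f0; rewrite integral_hypE //.
rewrite (@fubini_tonelli2 _ _ _ _ R leb leb) /=; last 2 first.
- by apply: emeasurable_funM => //; exact: measurable_hyp_density.
- by move=> z; rewrite mule_ge0 ?hyp_density_ge0.
apply: eq_integral => y _; rewrite /fubini_G /hyp_density /=; case: ifPn => y0.
  rewrite -ge0_integralZl //.
  - by apply: eq_integral => x _; rewrite muleC.
  - exact: (measurable_section2 y mf).
  - by rewrite lee_fin invr_ge0 exprn_ge0 // ltW.
by apply: integral0_eq => x _; rewrite mule0.
Qed.

(* Coordinates (x/y, y), in which the hyperbolic measure is a product. *)
Lemma integral_hyp_slopes f : measurable_fun setT f -> (forall z, (0 <= f z)%E) ->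
  (\int[hyp]_z f z = \int[leb]_s mint (fun y => f (s * y, y)%R))%E.
Proof.
move=> mf f0; rewrite integral_hyp_rows //.
have mF : measurable_fun setT (fun p : R * R => f (p.2 * p.1, p.1)).
  apply: (measurableT_comp mf); apply: measurable_fun_pair => //.
  exact: measurable_funM.
rewrite -(@mint_tonelli _ (fun y s => f (s * y, y)%R)) //.
apply: eq_integral => y _; case: ifPn => // y0.
have my := measurable_section2 y mf.
rewrite (ge0_integral_affine 0 y0 my) //.
rewrite muleA -EFinM muleC; congr (_ * _%:E)%E; last by field; rewrite gt_eqF.
by apply: eq_integral => x _; rewrite addr0 mulrC.
Qed.

Lemma integral_hyp_translate b f : measurable_fun setT f -> (forall z, (0 <= f z)%E) ->
  (\int[hyp]_z f (z.1 + b, z.2)%R = \int[hyp]_z f z)%E.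
Proof.
move=> mf f0.
have mfb : measurable_fun setT (fun z : R * R => f (z.1 + b, z.2)).
  apply: (measurableT_comp mf); apply: measurable_fun_pair => //.
  by apply: measurable_funD => //; exact: measurable_fst.
rewrite (integral_hyp_rows mfb (fun z => f0 _)) (integral_hyp_rows mf f0) /=.
apply: eq_integral => y _; case: ifPn => // y0; congr (_ * _)%E.
have my := measurable_section2 y mf.
exact: (ge0_integral_translate b my).
Qed.

Lemma integral_hyp_scale a f : 0 < a -> measurable_fun setT f -> (forall z, (0 <= f z)%E) ->
  (\int[hyp]_z f (a * z.1, a * z.2)%R = \int[hyp]_z f z)%E.
Proof.
move=> a0 mf f0.
have m1 : measurable_fun setT (fst : R * R -> R) by exact: measurable_fst.
have m2 : measurable_fun setT (snd : R * R -> R) by exact: measurable_snd.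
have mfa : measurable_fun setT (fun z : R * R => f (a * z.1, a * z.2)).
  apply: (measurableT_comp mf); apply: measurable_fun_pair => //;
    by apply: measurable_funM.
rewrite (integral_hyp_slopes mfa (fun z => f0 _)) (integral_hyp_slopes mf f0) /=.
apply: eq_integral => s _.
have mg : measurable_fun setT (fun y : R => f (s * y, y)).
  apply: (measurableT_comp mf); apply: measurable_fun_pair => //; exact: mulrl_measurable.
rewrite -(mint_scale a0 mg (fun z => f0 _)).
by congr mint; apply/funext => y; rewrite mulrCA.
Qed.

(** The inversion [- 1 / z]. *)
Definition minv (z : R * R) : R * R :=
  (- z.1 / (z.1 ^+ 2 + z.2 ^+ 2), z.2 / (z.1 ^+ 2 + z.2 ^+ 2)).

Lemma measurable_minv : measurable_fun setT minv.
Proof.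
have m1 : measurable_fun setT (fst : R * R -> R) by exact: measurable_fst.
have m2 : measurable_fun setT (snd : R * R -> R) by exact: measurable_snd.
have md : measurable_fun setT (fun z : R * R => (z.1 ^+ 2 + z.2 ^+ 2)^-1).
  apply: (measurableT_comp (@measurable_invr R)).
  by apply: measurable_funD; apply: measurable_funX.
apply: measurable_fun_pair; apply: measurable_funM => //.
exact: measurable_funN.
Qed.

(** In the coordinates [(s, y)] with [s = x / y], the inversion is [s -> - s] and
    [y -> 1 / ((1 + s^2) y)]. It therefore preserves the product of ds and dy / y: the former by
    reflection, the latter by scaling and inversion. *)
Lemma integral_hyp_inv f : measurable_fun setT f -> (forall z, (0 <= f z)%E) ->
  (\int[hyp]_z f (minv z) = \int[hyp]_z f z)%E.
Proof.
move=> mf f0.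
have mfi : measurable_fun setT (fun z => f (minv z)).
  exact: measurableT_comp mf measurable_minv.
rewrite (integral_hyp_slopes mfi (fun z => f0 _)) (integral_hyp_slopes mf f0) /=.
have mF : measurable_fun setT (fun p : R * R => f (p.1 * p.2, p.2)).
  apply: (measurableT_comp mf); apply: measurable_fun_pair => //.
  by apply: measurable_funM.
rewrite -[RHS]ge0_integral_opp; last 2 first.
- have := measurable_fun_fubini_tonelli_F (m2 := leb) (fun p : R * R => if (0 < p.2)%R then f (p.1 * p.2, p.2)%R * (p.2^-1)%:E else 0)%E.
  rewrite /fubini_F /mint /=; apply.
  + apply: measurable_fun_ifT; first by apply: measurable_fun_ltr.
      apply: emeasurable_funM => //; apply/measurable_EFinP.
      by apply: (measurableT_comp (@measurable_invr R)).
    exact: measurable_cst.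
  + by move=> p; case: ifPn => // p0; rewrite mule_ge0 // lee_fin invr_ge0 ltW.
- by move=> s; apply: integral_ge0 => y _; case: ifPn => // y0; rewrite mule_ge0 // lee_fin invr_ge0 ltW.
apply: eq_integral => s _.
have mg := measurable_section1 (- s) mF.
have s0 : 0 < 1 + s ^+ 2 by rewrite ltr_wpDr ?sqr_ge0.
have g0 y : (0 <= f (- s * y, y)%R)%E by [].
have mgV : measurable_fun setT (fun y : R => f (- s * y^-1, y^-1)).
  exact: (measurableT_comp mg (@measurable_invr R)).
rewrite -[RHS](mint_inv mg g0) -[RHS](mint_scale s0 mgV) //.
apply: eq_integral => y _; case: ifPn => // y0; congr (f _ * _)%E.
have Dy : 0 < (s * y) ^+ 2 + y ^+ 2 by rewrite ltr_wpDl ?sqr_ge0 ?exprn_gt0.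
by rewrite /minv /=; congr (_, _); field; rewrite !gt_eqF.
Qed.

Lemma measurable_mobius (g : 'M[R]_2) : measurable_fun setT (mobius g).
Proof.
have m1 : measurable_fun setT (fst : R * R -> R) by exact: measurable_fst.
have m2 : measurable_fun setT (snd : R * R -> R) by exact: measurable_snd.
have -> : mobius g = fun z => (((g 0 0 * z.1 + g 0 1) * (g 1 0 * z.1 + g 1 1) + g 0 0 * g 1 0 * z.2 ^+ 2)
     / mobden g z, (g 0 0 * g 1 1 - g 0 1 * g 1 0) * z.2 / mobden g z).
  by apply/funext => z; exact: mobiusE.
have mM (a : R) (h : R * R -> R) : measurable_fun setT h -> measurable_fun setT (fun z => a * h z).
  by move=> mh; apply: measurable_funM.
have mA (a b : R) : measurable_fun setT (fun z : R * R => a * z.1 + b).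
  by apply: measurable_funD => //; exact: mM.
have md : measurable_fun setT (fun z => (mobden g z)^-1).
  apply: (measurableT_comp (@measurable_invr R)).
  apply: measurable_funD; apply: measurable_funX; [exact: mA|exact: mM].
apply: measurable_fun_pair; apply: measurable_funM => //; last exact: mM.
apply: measurable_funD; first by apply: measurable_funM.
by apply: mM; apply: measurable_funX.
Qed.

(** The Bruhat decomposition [g z = a / c - 1 / (c^2 (z + d / c))]: invariance of the measure needs
    to be known only for translations, scalings and the inversion. *)
Lemma mobius_decomp (g : 'M[R]_2) z : SL2 g -> g 1 0 != 0 -> 0 < z.2 ->
  mobius g z = ((g 1 0 ^- 2 * (minv (z.1 + g 1 1 / g 1 0, z.2)).1) + g 0 0 / g 1 0,
                g 1 0 ^- 2 * (minv (z.1 + g 1 1 / g 1 0, z.2)).2).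
Proof.
move=> dg c0 z0; have D := lt0r_neq0 (mobden_gt0 dg z0).
have D2 : (z.1 + g 1 1 / g 1 0) ^+ 2 + z.2 ^+ 2 != 0.
  by rewrite gt_eqF // ltr_wpDl ?sqr_ge0 // exprn_gt0.
move: dg; rewrite mobiusE /minv /= /SL2 det2E; move: D D2; rewrite /mobden.
move: (g 0 0) (g 0 1) (g 1 0) (g 1 1) c0 => a b c d c0 D D2 dg.
have E : (z.1 + d / c) ^+ 2 + z.2 ^+ 2 = ((c * z.1 + d) ^+ 2 + (c * z.2) ^+ 2) / c ^+ 2.
  by field.
have b1 : b = (a * d - 1) / c by rewrite -dg; field.
rewrite E dg b1; congr (_, _); field; by rewrite c0 D.
Qed.

Lemma mobius_decomp0 (g : 'M[R]_2) z : SL2 g -> g 1 0 = 0 -> 0 < z.2 ->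
  mobius g z = (g 0 0 ^+ 2 * z.1 + g 0 1 * g 0 0, g 0 0 ^+ 2 * z.2).
Proof.
move=> dg c0 z0; have D := lt0r_neq0 (mobden_gt0 dg z0).
move: dg; rewrite mobiusE /SL2 det2E; move: D; rewrite /mobden c0.
rewrite !mul0r !mulr0 mul0r !add0r expr0n /= addr0 subr0 => D dg.
have d0 : g 1 1 != 0 by move: D; rewrite sqrf_eq0.
have -> : g 0 0 = (g 1 1)^-1 by rewrite -[RHS]mul1r -dg mulfK.
by congr (_, _); field.
Qed.

Lemma integral_hyp_mobius (g : 'M[R]_2) f : SL2 g -> measurable_fun setT f ->
  (forall z, (0 <= f z)%E) -> (\int[hyp]_z f (mobius g z) = \int[hyp]_z f z)%E.
Proof.
move=> dg mf f0.
have m1 : measurable_fun setT (fst : R * R -> R) by exact: measurable_fst.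
have m2 : measurable_fun setT (snd : R * R -> R) by exact: measurable_snd.
have mT b h : measurable_fun setT h ->
    measurable_fun setT (fun z : R * R => h (z.1 + b, z.2) : \bar R).
  move=> mh; apply: (measurableT_comp mh); apply: measurable_fun_pair => //.
  exact: measurable_funD.
have mS a h : measurable_fun setT h ->
    measurable_fun setT (fun z : R * R => h (a * z.1, a * z.2) : \bar R).
  move=> mh; apply: (measurableT_comp mh); apply: measurable_fun_pair => //;
  by apply: measurable_funM.
have mg : measurable_fun setT (fun z => f (mobius g z)).
  exact: measurableT_comp mf (measurable_mobius g).
have [c0|c0] := eqVneq (g 1 0) 0.
  have a0 : 0 < g 0 0 ^+ 2.
    rewrite lt_def sqr_ge0 andbT sqrf_eq0; apply/eqP => a0.
    by move: dg; rewrite /SL2 det2E c0 a0 mul0r mulr0 subr0 => /eqP; rewrite eq_sym oner_eq0.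
  transitivity (\int[hyp]_z (fun w => f (w.1 + g 0 1 * g 0 0, w.2)%R) (g 0 0 ^+ 2 * z.1, g 0 0 ^+ 2 * z.2)%R)%E.
    apply: integral_hyp_eq => // [z z0|]; first by rewrite mobius_decomp0.
    by apply: (mS _ (fun w => f (w.1 + g 0 1 * g 0 0, w.2))); exact: mT.
  rewrite (integral_hyp_scale a0 (mT _ _ mf)) //.
  exact: (integral_hyp_translate (g 0 1 * g 0 0) mf).
have a0 : 0 < g 1 0 ^- 2 by rewrite invr_gt0 exprn_even_gt0.
pose f1 w := f (w.1 + g 0 0 / g 1 0, w.2).
pose f2 w := f1 (g 1 0 ^- 2 * w.1, g 1 0 ^- 2 * w.2).
have mf1 : measurable_fun setT f1 by exact: mT.
have mf2 : measurable_fun setT f2 by exact: (mS _ f1).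
have mf3 : measurable_fun setT (f2 \o minv) by exact: measurableT_comp mf2 measurable_minv.
transitivity (\int[hyp]_z (f2 \o minv) (z.1 + g 1 1 / g 1 0, z.2)%R)%E.
  apply: integral_hyp_eq => //; last 2 first.
  - exact: (mT _ (f2 \o minv)).
  - by move=> z; exact: f0.
  by move=> z z0; rewrite (mobius_decomp dg c0 z0).
rewrite (integral_hyp_translate (g 1 1 / g 1 0) mf3); last first.
  by move=> z; exact: f0.
transitivity (\int[hyp]_z f2 z)%E; first exact: (integral_hyp_inv mf2 (fun z => f0 _)).
transitivity (\int[hyp]_z f1 z)%E; first exact: (integral_hyp_scale a0 mf1 (fun z => f0 _)).
exact: (integral_hyp_translate (g 0 0 / g 1 0) mf).
Qed.

Lemma hyp_set1 (z : R * R) : hyp [set z] = 0%E.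
Proof.
have mz : measurable [set z].
  have -> : [set z] = [set z.1] `*` [set z.2].
    apply/seteqP; split=> [_ -> //|[x y] /= [-> ->]]; by case: (z).
  by apply: measurableX; exact: measurable_set1.
rewrite -(setIT [set z]) -integral_indic //.
have mi : measurable_fun setT (fun w : R * R => (\1_([set z] : set (R * R)) w : R)%:E).
  by apply/measurable_EFinP; exact: measurable_indic.
rewrite (integral_hyp_rows mi) //.
apply: integral0_eq => y _; case: ifPn => // y0.
rewrite [X in (_ * X)%E](_ : _ = 0%E) ?mule0 //.
rewrite -(@integral_set1 R (fun x : R => (\1_([set z] : set (R * R)) (x, y) : R)%:E) z.1).
rewrite [RHS]integral_mkcond; apply: eq_integral => x _; rewrite patchE indicE.
case: ifPn => //; apply: contraNeq; rewrite !inE /= => h.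
by case: (boolP ((x, y) \in [set z])) h => [|_ /eqP//]; rewrite inE => <-.
Qed.

End HyperbolicMeasure.

Section ContinuousReal.
Context {R : realType} {T : topologicalType}.
Implicit Types f g : T -> R.

Lemma contC (a : R) : continuous (fun _ : T => a).
Proof. by move=> x; exact: cst_continuous. Qed.

Lemma contD f g : continuous f -> continuous g -> continuous (fun x => f x + g x).
Proof. by move=> cf cg x; exact: (@continuousD R R T f g x (cf x) (cg x)). Qed.

Lemma contN f : continuous f -> continuous (fun x => - f x).
Proof. by move=> cf x; exact: (@continuousN R R T f x (cf x)). Qed.

Lemma contM f g : continuous f -> continuous g -> continuous (fun x => f x * g x).
Proof. by move=> cf cg x; exact: (@continuousM R T f g x (cf x) (cg x)). Qed.

Lemma contX n f : continuous f -> continuous (fun x => f x ^+ n).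
Proof.
move=> cf; elim: n => [|n IH]; first exact: contC.
by under eq_fun do rewrite exprS; exact: contM.
Qed.

Lemma contV f : (forall x, f x != 0) -> continuous f -> continuous (fun x => (f x)^-1).
Proof. by move=> f0 cf x; exact: (@continuousV R T f x (f0 x) (cf x)). Qed.

Lemma cont_comp (h : R -> R) f : continuous h -> continuous f ->
  continuous (fun x => h (f x)).
Proof. by move=> ch cf x; apply: continuous_comp; [exact: cf|exact: ch]. Qed.

End ContinuousReal.

(** * Areas of hyperbolic discs and integrals of radial functions *)

Section DiscArea.
Variable R : realType.
Local Notation leb := (@lebesgue_measure R).
Local Notation hyp := (@hyp_measure R).

Lemma is_derive_div (f g : R -> R) (x df dg : R) : g x != 0 ->
  is_derive x (1 : R) f df -> is_derive x (1 : R) g dg ->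
  is_derive x (1 : R) (fun y => f y / g y) ((df * g x - f x * dg) / g x ^+ 2).
Proof.
move=> g0 hf hg; have hV := is_deriveV g0 hg.
apply: is_derive_eq (is_deriveM hf hV) _.
by rewrite /GRing.scale /=; field.
Qed.

Lemma is_derive_sqrt_comp (f : R -> R) (x df : R) : 0 < f x ->
  is_derive x (1 : R) f df ->
  is_derive x (1 : R) (fun y => Num.sqrt (f y)) (df / (2 * Num.sqrt (f x))).
Proof.
move=> f0 hf.
by apply: is_derive_eq (is_derive1_comp (is_derive1_sqrt f0) hf) _; rewrite mulrC.
Qed.

Section DiscRow.
Variables (t : R) (t1 : 1 < t).
Let rho : R := Num.sqrt (t ^+ 2 - 1).
Let q (x : R) : R := Num.sqrt (rho ^+ 2 - x ^+ 2).
Let s (x : R) : R := Num.sqrt (1 + x ^+ 2).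

Let rho2 : rho ^+ 2 = t ^+ 2 - 1.
Proof. by rewrite sqr_sqrtr // subr_ge0 expr_ge1 // ltW // (lt_trans ltr01). Qed.

Let rho0 : 0 < rho.
Proof. by rewrite sqrtr_gt0 subr_gt0 expr_gt1 // ltW // (lt_trans ltr01). Qed.

Let s0 x : 0 < s x.
Proof. by rewrite sqrtr_gt0 ltr_wpDr ?sqr_ge0. Qed.

Let s2 x : s x ^+ 2 = 1 + x ^+ 2.
Proof. by rewrite sqr_sqrtr // addr_ge0 ?sqr_ge0. Qed.

Let q0 x : 0 <= q x. Proof. exact: sqrtr_ge0. Qed.

(** The primitive [2 t atan (t x / q) - 2 asin (x / rho)] in half-angle form. The half angles use
    [q^2 + t^2 x^2 = rho^2 s^2], and their denominators stay positive at the ends of the interval,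
    where [q] vanishes. *)
Definition disc_primitive (x : R) : R :=
  4 * t * atan (t * x / (rho * s x + q x)) - 4 * atan (x / (rho + q x)).

Let cq : continuous q.
Proof.
apply: cont_comp; first exact: sqrt_continuous.
apply: contD; first exact: contC.
by apply: contN; apply: contX => x; exact: cvg_id.
Qed.

Let cs : continuous s.
Proof.
apply: cont_comp; first exact: sqrt_continuous.
apply: contD; first exact: contC.
by apply: contX => x; exact: cvg_id.
Qed.

Let D10 x : 0 < rho + q x. Proof. by rewrite ltr_wpDr. Qed.
Let D20 x : 0 < rho * s x + q x. Proof. by rewrite ltr_wpDr // mulr_gt0. Qed.

Lemma disc_primitive_continuous : continuous disc_primitive.
Proof.
have cI : continuous (fun x : R => x) by move=> x; exact: cvg_id.
apply: contD; [|apply: contN]; apply: contM; try exact: contC.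
  apply: cont_comp; first exact: continuous_atan.
  apply: contM; first by apply: contM; first exact: contC.
  apply: contV; first by move=> x; rewrite gt_eqF.
  by apply: contD; [apply: contM; [exact: contC|exact: cs]|exact: cq].
apply: cont_comp; first exact: continuous_atan.
apply: contM => //; apply: contV; first by move=> x; rewrite gt_eqF.
by apply: contD; [exact: contC|exact: cq].
Qed.

Lemma is_derive_disc_primitive (x : R) : - rho < x < rho ->
  is_derive x (1 : R) disc_primitive (2 * q x / (1 + x ^+ 2)).
Proof.
move=> /andP[x1 x2].
have d0 : 0 < rho ^+ 2 - x ^+ 2.
  by rewrite subr_sqr mulr_gt0 // ?subr_gt0 // -ltrBlDl sub0r.
have qx : 0 < q x by rewrite sqrtr_gt0.
have q2 : q x ^+ 2 = rho ^+ 2 - x ^+ 2 by rewrite sqr_sqrtr // ltW.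
have dx2 : is_derive x (1 : R) (fun y : R => y ^+ 2) (2 * x).
  by apply: is_derive_eq (is_deriveX 2 (is_derive_id x (1 : R))) _; rewrite [_ *: 1]mulr1 /= expr1.
have dq : is_derive x (1 : R) q (- x / q x).
  have h : is_derive x (1 : R) (fun y : R => rho ^+ 2 - y ^+ 2) (0 - 2 * x).
    exact: is_deriveB (is_derive_cst _ _ _) dx2.
  rewrite /q; apply: is_derive_eq (@is_derive_sqrt_comp (fun y => rho ^+ 2 - y ^+ 2) x _ d0 h) _; rewrite -/(q x).
  by field; rewrite gt_eqF.
have ds : is_derive x (1 : R) s (x / s x).
  have h : is_derive x (1 : R) (fun y : R => 1 + y ^+ 2) (0 + 2 * x).
    exact: is_deriveD (is_derive_cst _ _ _) dx2.
  have h1 : 0 < 1 + x ^+ 2 by rewrite ltr_wpDr ?sqr_ge0.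
  rewrite /s; apply: is_derive_eq (@is_derive_sqrt_comp (fun y => 1 + y ^+ 2) x _ h1 h) _; rewrite -/(s x).
  by field; rewrite gt_eqF.
have dD1 : is_derive x (1 : R) (fun y => rho + q y) (0 + - x / q x).
  exact: is_deriveD (is_derive_cst _ _ _) dq.
have dD2 : is_derive x (1 : R) (fun y => rho * s y + q y) (rho * (x / s x) + - x / q x).
  exact: is_deriveD (is_deriveZ rho ds) dq.
have dtx : is_derive x (1 : R) (fun y : R => t * y) t.
  by apply: is_derive_eq (is_deriveZ t (is_derive_id x (1 : R))) _; rewrite [_ *: 1]mulr1.
have dT1 := @is_derive_div (fun y => y) (fun y => rho + q y) x _ _ (lt0r_neq0 (D10 x)) (is_derive_id x (1 : R)) dD1.
have dT2 := @is_derive_div (fun y => t * y) (fun y => rho * s y + q y) x _ _ (lt0r_neq0 (D20 x)) dtx dD2.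
have dA1 := @is_derive1_comp _ atan (fun y => y / (rho + q y)) _ _ _ (is_derive1_atan _) dT1.
have dA2 := @is_derive1_comp _ atan (fun y => t * y / (rho * s y + q y)) _ _ _ (is_derive1_atan _) dT2.
have h := is_deriveB (is_deriveZ (4 * t) dA2) (is_deriveZ (4 : R) dA1).
apply: is_derive_eq h _; rewrite /GRing.scale /=.
have E1 : 1 + (x / (rho + q x)) ^+ 2 = 2 * rho / (rho + q x).
  have -> : 1 + (x / (rho + q x)) ^+ 2 = ((rho + q x) ^+ 2 + x ^+ 2) / (rho + q x) ^+ 2.
    by field; rewrite gt_eqF.
  have -> : (rho + q x) ^+ 2 + x ^+ 2 = 2 * rho * (rho + q x).
    by rewrite sqrrD q2; ring.
  by field; rewrite gt_eqF.
have E2 : 1 + (t * x / (rho * s x + q x)) ^+ 2 = 2 * rho * s x / (rho * s x + q x).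
  have -> : 1 + (t * x / (rho * s x + q x)) ^+ 2 =
      ((rho * s x + q x) ^+ 2 + (t * x) ^+ 2) / (rho * s x + q x) ^+ 2.
    by field; rewrite gt_eqF.
  have -> : (rho * s x + q x) ^+ 2 + (t * x) ^+ 2 = 2 * (rho * s x) * (rho * s x + q x).
    have -> : (rho * s x + q x) ^+ 2 + (t * x) ^+ 2 = 2 * (rho * s x) * (rho * s x + q x)
        - rho ^+ 2 * (s x ^+ 2 - 1 - x ^+ 2) + (q x ^+ 2 - rho ^+ 2 + x ^+ 2)
        + (t ^+ 2 - rho ^+ 2 - 1) * x ^+ 2 by ring.
    by rewrite s2 q2 rho2; ring.
  by field; rewrite gt_eqF.
have N1 : 1 * (rho + q x) - x * (0 + - x / q x) = rho * (rho + q x) / q x.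
  have -> : 1 * (rho + q x) - x * (0 + - x / q x) = (rho * q x + (q x ^+ 2 + x ^+ 2)) / q x.
    by field; rewrite gt_eqF.
  by rewrite q2; field; rewrite gt_eqF.
have N2 : t * (rho * s x + q x) - t * x * (rho * (x / s x) + - x / q x) =
    t * rho * (rho * s x + q x) / (s x * q x).
  have -> : t * (rho * s x + q x) - t * x * (rho * (x / s x) + - x / q x) =
      t * (rho * (s x ^+ 2 - x ^+ 2) * q x + (q x ^+ 2 + x ^+ 2) * s x) / (s x * q x).
    by field; rewrite !gt_eqF.
  by rewrite q2 s2; field; rewrite !gt_eqF.
rewrite E1 E2 N1 N2 -s2.
have -> : 4 * t * ((2 * rho * s x / (rho * s x + q x))^-1 *
   (t * rho * (rho * s x + q x) / (s x * q x) / (rho * s x + q x) ^+ 2)) -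
   4 * ((2 * rho / (rho + q x))^-1 * (rho * (rho + q x) / q x / (rho + q x) ^+ 2))
   = 2 * (t ^+ 2 - s x ^+ 2) / (s x ^+ 2 * q x).
  by field; rewrite !gt_eqF.
have -> : t ^+ 2 - s x ^+ 2 = q x ^+ 2 by rewrite s2 q2 rho2; ring.
by field; rewrite !gt_eqF.
Qed.

Lemma integral_disc_row :
  (\int[leb]_(x in `[(- rho)%R, rho]) (2 * q x / (1 + x ^+ 2))%:E = (2 * pi * (t - 1))%:E)%E.
Proof.
rewrite (@continuous_FTC2 R (fun x => 2 * q x / (1 + x ^+ 2)) disc_primitive).
- rewrite -EFinB; congr EFin; rewrite /disc_primitive.
  have -> : q rho = 0 by rewrite /q subrr sqrtr0.
  have -> : q (- rho) = 0 by rewrite /q sqrrN subrr sqrtr0.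
  have -> : s rho = t by rewrite /s rho2 addrC subrK sqrtr_sqr gtr0_norm // (lt_trans ltr01).
  have -> : s (- rho) = t by rewrite /s sqrrN rho2 addrC subrK sqrtr_sqr gtr0_norm // (lt_trans ltr01).
  have rn : rho != 0 by rewrite gt_eqF.
  have tn : t != 0 by rewrite gt_eqF // (lt_trans ltr01).
  have -> : t * rho / (rho * t + 0) = 1 by field; rewrite rn tn.
  have -> : t * - rho / (rho * t + 0) = - 1 by field; rewrite rn tn.
  have -> : rho / (rho + 0) = 1 by field.
  have -> : - rho / (rho + 0) = - 1 by field.
  by rewrite !atanN atan1; field.
- by rewrite gtrN.
- apply: continuous_subspaceT; apply: contM.
    by apply: contM; [exact: contC|exact: cq].
  apply: contV; first by move=> x; rewrite gt_eqF // ltr_wpDr ?sqr_ge0.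
  by apply: contD; [exact: contC|apply: contX => x; exact: cvg_id].
- split.
  + by move=> x; rewrite in_itv /= => /is_derive_disc_primitive [].
  + exact/cvg_at_right_filter/disc_primitive_continuous.
  + exact/cvg_at_left_filter/disc_primitive_continuous.
- move=> x; rewrite in_itv /= => /is_derive_disc_primitive [_ h].
  by rewrite derive1E h.
Qed.

End DiscRow.

(** A hyperbolic disc about i is the Euclidean disc with centre [(0, t)] and squared radius
    [t^2 - 1]. *)
Lemma hypu_i_le (t x y : R) : 0 < y ->
  (hypu (0, 1) (x, y) <= t) = ((y - t) ^+ 2 <= t ^+ 2 - 1 - x ^+ 2).
Proof.
move=> y0; rewrite /hypu /sqdist /= mulr1 -lerBrDl ler_pdivrMr; last by rewrite mulr_gt0.
rewrite -subr_ge0 -[RHS]subr_ge0; congr (0 <= _); ring.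
Qed.

Lemma measurable_hypu (z : R * R) : measurable_fun setT (hypu z).
Proof.
have m1 : measurable_fun setT (fst : R * R -> R) by exact: measurable_fst.
have m2 : measurable_fun setT (snd : R * R -> R) by exact: measurable_snd.
apply: measurable_funD => //; apply: measurable_funM.
  by apply: measurable_funD; apply: measurable_funX; apply: measurable_funB.
by apply: (measurableT_comp (@measurable_invr R)); apply: measurable_funM.
Qed.

Definition hdisc (z : R * R) (t : R) : set (R * R) :=
  [set w | 0 < w.2 /\ hypu z w <= t].

Lemma measurable_hdisc (z : R * R) (t : R) : measurable (hdisc z t).
Proof.
have -> : hdisc z t = upper_half R `&` (setT `&` (hypu z @^-1` `]-oo, t])).
  by rewrite setTI; apply/seteqP; split=> w /=; rewrite in_itv.
apply: measurableI; first exact: measurable_upper_half.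
by apply: measurable_hypu => //; exact: measurable_itv.
Qed.

Lemma integral_inv_sq (a b : R) : 0 < a -> a <= b ->
  (\int[leb]_(y in `[a, b]) (y ^- 2)%:E = (a^-1 - b^-1)%:E)%E.
Proof.
move=> a0; rewrite le_eqVlt => /orP[/eqP <-|ab].
  by rewrite set_itv1 integral_set1 subrr.
have pos x : a <= x -> x != 0 by move=> ax; rewrite gt_eqF // (lt_le_trans a0).
have cV x : a <= x -> {for x, continuous (fun y : R => - y^-1)}.
  by move=> /pos x0; apply: continuousN; apply: (@continuousV R) => //; exact: cvg_id.
rewrite (@continuous_FTC2 R (fun y => y ^- 2) (fun y => - y^-1)) //.
- by rewrite -EFinB opprK addrC.
- apply: continuous_in_subspaceT => x; rewrite inE /= in_itv /= => /andP[/pos x0 _].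
  apply: (@continuousV R R (fun y => y ^+ 2) x); first by rewrite expf_eq0.
  exact: exprn_continuous.
- split.
  + move=> x; rewrite in_itv /= => /andP[/ltW/pos x0 _].
    by apply: derivableN; apply: (@derivableV R).
  + exact/cvg_at_right_filter/cV.
  + by apply/cvg_at_left_filter/cV; exact: ltW.
- move=> x; rewrite in_itv /= => /andP[/ltW/pos x0 _].
  rewrite derive1E; have h := is_deriveN (is_deriveV x0 (is_derive_id x (1 : R))).
  by case: h => _ ->; rewrite [_ *: 1]mulr1 opprK.
Qed.

(** The vertical chord at abscissa x is [[t - q, t + q]]; as [t^2 - q^2 = 1 + x^2], integrating dy /
    y^2 over it gives the integrand of [integral_disc_row]. *)
Lemma hyp_disc_i (t : R) : 1 < t -> hyp (hdisc (0, 1) t) = (2 * pi * (t - 1))%:E.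
Proof.
move=> t1; have t0 : 0 < t by rewrite (lt_trans ltr01).
rewrite -(integral_disc_row t1) /hyp_measure integral_mkcond.
have mF : measurable_fun setT ((@hyp_density R) \_ (hdisc (0, 1) t)).
  apply/(measurable_restrictT _ (measurable_hdisc _ _)).
  exact: measurable_funS (@measurable_hyp_density R).
rewrite (@fubini_tonelli1 _ _ _ _ R leb leb) //; last first.
  by move=> z; rewrite patchE; case: ifPn => // _; exact: hyp_density_ge0.
rewrite [RHS]integral_mkcond; apply: eq_integral => x _.
rewrite /fubini_F patchE mem_setE in_itv /= -ler_norml -ler_sqr ?nnegrE ?sqrtr_ge0 //.
have rho2 : Num.sqrt (t ^+ 2 - 1) ^+ 2 = t ^+ 2 - 1.
  by rewrite sqr_sqrtr // subr_ge0 expr_ge1 // ltW.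
rewrite real_normK ?num_real // rho2.
pose q := Num.sqrt (t ^+ 2 - 1 - x ^+ 2).
case: leP => hx; last first.
  apply: integral0_eq => y _; rewrite patchE; case: ifPn => //.
  rewrite inE => -[/= y0]; rewrite hypu_i_le // => h; exfalso.
  by have := le_trans (sqr_ge0 _) h; rewrite leNgt subr_lt0 hx.
have q2 : q ^+ 2 = t ^+ 2 - 1 - x ^+ 2 by rewrite sqr_sqrtr // subr_ge0.
have q0 : 0 <= q by exact: sqrtr_ge0.
have x20 := sqr_ge0 x.
have qt : 0 < t - q.
  rewrite subr_gt0 -(@ltr_sqr _ q t) ?nnegrE //; last exact: ltW.
  by rewrite q2; lra.
have -> : (2 * q / (1 + x ^+ 2))%:E = (\int[leb]_(y in `[(t - q)%R, (t + q)%R]) (y ^- 2)%:E)%E.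
  rewrite integral_inv_sq //; last by rewrite lerD2l ge0_cp.
  congr EFin; have -> : 1 + x ^+ 2 = (t - q) * (t + q) by rewrite -subr_sqr q2; ring.
  have tq : 0 < t + q by rewrite ltr_wpDr.
  by field; rewrite !gt_eqF.
rewrite [RHS]integral_mkcond; apply: eq_integral => y _; rewrite !patchE.
have -> : ((x, y) \in hdisc (0, 1) t) = (y \in `[(t - q)%R, (t + q)%R]%classic).
  rewrite mem_setE in_itv /= -ler_distl; apply/idP/idP.
    rewrite inE => -[/= y0]; rewrite hypu_i_le // => h.
    by rewrite -ler_sqr ?nnegrE // real_normK ?num_real // q2.
  move=> h; have y0 : 0 < y.
    by move: h; rewrite ler_distl => /andP[h _]; exact: lt_le_trans h.
  rewrite inE; split=> //=; rewrite hypu_i_le // -q2 -[(y - t) ^+ 2]real_normK ?num_real //.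
  by rewrite ler_sqr ?nnegrE.
case: ifPn => //; rewrite mem_setE in_itv /= => /andP[h _].
by rewrite /hyp_density /= (lt_le_trans qt h).
Qed.

Lemma hyp_disc (z : R * R) (t : R) : 0 < z.2 -> 1 < t -> hyp (hdisc z t) = (2 * pi * (t - 1))%:E.
Proof.
move=> z0 t1; rewrite -(hyp_disc_i t1).
rewrite -(setIT (hdisc z t)) -(setIT (hdisc (0, 1) t)).
rewrite -!integral_indic //; try exact: measurable_hdisc.
have m w : measurable_fun setT (fun v : R * R => (\1_(hdisc w t) v : R)%:E).
  by apply/measurable_EFinP; apply: measurable_indic; exact: measurable_hdisc.
have da := aff_SL2 z0.
rewrite -(integral_hyp_mobius da (m z)) //.
apply: integral_hyp_eq => //.
- move=> w w0; rewrite !indicE; congr (_%:R)%:E; congr nat_of_bool.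
  apply/idP/idP; rewrite !inE => -[h1 h2]; split=> //.
    by rewrite -(hypu_mobius da) // mobius_aff_i.
    exact: mobius_upper.
  by rewrite -{1}(mobius_aff_i z0) hypu_mobius.
- exact: (measurableT_comp (m z) (measurable_mobius (aff z))).
Qed.

Lemma hyp_setI_upper (A : set (R * R)) : measurable A -> hyp (A `&` upper_half R) = hyp A.
Proof.
move=> mA; have mH := @measurable_upper_half R.
have m : measurable_fun setT (fun v : R * R => (\1_A v : R)%:E).
  by apply/measurable_EFinP; exact: measurable_indic.
rewrite -integral_indic // (integral_hyp_upper m) // integral_indic // setIT //.
Qed.

(** The areas of discs determine the pushforward of the hyperbolic measure under [hypu z]: it is
    [2 pi] times Lebesgue measure on []1, +oo[]. *)
Lemma integral_radial (z : R * R) (f : R -> \bar R) : 0 < z.2 -> measurable_fun setT f ->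
  (forall x, (0 <= f x)%E) ->
  (\int[hyp]_(w in upper_half R) f (hypu z w) =
   (2 * pi)%:E * \int[leb]_(x in `]1%R, +oo[) f x)%E.
Proof.
move=> z0 mf f0.
have p0 : 0 < 2 * pi :> R by rewrite mulr_gt0 // pi_gt0.
have mu_ : measurable_fun setT (hypu z : R * R -> measurableTypeR R).
  by move=> _ Y mY; exact: (@measurable_hypu z measurableT Y mY).
have mH : measurable (upper_half R) by exact: measurable_upper_half.
pose m1 := measure_function_pushforward__canonical__measure_function_Measure hyp mu_.
have p1 : 0 <= (2 * pi)^-1 :> R by rewrite invr_ge0 ltW.
pose m2 := mscale (NngNum p1) m1.
have mI : measurable (`]-oo, 1%R]%classic : set (measurableTypeR R)) by exact: measurable_itv.
(* Lebesgue measure on []-oo, 1]], where the pushforward vanishes, is added, so that the uniqueness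
   of Lebesgue measure applies on the whole line. *)
pose m3 := measure_add m2 (mrestr leb mI).
have HdE (t : R) : hyp (hdisc z t) = (2 * pi * Num.max (t - 1) 0)%:E.
  case: (ltP 1 t) => t1.
    by rewrite hyp_disc // max_l // subr_ge0 ltW.
  rewrite max_r ?subr_le0 // mulr0.
  apply/eqP; rewrite eq_le measure_ge0 andbT.
  rewrite [X in (_ <= X)%E](_ : _ = hyp [set z]); last by rewrite hyp_set1.
  apply: le_measure; rewrite ?inE.
  - exact: measurable_hdisc.
  - have -> : [set z] = [set z.1] `*` [set z.2].
      apply/seteqP; split=> [_ -> //|[x y] /= [-> ->]]; by case: (z).
    by apply: measurableX; exact: measurable_set1.
  - move=> w [w0 h] /=; apply/esym/eqP.
    by rewrite -hypu_eq1 // eq_le hypu_ge1 // (le_trans h).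
have m1E (a b : R) : a < b ->
    m1 `]a, b]%classic = (2 * pi * (Num.max (b - 1) 0 - Num.max (a - 1) 0))%:E.
  move=> ab; rewrite mulrBr EFinB -!HdE.
  have sab : hdisc z b `&` hdisc z a = hdisc z a.
    by apply/setIidPr => w [w0 h]; split=> //; exact: le_trans h (ltW ab).
  rewrite -[X in (_ - hyp X)%E]sab -measureD; last 3 first.
  - exact: measurable_hdisc.
  - exact: measurable_hdisc.
  - by rewrite [X in (X < _)%E]HdE ltry.
  have mP : measurable (hypu z @^-1` `]a, b]).
    by rewrite -[X in measurable X]setTI; apply: measurable_hypu => //; exact: measurable_itv.
  rewrite /m1 /= /pushforward -(hyp_setI_upper mP); congr (hyp _).
  apply/seteqP; split=> [w [/= + w0]|w [[w0 h1] h2]].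
    rewrite in_itv /= => /andP[h1 h2]; split; first by split.
    by move=> [_ h3]; move: h1; rewrite ltNge h3.
  split=> //=; rewrite in_itv /= h1 andbT ltNge; apply/negP => h3.
  by apply: h2; split.
have m3add B : m3 B = (m2 B + mrestr leb mI B)%E by exact: measure_addE.
have m3E A : measurable A -> leb A = m3 A.
  apply: lebesgue_measure_unique => _ [[a b] _ <-] /=.
  rewrite lebesgue_measure_itv /= lte_fin; case: ltP => ab; last first.
    have E : `]a, b]%classic = set0 :> set R by rewrite set_itv_ge // bnd_simp -leNgt.
    by rewrite E [RHS]measure0.
  rewrite -[RHS]/(m3 `]a, b]%classic) m3add.
  rewrite /m2 /mscale m1E //= /mrestr.
  have -> : (`]a, b] `&` `]-oo, 1] = `]a, Num.min b 1] :> set R)%classic.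
    apply/seteqP; split=> x /=; rewrite !in_itv /= le_min.
      by move=> [/andP[-> ->] ->].
    by move=> /and3P[-> -> ->].
  rewrite lebesgue_measure_itv /= lte_fin -EFinM mulrA mulVf ?gt_eqF // mul1r.
  case: ltP => h.
    rewrite -!EFinD; congr EFin; move: h; rewrite lt_min => /andP[_ h].
    rewrite (@max_r _ _ (a - 1)) ?subr_le0 1?ltW // /Num.max /Num.min.
    by case: ltP => h1; case: ltP => h2; lra.
  rewrite adde0 -!EFinD; congr EFin; move: h; rewrite ge_min leNgt ab /= => h.
  by rewrite !max_l ?subr_ge0 //; [lra|exact: le_trans (ltW ab)].
have mD : measurable (`]1%R, +oo[%classic : set (measurableTypeR R)) by exact: measurable_itv.
have mfu : measurable_fun setT (fun w => f (hypu z w)).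
  exact: measurableT_comp mf (@measurable_hypu z).
rewrite (integral_hyp_upper mfu) //.
transitivity (\int[m1]_x f x)%E.
  by rewrite ge0_integral_pushforward.
have -> : setT = `]-oo, 1%R]%classic `|` `]1%R, +oo[%classic :> set (measurableTypeR R).
  by apply/seteqP; split=> x // _ /=; rewrite !in_itv /= andbT; case: leP; [left|right].
rewrite ge0_integral_setU //; last 2 first.
- exact: measurable_funS mf.
- apply/disj_set2P; apply/seteqP; split=> x //= []; rewrite !in_itv /= andbT.
  by case: leP.
have mP : measurable (hypu z @^-1` `]-oo, 1]).
  by rewrite -[X in measurable X]setTI; apply: measurable_hypu => //; exact: measurable_itv.
have m10 : m1 `]-oo, 1%R]%classic = 0%E.
  rewrite /m1 /= /pushforward -(hyp_setI_upper mP).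
  rewrite (_ : _ `&` _ = hdisc z 1); first by rewrite HdE subrr max_r // mulr0.
  by apply/seteqP; split=> w /=; rewrite in_itv /= => -[].
rewrite null_set_integral //; last exact: measurable_funS mf.
rewrite add0e -[X in (X * _)%E]/((NngNum (ltW p0))%:num%:E) -ge0_integral_mscale //; last exact: measurable_funS mf.
apply: eq_measure_integral => A mA AD.
suff E : (m1 A = (2 * pi)%:E * leb A)%E by exact: E.
have rA : mrestr leb mI A = 0%E.
  rewrite /mrestr (_ : A `&` `]-oo, 1]%classic = set0) ?measure0 //.
  apply/seteqP; split=> x //= -[/AD] /=; rewrite !in_itv /= andbT.
  by case: leP.
rewrite m3E // m3add rA adde0 -[m2 A]/(((2 * pi)^-1)%:E * m1 A)%E.
by rewrite muleA -EFinM mulfV ?gt_eqF // mul1e.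
Qed.

End DiscArea.

(** * Fuchsian groups *)

Section Counting.

(** A cardinality bound stated through duplicate-free sequences passes to subsets and along
    injections without a prior proof of finiteness, and implies finiteness. *)
Definition count_le {T : eqType} (A : set T) (N : nat) : Prop :=
  forall s : seq T, uniq s -> (forall x, x \in s -> A x) -> (size s <= N)%N.

Lemma count_leS {T : eqType} (A B : set T) N : A `<=` B -> count_le B N -> count_le A N.
Proof. by move=> AB h s us sA; apply: h => // x /sA /AB. Qed.

Lemma count_le_inj {T U : eqType} (A : set T) (B : set U) (f : T -> U) N :
  (forall x, A x -> B (f x)) -> {in A &, injective f} -> count_le B N -> count_le A N.
Proof.
move=> AB fi h s us sA; rewrite -(size_map f); apply: h.
  by rewrite map_inj_in_uniq // => x y /sA Ax /sA Ay; apply: fi; rewrite inE.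
by move=> _ /mapP[x /sA/AB ? ->].
Qed.

Lemma count_le_fin {T : eqType} {U : finType} (A : set T) (f : T -> U) :
  {in A &, injective f} -> count_le A #|U|.
Proof.
move=> fi; apply: (@count_le_inj _ _ A setT f) => // s us _.
by rewrite -(card_uniqP us) max_card.
Qed.

Lemma count_le_finite {T : choiceType} (A : set T) N : count_le A N -> finite_set A.
Proof.
move=> h; apply: contrapT => iA; have [B BA] := @infinite_set_fset T A N.+1 iA.
by apply/negP; rewrite -ltnNge ltnS; apply: h.
Qed.

Lemma count_le_fset {T : choiceType} (A : set T) N :
  count_le A N -> (#|` fset_set A| <= N)%N.
Proof.
move=> h; apply: (h) => // x; rewrite in_fset_set; last exact: count_le_finite h.
by rewrite inE.
Qed.

End Counting.

Section MatrixCounting.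
Variable R : realType.
Implicit Types (g h : 'M[R]_2) (z w : R * R).

Lemma frob_ge0 g : 0 <= frob g.
Proof. by rewrite !addr_ge0 ?sqr_ge0. Qed.

Lemma frobM g h : frob (g *m h) <= frob g * frob h.
Proof.
have cs (a b c d : R) : (a * c + b * d) ^+ 2 <= (a ^+ 2 + b ^+ 2) * (c ^+ 2 + d ^+ 2).
  rewrite -subr_ge0 (_ : _ - _ = (a * d - b * c) ^+ 2) ?sqr_ge0 //; ring.
rewrite /frob !mulmx2E.
apply: le_trans (lerD (lerD (lerD (cs _ _ _ _) (cs _ _ _ _)) (cs _ _ _ _)) (cs _ _ _ _)) _.
rewrite le_eqVlt; apply/orP; left; apply/eqP; ring.
Qed.

Lemma frobV g : SL2 g -> frob (invmx g) = frob g.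
Proof. by move=> dg; rewrite invmx2 // /frob !mx2E; ring. Qed.

Lemma frob_entry g (i j : 'I_2) : (g i j) ^+ 2 <= frob g.
Proof.
have I2 (k : 'I_2) : k = 0 \/ k = 1.
  by case: k => [[|[|//]] ki]; [left|right]; apply/val_inj.
have := sqr_ge0 (g 0 0); have := sqr_ge0 (g 0 1).
have := sqr_ge0 (g 1 0); have := sqr_ge0 (g 1 1).
by rewrite /frob; case: (I2 i) => ->; case: (I2 j) => -> h1 h2 h3 h4; lra.
Qed.

(* Cutting the cube of entries of size at most c into small cubes; a set of
   matrices that are pairwise far apart meets each small cube at most once. *)
Lemma count_separated (c e : R) : 0 < e -> exists N, forall A : set 'M[R]_2,
  (forall g, A g -> frob g <= c) ->
  (forall g h, A g -> A h -> frob (g - h) < e -> g = h) -> count_le A N.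
Proof.
move=> e0; pose d := Num.sqrt (e / 4); pose r := Num.sqrt c.
have d0 : 0 < d by rewrite sqrtr_gt0 divr_gt0.
have r0 : 0 <= r by exact: sqrtr_ge0.
pose m := Num.truncn ((r + r) / d).
pose cell (x : R) : 'I_m.+1 := inord (Num.truncn ((x + r) / d)).
pose f g := (cell (g 0 0), cell (g 0 1), cell (g 1 0), cell (g 1 1)).
exists #|{: 'I_m.+1 * 'I_m.+1 * 'I_m.+1 * 'I_m.+1}| => A Ac Ae.
apply: (@count_le_fin _ _ A f) => g h; rewrite !inE => Ag Ah.
have bnd k i j : A k -> - r <= k i j <= r.
  move=> Ak; rewrite -ler_norml -ler_sqr ?nnegrE // real_normK ?num_real //.
  have h1 := le_trans (frob_entry k i j) (Ac k Ak).
  by rewrite /r sqr_sqrtr // (le_trans (sqr_ge0 _) h1).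
have cellE i j : cell (g i j) = cell (h i j) -> (g i j - h i j) ^+ 2 < e / 4.
  have [/andP[g1 g2] /andP[h1 h2]] := (bnd g i j Ag, bnd h i j Ah).
  have nn (x : R) : - r <= x -> 0 <= (x + r) / d.
    by move=> x1; rewrite divr_ge0 ?(ltW d0) //; lra.
  have lt (x : R) : - r <= x -> x <= r -> (Num.truncn ((x + r) / d) < m.+1)%N.
    move=> x1 x2; rewrite ltnS; apply: le_truncn.
    by rewrite ler_pM2r ?invr_gt0 // lerD2r.
  move=> /(congr1 val); rewrite /= !inordK ?lt // => E.
  have /andP[a1 a2] := truncn_itv (nn _ g1).
  have /andP[b1 b2] := truncn_itv (nn _ h1).
  rewrite E in a1 a2.
  have D : `|(g i j - h i j) / d| < 1.
    have -> : (g i j - h i j) / d = (g i j + r) / d - (h i j + r) / d.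
      by rewrite -mulrBl opprD addrACA subrr addr0.
    rewrite ltr_norml; apply/andP; split.
      by move: a1 b2; rewrite -natr1; lra.
    by move: a2 b1; rewrite -natr1; lra.
  have e4 : 0 <= e / 4 by rewrite divr_ge0 // ltW.
  rewrite -real_normK ?num_real // -(sqr_sqrtr e4) ltr_sqr ?nnegrE ?sqrtr_ge0 //.
  by move: D; rewrite normrM normfV (gtr0_norm d0) ltr_pdivrMr // mul1r.
move=> [/cellE e1 /cellE e2 /cellE e3 /cellE e4]; apply: Ae => //.
by rewrite /frob !mxE; lra.
Qed.

(** Conjugation turns [h^-1 g - 1] into [h^-1 (g - h)], inversion preserves the Frobenius norm for
    determinant 1, and the norm is submultiplicative. *)
Lemma conjz_frob_sub z g h : 0 < z.2 -> SL2 g -> SL2 h ->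
  frob (conjz z (invmx h *m g) - 1%:M) <= frob (conjz z h) * frob (conjz z g - conjz z h).
Proof.
move=> z0 dg dh; have dVh := SL2V dh.
have E : conjz z (invmx h) = invmx (conjz z h).
  have u := SL2_unit (conjz_SL2 z0 dh).
  by rewrite -[LHS]mulmx1 -(mulmxV u) mulmxA -conjzM // mulVmx ?SL2_unit // conjz1 // mul1mx.
rewrite conjzM // E -(frobV (conjz_SL2 z0 dh)).
rewrite -(mulVmx (SL2_unit (conjz_SL2 z0 dh))) -mulmxBr.
exact: frobM.
Qed.

(** Two elements whose conjugates are close have a quotient close to 1, hence are equal. The bound
    depends on [c] and [e] only, not on the group or the point; all later uniformity rests on
    this. *)
Lemma count_conj_separated (c e : R) : 0 < e -> exists N,
  forall (G : set 'M[R]_2) z, SL2_subgroup G -> 0 < z.2 ->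
  (forall g, G g -> frob (conjz z g - 1%:M) < e -> g = 1%:M) ->
  count_le [set g | G g /\ hypu z (mobius g z) <= c] N.
Proof.
move=> e0; pose c' := `|2 * c| + 1.
have c0 : 0 < c' by rewrite ltr_wpDl.
have [N hN] := @count_separated c' (e / c') (divr_gt0 e0 c0).
exists N => G z [Gd G1 GM GV] z0 sep.
apply: (@count_le_inj _ _ _ [set k | exists2 g, G g /\ hypu z (mobius g z) <= c & k = conjz z g] (conjz z)).
- by move=> g Ag; exists g.
- by move=> g h _ _; exact: conjz_inj.
have cc g : G g -> hypu z (mobius g z) <= c -> frob (conjz z g) <= c'.
  move=> /Gd dg h; rewrite frob_conjz //.
  rewrite (@le_trans _ _ (2 * c)) ?ler_pM2l //.
  by rewrite (le_trans (ler_norm _)) // lerDl.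
apply: hN => [_ [g [Gg h] ->]|_ _ [g [Gg hg] ->] [h [Gh hh] ->] D].
  exact: cc.
congr (conjz z _).
have [dg dh] : SL2 g /\ SL2 h by split; exact: Gd.
have : invmx h *m g = 1%:M.
  apply: sep; first by apply: GM => //; exact: GV.
  apply: le_lt_trans (conjz_frob_sub z0 dg dh) _.
  apply: (@le_lt_trans _ _ (c' * frob (conjz z g - conjz z h))).
    by rewrite ler_wpM2r ?frob_ge0 ?cc.
  by rewrite mulrC -ltr_pdivlMr.
move=> /(congr1 (mulmx h)).
by rewrite mulmxA mulmxV ?SL2_unit // mul1mx mulmx1.
Qed.

End MatrixCounting.

(** * Counting in discrete groups *)

Section Discrete.
Variable R : realType.
Implicit Types (G : set 'M[R]_2) (g h : 'M[R]_2) (z w : R * R).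

Lemma fuchsian_isolated1 G : fuchsian G ->
  exists2 e : R, 0 < e & forall g, G g -> frob (g - 1%:M) < e -> g = 1%:M.
Proof.
move=> [[Gd G1 GM GV] iso]; have [_ [V nV VG]] := iso _ G1.
have [e /= e0 eV] := (nbhs_ballP _ _).1 nV.
exists (e ^+ 2); first by rewrite exprn_gt0.
move=> g Gg ge; suff : (V `&` G) g by rewrite VG.
split=> //; apply: eV; split=> // i j; rewrite /ball /=.
rewrite -(@ltr_sqr _ _ e) ?nnegrE //; last exact: ltW.
  rewrite real_normK ?num_real // -sqrrN opprB.
  by apply: le_lt_trans ge; have := frob_entry (g - 1%:M) i j; rewrite !mxE.
Qed.

Lemma fuchsian_count G z c : fuchsian G -> 0 < z.2 ->
  exists N, count_le [set g | G g /\ hypu z (mobius g z) <= c] N.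
Proof.
move=> FG z0; have [e e0 sep] := fuchsian_isolated1 FG.
have [sG _] := FG; have [Gd _ _ _] := sG.
have i0 : 0 < (0 : R, 1 : R).2 by [].
have ci g : conjz (0, 1) g = g.
  by apply: matrix2P; rewrite mx2E /= ?mulr0 ?expr0n /= ?mulr0 ?subr0 ?addr0 ?divr1 ?mulr1.
pose u := hypu (0, 1) z.
have [N hN] := @count_conj_separated R (2 * (2 * u * c) * u) e e0.
exists N; apply: count_leS (hN G (0, 1) sG i0 _); last first.
  by move=> g Gg; rewrite ci; exact: sep.
move=> g [Gg h]; split=> //.
have dg := Gd _ Gg; have gz0 := mobius_upper dg z0; have gi0 := mobius_upper dg i0.
have u1 : 1 <= u by exact: hypu_ge1.
apply: le_trans (hypu_triangle i0 gz0 gi0) _.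
rewrite [hypu (mobius g z) _]hypuC hypu_mobius // ler_wpM2r ?(le_trans ler01) //.
rewrite ler_wpM2l //; apply: le_trans (hypu_triangle i0 z0 gz0) _.
by rewrite ler_wpM2l // mulr_ge0 // (le_trans ler01).
Qed.

Lemma fuchsian_count2 G z w c : fuchsian G -> 0 < z.2 -> 0 < w.2 ->
  exists N, count_le [set g | G g /\ hypu z (mobius g w) <= c] N.
Proof.
move=> FG z0 w0; have [[Gd _ _ _] _] := FG.
have [N hN] := fuchsian_count (2 * c * hypu w z) FG z0.
exists N; apply: count_leS hN => g [Gg h]; split=> //.
have dg := Gd _ Gg; have gz0 := mobius_upper dg z0; have gw0 := mobius_upper dg w0.
apply: le_trans (hypu_triangle z0 gw0 gz0) _; rewrite hypu_mobius //.
by rewrite ler_wpM2r ?ler_wpM2l // (le_trans ler01) // hypu_ge1.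
Qed.

(* Fixing one solution g0, the others are g g0 with g moving z boundedly. *)
Lemma count_translate G z w c N : SL2_subgroup G -> 0 < z.2 -> 0 < w.2 ->
  count_le [set g | G g /\ hypu z (mobius g z) <= 2 * c * c] N ->
  count_le [set g | G g /\ hypu z (mobius g w) <= c] N.
Proof.
move=> [Gd _ GM GV] z0 w0 hN s us sA.
case: s us sA => [|g0 s] us sA; first by [].
have [G0 h0] := sA g0 (mem_head _ _); have d0 := Gd _ G0.
have g0w := mobius_upper d0 w0.
rewrite -(size_map (fun g => g *m invmx g0)); apply: hN.
  rewrite map_inj_uniq // => g h E.
  by rewrite -[g]mulmx1 -(mulVmx (SL2_unit d0)) mulmxA E -mulmxA mulVmx ?mulmx1 // SL2_unit.
move=> _ /mapP[g /sA[Gg hg] ->]; split; first by apply: GM => //; exact: GV.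
have dg := Gd _ Gg; have dV := SL2V d0.
rewrite mobiusM //.
have zV := mobius_upper dV z0; have gzV := mobius_upper dg zV.
have gw := mobius_upper dg w0.
apply: le_trans (hypu_triangle z0 gw gzV) _; rewrite hypu_mobius //.
have E : hypu w (mobius (invmx g0) z) = hypu z (mobius g0 w).
  by rewrite hypuC -(hypu_mobius d0) // mobiusVK.
have := hypu_ge1 z0 g0w; have := hypu_ge1 z0 gw; rewrite E; nra.
Qed.

Lemma fuchsian_countable G : fuchsian G -> countable G.
Proof.
move=> FG; have i0 : 0 < (0 : R, 1 : R).2 by [].
have -> : G = \bigcup_n [set g | G g /\ hypu (0, 1) (mobius g (0, 1)) <= n%:R].
  apply/seteqP; split=> [g Gg|g [n _ []//]].
  exists (Num.truncn (hypu (0, 1) (mobius g (0, 1)))).+1 => //; split=> //.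
  by rewrite ltW // truncnS_gt.
apply: bigcup_countable => // n _; apply: finite_set_countable.
by have [N /count_le_finite] := fuchsian_count n%:R FG i0.
Qed.

(** Sums over the group are [esum]s, which are easy to reindex; an enumeration turns them into
    series, to which measurability and the interchange with integrals apply. *)
Lemma fuchsian_enum G : fuchsian G -> exists (e : nat -> 'M[R]_2) (P : pred nat),
  [/\ (forall n, P n -> G (e n)), (forall g, G g -> exists2 n, P n & e n = g) &
  forall F : 'M[R]_2 -> \bar R, (forall g, (0 <= F g)%E) ->
    (\esum_(g in G) F g = \sum_(n <oo | P n) F (e n))%E].
Proof.
move=> FG; have /countable_bijP[B] := fuchsian_countable FG.
rewrite card_eq_sym => cB.
have /card_set_bijP[f fbij] := cB.
exists f, (fun n => n \in B); split=> [n|g Gg|F F0].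
- by rewrite inE => nB; case: fbij => fB _ _; exact: fB.
- by case: fbij => _ _ /(_ _ Gg)[n nB fn]; exists n => //; rewrite inE.
rewrite (@reindex_esum _ _ _ B G f F fbij) nneseries_esum //; congr esum.
by apply/seteqP; split=> n /=; rewrite inE.
Qed.

End Discrete.

(** * The fundamental domain and stabilisers *)

Section FundamentalDomain.
Variable R : realType.
Implicit Types (G : set 'M[R]_2) (g h : 'M[R]_2) (z w : R * R).
Local Notation hyp := (@hyp_measure R).
Local Notation i := ((0, 1) : R * R).

(** The order in [fundom] as a Boolean, for measurability and for minima over finite lists. *)
Definition lexle z w : bool :=
  (hypu z i < hypu w i) ||
  ((hypu z i == hypu w i) && ((z.1 < w.1) || ((z.1 == w.1) && (z.2 <= w.2)))).

Lemma lexleP z w : reflect (hypu z i < hypu w i \/ hypu z i = hypu w i /\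
    (z.1 < w.1 \/ z.1 = w.1 /\ z.2 <= w.2)) (lexle z w).
Proof.
apply: (iffP idP).
  by move=> /orP[h|/andP[/eqP h1 /orP[h2|/andP[/eqP h2 h3]]]];
    [left|right; split=> //; left|right; split=> //; right].
rewrite /lexle; case=> [-> //|[-> h]]; rewrite eqxx ltxx /=.
by case: h => [-> //|[-> ->]]; rewrite eqxx orbT.
Qed.

Lemma lexle_refl z : lexle z z.
Proof. by rewrite /lexle !eqxx lexx !orbT. Qed.

Lemma lexle_total z w : lexle z w || lexle w z.
Proof.
rewrite /lexle [hypu w i == _]eq_sym [w.1 == _]eq_sym.
case: ltgtP => //= _; case: ltgtP => //= _; exact: le_total.
Qed.

Lemma lexle_trans : transitive lexle.
Proof.
move=> b a c /lexleP h1 /lexleP h2; apply/lexleP.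
case: h1 => [h1|[e1 h1]].
  by case: h2 => [h2|[<- _]]; left=> //; exact: lt_trans h2.
case: h2 => [h2|[e2 h2]]; first by left; rewrite e1.
right; split; first by rewrite e1.
case: h1 => [h1|[f1 h1]].
  by case: h2 => [h2|[<- _]]; left=> //; exact: lt_trans h2.
case: h2 => [h2|[f2 h2]]; first by left; rewrite f1.
by right; rewrite f1 f2; split=> //; exact: le_trans h2.
Qed.

Lemma lexle_anti z w : lexle z w -> lexle w z -> z = w.
Proof.
move=> /lexleP[h|[h1 h2]] /lexleP[h'|[h1' h2']].
- by move: (lt_trans h h'); rewrite ltxx.
- by move: h; rewrite h1' ltxx.
- by move: h'; rewrite h1 ltxx.
case: h2 => [h2|[e2 h2]]; case: h2' => [h2'|[e2' h2']].
- by move: (lt_trans h2 h2'); rewrite ltxx.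
- by move: h2; rewrite e2' ltxx.
- by move: h2'; rewrite e2 ltxx.
by rewrite (surjective_pairing z) (surjective_pairing w) e2; congr (_, _); apply/eqP; rewrite eq_le h2.
Qed.

Lemma fundomP G z : fundom G z <-> 0 < z.2 /\ forall g, G g -> lexle z (mobius g z).
Proof.
split=> -[z0 h]; split=> //.
  by move=> g Gg; apply/lexleP; apply: h; exists g.
by move=> _ [g Gg <-]; apply/lexleP; exact: h.
Qed.

Lemma fundom_upper G z : fundom G z -> 0 < z.2.
Proof. by case. Qed.

Lemma lex_min (s : seq (R * R)) (x0 : R * R) : x0 \in s ->
  exists2 m, m \in s & forall x, x \in s -> lexle m x.
Proof.
elim: s x0 => [//|a s IH] x0 _; case: s IH => [|b s] IH.
  by exists a; rewrite ?mem_head // => x; rewrite inE => /eqP ->; exact: lexle_refl.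
have [m ms hm] := IH b (mem_head _ _).
case/orP: (lexle_total a m) => h.
  exists a; rewrite ?mem_head // => x; rewrite in_cons => /orP[/eqP ->|/hm h'].
    exact: lexle_refl.
  exact: lexle_trans h h'.
exists m; first by rewrite in_cons ms orbT.
by move=> x; rewrite in_cons => /orP[/eqP -> //|/hm].
Qed.

(** Only finitely many elements of the group move z to a point at most as far from i as z itself; a
    lexicographic minimum over them is a minimum over the orbit. *)
Lemma fundom_exists G z : fuchsian G -> 0 < z.2 ->
  exists2 g, G g & fundom G (mobius g z).
Proof.
move=> FG z0; have [[Gd G1 GM GV] _] := FG.
have i0 : 0 < i.2 by [].
have [N hN] := fuchsian_count2 (hypu i z) FG i0 z0.
pose A := [set g | G g /\ hypu i (mobius g z) <= hypu i z].
have fA : finite_set A by exact: count_le_finite hN.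
pose s := [seq mobius g z | g <- fset_set A].
have memA g : A g -> mobius g z \in s.
  by move=> Ag; apply: map_f; rewrite in_fset_set // inE.
have [m ms hm] : exists2 m, m \in s & forall x, x \in s -> lexle m x.
  apply: (@lex_min s z); rewrite -{1}(mobius1 z); apply: memA.
  by split=> //; rewrite mobius1.
have [g gA mE] := mapP ms.
have {}gA : A g by move: gA; rewrite in_fset_set // inE.
have [Gg hg] := gA; have dg := Gd _ Gg.
exists g => //; apply/fundomP; split; first exact: mobius_upper.
move=> h Gh; have dh := Gd _ Gh.
rewrite -mobiusM // -mE; case: (leP (hypu i (mobius (h *m g) z)) (hypu i z)) => hu.
  by apply: hm; apply: memA; split=> //; exact: GM.
apply/lexleP; left; rewrite mE hypuC (le_lt_trans hg) //.
by rewrite [X in _ < X]hypuC.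
Qed.

Lemma fundom_unique G g z : SL2_subgroup G -> G g -> fundom G z ->
  fundom G (mobius g z) -> mobius g z = z.
Proof.
move=> [Gd _ _ GV] Gg /fundomP[z0 h1] /fundomP[_ h2]; apply: lexle_anti.
  by have := h2 _ (GV _ Gg); rewrite mobiusK //; exact: Gd.
exact: h1.
Qed.

Lemma measurable_lexle (f1 f2 : R * R -> R * R) :
  measurable_fun setT f1 -> measurable_fun setT f2 ->
  measurable_fun setT (fun z => lexle (f1 z) (f2 z)).
Proof.
move=> m1 m2.
have mu (f : R * R -> R * R) : measurable_fun setT f -> measurable_fun setT (fun z => hypu (f z) i).
  move=> mf; under eq_fun do rewrite hypuC.
  exact: measurableT_comp (@measurable_hypu R i) mf.
have p1 (f : R * R -> R * R) : measurable_fun setT f -> measurable_fun setT (fun z => (f z).1).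
  by move=> mf; exact: measurableT_comp measurable_fst mf.
have p2 (f : R * R -> R * R) : measurable_fun setT f -> measurable_fun setT (fun z => (f z).2).
  by move=> mf; exact: measurableT_comp measurable_snd mf.
apply: measurable_or; first by apply: measurable_fun_ltr; exact: mu.
apply: measurable_and; first by apply: measurable_fun_eqr; exact: mu.
apply: measurable_or; first by apply: measurable_fun_ltr; exact: p1.
by apply: measurable_and; [apply: measurable_fun_eqr; exact: p1|apply: measurable_fun_ler; exact: p2].
Qed.

Lemma measurable_fundom G : fuchsian G -> measurable (fundom G).
Proof.
move=> FG.
have -> : fundom G = upper_half R `&` \bigcap_(g in G) [set z | lexle z (mobius g z)].
  by apply/seteqP; split=> z; rewrite fundomP /=.
apply: measurableI; first exact: measurable_upper_half.
have mg g : measurable [set z | lexle z (mobius g z)].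
  have -> : [set z | lexle z (mobius g z)] = setT `&` (fun z => lexle z (mobius g z)) @^-1` [set true].
    by rewrite setTI; apply/seteqP; split.
  have m := measurable_lexle (@measurable_id _ _ setT) (measurable_mobius g).
  exact: m.
have [e [P [eG eS _]]] := fuchsian_enum FG.
have -> : \bigcap_(g in G) [set z | lexle z (mobius g z)] =
    \bigcap_(n in [set n | P n]) [set z | lexle z (mobius (e n) z)].
  apply/seteqP; split=> z h; first by move=> n Pn; apply: h; exact: eG.
  by move=> g /eS[n Pn <-]; exact: h.
apply: bigcap_measurableType => n _; exact: mg.
Qed.

(** A fixed point is a root of [c z^2 + (d - a) z - b]. This real polynomial has at most one root in
    the half-plane unless it vanishes, and then [g] is 1 or -1. *)
Lemma mobius_fixed g z w : SL2 g -> g != 1%:M -> g != - 1%:M -> 0 < z.2 -> 0 < w.2 ->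
  mobius g z = z -> mobius g w = w -> z = w.
Proof.
move=> dg g1 gN1 z0 w0.
have fix_eq v : 0 < v.2 -> mobius g v = v ->
   g 1 0 * v.1 ^+ 2 - g 1 0 * v.2 ^+ 2 + (g 1 1 - g 0 0) * v.1 - g 0 1 = 0 /\
   2 * g 1 0 * v.1 + (g 1 1 - g 0 0) = 0.
  move=> v0 hv; have D := toC_den_neq0 dg v0.
  have := congr1 (fun x => x * ((g 1 0)%:C%C * toC v + (g 1 1)%:C%C)) (congr1 (@toC R) hv).
  rewrite toC_mobius divfK //; move: v0; case: (v) => x y /= y0 [] /=.
  rewrite !mul0r !subr0 !addr0 => e1 e2; split; first by lra.
  by apply: (mulIf (lt0r_neq0 y0)); rewrite mul0r; lra.
move=> /(fix_eq _ z0)[z1 z2] /(fix_eq _ w0)[w1 w2].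
have [c0|c0] := eqVneq (g 1 0) 0.
  exfalso; rewrite c0 in z1 z2 w1 w2.
  have ad : g 1 1 = g 0 0 by lra.
  have b0 : g 0 1 = 0 by move: z1; rewrite ad; lra.
  move: dg; rewrite /SL2 det2E b0 c0 ad mulr0 subr0 -expr2 => /eqP; rewrite sqrf_eq1 => /orP[] /eqP a1.
    by move/eqP: g1; apply; apply: matrix2P; rewrite ?ad ?b0 ?c0 ?a1 !mxE.
  by move/eqP: gN1; apply; apply: matrix2P; rewrite ?ad ?b0 ?c0 ?a1 !mxE /= ?oppr0.
have x1 : z.1 = w.1.
  by apply: (mulfI c0); lra.
have y2 : z.2 ^+ 2 = w.2 ^+ 2.
  by apply: (mulfI c0); rewrite x1 in z1; lra.
have y1 : z.2 = w.2.
  by apply/eqP; rewrite -(eqrXn2 (n:=2)) ?ltW //; apply/eqP.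
by rewrite (surjective_pairing z) (surjective_pairing w) x1 y1.
Qed.

Definition center G : set 'M[R]_2 := G `&` [set 1%:M; - 1%:M].

Lemma finite_center G : finite_set (center G).
Proof. by apply: sub_finite_set (@subIsetr _ _ _) _; exact: finite_set2. Qed.

Definition ncenter G : nat := #|` fset_set (center G)|%fset.

Lemma stack_factorE G : stack_factor G = (ncenter G)%:R^-1.
Proof. by []. Qed.

Lemma ncenter_gt0 G : SL2_subgroup G -> (0 < ncenter G)%N.
Proof.
move=> [_ G1 _ _]; rewrite /ncenter cardfs_gt0; apply/fset0Pn; exists 1%:M.
by rewrite in_fset_set ?inE; [split=> //; left|exact: finite_center].
Qed.

Lemma stack_factor_gt0 G : SL2_subgroup G -> 0 < stack_factor G.
Proof. by move=> sG; rewrite stack_factorE invr_gt0 ltr0n ncenter_gt0. Qed.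

(** Each of the countably many noncentral elements fixes at most one point of the half-plane. *)
Lemma stabilizers_null G : fuchsian G ->
  {ae hyp, forall z, 0 < z.2 -> forall g, G g -> mobius g z = z -> center G g}.
Proof.
move=> FG; have [[Gd _ _ _] _] := FG.
pose fixp g := [set z | 0 < z.2 /\ mobius g z = z].
have [e [P [eG eS _]]] := fuchsian_enum FG.
pose N n := if P n && (e n != 1%:M) && (e n != - 1%:M) then fixp (e n) else set0.
have : hyp.-negligible (\bigcup_n N n).
  apply: negligible_bigcup => n; rewrite /N; case: ifPn => [|_]; last exact: negligible_set0.
  move=> /andP[/andP[Pn n1] nN1].
  have [[z [z0 hz]]|nz] := pselect (exists z, fixp (e n) z); last first.
    suff -> : fixp (e n) = set0 by exact: negligible_set0.
    by apply/seteqP; split=> z // h; apply: nz; exists z.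
  exists [set z]; split; [|exact: hyp_set1|].
    have -> : [set z] = [set z.1] `*` [set z.2].
      apply/seteqP; split=> [_ -> //|[x y] /= [-> ->]]; by case: (z).
    by apply: measurableX; exact: measurable_set1.
  by move=> w [w0 hw] /=; apply: (mobius_fixed (Gd _ (eG _ Pn)) n1 nN1).
apply: negligibleS => z /= h.
apply: contrapT => nN; apply: h => z0 g Gg gz; split=> //.
apply: contrapT => hc; apply: nN; have [n Pn en] := eS _ Gg.
exists n => //; rewrite /N Pn en.
have -> : g != 1%:M by apply/eqP => E; apply: hc; left.
have -> : g != - 1%:M by apply/eqP => E; apply: hc; right.
by [].
Qed.

End FundamentalDomain.

(** * Unfolding integrals over the quotient *)

Section Unfolding.
Variable R : realType.
Implicit Types (G : set 'M[R]_2) (g h : 'M[R]_2) (z w : R * R).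
Local Notation hyp := (@hyp_measure R).

Lemma esum_mulr G h (F : 'M[R]_2 -> \bar R) : SL2_subgroup G -> G h ->
  \esum_(g in G) F (g *m h) = \esum_(g in G) F g.
Proof.
move=> [Gd _ GM GV] Gh; have uh := SL2_unit (Gd _ Gh); apply/esym/reindex_esum; split.
- by move=> g Gg; exact: GM.
- move=> g1 g2 _ _ E.
  by rewrite -[g1]mulmx1 -(mulmxV uh) mulmxA E -mulmxA mulmxV // mulmx1.
- by move=> g Gg; exists (g *m invmx h); [apply: GM => //; exact: GV|rewrite -mulmxA mulVmx // mulmx1].
Qed.

Lemma esum_inv G (F : 'M[R]_2 -> \bar R) : SL2_subgroup G ->
  \esum_(g in G) F (invmx g) = \esum_(g in G) F g.
Proof.
move=> [Gd _ GM GV]; apply/esym/reindex_esum; split.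
- by move=> g Gg; exact: GV.
- by move=> g1 g2 _ _ E; rewrite -[g1]invmxK E invmxK.
- by move=> g Gg; exists (invmx g); [exact: GV|rewrite invmxK].
Qed.

Lemma measurable_esum G d (T : measurableType d) (F : 'M[R]_2 -> T -> \bar R) :
  fuchsian G -> (forall g, measurable_fun setT (F g)) -> (forall g t, (0 <= F g t)%E) ->
  measurable_fun setT (fun t => \esum_(g in G) F g t).
Proof.
move=> FG mF F0; have [e [P [_ _ eE]]] := fuchsian_enum FG.
under eq_fun => t do rewrite eE //.
by apply: ge0_emeasurable_sum => // n t _ _.
Qed.

Lemma integral_esum G d (T : measurableType d) (mu : {measure set T -> \bar R})
    (D : set T) (F : 'M[R]_2 -> T -> \bar R) :
  fuchsian G -> measurable D ->
  (forall g, measurable_fun setT (F g)) -> (forall g t, (0 <= F g t)%E) ->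
  (\int[mu]_(t in D) (\esum_(g in G) F g t) = \esum_(g in G) (\int[mu]_(t in D) F g t))%E.
Proof.
move=> FG mD mF F0; have [e [P [_ _ eE]]] := fuchsian_enum FG.
rewrite eE; last by move=> g; apply: integral_ge0.
under eq_integral => t _ do rewrite eE // eseries_mkcond.
rewrite integral_nneseries //; last 2 first.
- move=> n; case: (P n); last exact: measurable_cst.
  by apply: (@measurable_funS _ _ _ _ setT) => //; exact: mF.
- by move=> n t _; case: (P n).
rewrite [RHS]eseries_mkcond; apply: eq_eseriesr => n _; case: ifP => // _.
by rewrite integral0.
Qed.

Lemma esum_card (T : choiceType) (A B : set T) (c : \bar R) : finite_set B -> B `<=` A ->
  (0 <= c)%E ->
  (\esum_(x in A) ((\1_B x : R)%:E * c) = (#|` fset_set B|%:R : R)%:E * c)%E.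
Proof.
move=> fB BA c0.
transitivity (\esum_(x in B) c)%E.
  rewrite (esum_mkcond B); rewrite (esum_mkcond A); apply: eq_esum => x _.
  rewrite indicE; case: (boolP (x \in B)) => xB; last by rewrite mul0e if_same.
  by rewrite mem_set ?mul1e //; apply: BA; rewrite -inE.
rewrite esum_fset //; rewrite fsbig_finite //= big_const_seq count_predT.
elim: #|` fset_set B|%fset => [|n IH] /=; first by rewrite mul0e.
by rewrite IH -[n.+1%:R]natr1 EFinD ge0_muleDl // mul1e addeC.
Qed.

Lemma hyp_setC_upper : hyp (~` upper_half R) = 0%E.
Proof.
have mC : measurable (~` upper_half R) by apply: measurableC; exact: measurable_upper_half.
by rewrite -(hyp_setI_upper mC) setICl measure0.
Qed.

(** Tonelli and invariance move the sum onto the indicator function of the fundamental domain. What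
    remains is the number of group elements that bring z into the domain; it is the order of the
    centre wherever the stabiliser of z is central, that is, almost everywhere. *)
Theorem integral_unfold G (f : R * R -> \bar R) : fuchsian G ->
  measurable_fun setT f -> (forall z, (0 <= f z)%E) ->
  (\int[hyp]_(z in fundom G) (\esum_(g in G) f (mobius g z)) =
   (ncenter G)%:R%:E * \int[hyp]_(z in upper_half R) f z)%E.
Proof.
move=> FG mf f0; have [sG _] := FG; have [Gd _ GM GV] := sG.
have mFd := measurable_fundom FG.
have mfg g : measurable_fun setT (fun z => f (mobius g z)).
  exact: measurableT_comp mf (measurable_mobius g).
rewrite integral_esum //.
pose F1 := (fun z => (\1_(fundom G) z : R)%:E).
have mF1 : measurable_fun setT F1.
  by apply/measurable_EFinP; exact: measurable_indic.
have F10 z : (0 <= F1 z)%E by rewrite lee_fin.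
have mF1g g : measurable_fun setT (fun z => F1 (mobius g z)).
  exact: measurableT_comp mF1 (measurable_mobius g).
transitivity (\esum_(g in G) \int[hyp]_z (F1 (mobius (invmx g) z) * f z))%E.
  apply: eq_esum => g Gg; have dg := Gd _ Gg.
  have mh : measurable_fun setT (fun z => F1 (mobius (invmx g) z) * f z)%E.
    by apply: emeasurable_funM.
  rewrite -(integral_hyp_mobius dg mh); last by move=> z; rewrite mule_ge0.
  rewrite integral_mkcond; apply: integral_hyp_eq.
  - move=> z z0; rewrite patchE mobiusK // /F1 indicE.
    by case: ifP; rewrite ?mul1e ?mul0e.
  - apply/(measurable_restrictT _ mFd); exact: measurable_funS (mfg g).
  - by move=> z; rewrite patchE; case: ifP.
  - by apply: (measurableT_comp mh); exact: measurable_mobius.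
  - by move=> z; rewrite mule_ge0.
rewrite -integral_esum //; last 2 first.
- by move=> g; apply: emeasurable_funM.
- by move=> g z; rewrite mule_ge0.
rewrite (integral_hyp_upper mf) // -ge0_integralZl //.
apply: ge0_ae_eq_integral => //.
- by apply: measurable_esum => // [g|g z]; [exact: emeasurable_funM|rewrite mule_ge0].
- by apply: emeasurable_funM => //; exact: measurable_cst.
- by move=> z _; apply: esum_ge0 => g _; rewrite mule_ge0.
- by move=> z _; rewrite mule_ge0.
have [N0 [mN0 N0N N0s]] := stabilizers_null FG.
exists (N0 `|` ~` upper_half R); split.
- by apply: measurableU => //; apply: measurableC; exact: measurable_upper_half.
- rewrite measureU0 //; first by apply: measurableC; exact: measurable_upper_half.
  exact: hyp_setC_upper.
move=> z /= hz; apply: contrapT => /not_orP[nN /contrapT z0]; apply: hz => _.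
have {N0s nN}st : forall g, G g -> mobius g z = z -> center G g.
  by move=> g Gg gz; apply: contrapT => nc; apply: nN; apply: N0s => /= H; apply: nc; exact: H.
(* After translation by [g0], the elements counted are those that fix [g0 z]; their conjugates by
   [g0] fix z and are therefore central. *)
have [g0 Gg0 Fg0] := fundom_exists FG z0; have dg0 := Gd _ Gg0.
rewrite (eq_esum (b := fun g => ((\1_(fundom G) (mobius (invmx g) z))%:E * f z)%E)) //.
rewrite (esum_inv (fun g => ((\1_(fundom G) (mobius g z))%:E * f z)%E)) //.
rewrite -(esum_mulr (fun g => ((\1_(fundom G) (mobius g z))%:E * f z)%E) sG Gg0).
transitivity (\esum_(g in G) ((\1_(center G) g)%:E * f z))%E.
  apply: eq_esum => g Gg; have dg := Gd _ Gg; congr (_%:E * _)%E; rewrite !indicE.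
  rewrite mobiusM //; congr (nat_of_bool _)%:R; apply/idP/idP; rewrite !inE.
    move=> h; have := fundom_unique sG Gg Fg0 h.
    rewrite -mobiusM // => E.
    have E2 : mobius (invmx g0 *m g *m g0) z = z.
      by rewrite -mulmxA mobiusM ?E ?mobiusK //; [exact: SL2V|exact: SL2M].
    have := st _ (GM _ _ (GM _ _ (GV _ Gg0) Gg) Gg0) E2.
    have ug := SL2_unit dg0.
    have Eg : g = g0 *m (invmx g0 *m g *m g0) *m invmx g0.
      by rewrite !mulmxA mulmxV // mul1mx -mulmxA mulmxV // mulmx1.
    move=> [_ /= [] E3]; split=> //=; rewrite Eg E3.
      by left; rewrite mulmx1 mulmxV.
    by right; rewrite mulmxN mulmx1 mulNmx mulmxV.
  by move=> [_ /= [] ->]; rewrite ?mobiusN mobius1.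
rewrite esum_card //; [exact: finite_center|exact: subIsetl].
Qed.
End Unfolding.

Section Transpose.
Variable R : realType.
Implicit Types (G : set 'M[R]_2) (g h : 'M[R]_2) (z w : R * R).
Local Notation hyp := (@hyp_measure R).

Lemma hyp_sigma_finite : sigma_finite setT hyp.
Proof.
pose i : R * R := (0, 1); have i0 : 0 < i.2 by [].
exists (fun n => ~` upper_half R `|` hdisc i n%:R).
  apply/seteqP; split=> // z _; have [z0|z0] := pselect (0 < z.2); last by exists 0%N => //; left.
  have [n hn] : exists n : nat, hypu i z <= n%:R.
    by exists (Num.truncn (hypu i z)).+1; rewrite ltW // truncnS_gt.
  by exists n => //; right; split.
move=> n; have mC : measurable (~` upper_half R) by apply: measurableC; exact: measurable_upper_half.
have mD := measurable_hdisc i n%:R.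
split; first exact: measurableU.
apply: le_lt_trans (measureU2 _ mC mD) _.
rewrite [X in (X + _)%E]hyp_setC_upper add0e.
(* The area formula needs a parameter above 1, hence the shift by 2. *)
apply: (@le_lt_trans _ _ (hyp (hdisc i n.+2%:R))); last by rewrite (hyp_disc i0) ?ltry // ltr1n.
apply: le_measure; rewrite ?inE //; first exact: measurable_hdisc.
by move=> z [z0 h]; split=> //; rewrite (le_trans h) // ler_nat !leqW.
Qed.

HB.instance Definition _ := Measure_isSigmaFinite.Build _ _ _ (@hyp_measure R) hyp_sigma_finite.

Lemma hyp_tonelli (A B : set (R * R)) (k : R * R -> R * R -> \bar R) :
  measurable A -> measurable B -> measurable_fun setT (fun p => k p.1 p.2) ->
  (forall z w, (0 <= k z w)%E) ->
  (\int[hyp]_(z in A) (\int[hyp]_(w in B) k z w) =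
   \int[hyp]_(w in B) (\int[hyp]_(z in A) k z w))%E.
Proof.
move=> mA mB mk k0.
pose f (p : (R * R) * (R * R)) : \bar R := ((\1_A p.1 : R)%:E * (\1_B p.2 : R)%:E * k p.1 p.2)%E.
have mf : measurable_fun setT f.
  apply: emeasurable_funM => //; apply: emeasurable_funM.
    by apply/measurable_EFinP; apply: measurableT_comp => //; exact: measurable_indic.
  by apply/measurable_EFinP; apply: measurableT_comp => //; exact: measurable_indic.
have f0 p : (0 <= f p)%E by rewrite !mule_ge0 // lee_fin.
have := @fubini_tonelli _ _ _ _ R hyp hyp f mf f0.
have E1 : (\int[hyp]_z (\int[hyp]_w f (z, w)) = \int[hyp]_(z in A) (\int[hyp]_(w in B) k z w))%E.
  rewrite [RHS]integral_mkcond; apply: eq_integral => z _; rewrite patchE /f /= indicE.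
  case: ifP => zA; last by rewrite integral0_eq // => w _; rewrite !mul0e.
  rewrite [RHS]integral_mkcond; apply: eq_integral => w _; rewrite patchE mul1e indicE.
  by case: ifP; rewrite ?mul1e ?mul0e.
have E2 : (\int[hyp]_w (\int[hyp]_z f (z, w)) = \int[hyp]_(w in B) (\int[hyp]_(z in A) k z w))%E.
  rewrite [RHS]integral_mkcond; apply: eq_integral => w _; rewrite patchE /f /= indicE.
  case: ifP => zA; last by rewrite integral0_eq // => z _; rewrite mule0 mul0e.
  rewrite [RHS]integral_mkcond; apply: eq_integral => z _; rewrite patchE mule1 indicE.
  by case: ifP; rewrite ?mul1e ?mul0e.
by rewrite -E1 -E2.
Qed.

Lemma measurable_hyp_integral (B : set (R * R)) d (T : measurableType d) (k : T -> R * R -> \bar R) :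
  measurable B -> measurable_fun setT (fun p => k p.1 p.2) ->
  (forall (t : T) w, (0 <= k t w)%E) ->
  measurable_fun setT (fun t => \int[hyp]_(w in B) k t w)%E.
Proof.
move=> mB mk k0.
pose f (p : T * (R * R)) : \bar R := ((\1_B p.2 : R)%:E * k p.1 p.2)%E.
have mf : measurable_fun setT f.
  apply: emeasurable_funM => //.
  by apply/measurable_EFinP; apply: measurableT_comp => //; exact: measurable_indic.
have f0 p : (0 <= f p)%E by rewrite !mule_ge0 // lee_fin.
have -> : (fun t => \int[hyp]_(w in B) k t w)%E = (fun t => \int[hyp]_w f (t, w))%E.
  apply/funext => z; rewrite integral_mkcond; apply: eq_integral => w _.
  by rewrite patchE /f /= indicE; case: ifP; rewrite ?mul1e ?mul0e.
exact: (@measurable_fun_fubini_tonelli_F _ _ T _ R hyp f mf f0).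
Qed.

(** Unfolding replaces the half-plane by the fundamental domain and the kernel by its sum over the
    group. On the product of two domains Tonelli applies, and substituting the inverse in the sum
    exchanges the variables. *)
Lemma integral_transpose G (k : R * R -> R * R -> \bar R) : fuchsian G ->
  measurable_fun setT (fun p => k p.1 p.2) -> (forall z w, (0 <= k z w)%E) ->
  (forall g z w, G g -> 0 < z.2 -> 0 < w.2 -> k (mobius g z) (mobius g w) = k z w) ->
  (\int[hyp]_(z in fundom G) (\int[hyp]_(w in upper_half R) k z w) =
   \int[hyp]_(w in fundom G) (\int[hyp]_(z in upper_half R) k z w))%E.
Proof.
move=> FG mk k0 kG; have [sG _] := FG; have [Gd _ GM GV] := sG.
have mF := measurable_fundom FG.
have c0 := ncenter_gt0 sG.
have mkz z : measurable_fun setT (fun w => k z w).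
  exact: (measurable_fun_pair2 z mk).
have mkw w : measurable_fun setT (fun z => k z w).
  exact: (measurable_fun_pair1 w mk).
have m1 g : measurable_fun setT (fun p : (R * R) * (R * R) => k p.1 (mobius g p.2)).
  apply: (measurableT_comp (f := fun p : (R * R) * (R * R) => k p.1 p.2) mk (g := fun p => (p.1, mobius g p.2))).
  apply: measurable_fun_pair => //=.
  by apply: measurableT_comp; [exact: measurable_mobius|exact: measurable_snd].
have mE : measurable_fun setT (fun p : (R * R) * (R * R) => \esum_(g in G) k p.1 (mobius g p.2)).
  exact: measurable_esum.
have U1 z : (\int[hyp]_(w in fundom G) (\esum_(g in G) k z (mobius g w)) =
    (ncenter G)%:R%:E * \int[hyp]_(w in upper_half R) k z w)%E.
  exact: integral_unfold.
have U2 w : (\int[hyp]_(z in fundom G) (\esum_(g in G) k (mobius g z) w) =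
    (ncenter G)%:R%:E * \int[hyp]_(z in upper_half R) k z w)%E.
  by apply: (integral_unfold (f := fun z => k z w)).
have mH := @measurable_upper_half R.
suff : ((ncenter G)%:R%:E * \int[hyp]_(z in fundom G) (\int[hyp]_(w in upper_half R) k z w) =
   (ncenter G)%:R%:E * \int[hyp]_(w in fundom G) (\int[hyp]_(z in upper_half R) k z w))%E.
  move/(congr1 (fun x => ((ncenter G)%:R^-1)%:E * x)%E).
  by rewrite !muleA -!EFinM mulVf ?mul1e // pnatr_eq0 -lt0n.
rewrite -(ge0_integralZl hyp mF) //; last first.
- by move=> z _; apply: integral_ge0.
- by apply: (@measurable_funS _ _ _ _ setT) => //; exact: measurable_hyp_integral.
rewrite -(ge0_integralZl hyp mF) //.
- under eq_integral => z _ do rewrite -U1.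
  under [RHS]eq_integral => z _ do rewrite -U2.
  have E0 z w : (0 <= \esum_(g in G) k z (mobius g w))%E by apply: esum_ge0 => g _.
  apply: etrans (hyp_tonelli mF mF mE E0) _.
  apply: eq_integral => w; rewrite inE => /fundom_upper w0.
  apply: eq_integral => z; rewrite inE => /fundom_upper z0.
  rewrite -[RHS](esum_inv _ sG); apply: eq_esum => g Gg; have dg := Gd _ Gg.
  have u0 := mobius_upper (SL2V dg) z0.
  by rewrite -(kG g (mobius (invmx g) z) w) // mobiusVK.
- apply: (@measurable_funS _ _ _ _ setT) => //.
  apply: (measurable_hyp_integral (k := fun w z => k z w)) => //.
  apply: (measurableT_comp (f := fun p : (R * R) * (R * R) => k p.1 p.2) mk (g := fun p => (p.2, p.1))).
  exact: measurable_fun_pair.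
- by move=> z _; apply: integral_ge0.
Qed.

Lemma coset_reps (G0 G : set 'M[R]_2) : SL2_subgroup G0 -> SL2_subgroup G ->
  finite_index_in G0 G -> exists s : seq 'M[R]_2,
    (forall g, g \in s -> G0 g) /\
    forall g, G0 g -> exists g1 h, [/\ g1 \in s, G h & g = g1 *m h].
Proof.
move=> [G0d _ _ _] [Gd G1 GM GV] [GG0 fC].
pose coset g := [set g *m h | h in G].
pose rep (C : set 'M[R]_2) := xget 1%:M (C `&` G0).
exists [seq rep C | C <- fset_set [set coset g | g in G0]].
have repC g : G0 g -> (coset g `&` G0) (rep (coset g)).
  by move=> G0g; apply: xgetPex; exists g; split=> //; exists 1%:M => //; rewrite mulmx1.
have repP g : G0 g -> exists2 h, G h & rep (coset g) = g *m h.
  by move=> /repC[[h Gh <-] _]; exists h.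
have repG g : G0 g -> G0 (rep (coset g)) by move=> /repC[].
split=> [x /mapP[C + ->]|g G0g].
  by rewrite in_fset_set // inE => -[g G0g <-]; exact: repG.
have [h Gh E] := repP _ G0g.
exists (rep (coset g)), (invmx h); split; [|exact: GV|].
  by apply: map_f; rewrite in_fset_set // inE; exists g.
by rewrite E -mulmxA mulmxV ?mulmx1 //; apply: SL2_unit; exact: Gd.
Qed.

Lemma fuchsian_sub (G0 G : set 'M[R]_2) : fuchsian G0 -> SL2_subgroup G ->
  G `<=` G0 -> fuchsian G.
Proof.
move=> [_ i0] sG GG0; split=> // g Gg; have := i0 _ (GG0 _ Gg).
move=> [_ [V nV VE]]; split; first by rewrite inE.
exists V => //; apply/seteqP; split=> [h [Vh Gh]|_ ->].
  by rewrite -VE; split=> //; exact: GG0.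
by split=> //; exact: nbhs_singleton.
Qed.

(** Every point is moved into [fundom G0] by an element of [G] followed by one of finitely many
    representatives. The sum over [G] of the counting function [f] of the representatives is thus at
    least 1, and unfolding bounds the volume by the finite integral of [f]. *)
Lemma cofinite_sub (G0 G : set 'M[R]_2) : cofinite_fuchsian G0 -> SL2_subgroup G ->
  finite_index_in G0 G -> fuchsian G -> cofinite_fuchsian G.
Proof.
move=> [FG0 v0] sG ix FG; split=> //; have [s [sG0 sP]] := coset_reps FG0.1 sG ix.
have [[G0d _ _ _] _] := FG0; have [Gd _ _ _] := sG.
have mF0 := measurable_fundom FG0; have mF := measurable_fundom FG.
pose F1 := (fun z => (\1_(fundom G0) z : R)%:E).
have mF1 : measurable_fun setT F1 by apply/measurable_EFinP; exact: measurable_indic.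
have mF1g g : measurable_fun setT (fun z => F1 (mobius g z)).
  exact: measurableT_comp mF1 (measurable_mobius g).
pose f z : \bar R := (\sum_(g <- s) F1 (mobius g z))%E.
have mf : measurable_fun setT f by exact: emeasurable_sum.
have f0 z : (0 <= f z)%E by apply: sume_ge0 => g _; rewrite lee_fin.
have fE : (\int[hyp]_(z in upper_half R) f z < +oo)%E.
  rewrite (integral_hyp_upper mf f0) ge0_integral_sum //; last first.
    by move=> g z _; rewrite lee_fin.
  rewrite (eq_big_seq (fun=> hyp (fundom G0))); last first.
    move=> g /sG0 G0g; rewrite (integral_hyp_mobius (G0d _ G0g) mF1) //.
    by rewrite integral_indic // setIT.
    by move=> z; rewrite lee_fin.
  by apply: lte_sum_pinfty.
apply: (@le_lt_trans _ _ (\int[hyp]_(z in fundom G) (\esum_(g in G) f (mobius g z)))%E); last first.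
  by rewrite (integral_unfold FG mf f0) // lte_mul_pinfty.
rewrite -[leLHS]mul1e -integral_cst //; apply: ge0_le_integral => //.
- apply: (@measurable_funS _ _ _ _ setT) => //; apply: measurable_esum => // g.
  by apply: measurableT_comp mf (measurable_mobius g).
move=> z /fundom_upper z0.
have [g0 G0g0 Fg0] := fundom_exists FG0 z0.
have [g1 [h [g1s Gh E]]] := sP _ G0g0.
apply: (@le_trans _ _ (f (mobius h z))); last first.
  apply: esum_ge; exists [set h]; [split; [exact: finite_set1|by move=> _ ->]|by rewrite fsbig_set1].
have dh := Gd _ Gh; have dg1 := G0d _ (sG0 _ g1s).
rewrite /f (big_rem g1) //= -mobiusM // -E /F1 indicE mem_set // leeDl // sume_ge0 //.
Qed.
End Transpose.

(** * Radial kernels *)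

Section RadialKernels.
Variable R : realType.
Local Notation RR := (setT : set (GRing.regular R)).
Local Notation leb := (@lebesgue_measure R).

(** One support bound for all kernels, so that the counting constants do not depend on the
    kernel. *)
Definition rkernel (k : R -> R) : Prop :=
  [/\ forall n, Cn n RR k, forall u, 0 <= k u & forall u, 3 <= u -> k u = 0].

Definition step : R -> R := projT1 (cid (@smooth_step_exists R)).
Definition step' : R -> R := projT1 (cid (projT2 (cid (@smooth_step_exists R)))).

Lemma stepP : [/\ (forall t, is_derive t (1 : R) step (step' t)),
      (forall n, Cn n RR step'),
      (forall t, 0 <= step' t) /\ (forall t, ~~ (0 < t < 1) -> step' t = 0),
      (forall t, t <= 0 -> step t = 0) &
      (forall t, 1 <= t -> step t = 1)].
Proof. exact: (projT2 (cid (projT2 (cid (@smooth_step_exists R))))). Qed.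

Lemma step_homo t1 t2 : t1 <= t2 -> step t1 <= step t2.
Proof. by have [d _ [p _] _ _] := stepP => t12; apply: (@derive_ge0_homo _ _ step'). Qed.

Lemma step_itv t : 0 <= step t <= 1.
Proof.
have [_ _ _ s0 s1] := stepP; apply/andP; split.
  by have [/s0 -> //|/ltW t0] := leP t 0; rewrite -(s0 0) // step_homo.
by have [/s1 -> //|/ltW t0] := leP 1 t; rewrite -(s1 1) // step_homo.
Qed.

Lemma tail_integral (F f : R -> R) : continuous f ->
  (forall u, is_derive u (1 : R) F (f u)) -> (forall u, 3 <= u -> f u = 0) ->
  (\int[leb]_(x in `]1%R, +oo[) (f x)%:E = (F 3 - F 1)%:E)%E.
Proof.
move=> cf dF f3.
have mf : measurable_fun setT f by exact: continuous_measurable_fun.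
transitivity (\int[leb]_(x in `]1%R, 3%R]) (f x)%:E)%E.
  rewrite [LHS]integral_mkcond [RHS]integral_mkcond; apply: eq_integral => x _.
  rewrite !patchE !mem_setE !in_itv /= andbT; case: ltP => //= x1.
  by case: leP => // /ltW /f3 ->.
rewrite integral_itv_obnd_cbnd; last first.
  by apply/measurable_EFinP; apply: measurable_funS mf.
rewrite (@continuous_FTC2 R f F) ?EFinB //.
- by rewrite ltr1n.
- exact: continuous_subspaceT.
- split.
  + by move=> x _; case: (dF x).
  + by apply: cvg_at_right_filter; exact: is_derive_continuous (dF 1).
  + by apply: cvg_at_left_filter; exact: is_derive_continuous (dF 3).
- by move=> x _; rewrite derive1E; case: (dF x).
Qed.

Lemma Cn_affine_comp n (f : R -> R) (a b : R) : Cn n RR f -> Cn n RR (fun u => f (a * u + b)).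
Proof.
move=> Cf; apply: (@Cn_comp _ _ _ RR setT f (fun u => a * u + b)) => //; first exact: openT.
exact: Cn_affine.
Qed.

Lemma is_derive_affine_comp (f f' : R -> R) (a b x : R) :
  (forall t, is_derive t (1 : R) f (f' t)) ->
  is_derive x (1 : R) (fun u => f (a * u + b)) (a * f' (a * x + b)).
Proof.
move=> df; have h := is_derive_affine a b x.
have [d1 d2] := h; have := is_derive_compR d1 (df (a * x + b)).
by rewrite d2 mulrC.
Qed.

Lemma Cn_step n : Cn n RR step.
Proof. by have [d C _ _ _] := stepP; exact: Cn_primitive d (C n). Qed.

(* [mn n], [cn n] and [bn n] (the primitive of [cn n]) are made so that the radial
   Laplacian of [bn n] is [kk - kn n]. *)
Definition kk (u : R) : R := (2 * pi)^-1 * step' (1 * u + -2).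
Definition kn (n : nat) (u : R) : R := (2 * pi)^-1 * (n%:R * step' (n%:R * u + (- n%:R - 1))).
Definition mn (n : nat) (u : R) : R := step (n%:R * u + (- n%:R - 1)) - step (1 * u + -2).
Definition cn (n : nat) (u : R) : R := - ((2 * pi)^-1 * (mn n u / (u ^+ 2 - 1))).

Lemma pi2_gt0 : 0 < 2 * pi :> R. Proof. by rewrite mulr_gt0 // pi_gt0. Qed.

Lemma rkernel_kk : rkernel kk.
Proof.
have [d C [p z] _ _] := stepP; split => [n|u|u u3].
- by apply: CnZ; [exact: openT|exact: Cn_affine_comp].
- by rewrite mulr_ge0 // invr_ge0 ltW // pi2_gt0.
- by rewrite /kk z ?mulr0 //; apply/negP => /andP[]; lra.
Qed.

Lemma kn_supp n u : (0 < n)%N -> kn n u != 0 -> 1 < u < 1 + 2 / n%:R.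
Proof.
move=> n0; have [_ _ [_ z] _ _] := stepP; apply: contraNT => h.
have n1 : 0 < n%:R :> R by rewrite ltr0n.
rewrite /kn z ?mulr0 //; apply: contra h => /andP[h1 h2].
have E : u = 1 + (n%:R * u - n%:R) / n%:R by field; rewrite gt_eqF.
apply/andP; split; rewrite E; first by rewrite ltrDl divr_gt0 //; lra.
by rewrite ltrD2l ltr_pM2r ?invr_gt0 //; lra.
Qed.

Lemma rkernel_kn n : (0 < n)%N -> rkernel (kn n).
Proof.
move=> n0; have [d C [p z] _ _] := stepP; split => [m|u|u u3].
- apply: CnZ; first exact: openT.
  by apply: CnZ; [exact: openT|exact: Cn_affine_comp].
- by rewrite !mulr_ge0 // invr_ge0 ltW // pi2_gt0.
- apply/eqP; apply: contraT => /(kn_supp n0) /andP[_].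
  have : 2 / n%:R <= 2 :> R by rewrite ler_pdivrMr ?ltr0n // ler_peMr // ler1n.
  lra.
Qed.

Lemma mn_supp n u : (1 < n)%N -> ~~ (1 + n%:R^-1 <= u <= 3) -> mn n u = 0.
Proof.
move=> n1 h; have [_ _ _ s0 s1] := stepP.
have n0 : 0 < n%:R :> R by rewrite ltr0n (ltn_trans _ n1).
have n2 : 2 <= n%:R :> R by rewrite (ler_nat R 2).
have [u1|u1] := ltP u (1 + n%:R^-1).
  have h1 : n%:R * (u - 1) <= 1.
    by rewrite mulrC -ler_pdivlMr // mul1r; lra.
  have h2 : n%:R^-1 <= 1 :> R by rewrite invf_le1 //; lra.
  by rewrite /mn !s0 ?subrr //; lra.
have u3 : 3 < u by move: h; rewrite u1 /= -ltNge.
have : 2 * 2 <= n%:R * (u - 1) by apply: ler_pM => //; lra.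
by move=> h3; rewrite /mn !s1 ?subrr //; lra.
Qed.

Lemma mn_ge0 n u : (1 < n)%N -> 0 <= mn n u.
Proof.
move=> n1; have [u1|u1] := ltP u (1 + n%:R^-1).
  by rewrite mn_supp // leNgt u1.
have n2 : 2 <= n%:R :> R by rewrite (ler_nat R 2).
have i0 : 0 <= n%:R^-1 :> R by rewrite invr_ge0.
rewrite subr_ge0 step_homo //.
have : 1 * (u - 1) <= n%:R * (u - 1) by rewrite ler_wpM2r //; lra.
lra.
Qed.

Lemma mn_le1 n u : mn n u <= 1.
Proof. by rewrite /mn; have /andP[] := step_itv (n%:R * u + (- n%:R - 1)); have /andP[] := step_itv (1 * u + -2); lra. Qed.

Lemma cn_supp n u : (1 < n)%N -> ~~ (1 <= u <= 3) -> cn n u = 0.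
Proof.
move=> n1 h; rewrite /cn mn_supp ?mul0r ?mulr0 ?oppr0 //; apply: contra h => /andP[h1 ->].
by rewrite (le_trans _ h1) // lerDl invr_ge0.
Qed.

Lemma Cn_cn m n : (1 < n)%N -> Cn m RR (cn n).
Proof.
move=> n1; have n0 : 0 < n%:R :> R by rewrite ltr0n (ltn_trans _ n1).
have i0 : 0 < n%:R^-1 :> R by rewrite invr_gt0.
pose U1 : set (GRing.regular R) := [set u | u < 1 + n%:R^-1].
pose U2 : set (GRing.regular R) := [set u | 1 < u].
have oU1 : open U1 by exact: open_lt.
have oU2 : open U2 by exact: open_gt.
have -> : RR = U1 `|` U2.
  apply/seteqP; split=> // u _ /=; have [|b] := ltP u (1 + n%:R^-1); [by left|right].
  by apply: lt_le_trans b; rewrite ltrDl.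
apply: Cn_setU.
  apply: Cn_eq (Cn_cst m U1 0) => // u u1.
  by rewrite /cn mn_supp ?mul0r ?mulr0 ?oppr0 // leNgt u1.
have Cid : Cn m U2 (fun u : R => u).
  apply: Cn_eq (Cn_sub (@subsetT _ U2) (Cn_affine m 1 0)) => // u _.
  by rewrite mul1r addr0.
have : Cn m U2 (fun u : R => - (2 * pi)^-1 * (mn n u * ((u * u + -1)^-1))).
  apply: (CnZ _ oU2); apply: (CnM oU2).
    apply: (CnD oU2).
      apply: (Cn_sub (@subsetT _ U2)); exact: (Cn_affine_comp _ _ (Cn_step m)).
    have : Cn m U2 (fun u : R => -1 * step (1 * u + -2)).
      apply: (CnZ _ oU2); apply: (Cn_sub (@subsetT _ U2)); exact: (Cn_affine_comp _ _ (Cn_step m)).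
    by apply: Cn_eq => // u _; rewrite mulN1r.
  apply: (CnV oU2).
    move=> u /= u1; rewrite gt_eqF //.
    have : 1 * 1 < u * u by apply: ltr_pM.
    lra.
  apply: (CnD oU2); last exact: Cn_cst.
  exact: (CnM oU2).
by apply: Cn_eq => // u _; rewrite /cn mulNr expr2.
Qed.

Lemma cn_continuous n : (1 < n)%N -> continuous (cn n).
Proof. by move=> n1 u; have [] := Cn_cn 0 n1; move=> /(_ u I). Qed.

Lemma primitive_cn n : (1 < n)%N -> exists F : R -> R, forall x, is_derive x (1 : R) F (cn n x).
Proof.
move=> n1; apply: (@primitive_exists _ _ 1 3); first exact: cn_continuous.
by move=> x; exact: cn_supp.
Qed.

(** The primitive is normalised to vanish at 3, where [cn n] stops, and hence has bounded support to
    the right. Existence of a primitive is tested because it is proved for [1 < n] only. *)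
Definition bn (n : nat) (u : R) : R :=
  if pselect (exists F : R -> R, forall x, is_derive x (1 : R) F (cn n x)) is left h
  then projT1 (cid h) u - projT1 (cid h) 3 else 0.

Lemma is_derive_bn n u : (1 < n)%N -> is_derive u (1 : R) (bn n) (cn n u).
Proof.
move=> n1; rewrite /bn; case: pselect => [h|]; last by have := primitive_cn n1.
have := is_deriveB (projT2 (cid h) u) (is_derive_cst (projT1 (cid h) 3) u (1 : R)).
by rewrite subr0.
Qed.

Lemma bn3 n : bn n 3 = 0.
Proof. by rewrite /bn; case: pselect => // h; rewrite subrr. Qed.

Lemma bn_supp n u : (1 < n)%N -> 3 <= u -> bn n u = 0.
Proof.
move=> n1 u3; rewrite -(bn3 n); symmetry; apply: derive0_const => // x /andP[x3 _].
have [->|x3'] := eqVneq x 3.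
  have [_ _ _ _ s1] := stepP; have n2 : 2 <= n%:R :> R by rewrite (ler_nat R 2).
  have <- : cn n 3 = 0 by rewrite /cn /mn !s1 ?subrr ?mul0r ?mulr0 ?oppr0 //; lra.
  exact: is_derive_bn.
have <- : cn n x = 0; last exact: is_derive_bn.
rewrite cn_supp // negb_and -!ltNge orbC.
by rewrite lt_neqAle eq_sym x3' x3.
Qed.

Lemma cn_le0 n u : (1 < n)%N -> cn n u <= 0.
Proof.
move=> n1; have [h|h] := boolP (1 <= u <= 3); last by rewrite cn_supp.
have /andP[u1 _] := h.
rewrite oppr_le0 mulr_ge0 ?invr_ge0 ?(ltW pi2_gt0) // divr_ge0 ?mn_ge0 // subr_ge0.
by rewrite exprn_ege1.
Qed.

Lemma bn_anti n u v : (1 < n)%N -> u <= v -> bn n v <= bn n u.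
Proof.
move=> n1 uv; rewrite -lerN2.
apply: (@derive_ge0_homo _ (- bn n) (fun x => - cn n x)) => // x _.
  by apply: is_deriveN; exact: is_derive_bn.
by rewrite oppr_ge0 cn_le0.
Qed.

Lemma rkernel_bn n : (1 < n)%N -> rkernel (bn n).
Proof.
move=> n1; split=> [m|u|u]; last exact: bn_supp.
  by apply: Cn_primitive (Cn_cn m n1) => u; exact: is_derive_bn.
have [u3|u3] := leP 3 u; first by rewrite bn_supp.
by rewrite -(bn3 n) bn_anti // ltW.
Qed.

(** The radial Laplacian of b is the derivative of [(u^2 - 1) b'], and for [bn n] this product is
    [- mn n / (2 pi)], a difference of two steps. *)
Lemma radial_bn n : (1 < n)%N -> exists c' : R -> R,
  (forall u, is_derive u (1 : R) (cn n) (c' u)) /\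
  forall u, (u ^+ 2 - 1) * c' u + 2 * u * cn n u = kk u - kn n u.
Proof.
move=> n1; have n0 : 0 < n%:R :> R by rewrite ltr0n (ltn_trans _ n1).
have [d C [p z] s0 s1] := stepP.
have [_ /(_ 1)[d1 _]] := Cn_cn 1 n1.
have dc (u : R) : is_derive u (1 : R) (cn n) ('D_1 (cn n) u) by exact: (DeriveDef (d1 u I) erefl).
exists (fun u => 'D_1 (cn n) u); split=> // u.
have E : (fun v => (v ^+ 2 - 1) * cn n v) = (fun v => - (2 * pi)^-1 * mn n v).
  apply/funext => v; rewrite /cn.
  (* Where the denominator of [cn] vanishes, [mn n] vanishes as well, since it is supported in
     [u >= 1 + 1 / n]. *)
  have [v0|v0] := eqVneq (v ^+ 2 - 1) 0; last by rewrite mulrN mulrCA (mulrC (v ^+ 2 - 1)) divfK // mulNr.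
  rewrite v0 mul0r mn_supp ?mulr0 //; apply/negP => /andP[v1 _].
  have : 1 * 1 < v * v.
    by apply: ltr_pM => //; apply: lt_le_trans v1; rewrite ltrDl invr_gt0.
  by move: v0; rewrite expr2; lra.
have dmn : is_derive u (1 : R) (mn n) (n%:R * step' (n%:R * u + (- n%:R - 1)) - 1 * step' (1 * u + -2)).
  apply: is_deriveB; exact: is_derive_affine_comp.
have h1 := is_deriveZ (- (2 * pi)^-1) dmn.
have h2 : is_derive u (1 : R) (fun v : R => v ^+ 2 - 1) (2 * u).
  have h := is_deriveB (is_deriveM (is_derive_id u (1 : R)) (is_derive_id u (1 : R)))
    (is_derive_cst (1 : R) u (1 : R)).
  have -> : (fun v : R => v ^+ 2 - 1) = id * id - cst (1 : R) by apply/funext => v; rewrite expr2.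
  have -> : 2 * u = u * 1 + u * 1 - 0 by ring.
  exact: h.
have h3 := is_deriveM h2 (dc u).
have e : (fun v : R => v ^+ 2 - 1) * cn n = - (2 * pi)^-1 \*: mn n by exact: E.
have [_ E1] := h1; have [_ E2] := h3.
have : (u ^+ 2 - 1) *: 'D_1 (cn n) u + cn n u *: (2 * u) =
   - (2 * pi)^-1 *: (n%:R * step' (n%:R * u + (- n%:R - 1)) - 1 * step' (1 * u + -2)).
  by rewrite -E1 -E2 e.
rewrite /GRing.scale /= /kk /kn => E3; have -> : 2 * u * cn n u = cn n u * (2 * u) by rewrite mulrC.
by rewrite E3; ring.
Qed.
End RadialKernels.

(** * Masses of the kernels and comparison with L *)

Section Masses.
Variable R : realType.
Local Notation RR := (setT : set (GRing.regular R)).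
Local Notation leb := (@lebesgue_measure R).

Lemma rkernel_continuous (k : R -> R) : rkernel k -> continuous k.
Proof. by move=> [C _ _] u; have [/(_ u I)] := C 0%N. Qed.

Lemma mass_step (a c : R) : a * 1 + c <= 0 -> 1 <= a * 3 + c ->
  (forall u, 3 <= u -> 1 <= a * u + c) ->
  (\int[leb]_(x in `]1%R, +oo[) ((2 * pi)^-1 * (a * step' (a * x + c)))%:E = ((2 * pi)^-1)%:E)%E.
Proof.
move=> h1 h3 h; have [d C [p z] s0 s1] := @stepP R.
apply: etrans (@tail_integral _ (fun u => (2 * pi)^-1 * step (a * u + c))
  (fun u => (2 * pi)^-1 * (a * step' (a * u + c))) _ _ _) _.
- move=> u; have : Cn 0 RR (fun u => (2 * pi)^-1 * (a * step' (a * u + c))).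
    apply: CnZ; first exact: openT.
    by apply: CnZ; [exact: openT|exact: Cn_affine_comp].
  by case=> /(_ u I).
- by move=> u; apply: is_deriveZ; exact: is_derive_affine_comp.
- by move=> u /h u3; rewrite z ?mulr0 //; apply/negP => /andP[_]; lra.
- by rewrite (s0 (a * 1 + c)) // (s1 (a * 3 + c)) // mulr0 mulr1 subr0.
Qed.

Lemma mass_kk : (\int[leb]_(x in `]1%R, +oo[) (kk x)%:E = ((2 * pi)^-1)%:E)%E.
Proof.
rewrite -(@mass_step 1 (-2)); [|lra|lra|by move=> u; lra].
by apply: eq_integral => x _; rewrite /kk [1 * step' _]mul1r.
Qed.

Lemma mass_kn n : (1 < n)%N -> (\int[leb]_(x in `]1%R, +oo[) (kn n x)%:E = ((2 * pi)^-1)%:E)%E.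
Proof.
move=> n1; have n2 : 2 <= n%:R :> R by rewrite (ler_nat R 2).
apply: mass_step; [lra|lra|move=> u u3].
by have : 2 * 2 <= n%:R * (u - 1); [apply: ler_pM; lra|lra].
Qed.

(** Integration by parts: the integral of [b] is that of [- (u - 1) b'], the boundary terms
    vanishing at 1 and at 3. The new integrand is at most [1 / (4 pi)] and vanishes beyond
    [1 + r]. *)
Lemma mass_parts (b b' : R -> R) (r : R) : 0 <= r <= 2 -> continuous b' ->
  (forall u, is_derive u (1 : R) b (b' u)) -> (forall u, 3 <= u -> b u = 0) ->
  (forall u, u <= 1 -> b' u = 0) -> (forall u, 1 + r <= u -> b' u = 0) ->
  (forall u, 1 <= u -> - (u - 1) * b' u <= (4 * pi)^-1) ->
  (\int[leb]_(x in `]1%R, +oo[) (b x)%:E <= (r * (4 * pi)^-1)%:E)%E.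
Proof.
move=> /andP[r0 r2] cb' db b3 b'1 b'r ub.
pose q u := - (u - 1) * b' u.
have cq : continuous q.
  have h : continuous (fun u : R => - (u - 1)).
    have E : (fun u : R => - (u - 1)) = (fun u => -1 * u + 1) by apply/funext => v; ring.
    by move=> u; rewrite E; exact: is_derive_continuous (is_derive_affine _ _ _).
  exact: (contM h cb').
have qr u : 1 + r <= u -> q u = 0 by move=> h; rewrite /q b'r ?mulr0.
have [Q dQ] : exists Q : R -> R, forall x, is_derive x (1 : R) Q (q x).
  apply: (@primitive_exists _ _ 1 3) => // u; rewrite negb_and -!ltNge => /orP[u1|u3].
    by rewrite /q b'1 ?mulr0 // ltW.
  by apply: qr; lra.
have cb : continuous b by move=> u; exact: is_derive_continuous (db u).
have dE u : is_derive u (1 : R) (fun u => (u - 1) * b u + Q u) (b u).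
  have h1 := is_deriveB (is_derive_id u (1 : R)) (is_derive_cst (1 : R) u (1 : R)).
  have := is_deriveD (is_deriveM h1 (db u)) (dQ u).
  rewrite /GRing.scale /= /q; have -> : (u - 1) * b' u + b u * (1 - 0) + - (u - 1) * b' u = b u by ring.
  by [].
have -> := @tail_integral _ _ b cb dE b3.
- rewrite b3 // mulr0 subrr mul0r !add0r lee_fin.
  have -> : Q 3 = Q (1 + r).
    symmetry; apply: derive0_const => [|x /andP[x1 _]]; first lra.
    by rewrite -(qr _ x1).
  have : (4 * pi)^-1 * 1 - Q 1 <= (4 * pi)^-1 * (1 + r) - Q (1 + r).
    apply: (@derive_ge0_homo _ (fun u => (4 * pi)^-1 * u - Q u) (fun u => (4 * pi)^-1 * 1 - q u)).
    + lra.
    + by move=> x /andP[x1 _]; rewrite mulr1 subr_ge0 ub.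
  lra.
Qed.

Lemma cn_eq n (u : R) : 1 < u -> - (u - 1) * cn n u = (2 * pi)^-1 * (u + 1)^-1 * mn n u.
Proof.
move=> u1; have p0 := pi_gt0 R.
have h1 : u - 1 != 0 by rewrite gt_eqF // subr_gt0.
have h2 : u + 1 != 0 by rewrite gt_eqF //; lra.
have h3 : pi != 0 :> R by rewrite gt_eqF.
rewrite /cn (_ : u ^+ 2 - 1 = (u - 1) * (u + 1)); last by ring.
move: (pi : R) h3 (mn n u) => p h3 M; field; rewrite h1 h2 h3.
by [].
Qed.

Lemma inv4pi (u : R) : 1 <= u -> (2 * pi)^-1 * (u + 1)^-1 <= (4 * pi)^-1.
Proof.
move=> u1; have p0 := pi_gt0 R; rewrite -invfM lef_pV2 ?posrE; last 2 first.
- by rewrite !mulr_gt0 //; lra.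
- by rewrite mulr_gt0.
have : 2 * pi * 2 <= 2 * pi * (u + 1) by rewrite ler_pM2l ?mulr_gt0 //; lra.
lra.
Qed.

Lemma mass_bn n : (1 < n)%N ->
  (\int[leb]_(x in `]1%R, +oo[) (bn n x)%:E <= ((2 * pi)^-1)%:E)%E.
Proof.
move=> n1; have p0 := pi_gt0 R; have -> : (2 * pi)^-1 = 2 * (4 * pi)^-1 :> R by move: (pi : R) p0 => p p0; field; rewrite gt_eqF.
have cn1 (u : R) : u <= 1 -> cn n u = 0.
  move=> u1; rewrite /cn mn_supp ?mul0r ?mulr0 ?oppr0 //; apply/negP => /andP[h _].
  have : 0 < n%:R^-1 :> R by rewrite invr_gt0 ltr0n (ltn_trans _ n1).
  lra.
apply: (mass_parts (b' := cn n)) => //.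
- by rewrite ler0n lexx.
- exact: cn_continuous.
- by move=> u; exact: is_derive_bn.
- by move=> u; exact: bn_supp.
- move=> u u3; have [_ _ _ _ s1] := @stepP R; have n2 : 2 <= n%:R :> R by rewrite (ler_nat R 2).
  have h : 2 * 2 <= n%:R * (u - 1) by apply: ler_pM; lra.
  by rewrite /cn /mn !s1 ?subrr ?mul0r ?mulr0 ?oppr0 //; lra.
- move=> u u1; have [->|ne] := eqVneq u 1; first by rewrite subrr oppr0 mul0r invr_ge0 mulr_ge0 // ltW.
  rewrite cn_eq; last by rewrite lt_neqAle eq_sym ne.
  apply: le_trans (inv4pi u1); rewrite ler_piMr ?mn_le1 //.
  by rewrite mulr_ge0 // invr_ge0; [rewrite mulr_ge0 // ltW|lra].
Qed.

Section TwoKernels.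
Variables m n : nat.
Hypotheses (n1 : (1 < n)%N) (nm : (n <= m)%N).


Lemma mn_far (u : R) : 1 + 2 / n%:R <= u -> mn m u = mn n u.
Proof.
have m1 : (1 < m)%N := leq_trans n1 nm.
have n2 : 2 <= n%:R :> R by rewrite (ler_nat R 2).
have m2 : n%:R <= m%:R :> R by rewrite ler_nat.
have in0 : 0 < n%:R^-1 :> R by rewrite invr_gt0; lra.
move=> h; have [_ _ _ _ s1] := @stepP R.
have h2 : 2 <= n%:R * (u - 1) by rewrite mulrC -ler_pdivrMr; lra.
have h3 : n%:R * (u - 1) <= m%:R * (u - 1).
  by rewrite ler_wpM2r //; have : 0 <= 2 / n%:R :> R; [rewrite mulr_ge0 // ltW|lra].
by rewrite /mn (s1 (m%:R * u + _)) ?(s1 (n%:R * u + _)) //; lra.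
Qed.

Lemma cn_far (u : R) : 1 + 2 / n%:R <= u -> cn m u = cn n u.
Proof. by move=> h; rewrite /cn mn_far. Qed.

Lemma mn_diff (u : R) : 1 <= u -> 0 <= mn m u - mn n u <= 1.
Proof.
have m1 : (1 < m)%N := leq_trans n1 nm.
have n2 : 2 <= n%:R :> R by rewrite (ler_nat R 2).
have m2 : n%:R <= m%:R :> R by rewrite ler_nat.
have in0 : 0 < n%:R^-1 :> R by rewrite invr_gt0; lra.
move=> u1; rewrite /mn.
have h3 : n%:R * (u - 1) <= m%:R * (u - 1) by rewrite ler_wpM2r //; lra.
have : step (n%:R * u + (- n%:R - 1)) <= step (m%:R * u + (- m%:R - 1)) by apply: step_homo; lra.
have /andP[] := step_itv (n%:R * u + (- n%:R - 1)).
have /andP[] := step_itv (m%:R * u + (- m%:R - 1)).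
move=> *; apply/andP; split; lra.
Qed.

Lemma cn1 l (u : R) : (1 < l)%N -> u <= 1 -> cn l u = 0.
Proof.
move=> l1 u1; rewrite /cn mn_supp ?mul0r ?mulr0 ?oppr0 //; apply/negP => /andP[h _].
have : 0 < l%:R^-1 :> R by rewrite invr_gt0 ltr0n (ltn_trans _ l1).
lra.
Qed.

Lemma bn_far (u : R) : 1 + 2 / n%:R <= u -> bn m u = bn n u.
Proof.
have m1 : (1 < m)%N := leq_trans n1 nm.
have n2 : 2 <= n%:R :> R by rewrite (ler_nat R 2).
have m2 : n%:R <= m%:R :> R by rewrite ler_nat.
have in0 : 0 < n%:R^-1 :> R by rewrite invr_gt0; lra.
move=> h; have [u3|u3] := leP 3 u; first by rewrite !bn_supp.
have := @derive0_const _ (fun u => bn m u - bn n u) u 3 (ltW u3).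
rewrite !bn3 subrr => H; apply/eqP; rewrite -subr_eq0; apply/eqP; apply: H => x /andP[ux _].
rewrite -[0](subrr (cn n x)) -{1}(cn_far (le_trans h ux)).
by apply: is_deriveB; exact: is_derive_bn.
Qed.

Lemma bn_diff_ge0 (u : R) : bn n u <= bn m u.
Proof.
have m1 : (1 < m)%N := leq_trans n1 nm.
have n2 : 2 <= n%:R :> R by rewrite (ler_nat R 2).
have m2 : n%:R <= m%:R :> R by rewrite ler_nat.
have in0 : 0 < n%:R^-1 :> R by rewrite invr_gt0; lra.
have [u3|u3] := leP 3 u; first by rewrite !bn_supp.
have := @derive_ge0_homo _ (fun u => bn n u - bn m u) (fun u => cn n u - cn m u) u 3 (ltW u3).
rewrite !bn3 subrr => H.
rewrite -subr_le0; apply: H => [x _|x _]; first by apply: is_deriveB; exact: is_derive_bn.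
have [x1|x1] := leP x 1; first by rewrite !cn1 ?subrr.
have E l : cn l x = - ((2 * pi)^-1 * (x ^+ 2 - 1)^-1 * mn l x) by rewrite /cn mulrA mulrAC.
have /andP[h _] := mn_diff (ltW x1); rewrite !E opprK addrC -mulrBr mulr_ge0 //.
by rewrite mulr_ge0 // invr_ge0 ?(ltW (pi2_gt0 R)) // subr_ge0 exprn_ege1 // ltW.
Qed.

(** The derivatives of [bn m] and [bn n] differ only for [u <= 1 + 2 / n], so [mass_parts] applies
    with [r = 2 / n]. This decay in [n] makes the averages in [nrm_SR_le] a Cauchy sequence. *)
Lemma mass_bn_diff :
  (\int[leb]_(x in `]1%R, +oo[) (bn m x - bn n x)%:E <= ((2 * pi)^-1 / n%:R)%:E)%E.
Proof.
have m1 : (1 < m)%N := leq_trans n1 nm.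
have n2 : 2 <= n%:R :> R by rewrite (ler_nat R 2).
have m2 : n%:R <= m%:R :> R by rewrite ler_nat.
have in0 : 0 < n%:R^-1 :> R by rewrite invr_gt0; lra.
have p0 := pi_gt0 R; have -> : (2 * pi)^-1 / n%:R = (2 / n%:R) * (4 * pi)^-1 :> R.
  by move: (pi : R) p0 => p p0; field; rewrite !gt_eqF //; lra.
apply: (mass_parts (b' := fun u => cn m u - cn n u)) => //.
- apply/andP; split; first by rewrite mulr_ge0 // ltW.
  by rewrite ler_pdivrMr; lra.
- by move=> u; apply: contD; [exact: cn_continuous|apply: contN; exact: cn_continuous].
- by move=> u; apply: is_deriveB; exact: is_derive_bn.
- by move=> u u3; rewrite !bn_supp ?subrr.
- by move=> u u1; rewrite !cn1 ?subrr.
- by move=> u u3; rewrite cn_far ?subrr.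
- move=> u u1; have [->|ne] := eqVneq u 1; first by rewrite subrr oppr0 mul0r invr_ge0 mulr_ge0 // ltW.
  have u1' : 1 < u by rewrite lt_neqAle eq_sym ne.
  rewrite mulrBr !cn_eq // -mulrBr; have /andP[h1 h2] := mn_diff u1.
  apply: le_trans (inv4pi u1); rewrite ler_piMr //.
  by rewrite mulr_ge0 // invr_ge0; [rewrite mulr_ge0 // ltW|lra].
Qed.
End TwoKernels.

Lemma is_derive_hypL (u : R) : 1 < u -> is_derive u (1 : R) (@hypL R) (- ((2 * pi)^-1 / (u ^+ 2 - 1))).
Proof.
move=> u1; have p0 := pi_gt0 R.
have h1 : is_derive u (1 : R) (fun v : R => v + 1) (1 + 0).
  exact: is_deriveD (is_derive_id u (1 : R)) (is_derive_cst (1 : R) u (1 : R)).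
have h2 : is_derive u (1 : R) (fun v : R => v - 1) (1 - 0).
  exact: is_deriveB (is_derive_id u (1 : R)) (is_derive_cst (1 : R) u (1 : R)).
have um : u - 1 != 0 by rewrite gt_eqF // subr_gt0.
have up : u + 1 != 0 by rewrite gt_eqF //; lra.
have h3 := @is_derive_div R (fun v => v + 1) (fun v => v - 1) u _ _ um h1 h2.
have q0 : 0 < (u + 1) / (u - 1) by rewrite divr_gt0 //; lra.
have [e1 e2] := h3.
have h4 := is_derive_compR e1 (is_derive1_ln q0).
have := is_deriveZ ((4 * pi)^-1) h4.
rewrite e2 /GRing.scale /=.
rewrite (_ : (4 * pi)^-1 * _ = - ((2 * pi)^-1 / (u ^+ 2 - 1))) //.
have h5 : u ^+ 2 - 1 != 0 by rewrite (_ : _ - _ = (u - 1) * (u + 1)) ?mulf_neq0 //; ring.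
by move: (pi : R) p0 => p p0; field; rewrite um up h5 gt_eqF.
Qed.

Lemma hypL_ge0 (u : R) : 1 < u -> 0 <= hypL u.
Proof.
move=> u1; rewrite mulr_ge0 // ?invr_ge0 ?mulr_ge0 ?pi_ge0 // ln_ge0 // ler_pdivlMr; lra.
Qed.

Lemma hypL_anti (u v : R) : 1 < u -> u <= v -> hypL v <= hypL u.
Proof.
move=> u1 uv; rewrite -lerN2.
apply: (@derive_ge0_homo _ (- @hypL R) (fun x => - - ((2 * pi)^-1 / (x ^+ 2 - 1)))) => // x /andP[ux _].
  by apply: is_deriveN; apply: is_derive_hypL; lra.
rewrite opprK mulr_ge0 ?invr_ge0 ?(ltW (pi2_gt0 R)) // subr_ge0 exprn_ege1 //; lra.
Qed.

(** Between [1 + 2 / n] and 2 both steps in [mn n] are settled, so that [bn n] and [hypL] have the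
    same derivative; their difference is its value at 2, which is bounded independently of [n].
    Beyond 2 every term is bounded. *)
Lemma bn_hypL (delta : R) : 1 < delta -> exists C : R, forall n u, (1 < n)%N -> 1 + 2 / n%:R <= u -> 1 < u ->
  `|bn n u - (if u <= delta then hypL u - hypL delta else 0)| <= C.
Proof.
move=> d1; exists ((2 * pi)^-1 + hypL 2 + hypL delta) => n u n1 un u1.
have n2 : 2 <= n%:R :> R by rewrite (ler_nat R 2).
have c0 : 0 < (2 * pi)^-1 :> R by rewrite invr_gt0 pi2_gt0.
have [_ _ _ _ s1] := @stepP R.
have b2 : bn n 2 <= (2 * pi)^-1 :> R.
  have : bn n 2 + (2 * pi)^-1 * 2 <= bn n 3 + (2 * pi)^-1 * 3 :> R.
    apply: (@derive_ge0_homo _ (fun x => bn n x + (2 * pi)^-1 * x) (fun x => cn n x + (2 * pi)^-1 * 1)).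
    + by rewrite ler_nat.
    + move=> x _; apply: is_deriveD; exact: is_derive_bn.
    + move=> x /andP[x2 _]; rewrite /cn mulr1 addrC subr_ge0 ler_piMr ?(ltW c0) //.
      have : 2 * 2 <= x * x by apply: ler_pM; lra.
      rewrite -expr2 => h; rewrite ler_pdivrMr; last lra.
      by rewrite mul1r (le_trans (mn_le1 _ _)) //; lra.
  rewrite bn3; lra.
have b0 v : 0 <= bn n v :> R by have [_ ] := @rkernel_bn R n n1.
have L2 : 0 <= hypL 2 :> R by apply: hypL_ge0; lra.
have Ld := hypL_ge0 d1; have Lu := hypL_ge0 u1.
have [u2|u2] := leP u 2; last first.
  have h1 : bn n u <= bn n 2 by apply: bn_anti => //; exact: ltW.
  have h2 : hypL u <= hypL 2 by apply: hypL_anti => //; lra.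
  have h3 := b0 u; have [ud|ud] := leP u delta.
    have h4 : hypL delta <= hypL u by exact: hypL_anti.
    rewrite ler_norml; apply/andP; split; lra.
  rewrite subr0 ger0_norm //; lra.
have E : bn n u - hypL u = bn n 2 - hypL 2.
  apply: (@derive0_const _ (fun u => bn n u - hypL u)) => // x /andP[ux x2].
  have -> : 0 = cn n x - - ((2 * pi)^-1 / (x ^+ 2 - 1)) :> R.
    have h2 : 2 <= n%:R * (x - 1) by rewrite mulrC -ler_pdivrMr; lra.
    rewrite /cn /mn s1; last lra.
    have [_ _ _ s0 _] := @stepP R.
    by rewrite s0 ?subr0 ?mul1r ?opprK ?addNr //; lra.
  by apply: is_deriveB; [exact: is_derive_bn|apply: is_derive_hypL; lra].
have h0 := b0 2.
have [ud|ud] := leP u delta; first by rewrite ler_norml; apply/andP; split; lra.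
have h4 : hypL u <= hypL delta by apply: hypL_anti => //; exact: ltW.
rewrite subr0 ger0_norm //; lra.
Qed.
End Masses.

(** * Automorphic kernels *)

Section RadialFunctions.
Variable R : realType.
Implicit Types (z w : R * R).
Local Notation RR := (setT : set (GRing.regular R)).

Lemma smooth_hypu z n : 0 < z.2 -> Cn n (upper_half R) (hypu z).
Proof.
move=> z0; have oH := @open_upper_half R.
have : Cn n (upper_half R) (fun w : R * R => 1 + ((w.1 + - z.1) * (w.1 + - z.1) +
    (w.2 + - z.2) * (w.2 + - z.2)) * ((2 * z.2) * w.2)^-1).
  apply: (CnD oH); first exact: Cn_cst.
  apply: (CnM oH).
    have hx : Cn n (upper_half R) (fun w : R * R => w.1 + - z.1).
      by apply: (CnD oH); [exact: Cn_fst|exact: Cn_cst].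
    have hy : Cn n (upper_half R) (fun w : R * R => w.2 + - z.2).
      by apply: (CnD oH); [exact: Cn_snd|exact: Cn_cst].
    by apply: (CnD oH); exact: (CnM oH).
  apply: (CnV oH) => [w w0|]; first by rewrite mulf_neq0 ?mulf_neq0 ?gt_eqF.
  by apply: (CnZ _ oH); exact: Cn_snd.
apply: Cn_eq => // w _; rewrite /hypu /sqdist.
by congr (1 + _ * _); rewrite !expr2; ring.
Qed.

Lemma smooth_radial z (k : R -> R) n : 0 < z.2 -> Cn n RR k ->
  Cn n (upper_half R) (fun w => k (hypu z w)).
Proof.
move=> z0 Ck; apply: (@Cn_comp _ _ _ (upper_half R) setT k (hypu z)) => //.
  exact: open_upper_half.
exact: smooth_hypu.
Qed.

Definition hypu1 z w : R := (w.1 - z.1) / (z.2 * w.2).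
Definition hypu2 z w : R := (w.2 - z.2) / (z.2 * w.2) - sqdist z w / (2 * z.2 * w.2 ^+ 2).

Lemma is_derive_coord1 (f : R * R -> R) w (d : R) :
  is_derive w.1 (1 : R) (fun x : R => f (x, w.2)) d -> is_derive w (1, 0) f d.
Proof.
move=> [d1 d2].
have E : (fun h : R => h^-1 *: (((fun x : R => f (x, w.2)) \o shift w.1) (h *: (1 : R)) - f (w.1, w.2))) =
   (fun h : R => h^-1 *: ((f \o shift w) (h *: ((1, 0) : R * R)) - f w)).
  apply/funext => h /=; congr (_ *: (f _ - f _)); last by case: (w).
  by rewrite /shift /=; case: (w) => a b; congr (_, _); rewrite /= scaler0 add0r.
by split; [rewrite /derivable -E|rewrite /derive -E].
Qed.

Lemma is_derive_coord2 (f : R * R -> R) w (d : R) :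
  is_derive w.2 (1 : R) (fun y : R => f (w.1, y)) d -> is_derive w (0, 1) f d.
Proof.
move=> [d1 d2].
have E : (fun h : R => h^-1 *: (((fun y : R => f (w.1, y)) \o shift w.2) (h *: (1 : R)) - f (w.1, w.2))) =
   (fun h : R => h^-1 *: ((f \o shift w) (h *: ((0, 1) : R * R)) - f w)).
  apply/funext => h /=; congr (_ *: (f _ - f _)); last by case: (w).
  by rewrite /shift /=; case: (w) => a b; congr (_, _); rewrite /= scaler0 add0r.
by split; [rewrite /derivable -E|rewrite /derive -E].
Qed.

Lemma is_derive_eqd (f : R -> R) (x d d' : R) : is_derive x (1 : R) f d -> d = d' -> is_derive x (1 : R) f d'.
Proof. by move=> h <-. Qed.

Lemma is_derive_hypu1 z w : 0 < z.2 -> 0 < w.2 -> is_derive w (1, 0) (hypu z) (hypu1 z w).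
Proof.
move=> z0 w0; apply: is_derive_coord1.
have h := is_deriveB (is_derive_id w.1 (1 : R)) (is_derive_cst z.1 w.1 (1 : R)).
have h2 := is_deriveZ ((2 * z.2 * w.2)^-1) (is_deriveD (is_deriveM h h) (is_derive_cst ((z.2 - w.2) ^+ 2) w.1 (1 : R))).
have h3 := is_deriveD (is_derive_cst (1 : R) w.1 (1 : R)) h2.
have E : (fun x : R => hypu z (x, w.2)) = cst (1 : R) + (2 * z.2 * w.2)^-1 \*: ((id - cst z.1) * (id - cst z.1) + cst ((z.2 - w.2) ^+ 2)).
  apply/funext => x; rewrite /hypu /sqdist /=.
  change (1 + ((z.1 - x) ^+ 2 + (z.2 - w.2) ^+ 2) / (2 * z.2 * w.2) = 1 + (2 * z.2 * w.2)^-1 * ((x - z.1) * (x - z.1) + (z.2 - w.2) ^+ 2)).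
  ring.
rewrite E; apply: is_derive_eqd h3 _.
rewrite /GRing.scale /= /hypu1.
change (0 + (2 * z.2 * w.2)^-1 * ((w.1 - z.1) * (1 - 0) + (w.1 - z.1) * (1 - 0) + 0) = (w.1 - z.1) / (z.2 * w.2)).
by field; rewrite !gt_eqF.
Qed.

Lemma is_derive_hypu2 z w : 0 < z.2 -> 0 < w.2 -> is_derive w (0, 1) (hypu z) (hypu2 z w).
Proof.
move=> z0 w0; apply: is_derive_coord2.
have h := is_deriveB (is_derive_id w.2 (1 : R)) (is_derive_cst z.2 w.2 (1 : R)).
have h1 := is_deriveD (is_deriveM h h) (is_derive_cst ((z.1 - w.1) ^+ 2) w.2 (1 : R)).
have h2 := is_deriveZ (2 * z.2) (is_derive_id w.2 (1 : R)).
have n0 : 2 * z.2 * w.2 != 0 by rewrite !mulf_neq0 ?gt_eqF.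
have h3 := @is_derive_div R _ (fun y => 2 * z.2 * y) w.2 _ _ n0 h1 h2.
have h4 := is_deriveD (is_derive_cst (1 : R) w.2 (1 : R)) h3.
have E : (fun y : R => hypu z (w.1, y)) = cst (1 : R) + (fun y => (((id - cst z.2) * (id - cst z.2) + cst ((z.1 - w.1) ^+ 2)) : R -> R) y / (2 * z.2 * y)).
  apply/funext => y; rewrite /hypu /sqdist /=.
  change (1 + ((z.1 - w.1) ^+ 2 + (z.2 - y) ^+ 2) / (2 * z.2 * y) = 1 + ((y - z.2) * (y - z.2) + (z.1 - w.1) ^+ 2) / (2 * z.2 * y)).
  by congr (1 + _ * _); ring.
rewrite E; apply: is_derive_eqd h4 _.
rewrite /GRing.scale /= /hypu2 /sqdist.
change (0 + (((w.2 - z.2) * (1 - 0) + (w.2 - z.2) * (1 - 0) + 0) * (2 * z.2 * w.2) - ((w.2 - z.2) * (w.2 - z.2) + (z.1 - w.1) ^+ 2) * (2 * z.2 * 1)) / (2 * z.2 * w.2) ^+ 2 = (w.2 - z.2) / (z.2 * w.2) - ((z.1 - w.1) ^+ 2 + (z.2 - w.2) ^+ 2) / (2 * z.2 * w.2 ^+ 2)).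
by field; rewrite !gt_eqF.
Qed.

Lemma is_derive_hypu11 z w : 0 < z.2 -> 0 < w.2 -> is_derive w (1, 0) (hypu1 z) (z.2 * w.2)^-1.
Proof.
move=> z0 w0; apply: is_derive_coord1.
have h := is_deriveZ ((z.2 * w.2)^-1) (is_deriveB (is_derive_id w.1 (1 : R)) (is_derive_cst z.1 w.1 (1 : R))).
have E : (fun x : R => hypu1 z (x, w.2)) = (z.2 * w.2)^-1 \*: (id - cst z.1).
  by apply/funext => x; rewrite /hypu1 /= mulrC.
rewrite E; apply: is_derive_eqd h _.
by rewrite subr0 /GRing.scale /= mulr1.
Qed.

Lemma is_derive_hypu22 z w : 0 < z.2 -> 0 < w.2 -> is_derive w (0, 1) (hypu2 z)
  ((z.2 ^+ 2 + (z.1 - w.1) ^+ 2) / (z.2 * w.2 ^+ 3)).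
Proof.
move=> z0 w0; apply: is_derive_coord2.
pose c := (z.2 ^+ 2 + (z.1 - w.1) ^+ 2).
have h1 := is_deriveM (is_derive_id w.2 (1 : R)) (is_derive_id w.2 (1 : R)).
have h2 := is_deriveZ (2 * z.2) h1.
have n0 : 2 * z.2 * (w.2 * w.2) != 0 by rewrite !mulf_neq0 ?gt_eqF.
have h3 := @is_derive_div R (cst (- c)) (fun y => 2 * z.2 * (y * y)) w.2 _ _ n0 (is_derive_cst (- c) w.2 (1 : R)) h2.
have h4 := is_deriveD (is_derive_cst ((2 * z.2)^-1) w.2 (1 : R)) h3.
have E : \forall y \near w.2, (cst ((2 * z.2)^-1) + (fun y => (cst (- c) : R -> R) y / (2 * z.2 * (y * y)))) y = hypu2 z (w.1, y).
  near=> y.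
  have y0 : 0 < y by near: y; exact: lt_nbhsr.
  rewrite /hypu2 /sqdist /=.
  change ((2 * z.2)^-1 + - c / (2 * z.2 * (y * y)) = (y - z.2) / (z.2 * y) - ((z.1 - w.1) ^+ 2 + (z.2 - y) ^+ 2) / (2 * z.2 * y ^+ 2)).
  by rewrite /c; field; rewrite !gt_eqF.
apply: (near_eq_is_derive E); apply: is_derive_eqd h4 _.
rewrite /GRing.scale /=.
change (0 + (0 * (2 * z.2 * (w.2 * w.2)) - - c * (2 * z.2 * (w.2 * 1 + w.2 * 1))) / (2 * z.2 * (w.2 * w.2)) ^+ 2 = c / (z.2 * w.2 ^+ 3)).
by field; rewrite !gt_eqF.
Unshelve. all: by end_near. Qed.

Lemma is_derive_radial (f : R * R -> R) w v (b b' : R -> R) (d : R) :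
  (forall u, is_derive u (1 : R) b (b' u)) -> is_derive w v f d ->
  is_derive w v (fun w => b (f w)) (b' (f w) * d).
Proof. by move=> db [d1 <-]; exact: is_derive_compR d1 (db _). Qed.

(** This expresses that [u] has squared hyperbolic gradient [u^2 - 1] and Laplacian [2 u]. *)
Lemma lap_radial z w (b b' b'' : R -> R) : 0 < z.2 -> 0 < w.2 ->
  (forall u, is_derive u (1 : R) b (b' u)) -> (forall u, is_derive u (1 : R) b' (b'' u)) ->
  lap (fun w => b (hypu z w)) w =
  (hypu z w ^+ 2 - 1) * b'' (hypu z w) + 2 * hypu z w * b' (hypu z w).
Proof.
move=> z0 w0 db db'.
have nH : \forall w' \near w, 0 < w'.2.
  exact: (open_nbhs_nbhs (conj (@open_upper_half R) w0)).
have E1 : 'D_(1, 0) ('D_(1, 0) (fun w => b (hypu z w))) w =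
    b' (hypu z w) * (z.2 * w.2)^-1 + hypu1 z w * (b'' (hypu z w) * hypu1 z w).
  have nE : \forall w' \near w, (fun w' => b' (hypu z w')) w' * hypu1 z w' = 'D_(1, 0) (fun w => b (hypu z w)) w'.
    near=> w'.
    have w'0 : 0 < w'.2 by near: w'.
    by case: (is_derive_radial db (is_derive_hypu1 z0 w'0)) => _ ->.
  have [_ <-] := near_eq_is_derive nE (is_deriveM (is_derive_radial db' (is_derive_hypu1 z0 w0)) (is_derive_hypu11 z0 w0)).
  by [].
have E2 : 'D_(0, 1) ('D_(0, 1) (fun w => b (hypu z w))) w =
    b' (hypu z w) * ((z.2 ^+ 2 + (z.1 - w.1) ^+ 2) / (z.2 * w.2 ^+ 3)) + hypu2 z w * (b'' (hypu z w) * hypu2 z w).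
  have nE : \forall w' \near w, (fun w' => b' (hypu z w')) w' * hypu2 z w' = 'D_(0, 1) (fun w => b (hypu z w)) w'.
    near=> w'.
    have w'0 : 0 < w'.2 by near: w'.
    by case: (is_derive_radial db (is_derive_hypu2 z0 w'0)) => _ ->.
  have [_ <-] := near_eq_is_derive nE (is_deriveM (is_derive_radial db' (is_derive_hypu2 z0 w0)) (is_derive_hypu22 z0 w0)).
  by [].
rewrite /lap E1 E2 /hypu1 /hypu2.
move: (b' _) (b'' _) => B' B''; rewrite /hypu /sqdist.
by field; rewrite !gt_eqF.
Unshelve. all: by end_near. Qed.
End RadialFunctions.

(** * Sums of radial kernels over the group *)

Section AutomorphicKernels.
Variable R : realType.
Implicit Types (G : set 'M[R]_2) (g h : 'M[R]_2) (z w : R * R) (k : R -> R).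

Lemma esum_seq (T : choiceType) (A : set T) (s : seq T) (F : T -> \bar R) :
  uniq s -> (forall x, x \in s -> A x) -> (forall x, A x -> x \notin s -> F x = 0%E) ->
  (forall x, (0 <= F x)%E) -> (\esum_(x in A) F x = \sum_(x <- s) F x)%E.
Proof.
move=> us sA F0 Fp.
transitivity (\esum_(x in [set` s]) F x)%E.
  rewrite (esum_mkcond A) (esum_mkcond [set` s]); apply: eq_esum => x _.
  case: (boolP (x \in A)) => xA; case: (boolP (x \in [set` s])) => xs //.
    by apply: F0; [rewrite -inE|move: xs; rewrite notin_setE /= => /negP].
  by move: xA; rewrite notin_setE; case; apply: sA; move: xs; rewrite inE.
rewrite esum_fset; [by rewrite -fsbig_seq|exact: finite_seq|by []].
Qed.

(** The sum runs over the whole group, not modulo the centre: the stack factor in the inner product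
    compensates for the repetition. *)
Definition aut G k z w : R := fine (\esum_(g in G) (k (hypu z (mobius g w)))%:E).

Lemma measurable_hypu2 : measurable_fun setT (fun p : (R * R) * (R * R) => hypu p.1 p.2).
Proof.
rewrite /hypu /sqdist.
have m11 : measurable_fun setT (fun p : (R * R) * (R * R) => p.1.1) by apply: measurableT_comp.
have m12 : measurable_fun setT (fun p : (R * R) * (R * R) => p.1.2) by apply: measurableT_comp.
have m21 : measurable_fun setT (fun p : (R * R) * (R * R) => p.2.1) by apply: measurableT_comp.
have m22 : measurable_fun setT (fun p : (R * R) * (R * R) => p.2.2) by apply: measurableT_comp.
apply: measurable_funD => //; apply: measurable_funM.
  by apply: measurable_funD; apply: measurable_funX; exact: measurable_funB.
apply: measurableT_comp; first exact: measurable_invr.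
by apply: measurable_funM => //; exact: measurable_funM.
Qed.

Lemma rkernel_measurable k : rkernel k -> measurable_fun setT k.
Proof. by move=> /rkernel_continuous; exact: continuous_measurable_fun. Qed.

Lemma measurable_rkernel2 k : rkernel k ->
  measurable_fun setT (fun p : (R * R) * (R * R) => k (hypu p.1 p.2)).
Proof. by move=> /rkernel_measurable mk; exact: measurableT_comp mk measurable_hypu2. Qed.

Lemma measurable_rkernel_hypu k z : rkernel k -> measurable_fun setT (fun w => k (hypu z w)).
Proof. by move=> /rkernel_measurable mk; exact: measurableT_comp mk (measurable_hypu z). Qed.

Lemma rkernel_le3 k u : rkernel k -> k u != 0 -> u <= 3.
Proof.
move=> [_ _ k3] h; rewrite leNgt; apply/negP => /ltW /k3 E.
by rewrite E eqxx in h.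
Qed.

Lemma rkernel_bounded k : rkernel k -> exists2 M : R, 0 <= M & forall u, 0 <= u -> k u <= M.
Proof.
move=> kk; have [_ k0 k3] := kk.
have [c _ hc] : exists2 c : R, c \in `[0, 3] & forall t, t \in `[0, 3] -> k t <= k c.
  apply: EVT_max => //; apply: continuous_subspaceT; exact: rkernel_continuous.
exists (k c) => // u u0; have [/k3 -> //|u3] := leP 3 u.
by apply: hc; rewrite in_itv /= u0 ltW.
Qed.

Section Fixed.
Variable G : set 'M[R]_2.
Hypothesis FG : fuchsian G.
Let sG : SL2_subgroup G. Proof. by case: FG. Qed.
Let Gd : G `<=` [set g | \det g = 1]. Proof. by case: sG. Qed.

Lemma aut_local z w0 : 0 < z.2 -> 0 < w0.2 -> exists s : seq 'M[R]_2,
  [/\ uniq s, forall g, g \in s -> G g &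
  forall w, 0 < w.2 -> hypu w0 w <= 2 -> forall k, rkernel k ->
    (\esum_(g in G) (k (hypu z (mobius g w)))%:E = (\sum_(g <- s) k (hypu z (mobius g w)))%:E)%E].
Proof.
(* If [u(z, g w) <= 3] and [u(w, w0) <= 2], the triangle inequality gives
   [u(z, g w0) <= 2 * 3 * 2 = 12]; one finite list of elements therefore serves for all w near [w0]
   and all kernels. *)
move=> z0 w00; have [N hN] := fuchsian_count2 12 FG z0 w00.
pose A := [set g | G g /\ hypu z (mobius g w0) <= 12].
have fA : finite_set A by exact: count_le_finite hN.
exists (fset_set A); split=> [|g|w w_0 hw k kk]; first exact: fset_uniq.
  by rewrite in_fset_set // inE => -[].
have [_ k0 _] := kk.
rewrite (@esum_seq _ _ (fset_set A)) ?sumEFin //.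
- by move=> g; rewrite in_fset_set // inE => -[].
- move=> g Gg; rewrite in_fset_set // notin_setE => nA; have dg := Gd Gg.
  apply/eqP; rewrite eqe; apply: contraT => /(rkernel_le3 kk) h3; exfalso; apply: nA; split=> //.
  have wg := mobius_upper dg w_0; have w0g := mobius_upper dg w00.
  apply: le_trans (hypu_triangle z0 wg w0g) _; rewrite hypu_mobius // [hypu w w0]hypuC.
  have := hypu_ge1 z0 wg; have := hypu_ge1 w00 w_0; nra.
- by move=> g; rewrite lee_fin.
Qed.

Lemma aut_esum k z w : rkernel k -> 0 < z.2 -> 0 < w.2 ->
  (\esum_(g in G) (k (hypu z (mobius g w)))%:E = (aut G k z w)%:E)%E.
Proof.
move=> kk z0 w0; have [s [_ _ h]] := aut_local z0 w0.
by rewrite /aut h // hypuxx ?ler1n.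
Qed.

Lemma aut_ge0 k z w : rkernel k -> 0 <= aut G k z w.
Proof. by move=> [_ k0 _]; apply: fine_ge0; apply: esum_ge0 => g _; rewrite lee_fin. Qed.

Lemma aut_invr k z w h : rkernel k -> G h -> 0 < w.2 -> aut G k z (mobius h w) = aut G k z w.
Proof.
move=> kk Gh w0; congr fine; rewrite -[RHS](esum_mulr _ sG Gh).
by apply: eq_esum => g Gg; rewrite mobiusM //; exact: Gd.
Qed.

Lemma aut_sym k z w : rkernel k -> 0 < z.2 -> 0 < w.2 -> aut G k z w = aut G k w z.
Proof.
move=> kk z0 w0; congr fine; rewrite -[RHS](esum_inv _ sG).
apply: eq_esum => g Gg; have dg := Gd Gg; congr (k _)%:E.
have u0 := mobius_upper (SL2V dg) z0.
by rewrite [RHS]hypuC -[RHS](hypu_mobius dg) // mobiusVK.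
Qed.

Lemma aut_invl k z w h : rkernel k -> G h -> 0 < z.2 -> 0 < w.2 ->
  aut G k (mobius h z) w = aut G k z w.
Proof.
move=> kk Gh z0 w0; have dh := Gd Gh; have h0 := mobius_upper dh z0.
by rewrite aut_sym // aut_invr // aut_sym.
Qed.

(** The terms that do not vanish have [u <= 3]; by [count_translate] their number is governed by the
    displacements of z up to [2 * 3 * 3 = 18]. The bound is therefore uniform in w. *)
Lemma aut_le k z w N M : rkernel k -> 0 < z.2 -> 0 < w.2 ->
  count_le [set g | G g /\ hypu z (mobius g z) <= 18] N ->
  (forall u, 0 <= u -> k u <= M) -> aut G k z w <= N%:R * M.
Proof.
move=> kk z0 w0 hN hM; have [_ k0 _] := kk.
pose A := [set g | G g /\ hypu z (mobius g w) <= 3].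
have cA : count_le A N.
  by apply: (count_translate sG z0 w0); rewrite (_ : 2 * 3 * 3 = 18 :> R) //; ring.
have fA : finite_set A by exact: count_le_finite cA.
have := aut_esum kk z0 w0; rewrite (@esum_seq _ _ (fset_set A)) //.
- rewrite sumEFin; case=> <-.
  apply: (@le_trans _ _ (\sum_(g <- fset_set A) M)).
    rewrite big_seq [leRHS]big_seq; apply: ler_sum => g.
    rewrite in_fset_set // inE => -[Gg _]; apply: hM.
    by rewrite (le_trans ler01) // hypu_ge1 //; apply: mobius_upper => //; exact: Gd.
  rewrite big_const_seq count_predT iter_addr_0 -[leLHS]mulr_natl; apply: ler_wpM2r.
    by rewrite (le_trans (k0 0)) // hM.
  by rewrite ler_nat; exact: count_le_fset.
- by move=> g; rewrite in_fset_set // inE => -[].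
- move=> g Gg; rewrite in_fset_set // notin_setE => nA.
  apply/eqP; rewrite eqe; apply: contraT => /(rkernel_le3 kk) h3.
  by exfalso; apply: nA.
- by move=> g; rewrite lee_fin.
Qed.

Lemma aut_bounded k z : rkernel k -> 0 < z.2 -> exists M, forall w, 0 < w.2 -> `|aut G k z w| <= M.
Proof.
move=> kk z0; have [N hN] := fuchsian_count 18 FG z0.
have [M _ hM] := rkernel_bounded kk; exists (N%:R * M) => w w0.
by rewrite ger0_norm ?aut_ge0 //; exact: aut_le.
Qed.

Definition disc2 w0 : set (R * R) := upper_half R `&` [set w | hypu w0 w < 2].

Lemma open_disc2 w0 : 0 < w0.2 -> open (disc2 w0).
Proof.
move=> w00; rewrite openE => w [w_0 hw]; rewrite /interior.
have c : {for w, continuous (hypu w0)} by have [/(_ w w_0)] := smooth_hypu 0 w00.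
have n1 : (\forall w' \near w, hypu w0 w' < 2) by exact: (c _ (lt_nbhsl hw)).
have n2 : \forall w' \near w, upper_half R w' by exact: (open_nbhs_nbhs (conj (@open_upper_half R) w_0)).
by apply: filterS2 n1 n2 => w'; split.
Qed.

Lemma aut_local_sum z w0 : 0 < z.2 -> 0 < w0.2 -> exists s : seq 'M[R]_2,
  [/\ forall g, g \in s -> SL2 g & forall k, rkernel k -> forall w, disc2 w0 w ->
    aut G k z w = \sum_(i < size s) k (hypu (mobius (nth 1%:M s i) z) w)].
Proof.
move=> z0 w00; have [s [us sG' h]] := aut_local z0 w00.
exists [seq invmx g | g <- s]; split=> [g /mapP[g' /sG' Gg' ->]|k kk w [w_0 hw]].
  by apply: SL2V; exact: Gd.
have := h w w_0 (ltW hw) k kk; rewrite aut_esum //; case=> ->.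
rewrite size_map (big_nth 1%:M) big_mkord; apply: eq_bigr => i _; congr k.
have dg : SL2 (nth 1%:M s i) by apply: Gd; apply: sG'; exact: mem_nth.
rewrite (nth_map 1%:M) // -[RHS](hypu_mobius dg) //; last by apply: mobius_upper => //; exact: SL2V.
by rewrite mobiusVK.
Qed.

Lemma smooth_aut k z : rkernel k -> 0 < z.2 -> smooth (upper_half R) (aut G k z).
Proof.
move=> kk z0 n; have [Ck _ _] := kk.
have loc w0 : upper_half R w0 -> Cn n (disc2 w0) (aut G k z).
  move=> w00; have [s [sd h]] := aut_local_sum z0 w00.
  have od := open_disc2 w00.
  have : Cn n (disc2 w0) (fun w => \sum_(i < size s) k (hypu (mobius (nth 1%:M s i) z) w)).
    apply: (Cn_sum (F := fun i w => k (hypu (mobius (nth 1%:M s i) z) w))) => // i si.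
    apply: (@Cn_sub _ _ _ (upper_half R)); first by move=> w [].
    by apply: smooth_radial => //; apply: mobius_upper => //; apply: sd; exact: mem_nth.
  by apply: Cn_eq => // w hw; rewrite h.
have self w : upper_half R w -> disc2 w w by move=> w0; split=> //=; rewrite hypuxx // ltr1n.
elim: n {Ck} (aut G k z) loc => [|n IH] f loc.
  by split=> // w w0; have [/(_ w (self w w0))] := loc _ w0.
split=> [w w0|v]; first by have [/(_ w (self w w0))] := loc _ w0.
split=> [w w0|].
  by have [_ /(_ v)[/(_ w (self w w0))]] := loc _ w0.
by apply: IH => w w0; have [_ /(_ v)[]] := loc _ w0.
Qed.

Lemma lap_aut (b k1 k2 b' b'' : R -> R) z w : rkernel b -> rkernel k1 -> rkernel k2 ->
  (forall u, is_derive u (1 : R) b (b' u)) -> (forall u, is_derive u (1 : R) b' (b'' u)) ->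
  (forall u, (u ^+ 2 - 1) * b'' u + 2 * u * b' u = k1 u - k2 u) ->
  0 < z.2 -> 0 < w.2 -> lap (aut G b z) w = aut G k1 z w - aut G k2 z w.
Proof.
move=> kb kk1 kk2 db db' E z0 w0.
have [s [sd h]] := aut_local_sum z0 w0.
have dw : disc2 w w by split=> //=; rewrite hypuxx // ltr1n.
have od := open_disc2 w0.
rewrite !h // -sumrB.
have zi (i : 'I_(size s)) : 0 < (mobius (nth 1%:M s i) z).2.
  by apply: mobius_upper => //; apply: sd; exact: mem_nth.
under eq_bigr => i _ do rewrite -E -(lap_radial (zi i) w0 db db').
have sm (i : 'I_(size s)) : Cn 2 (upper_half R) (fun w => b (hypu (mobius (nth 1%:M s i) z) w)).
  by apply: smooth_radial => //; case: kb.
have nw : \forall w' \near w, disc2 w w' by exact: (open_nbhs_nbhs (conj od dw)).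
have D1 v w' : disc2 w w' -> 'D_v (aut G b z) w' =
    \sum_(i < size s) 'D_v (fun w => b (hypu (mobius (nth 1%:M s i) z) w)) w'.
  move=> dw'; have nw' : \forall x \near w', disc2 w x by exact: (open_nbhs_nbhs (conj od dw')).
  rewrite -derive_sum; last by move=> i; have [_ /(_ v)[/(_ w' dw'.1)]] := sm i.
  apply: near_eq_derive; apply: filterS nw' => x dx; rewrite h //.
  by rewrite fct_sumE.
have D2 v : 'D_v ('D_v (aut G b z)) w =
    \sum_(i < size s) 'D_v ('D_v (fun w => b (hypu (mobius (nth 1%:M s i) z) w))) w.
  rewrite -derive_sum; last first.
    by move=> i; have [_ /(_ v)[_ /=[_ /(_ v)[/(_ w w0)]]]] := sm i.
  apply: near_eq_derive; apply: filterS nw => x dx; rewrite D1 //.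
  by rewrite fct_sumE.
have S n (u v : 'I_n -> R) (c : R) : c * (\sum_i u i + \sum_i v i) = \sum_i c * (u i + v i).
  by rewrite -big_split mulr_sumr.
exact: etrans (f_equal2 (fun x y => w.2 ^+ 2 * (x + y)) (D2 (1, 0)) (D2 (0, 1))) (S _ _ _ _).
Qed.
End Fixed.
End AutomorphicKernels.

(** * Semi-inner products *)

Section Subsequences.
Variable R : realType.

Lemma increasing_seq_ge (f : nat -> nat) : increasing_seq f -> forall n, (n <= f n)%N.
Proof.
move=> fi; elim=> // n IH; apply: leq_ltn_trans IH _.
have := fi n.+1 n; rewrite !leEnat ltnn => /negbT; by rewrite -ltnNge.
Qed.

Lemma common_subsequence (n : nat) (a : 'I_n -> nat -> R) :
  (forall j, exists c, forall k, `|a j k| <= c) ->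
  exists2 f : nat -> nat, increasing_seq f & forall j, cvgn (a j \o f).
Proof.
elim: n a => [|n IH] a ha.
  by exists id => [m k|[]].
have [f fi fc] := IH (fun j => a (lift ord_max j)) (fun j => ha _).
have [c hc] := ha ord_max.
have [|g gi gc] := @bolzano_weierstrass R (a ord_max \o f).
  exists c; split=> [|x cx k _]; first exact: num_real.
  by apply: le_trans (ltW cx); exact: hc.
exists (f \o g) => [m k|j]; first by exact: etrans (fi _ _) (gi _ _).
have [->|jn] := eqVneq j ord_max; first exact: gc.
have [i ->] : exists i, j = lift ord_max i.
  by case: (unliftP ord_max j) => [i ->|E]; [exists i|rewrite E eqxx in jn].
have gy : g @ \oo --> \oo.
  by move=> A [N _ hN]; exists N => // k Nk; apply: hN; exact: leq_trans Nk (increasing_seq_ge gi k).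
have /cvg_ex[l fl] := fc i.
by apply/cvg_ex; exists l; exact: cvg_comp gy fl.
Qed.

Lemma cvg_sum_cauchy (n : nat) (a : 'I_n -> nat -> R) : (forall j, cvgn (a j)) ->
  forall e, 0 < e -> exists N, forall k l, (N <= k)%N -> (N <= l)%N ->
    \sum_j `|a j k - a j l| < e.
Proof.
elim: n a => [|n IH] a ha e e0; first by exists 0%N => k l _ _; rewrite big_ord0.
have e2 : 0 < e / 2 by rewrite divr_gt0.
have [N1 h1] := IH (fun j => a (widen_ord (leqnSn n) j)) (fun j => ha _) _ e2.
have /cvgrPdist_lt /(_ (e / 4)) := ha ord_max.
have e4 : 0 < e / 4 by rewrite divr_gt0.
move=> /(_ e4) [N2 _ h2].
exists (maxn N1 N2) => k l; rewrite !geq_max => /andP[k1 k2] /andP[l1 l2].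
rewrite big_ord_recr /=; have := h1 k l k1 l1; have := h2 k k2; have := h2 l l2.
move=> /=; set L := lim _ => hl hk hs.
have : `|a ord_max k - a ord_max l| <= `|L - a ord_max k| + `|L - a ord_max l|.
  rewrite -(normrN (L - a ord_max k)); apply: le_trans (ler_normD _ _); rewrite le_eqVlt; apply/orP; left.
  by apply/eqP; congr `|_|; ring.
lra.
Qed.
End Subsequences.

(** * A spectral alternative for symmetric operators *)

Section SemiInnerProduct.
Variables (R : realType) (V : lmodType R).
Implicit Types (f g h : V).

(** Square-integrable functions are kept as representatives, so the space is a predicate on all
    functions and the form is only semi-definite; equality of vectors becomes [nrm (f - g) = 0]. *)
Record sip (W : set V) (ip : V -> V -> R) : Prop := Sip {
  sip0 : W 0;
  sipL : forall (a : R) f g, W f -> W g -> W (a *: f + g);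
  sipC : forall f g, ip f g = ip g f;
  sipDl : forall (a : R) f g h, W f -> W g -> W h -> ip (a *: f + g) h = a * ip f h + ip g h;
  sip_ge0 : forall f, 0 <= ip f f }.

Definition sip_complete (W : set V) (ip : V -> V -> R) : Prop :=
  forall u : nat -> V, (forall n, W (u n)) ->
    (forall e, 0 < e -> exists N, forall m n, (N <= m)%N -> (N <= n)%N ->
       ip (u m - u n) (u m - u n) < e) ->
    exists2 v, W v & forall e, 0 < e -> exists N, forall n, (N <= n)%N ->
       ip (u n - v) (u n - v) < e.

Variables (W : set V) (ip : V -> V -> R).
Hypothesis hs : sip W ip.

Definition nrm f : R := Num.sqrt (ip f f).

Lemma sipZ (a : R) f : W f -> W (a *: f).
Proof. by move=> Wf; rewrite -[_ *: _]addr0; apply: (sipL hs) => //; exact: sip0 hs. Qed.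

Lemma sipD f g : W f -> W g -> W (f + g).
Proof. by move=> Wf Wg; rewrite -[f]scale1r; apply: (sipL hs). Qed.

Lemma sipB f g : W f -> W g -> W (f - g).
Proof. by move=> Wf Wg; rewrite addrC -scaleN1r; apply: (sipL hs). Qed.

Lemma ip0l h : W h -> ip 0 h = 0.
Proof.
move=> Wh; have := sipDl hs 1 (sip0 hs) (sip0 hs) Wh.
by rewrite scaler0 addr0 mul1r => /eqP; rewrite -subr_eq0 opprD addrA subrr sub0r oppr_eq0 => /eqP.
Qed.

Lemma ipZl (a : R) f h : W f -> W h -> ip (a *: f) h = a * ip f h.
Proof. by move=> Wf Wh; have := sipDl hs a Wf (sip0 hs) Wh; rewrite addr0 ip0l // addr0. Qed.

Lemma ipBl f g h : W f -> W g -> W h -> ip (f - g) h = ip f h - ip g h.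
Proof.
by move=> Wf Wg Wh; have := sipDl hs (-1) Wg Wf Wh; rewrite scaleN1r mulN1r addrC => ->; rewrite addrC.
Qed.

Lemma ipZr (a : R) f h : W f -> W h -> ip h (a *: f) = a * ip h f.
Proof. by move=> Wf Wh; rewrite (sipC hs) ipZl // (sipC hs). Qed.

Lemma ipBr f g h : W f -> W g -> W h -> ip h (f - g) = ip h f - ip h g.
Proof. by move=> Wf Wg Wh; rewrite (sipC hs) ipBl // !(sipC hs h). Qed.

Lemma ip_sqD (a : R) f g : W f -> W g ->
  ip (a *: f + g) (a *: f + g) = a ^+ 2 * ip f f + 2 * a * ip f g + ip g g.
Proof.
move=> Wf Wg; have Wfg := sipL hs a Wf Wg.
rewrite (sipDl hs) // !(sipC hs _ (_ + _)) !(sipDl hs) // (sipC hs g f); ring.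
Qed.

Lemma cauchy_schwarz f g : W f -> W g -> ip f g ^+ 2 <= ip f f * ip g g.
Proof.
move=> Wf Wg; have f0 := sip_ge0 hs f; have g0 := sip_ge0 hs g.
have h (a : R) : 0 <= a ^+ 2 * ip f f + 2 * a * ip f g + ip g g.
  by rewrite -ip_sqD //; exact: sip_ge0 hs _.
have [ff|ff] := eqVneq (ip f f) 0.
  rewrite ff mul0r; have [-> //|fg] := eqVneq (ip f g) 0; first by rewrite expr0n.
  (* At this value of [a] the non-negative polynomial would equal -1. *)
  have := h (- (ip g g + 1) / (2 * ip f g)).
  rewrite ff mulr0 add0r (_ : 2 * _ * _ = - (ip g g + 1)); last by field.
  lra.
have fp : 0 < ip f f by rewrite lt_neqAle eq_sym ff.
have := h (- ip f g / ip f f).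
rewrite (_ : _ + _ + _ = ip g g - ip f g ^+ 2 / ip f f); last by field.
by rewrite subr_ge0 ler_pdivrMr // mulrC.
Qed.

Lemma nrm_ge0 f : 0 <= nrm f. Proof. exact: sqrtr_ge0. Qed.

Lemma nrm_sq f : nrm f ^+ 2 = ip f f. Proof. by rewrite sqr_sqrtr // (sip_ge0 hs). Qed.

Lemma ip_le_nrm f g : W f -> W g -> `|ip f g| <= nrm f * nrm g.
Proof.
move=> Wf Wg; rewrite -(ler_pXn2r (n := 2)) ?nnegrE ?mulr_ge0 ?nrm_ge0 //.
by rewrite real_normK ?num_real // exprMn !nrm_sq cauchy_schwarz.
Qed.

Lemma nrmD f g : W f -> W g -> nrm (f + g) <= nrm f + nrm g.
Proof.
move=> Wf Wg; rewrite -(ler_pXn2r (n := 2)) ?nnegrE ?addr_ge0 ?nrm_ge0 //.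
rewrite nrm_sq -[f]scale1r ip_sqD // scale1r expr1n mul1r mulr1 sqrrD !nrm_sq.
have := ler_norm (ip f g); have := ip_le_nrm Wf Wg; lra.
Qed.

Lemma nrmZ (a : R) f : W f -> nrm (a *: f) = `|a| * nrm f.
Proof.
move=> Wf; rewrite /nrm ipZl ?ipZr //; last exact: sipZ.
by rewrite mulrA -expr2 sqrtrM ?sqr_ge0 // sqrtr_sqr.
Qed.

Lemma nrmN f : W f -> nrm (- f) = nrm f.
Proof. by move=> Wf; rewrite -scaleN1r nrmZ // normrN1 mul1r. Qed.

Lemma nrmB f g : W f -> W g -> nrm (f - g) <= nrm f + nrm g.
Proof.
move=> Wf Wg; rewrite -[X in _ <= _ + X]nrmN //; apply: nrmD => //.
by rewrite -scaleN1r; exact: sipZ.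
Qed.

Lemma nrm0_ip f g : W f -> W g -> nrm f = 0 -> ip f g = 0.
Proof.
by move=> Wf Wg f0; have := ip_le_nrm Wf Wg; rewrite f0 mul0r normr_le0 => /eqP.
Qed.

Section Spectral.
Variables (S : V -> V) (M0 : R).
Hypotheses (WS : forall f, W f -> W (S f))
  (Ssym : forall f g, W f -> W g -> ip (S f) g = ip f (S g))
  (Sbd : forall f, W f -> nrm (S f) <= M0 * nrm f).

(* Symmetry makes [S] linear up to null vectors. *)
Lemma ip_SL (a : R) f g h : W f -> W g -> W h ->
  ip (S (a *: f + g)) h = a * ip (S f) h + ip (S g) h.
Proof.
move=> Wf Wg Wh; rewrite Ssym //; last exact: sipL hs _ _ _ Wf Wg.
by rewrite (sipDl hs) ?Ssym //; exact: WS.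
Qed.

Lemma nrm_SL (a : R) f g : W f -> W g -> nrm (S (a *: f + g) - (a *: S f + S g)) = 0.
Proof.
move=> Wf Wg; have Wfg := sipL hs a Wf Wg; have WSf := WS Wf; have WSg := WS Wg.
have W1 := sipL hs a WSf WSg; have Wd := sipB (WS Wfg) W1.
rewrite /nrm ipBl //; last exact: WS.
by rewrite ip_SL // (sipDl hs) // subrr sqrtr0.
Qed.

(** Expanding the square and using [|S (S f)| <= M |S f|]: a vector that almost attains the norm is
    almost an eigenvector of the square of [S]. *)
Lemma approx_eigen (M : R) f : W f -> 0 <= M -> (forall g, W g -> nrm (S g) <= M * nrm g) ->
  nrm (S (S f) - M ^+ 2 *: f) ^+ 2 <= M ^+ 2 * (M ^+ 2 * ip f f - ip (S f) (S f)).
Proof.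
move=> Wf M_0 hM; have WSf := WS Wf; have WSSf := WS WSf; have WMf := sipZ (M ^+ 2) Wf.
have E : ip (S (S f)) f = ip (S f) (S f) by rewrite Ssym.
rewrite nrm_sq ipBl ?ipBr ?ipZl ?ipZr ?(sipC hs f) ?E //; last exact: sipB.
have : ip (S (S f)) (S (S f)) <= M ^+ 2 * ip (S f) (S f).
  rewrite -!nrm_sq -exprMn ler_pXn2r ?nnegrE ?mulr_ge0 ?nrm_ge0 //; exact: hM.
lra.
Qed.

Lemma nrm_SZ (a : R) f : W f -> nrm (S (a *: f)) = `|a| * nrm (S f).
Proof.
move=> Wf; have Waf := sipZ a Wf; have WSf := WS Wf.
have Z h : W h -> ip (S (a *: f)) h = a * ip (S f) h.
  by move=> Wh; rewrite Ssym // ipZl ?Ssym //; exact: WS.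
rewrite /nrm Z ?(sipC hs (S f)) ?Z //; last exact: WS.
by rewrite mulrA -expr2 sqrtrM ?sqr_ge0 // sqrtr_sqr.
Qed.

Lemma opnorm_exists : exists M : R, [/\ 0 <= M, forall g, W g -> nrm (S g) <= M * nrm g &
  forall e, 0 < e -> exists g, [/\ W g, nrm g <= 1 & M - e < nrm (S g)]].
Proof.
pose E : set R := [set x | exists2 g, W g /\ nrm g <= 1 & x = nrm (S g)].
have hE : has_sup E.
  split; first by exists (nrm (S 0)), 0 => //; split; [exact: sip0 hs|rewrite /nrm ip0l ?sqrtr0 //; exact: sip0 hs].
  exists `|M0| => _ [g [Wg g1] ->]; apply: le_trans (Sbd Wg) _.
  apply: le_trans (ler_norm _) _; rewrite normrM (ger0_norm (nrm_ge0 _)).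
  by rewrite ler_piMr.
have uE g : W g -> nrm g <= 1 -> nrm (S g) <= sup E.
  by move=> Wg g1; apply: ub_le_sup; [case: hE|exists g].
exists (sup E); split.
- have := uE 0 (sip0 hs); rewrite {1}/nrm ip0l ?sqrtr0 ?ler01; last exact: sip0 hs.
  by move/(_ isT); apply: le_trans; exact: nrm_ge0.
- move=> g Wg; have [g0|g0] := eqVneq (nrm g) 0.
    by have := Sbd Wg; rewrite g0 !mulr0.
  have gp : 0 < nrm g by rewrite lt_neqAle eq_sym g0 nrm_ge0.
  have := uE ((nrm g)^-1 *: g) (sipZ _ Wg).
  rewrite nrm_SZ // nrmZ // ger0_norm ?invr_ge0 ?nrm_ge0 // mulVf // lexx => /(_ isT).
  by rewrite mulrC ler_pdivrMr.
- move=> e e0; have [_ [g [Wg g1] ->] h] := sup_adherent e0 hE.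
  by exists g.
Qed.

Lemma nrm_subS f g : W f -> W g -> nrm (S f - S g) <= nrm (S (f - g)).
Proof.
move=> Wf Wg; have E := nrm_SL (-1) Wg Wf.
have -> : f - g = -1 *: g + f by rewrite scaleN1r addrC.
have -> : S f - S g = -1 *: S g + S f by rewrite scaleN1r addrC.
set x := S _ in E *; set y := -1 *: S g + _ in E *.
have Wx : W x by apply: WS; exact: sipL hs _ _ _ Wg Wf.
have Wy : W y by apply: (sipL hs); exact: WS.
have -> : y = x - (x - y) by rewrite opprB addrCA subrr addr0.
by apply: le_trans (nrmB Wx (sipB Wx Wy)) _; rewrite E addr0.
Qed.

(** For [d = f - g], the quantity [M^2 |d|^2 - |S d|^2] is small because [d] is almost an
    eigenvector of the square of [S], while [|S d|] is at most [beta |d|] up to the functionals. If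
    [M > beta], this makes [d] small. *)
Lemma almost_eigen_dist (M beta C : R) (n : nat) (v : 'I_n -> V) f g :
  W f -> W g -> (forall j, W (v j)) -> 0 <= beta -> 0 <= C -> nrm f <= 1 -> nrm g <= 1 ->
  (forall g, W g -> nrm (S g) <= beta * nrm g + C * \sum_j `|ip (v j) g|) ->
  (M ^+ 2 - beta ^+ 2) * ip (f - g) (f - g) <=
  2 * (nrm (S (S f) - M ^+ 2 *: f) + nrm (S (S g) - M ^+ 2 *: g)) +
  4 * beta * C * (\sum_j `|ip (v j) f - ip (v j) g|) + C ^+ 2 * (\sum_j `|ip (v j) f - ip (v j) g|) ^+ 2.
Proof.
move=> Wf Wg Wv b0 C0 f1 g1 hS; set s := \sum_j _.
have Wd := sipB Wf Wg; have WSd := WS Wd; set d := f - g in Wd WSd *.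
have d2 : nrm d <= 2 by apply: le_trans (nrmB Wf Wg) _; lra.
have sE : \sum_j `|ip (v j) d| = s by apply: eq_bigr => j _; rewrite /d ipBr.
have s0 : 0 <= s by exact: sumr_ge0.
have hd := hS _ Wd; rewrite sE in hd; have d0 := nrm_ge0 d.
have h1 : ip (S d) (S d) <= (beta * nrm d + C * s) ^+ 2.
  by rewrite -nrm_sq ler_pXn2r ?nnegrE ?nrm_ge0 // addr_ge0 // mulr_ge0.
have h2 : ip (S d) (S d) = ip (S (S f)) d - ip (S (S g)) d.
  rewrite Ssym // {1}/d ipBl //; last exact: WS.
  by rewrite -!Ssym //; exact: WS.
have WSSf := WS (WS Wf); have WSSg := WS (WS Wg).
have Wrf := sipB WSSf (sipZ (M ^+ 2) Wf); have Wrg := sipB WSSg (sipZ (M ^+ 2) Wg).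
have h3 : M ^+ 2 * ip d d - ip (S d) (S d) =
    - ip (S (S f) - M ^+ 2 *: f) d + ip (S (S g) - M ^+ 2 *: g) d.
  rewrite h2 !(ipBl _ _ Wd) ?(ipZl _ _ Wd) //; try exact: sipZ.
  ring.
have h4 := ip_le_nrm Wrf Wd; have h5 := ip_le_nrm Wrg Wd.
have h6 := nrm_ge0 (S (S f) - M ^+ 2 *: f); have h7 := nrm_ge0 (S (S g) - M ^+ 2 *: g).
have h8 : `|ip (S (S f) - M ^+ 2 *: f) d| <= nrm (S (S f) - M ^+ 2 *: f) * 2.
  by apply: le_trans h4 _; rewrite ler_wpM2l.
have h9 : `|ip (S (S g) - M ^+ 2 *: g) d| <= nrm (S (S g) - M ^+ 2 *: g) * 2.
  by apply: le_trans h5 _; rewrite ler_wpM2l.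
have h10 := ler_norm (- ip (S (S f) - M ^+ 2 *: f) d); rewrite normrN in h10.
have h11 := ler_norm (ip (S (S g) - M ^+ 2 *: g) d).
have h12 : 2 * (beta * nrm d) * (C * s) <= 4 * beta * C * s.
  have : 0 <= beta * C * s by rewrite !mulr_ge0.
  nra.
have := nrm_sq d; rewrite sqrrD !exprMn in h1; nra.
Qed.

(** If the norm [M] exceeds [B], it exceeds [beta]; a maximising sequence along which the finitely
    many functionals converge is then Cauchy, and its limit attains the norm and is an eigenvector
    of the square of [S]. *)
Lemma spectral_alternative (n : nat) (v : 'I_n -> V) (beta C B : R) :
  sip_complete W ip -> (forall j, W (v j)) -> 0 <= beta <= B -> 0 <= C ->
  (forall g, W g -> nrm (S g) <= beta * nrm g + C * \sum_j `|ip (v j) g|) ->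
  (forall g, W g -> nrm (S g) <= B * nrm g) \/
  exists h l, [/\ W h, 0 < ip h h, B < `|l| & nrm (S h - l *: h) = 0].
Proof.
move=> cW Wv /andP[b0 bB] C0 hS; have [M [M_0 hM aM]] := opnorm_exists.
have [MB|MB] := leP M B.
  by left=> g Wg; apply: le_trans (hM g Wg) _; rewrite ler_wpM2r ?nrm_ge0.
right.
have [G hG] : {G : nat -> V & forall k, [/\ W (G k), nrm (G k) <= 1 & M - k.+1%:R^-1 < nrm (S (G k))]}.
  by apply: (@choice _ _ (fun k g => [/\ W g, nrm g <= 1 & M - k.+1%:R^-1 < nrm (S g)])) => k; apply: aM; rewrite invr_gt0.
have WG k : W (G k) by case: (hG k).

have bd j : exists c, forall k, `|ip (v j) (G k)| <= c.
  exists (nrm (v j)) => k; apply: le_trans (ip_le_nrm (Wv j) (WG k)) _.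
  by rewrite ler_piMr ?nrm_ge0 //; case: (hG k).
have [phi phi_incr phi_cvg] := common_subsequence bd.
have phik k : (k <= phi k)%N by exact: increasing_seq_ge.
set u := G \o phi; have Wu k : W (u k) by exact: WG.
have u1 k : nrm (u k) <= 1 by case: (hG (phi k)).
have uM k : M - k.+1%:R^-1 < nrm (S (u k)).
  have [_ _] := hG (phi k); apply: le_lt_trans; rewrite lerD2l lerN2.
  by rewrite lef_pV2 ?posrE // ler_nat ltnS.
have Mp : 0 < M by apply: le_lt_trans MB; exact: le_trans bB.
have res k : nrm (S (S (u k)) - M ^+ 2 *: u k) ^+ 2 <= 2 * M ^+ 3 / k.+1%:R.
  apply: le_trans (approx_eigen (Wu k) M_0 hM) _.
  have e0 : 0 < k.+1%:R^-1 :> R by rewrite invr_gt0.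
  have := uM k; have := u1 k; rewrite -!nrm_sq.
  have := nrm_ge0 (u k); have := nrm_ge0 (S (u k)); move: (k.+1%:R^-1) e0 => e e0.
  move: (nrm _) (nrm _) => y x x0 y0 y1 xM.
  have h1 : y ^+ 2 <= 1 by rewrite expr_le1.
  have h2 : M ^+ 2 - 2 * M * e <= x ^+ 2.
    have [h|h] := leP 0 (M - e); last by nra.
    by have : (M - e) ^+ 2 <= x ^+ 2; [rewrite ler_pXn2r ?nnegrE // ltW|nra].
  have -> : 2 * M ^+ 3 * e = M ^+ 2 * (2 * M * e) by ring.
  rewrite ler_wpM2l ?sqr_ge0 //; have := sqr_ge0 M; nra.
have tp : 0 < M ^+ 2 - beta ^+ 2.
  by rewrite subr_gt0 ltr_pXn2r ?nnegrE // (le_lt_trans bB).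
have small e : 0 < e -> exists N, forall k, (N <= k)%N -> nrm (S (S (u k)) - M ^+ 2 *: u k) < e.
  move=> e0; have M3 : 0 <= 2 * M ^+ 3 by rewrite mulr_ge0 // exprn_ge0.
  exists (Num.truncn (2 * M ^+ 3 / e ^+ 2)) => k Nk.
  rewrite -(ltr_pXn2r (n := 2)) ?nnegrE ?nrm_ge0 ?(ltW e0) //.
  apply: le_lt_trans (res k) _; rewrite ltr_pdivrMr // [ltRHS]mulrC -ltr_pdivrMr ?exprn_gt0 //.
  apply: lt_le_trans (truncnS_gt _) _; by rewrite ler_nat ltnS.
have smalls e : 0 < e -> exists N, forall k l, (N <= k)%N -> (N <= l)%N ->
    \sum_j `|ip (v j) (u k) - ip (v j) (u l)| < e.
  exact: cvg_sum_cauchy.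
have [g Wg gl] : exists2 g, W g & forall e, 0 < e -> exists N, forall k, (N <= k)%N ->
    ip (u k - g) (u k - g) < e.
  apply: cW => // e e0; set t := (M ^+ 2 - beta ^+ 2) * e.
  have t0 : 0 < t by rewrite mulr_gt0.
  pose D := 4 * beta * C + C ^+ 2 + 1.
  have D0 : 0 < D.
    have : 0 <= 4 * beta * C by rewrite !mulr_ge0.
    have := sqr_ge0 C; rewrite /D; lra.
  have [N1 h1] := small (t / 8) (divr_gt0 t0 (ltr0n _ 8)).
  have m0 : 0 < Num.min 1 (t / (2 * D)) by rewrite lt_min ltr01 divr_gt0 // mulr_gt0.
  have [N2 h2] := smalls _ m0.
  exists (maxn N1 N2) => k l; rewrite !geq_max => /andP[k1 k2] /andP[l1 l2].
  have := almost_eigen_dist M (Wu k) (Wu l) Wv b0 C0 (u1 k) (u1 l) hS.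
  have := h1 k k1; have := h1 l l1; have := h2 k l k2 l2.
  have : 0 <= \sum_j `|ip (v j) (u k) - ip (v j) (u l)| by exact: sumr_ge0.
  move: (\sum_j _) => s s0; rewrite lt_min => /andP[s1 sD] r1 r2 H.
  rewrite -(ltr_pM2l tp) -/t; apply: le_lt_trans H _.
  have h3 : 4 * beta * C * s + C ^+ 2 * s ^+ 2 <= D * s.
    have : C ^+ 2 * s ^+ 2 <= C ^+ 2 * s by rewrite ler_wpM2l ?sqr_ge0 // expr2 ler_piMl // ltW.
    rewrite /D; lra.
  have h4 : D * s < t / 2.
    have := sD; rewrite ltr_pdivlMr ?mulr_gt0 // => h; lra.
  lra.
have glN e : 0 < e -> exists k, k.+1%:R^-1 < e /\ nrm (u k - g) < e.
  move=> e0; have [N hN] := gl (e ^+ 2) (exprn_gt0 2 e0).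
  pose k := maxn N (Num.truncn e^-1).
  exists k; split.
    rewrite -[ltRHS]invrK ltf_pV2 ?posrE ?invr_gt0 //.
    by apply: lt_le_trans (truncnS_gt _) _; rewrite ler_nat ltnS leq_maxr.
  rewrite -(ltr_pXn2r (n := 2)) ?nnegrE ?nrm_ge0 ?(ltW e0) // nrm_sq.
  by apply: hN; exact: leq_maxl.
have g1 : nrm g <= 1.
  apply/ler_addgt0Pr => e e0; have [k [_ hk]] := glN e e0.
  have -> : g = u k - (u k - g) by rewrite opprB addrCA subrr addr0.
  by apply: le_trans (nrmB (Wu k) (sipB (Wu k) Wg)) _; rewrite lerD // ltW.
have gM : M <= nrm (S g).
  apply/ler_addgt0Pr => e e0.
  have e1 : 0 < e / (1 + M) by rewrite divr_gt0 // addr_gt0.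
  have [k [h1 h2]] := glN _ e1.
  have h3 := uM k; have Wd := sipB (Wu k) Wg.
  have h4 : nrm (S (u k)) <= nrm (S g) + M * nrm (u k - g).
    have -> : S (u k) = S g + (S (u k) - S g) by rewrite addrCA subrr addr0.
    apply: le_trans (nrmD (WS Wg) (sipB (WS (Wu k)) (WS Wg))) _; rewrite lerD2l.
    exact: le_trans (nrm_subS (Wu k) Wg) (hM _ Wd).
  have h5 : M * nrm (u k - g) <= M * (e / (1 + M)) by rewrite ler_wpM2l // ltW.
  have h6 : e = e / (1 + M) + M * (e / (1 + M)) by field; rewrite gt_eqF // addr_gt0.
  move: h1 h2 h4 h5 h6 h3; move: (e / (1 + M)) (nrm (u k - g)) (nrm (S (u k))) (nrm (S g)) (k.+1%:R^-1).
  clear => a b c d f h1 h2 h4 h5 h6 h3; lra.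
have gp : 1 <= nrm g by rewrite -(ler_pM2l Mp) mulr1; apply: le_trans (hM g Wg).
have WSg := WS Wg; have WSSg := WS WSg.
have eig : nrm (S (S g) - M ^+ 2 *: g) = 0.
  apply/eqP; rewrite -sqrf_eq0 eq_le sqr_ge0 andbT.
  apply: le_trans (approx_eigen Wg M_0 hM) _; rewrite mulr_ge0_le0 ?sqr_ge0 //.
  rewrite -!nrm_sq subr_le0 -exprMn ler_pXn2r ?nnegrE ?mulr_ge0 ?nrm_ge0 //.
  by apply: le_trans gM; rewrite ler_piMr.
have WMg := sipZ M Wg; have Wh := sipD WSg WMg.
(* From [(S - M) (S + M) g = 0] up to null vectors: either [S g + M g] is null and [g] belongs to
   [- M], or it is an eigenvector for [M]. *)
have [h0|h0] := eqVneq (ip (S g + M *: g) (S g + M *: g)) 0.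
  exists g, (- M); split=> //.
  - by rewrite -nrm_sq exprn_gt0 // (lt_le_trans ltr01).
  - by rewrite normrN gtr0_norm.
  - by rewrite scaleNr opprK /nrm h0 sqrtr0.
exists (S g + M *: g), M; split=> //.
- by rewrite lt_neqAle eq_sym h0 (sip_ge0 hs).
- by rewrite gtr0_norm.
have E := nrm_SL M Wg WSg; rewrite (addrC (S g)).
set x := S _ in E *; set y := M *: S g + _ in E *.
have Wx : W x by apply: WS; exact: sipL hs _ _ _ Wg WSg.
have Wy : W y by apply: (sipL hs).
have -> : x - M *: (M *: g + S g) = (x - y) + (S (S g) - M ^+ 2 *: g).
  by rewrite /y scalerDr scalerA -expr2 !opprD !addrA subrK addrAC.
apply/eqP; rewrite eq_le nrm_ge0 andbT.
apply: le_trans (nrmD (sipB Wx Wy) (sipB WSSg (sipZ _ Wg))) _.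
by rewrite E eig addr0.
Qed.
End Spectral.
End SemiInnerProduct.

(** * Square-integrable invariant functions *)

Section RealL2.
Variable R : realType.
Implicit Types (z w : R * R) (f g : R * R -> R).
Local Notation hyp := (@hyp_measure R).

(** Measurability is asked on the whole plane, which makes restriction to any measurable subset
    immediate; complex functions enter through [re] and [im], which vanish outside the
    half-plane. *)
Definition L2r (G : set 'M[R]_2) f : Prop :=
  [/\ mobius_invariant G f, measurable_fun setT f &
      (\int[hyp]_(z in fundom G) (f z ^+ 2)%:E < +oo)%E].

Definition ipr (G : set 'M[R]_2) f g : R := qint G (fun z => f z * g z).

Variable G : set 'M[R]_2.
Hypothesis CG : cofinite_fuchsian G.
Let FG : fuchsian G. Proof. by case: CG. Qed.
Let sG : SL2_subgroup G. Proof. by case: FG. Qed.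
Local Notation F := (fundom G).
Local Notation sf := (stack_factor G).
Let mF : measurable F. Proof. exact: measurable_fundom. Qed.
Let sf0 : 0 < sf. Proof. exact: stack_factor_gt0. Qed.

Let mfunF (h : R * R -> \bar R) : measurable_fun setT h -> measurable_fun F h.
Proof. by move=> mh; apply: (@measurable_funS _ _ _ _ setT). Qed.

Lemma L2r_integrable_sq f : L2r G f -> hyp.-integrable F (fun z => (f z ^+ 2)%:E).
Proof.
move=> [_ mf If]; apply/integrableP; split.
  by apply: mfunF; apply/measurable_EFinP; exact: measurable_funX.
by under eq_integral => z _ do rewrite abse_EFin ger0_norm ?sqr_ge0 //.
Qed.

Lemma L2r_integrable_mul f g : L2r G f -> L2r G g ->
  hyp.-integrable F (fun z => (f z * g z)%:E).
Proof.
move=> Lf Lg; have [_ mf _] := Lf; have [_ mg _] := Lg.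
apply: (le_integrable mF (g := fun z => (f z ^+ 2)%:E + (g z ^+ 2)%:E)%E).
- by apply: mfunF; apply/measurable_EFinP; exact: measurable_funM.
- move=> z _; rewrite -EFinD !abse_EFin lee_fin [leRHS]ger0_norm ?addr_ge0 ?sqr_ge0 //.
  rewrite normrM -(real_normK (num_real (f z))) -(real_normK (num_real (g z))).
  have := sqr_ge0 (`|f z| - `|g z|); have := mulr_ge0 (normr_ge0 (f z)) (normr_ge0 (g z)); nra.
- by apply: integrableD => //; exact: L2r_integrable_sq.
Qed.

Lemma L2r_lin (a : R) f g : L2r G f -> L2r G g -> L2r G (fun z => a * f z + g z).
Proof.
move=> Lf Lg; have [If mf _] := Lf; have [Ig mg _] := Lg; split.
- by move=> h z Gh z0; rewrite If // Ig.
- by apply: measurable_funD => //; exact: measurable_funM.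
have I1 := L2r_integrable_sq Lf; have I2 := L2r_integrable_sq Lg.
have I3 := integrableD mF (integrableZl mF (2 * a ^+ 2) I1) (integrableZl mF 2 I2).
have /integrableP[_] : hyp.-integrable F (fun z => ((a * f z + g z) ^+ 2)%:E).
  apply: (le_integrable mF _ _ I3).
    apply: mfunF; apply/measurable_EFinP; apply: measurable_funX.
    by apply: measurable_funD => //; exact: measurable_funM.
  move=> z _; change (`|((a * f z + g z) ^+ 2)%:E| <= `|(2 * a ^+ 2 * f z ^+ 2 + 2 * g z ^+ 2)%:E|)%E.
  rewrite !abse_EFin lee_fin.
  rewrite ger0_norm ?sqr_ge0 // (le_trans _ (ler_norm _)) //.
  have := sqr_ge0 (a * f z - g z); nra.
by under eq_integral => z _ do rewrite abse_EFin ger0_norm ?sqr_ge0 //.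
Qed.

Lemma L2r_0 : L2r G (fun=> 0).
Proof.
split=> //; by rewrite integral0_eq // => z _; rewrite expr0n.
Qed.

Lemma ipr_sq f : L2r G f ->
  (\int[hyp]_(z in F) (f z ^+ 2)%:E = (ipr G f f / sf)%:E)%E.
Proof.
move=> [_ _ If]; rewrite /ipr /qint mulrC mulKf ?gt_eqF // /Rintegral.
rewrite fineK; first by apply: eq_integral => z _; rewrite expr2.
rewrite ge0_fin_numE; last by apply: integral_ge0 => z _; rewrite lee_fin -expr2 sqr_ge0.
by under eq_integral => z _ do rewrite -expr2.
Qed.

Theorem sip_L2r : sip (L2r G : set (R * R -> R)) (ipr G).
Proof.
split=> [|a f g Lf Lg|f g|a f g h Lf Lg Lh|f].
- exact: L2r_0.
- exact: L2r_lin.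
- by congr (_ * _); apply: eq_Rintegral => z _; rewrite mulrC.
- rewrite /ipr /qint mulrCA -mulrDr; congr (_ * _).
  have I1 := L2r_integrable_mul Lf Lh; have I2 := L2r_integrable_mul Lg Lh.
  rewrite -RintegralZl // -RintegralD //; last first.
    by have := integrableZl mF a I1; apply: eq_integrable => // z _; rewrite /= EFinM.
  by apply: eq_Rintegral => z _; rewrite /GRing.scale /=; change ((a * f z + g z) * h z = a * (f z * h z) + g z * h z); ring.
- by rewrite mulr_ge0 ?(ltW sf0) // Rintegral_ge0 // => z _; rewrite -expr2 sqr_ge0.
Qed.

Lemma L2r_bounded f (M : R) : mobius_invariant G f -> measurable_fun setT f ->
  (forall z, 0 < z.2 -> `|f z| <= M) -> L2r G f.
Proof.
move=> If mf fM; split=> //.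
apply: (@le_lt_trans _ _ (\int[hyp]_(z in F) (M ^+ 2)%:E)%E).
  apply: ge0_le_integral => //.
  - by move=> z _; rewrite lee_fin sqr_ge0.
  - by apply: mfunF; apply/measurable_EFinP; exact: measurable_funX.
  - by move=> z /fundom_upper /fM h; rewrite lee_fin -(real_normK (num_real (f z))) ler_pXn2r ?nnegrE // (le_trans _ h).
rewrite integral_cst // lte_mul_pinfty ?lee_fin ?sqr_ge0 //.
by case: CG.
Qed.

(** The Riesz-Fischer argument: along a rapid subsequence the weighted sum [h] of the squared
    increments is integrable, where it is finite the increments decrease geometrically, and Fatou's
    lemma gives convergence in norm. *)
Theorem L2r_complete : sip_complete (L2r G : set (R * R -> R)) (ipr G).
Proof.
move=> u Wu cu; have hs := sip_L2r.
have mu n : measurable_fun setT (u n) by case: (Wu n).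
have Wd m n : L2r G (u m - u n) by exact: sipB hs _ _ (Wu m) (Wu n).
have [N hN] : {N : nat -> nat & forall k m n, (N k <= m)%N -> (N k <= n)%N ->
    ipr G (u m - u n) (u m - u n) < sf * ((4 ^ k)%:R^-1 * (2 ^ k.+1)%:R^-1)}.
  apply: (@choice _ _ (fun k N => forall m n, (N <= m)%N -> (N <= n)%N ->
    ipr G (u m - u n) (u m - u n) < sf * ((4 ^ k)%:R^-1 * (2 ^ k.+1)%:R^-1))) => k.
  apply: (cu (sf * ((4 ^ k)%:R^-1 * (2 ^ k.+1)%:R^-1))).
  by apply: mulr_gt0; [exact: sf0|rewrite mulr_gt0 ?invr_gt0 ?ltr0n ?expn_gt0].
pose n k := (\sum_(i < k.+1) (N i).+1)%N.
have nN k : (N k <= n k)%N by rewrite /n big_ord_recr /= -addSnnS addnC leq_addr.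
have nk k : (k < n k)%N by elim: k => [|k IH]; rewrite /n big_ord_recr /= ?addnS // ltnS ltn_addr.
have nS k : (n k <= n k.+1)%N by rewrite /n [leqRHS]big_ord_recr leq_addr.
have nM k l : (k <= l)%N -> (n k <= n l)%N.
  by move=> kl; rewrite -(subnK kl); elim: (l - k)%N => // m IH; rewrite addSn (leq_trans IH).
pose d k z : R := u (n k.+1) z - u (n k) z.
have md k : measurable_fun setT (d k) by apply: measurable_funB; exact: mu.
pose h z : \bar R := (\sum_(k <oo) ((4 ^ k)%:R * d k z ^+ 2)%:E)%E.
have t0 k z : (0 <= ((4 ^ k)%:R * d k z ^+ 2)%:E :> \bar R)%E by rewrite lee_fin mulr_ge0 ?sqr_ge0.
have mt k : measurable_fun setT (fun z => ((4 ^ k)%:R * d k z ^+ 2)%:E).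
  by apply/measurable_EFinP; apply: measurable_funM => //; exact: measurable_funX.
have mh : measurable_fun setT h by apply: ge0_emeasurable_sum.
have h0 z : (0 <= h z)%E by apply: nneseries_ge0.
have Ih : (\int[hyp]_(z in F) h z < +oo)%E.
  rewrite /h integral_nneseries //; last by move=> k; apply: mfunF.
  apply: (@le_lt_trans _ _ (\sum_(k <oo) (0 + (1 / (2 ^ k.+1)%:R)%:E))%E).
    apply: lee_nneseries => [k _ _|k _]; first by apply: integral_ge0.
    rewrite add0e; under eq_integral => z _ do rewrite EFinM.
    rewrite ge0_integralZl_EFin //; last 2 first.
    - by move=> z _; rewrite lee_fin sqr_ge0.
    - by apply: mfunF; apply/measurable_EFinP; exact: measurable_funX.
    rewrite (ipr_sq (Wd (n k.+1) (n k))) -EFinM lee_fin.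
    have := hN k _ _ (leq_trans (nN k) (nS k)) (nN k).
    have a0 : 0 < (4 ^ k)%:R :> R by rewrite ltr0n expn_gt0.
    have b0 : 0 < (2 ^ k.+1)%:R :> R by rewrite ltr0n expn_gt0.
    move: (ipr G _ _) (4 ^ k)%:R (2 ^ k.+1)%:R a0 b0 => x a b a0 b0 /ltW hx.
    have -> : 1 / b = a * ((sf * (a^-1 * b^-1)) / sf) by field; rewrite !gt_eqF.
    by rewrite ler_pM2l // ler_pM2r // invr_gt0.
  apply: le_lt_trans (epsilon_trick _ (fun=> lexx 0%E) ler01) _.
  by rewrite eseries0 // add0e ltry.
(* Replacing the sequence by 0 where [h] is infinite makes it converge everywhere; since [h] is
   invariant, so is the limit. *)
pose a k z : R := if (h z < +oo)%E then u (n k) z else 0.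
have mA : measurable_fun setT (fun z => (h z < +oo)%E).
  by apply: measurable_fun_lte => //; exact: measurable_cst.
have ma k : measurable_fun setT (a k).
  by apply: measurable_fun_ifT => //; exact: measurable_cst.
have ca z : cvgn (fun k => a k z).
  rewrite /a; case: (boolP (h z < +oo)%E) => hz; last exact: is_cvg_cst.
  have [H H0 hH] : exists2 H : R, 0 <= H & h z = H%:E.
    exists (fine (h z)); first exact: fine_ge0.
    by rewrite fineK // ge0_fin_numE.
  have dk k : `|d k z| <= geometric (Num.sqrt H) (2^-1) k.
    have : (((4 ^ k)%:R * d k z ^+ 2)%:E <= h z)%E.
      apply: le_trans (nneseries_lim_ge k.+1 _); last by move=> *; exact: t0.
      by rewrite big_nat_recr //= leeDr // sume_ge0.
    rewrite hH lee_fin => hk; rewrite /geometric /= -(ler_pXn2r (n := 2)) ?nnegrE ?mulr_ge0 ?sqrtr_ge0 ?exprn_ge0 //.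
    rewrite real_normK ?num_real // exprMn sqr_sqrtr // -exprM mulnC exprM exprVn -natrX.
    by rewrite exprVn -natrX ler_pdivlMr ?ltr0n ?expn_gt0 // mulrC.
  have cs : cvgn (series (fun k => d k z)).
    apply: normed_cvg; apply: (@series_le_cvg _ _ (geometric (Num.sqrt H) (2^-1))) => //.
    - by move=> k /=.
    - by move=> k; rewrite /geometric /= mulr_ge0 ?sqrtr_ge0 ?exprn_ge0.
    - by apply: is_cvg_geometric_series; rewrite ger0_norm ?invf_lt1 // ltr1n.
  have E : (fun k => u (n k) z) = (fun k => series (fun k => d k z) k + u (n 0%N) z).
    apply/funext => k; have := telescopeK (fun k => u (n k) z).
    move/(congr1 (fun f : nat -> R => f k)) => /= E.
    by rewrite (_ : series (fun k => d k z) k = u (n k) z - u (n 0%N) z) ?subrK.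
  by rewrite E; apply: is_cvgD => //; exact: is_cvg_cst.
pose g z : R := limn (fun k => a k z).
have hinv : forall m z, G m -> upper_half R z -> h (mobius m z) = h z.
  move=> m z Gm z0; apply: eq_eseriesr => k _; rewrite /d.
  by have [-> // _ _] := Wu (n k.+1); have [-> // _ _] := Wu (n k).
have mg : measurable_fun setT g by apply: (measurable_fun_cvg ma) => z _; exact: ca.
have hae : {ae hyp, forall z, F z -> (h z < +oo)%E}.
  have Ihh : hyp.-integrable F h.
    apply/integrableP; split; first exact: mfunF.
    by under eq_integral => z _ do rewrite gee0_abs //.
  have := integrable_ae mF Ihh; apply: filterS => z hz Fz.
  by rewrite -ge0_fin_numE // hz.
have key m (e : R) K : 0 <= e -> (forall k, (K <= k)%N -> ipr G (u m - u (n k)) (u m - u (n k)) <= e) ->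
    (\int[hyp]_(z in F) ((u m z - g z) ^+ 2)%:E <= (e / sf)%:E)%E.
  move=> e0 he; have E z : limn_einf (fun k => ((u m z - a k z) ^+ 2)%:E) = ((u m z - g z) ^+ 2)%:E.
    have c : ((u m z - a k z) ^+ 2)%:E @[k --> \oo] --> ((u m z - g z) ^+ 2)%:E.
      apply: cvg_EFin; first exact: nearW.
      rewrite /= expr2; under eq_fun => k do rewrite /= expr2.
      by apply: cvgM; (apply: cvgB; [exact: cvg_cst|exact: ca]).
    by case: (cvg_limn_einf_sup c).
  under eq_integral => z _ do rewrite -E.
  have md2 k : measurable_fun F (fun z => ((u m z - a k z) ^+ 2)%:E).
    by apply: mfunF; apply/measurable_EFinP; apply: measurable_funX; exact: measurable_funB.
  apply: le_trans (fatou hyp mF md2 _) _; first by move=> k z _; rewrite lee_fin sqr_ge0.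
  rewrite limn_einf_lim; apply: lime_le; first exact: is_cvg_einfs.
  exists K => // k Kk; apply: ereal_inf_le.
  exists (\int[hyp]_(z in F) ((u m z - a k z) ^+ 2)%:E)%E; first by exists k => //=.
  rewrite (@ge0_ae_eq_integral _ _ _ hyp F _ (fun z => ((u m z - u (n k) z) ^+ 2)%:E)) //.
  - apply: (@le_trans _ _ (ipr G (u m - u (n k)) (u m - u (n k)) / sf)%:E).
      by rewrite -(ipr_sq (Wd m (n k))).
    by rewrite lee_fin ler_wpM2r ?invr_ge0 ?(ltW sf0) //; apply: (he _ _).
  - by apply: mfunF; apply/measurable_EFinP; apply: measurable_funX; exact: measurable_funB.
  - by move=> z _; rewrite lee_fin sqr_ge0.
  - by move=> z _; rewrite lee_fin sqr_ge0.
  - by apply: filterS hae => z hz Fz; rewrite /a hz.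
have Lg : L2r G g.
  have Lz : L2r G (u (n 0%N) - g).
    split.
    - move=> m z Gm z0; rewrite !fctE; have [-> // _ _] := Wu (n 0%N); congr (_ - _).
      rewrite /g; congr (limn _); apply/funext => k; rewrite /a hinv //.
      by have [-> // _ _] := Wu (n k).
    - exact: measurable_funB.
    - apply: le_lt_trans (key (n 0%N) (sf * ((4 ^ 0)%:R^-1 * (2 ^ 1)%:R^-1)) 0%N _ _) _.
      + by rewrite !mulr_ge0 // ltW.
      + by move=> k _; apply: ltW; apply: hN; [exact: nN|exact: leq_trans (nN 0%N) (nM _ _ _)].
      + by rewrite ltry.
  have -> : g = u (n 0%N) - (u (n 0%N) - g) by rewrite opprB addrCA subrr addr0.
  exact: sipB hs _ _ (Wu _) Lz.
exists g => // e e0; have e2 : 0 < e / 2 by rewrite divr_gt0.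
have [M hM] := cu _ e2; exists M => m Mm.
have Lmg : L2r G (u m - g) by exact: sipB hs _ _ (Wu m) Lg.
have H : ipr G (u m - g) (u m - g) <= e / 2.
  suff : ((ipr G (u m - g) (u m - g) / sf)%:E <= (e / 2 / sf)%:E)%E.
    by rewrite lee_fin ler_pM2r // invr_gt0.
  rewrite -(ipr_sq Lmg); apply: (key m (e / 2) M) => [|k Mk]; first exact: ltW.
  by apply/ltW; apply: hM => //; exact: leq_trans Mk (ltnW (nk k)).
by apply: le_lt_trans H _; rewrite ltr_pdivrMr // ltr_pMr // ltr1n.
Qed.
End RealL2.

(** * Convolution operators and Schur's test *)

Section KernelOperators.
Variable R : realType.
Implicit Types (z w : R * R) (f g : R * R -> R) (k : R -> R).
Local Notation hyp := (@hyp_measure R).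
Local Notation H := (upper_half R).
Let mH : measurable H. Proof. exact: measurable_upper_half. Qed.

(** For every [t > 0], [2 |f| <= t al + f^2 / (t al)]; integrating gives [2 X <= t a + B / t], and
    [t = X / a] is the choice that yields the claim. *)
Lemma integral_cauchy_schwarz (D : set (R * R)) (ka al f : R * R -> R) (a : R) :
  measurable D -> measurable_fun setT ka -> measurable_fun setT al -> measurable_fun setT f ->
  (forall w, 0 <= ka w) -> (forall w, D w -> 0 < al w) -> 0 < a ->
  (\int[hyp]_(w in D) (ka w * al w)%:E <= a%:E)%E ->
  ((\int[hyp]_(w in D) (ka w * `|f w|)%:E) ^+ 2 <=
   a%:E * \int[hyp]_(w in D) (ka w * (f w ^+ 2 / al w))%:E)%E.
Proof.
move=> mD mk mal mf k0 al0 a0 hA.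
set X := (\int[hyp]_(w in D) (ka w * `|f w|)%:E)%E.
set B := (\int[hyp]_(w in D) (ka w * (f w ^+ 2 / al w))%:E)%E.
have mS (h : R * R -> \bar R) : measurable_fun setT h -> measurable_fun D h.
  by move=> mh; apply: (@measurable_funS _ _ _ _ setT).
have m1 : measurable_fun setT (fun w => (ka w * `|f w|)%:E).
  by apply/measurable_EFinP; apply: measurable_funM => //; exact: measurableT_comp.
have m2 : measurable_fun setT (fun w => (ka w * (f w ^+ 2 / al w))%:E).
  apply/measurable_EFinP; apply: measurable_funM => //; apply: measurable_funM.
    exact: measurable_funX.
  by apply: measurableT_comp => //; exact: measurable_invr.
have m3 : measurable_fun setT (fun w => (ka w * al w)%:E).
  by apply/measurable_EFinP; exact: measurable_funM.
have p1 w : D w -> (0 <= (ka w * `|f w|)%:E)%E by move=> Dw; rewrite lee_fin mulr_ge0.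
have p2 w : D w -> (0 <= (ka w * (f w ^+ 2 / al w))%:E)%E.
  by move=> Dw; rewrite lee_fin mulr_ge0 // divr_ge0 ?sqr_ge0 // ltW // al0.
have p3 w : D w -> (0 <= (ka w * al w)%:E)%E by move=> Dw; rewrite lee_fin mulr_ge0 // ltW // al0.
have X0 : (0 <= X)%E by exact: integral_ge0.
have B0 : (0 <= B)%E by exact: integral_ge0.
have [->|Boo] := eqVneq B +oo%E; first by rewrite gt0_muley ?lte_fin // leey.
have /fineK BE : B \is a fin_num by rewrite ge0_fin_numE // lt_neqAle Boo leey.
set b := fine B in BE; have b0 : 0 <= b by exact: fine_ge0.
have ineq (t : R) : 0 < t -> (2%:E * X <= (t * a + t^-1 * b)%:E)%E.
  move=> t0; rewrite -ge0_integralZl_EFin //; last exact: mS.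
  have -> : (t * a + t^-1 * b)%:E = (t%:E * a%:E + t^-1%:E * B)%E by rewrite -BE -!EFinM -EFinD.
  apply: (@le_trans _ _ (t%:E * \int[hyp]_(w in D) (ka w * al w)%:E + t^-1%:E * B)%E); last first.
    by rewrite leeD2r // lee_wpmul2l // lee_fin ltW.
  rewrite -ge0_integralZl_EFin ?(ltW t0) //; last exact: mS.
  rewrite -ge0_integralZl_EFin ?invr_ge0 ?(ltW t0) //; last exact: mS.
  have it0 : 0 <= t^-1 by rewrite invr_ge0 ltW.
  rewrite -ge0_integralD //; last 4 first.
  - by move=> w Dw; rewrite mule_ge0 ?p3 // lee_fin ltW.
  - by apply: emeasurable_funM => //; exact: mS.
  - by move=> w Dw; rewrite mule_ge0 ?p2 // lee_fin ltW.
  - by apply: emeasurable_funM => //; exact: mS.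
  apply: ge0_le_integral => //.
  - by move=> w Dw; rewrite mule_ge0 ?p1 // lee_fin.
  - by apply: emeasurable_funM => //; exact: mS.
  - by apply: emeasurable_funD; apply: emeasurable_funM => //; exact: mS.
  move=> w Dw; rewrite -!EFinM -EFinD lee_fin.
  have aw := al0 w Dw; have kw := k0 w.
  have -> : t * (ka w * al w) + t^-1 * (ka w * (f w ^+ 2 / al w)) =
      ka w * (t * al w + f w ^+ 2 / (t * al w)) by field; rewrite !gt_eqF.
  rewrite mulrCA ler_wpM2l //.
  have -> : t * al w + f w ^+ 2 / (t * al w) = 2 * `|f w| + (t * al w - `|f w|) ^+ 2 / (t * al w).
    rewrite -(real_normK (num_real (f w))).
    by field; rewrite !gt_eqF.
  by rewrite lerDl divr_ge0 ?sqr_ge0 // mulr_ge0 // ltW.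
have Xoo : X \is a fin_num.
  rewrite ge0_fin_numE //; have := ineq 1 ltr01; case: (X) X0 => [x _ _|_|//]; first exact: ltry.
  by rewrite mulry gtr0_sg ?mul1e ?leye_eq.
have /fineK XE := Xoo; set x := fine X in XE; have x0 : 0 <= x by exact: fine_ge0.
rewrite -XE -BE -EFin_expe -EFinM lee_fin.
have [->|xn] := eqVneq x 0; first by rewrite expr0n mulr_ge0 // ltW.
have xp : 0 < x by rewrite lt_neqAle eq_sym xn.
have := ineq (x / a) (divr_gt0 xp a0); rewrite -XE -EFinM lee_fin divfK ?gt_eqF // invf_div => h.
have {h} : x <= a / x * b by lra.
by rewrite mulrAC ler_pdivlMr // expr2.
Qed.

Section Fixed.
Variable G : set 'M[R]_2.
Hypothesis CG : cofinite_fuchsian G.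
Let FG : fuchsian G. Proof. by case: CG. Qed.
Let sG : SL2_subgroup G. Proof. by case: FG. Qed.
Local Notation F := (fundom G).
Local Notation sf := (stack_factor G).
Let mF : measurable F. Proof. exact: measurable_fundom. Qed.
Let sf0 : 0 < sf. Proof. exact: stack_factor_gt0. Qed.
Let mfunF (h : R * R -> \bar R) : measurable_fun setT h -> measurable_fun F h.
Proof. by move=> mh; apply: (@measurable_funS _ _ _ _ setT). Qed.

(** Cauchy-Schwarz with the weight [al], followed by [integral_transpose], which requires the
    invariance of kernel, weight and function. The two estimates are separate hypotheses because the
    cut-off kernel of [thin_bound] is not symmetric. *)
Theorem schur (ka : R * R -> R * R -> R) (al f : R * R -> R) (q1 q2 : R) :
  measurable_fun setT (fun p => ka p.1 p.2) -> (forall z w, 0 <= ka z w) ->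
  (forall (g : 'M[R]_2) z w, G g -> 0 < z.2 -> 0 < w.2 -> ka (mobius g z) (mobius g w) = ka z w) ->
  measurable_fun setT al -> mobius_invariant G al -> (forall z, 0 < z.2 -> 0 < al z) ->
  measurable_fun setT f -> mobius_invariant G f -> 0 < q1 -> 0 <= q2 ->
  (forall z, F z -> (\int[hyp]_(w in H) (ka z w * al w)%:E <= (q1 * al z)%:E)%E) ->
  (forall w, F w -> (\int[hyp]_(z in H) (ka z w * al z)%:E <= (q2 * al w)%:E)%E) ->
  (\int[hyp]_(z in F) ((\int[hyp]_(w in H) (ka z w * `|f w|)%:E) ^+ 2) <=
   (q1 * q2)%:E * \int[hyp]_(z in F) (f z ^+ 2)%:E)%E.
Proof.
move=> mk k0 kG mal alG al0 mf fG q10 q20 h1 h2.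
have mkz z : measurable_fun setT (fun w => ka z w) by exact: (measurable_fun_pair2 z mk).
have mkw w : measurable_fun setT (fun z => ka z w) by exact: (measurable_fun_pair1 w mk).
(* The absolute values keep the integrand non-negative outside the half-plane, where the sign of
   [al] is unknown. *)
pose c z w : \bar R := (ka z w * (`|al z| * (f w ^+ 2 / `|al w|)))%:E.
have c0 z w : (0 <= c z w)%E by rewrite lee_fin mulr_ge0 // mulr_ge0 // divr_ge0 // sqr_ge0.
have mc : measurable_fun setT (fun p => c p.1 p.2).
  apply/measurable_EFinP; apply: measurable_funM => //; apply: measurable_funM.
    by apply: measurableT_comp => //; exact: measurableT_comp mal _.
  apply: measurable_funM; first by apply: measurable_funX; exact: measurableT_comp mf _.
  apply: measurableT_comp; first exact: measurable_invr.
  by apply: measurableT_comp => //; exact: measurableT_comp mal _.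
have mk1 : measurable_fun setT (fun p => (ka p.1 p.2 * `|f p.2|)%:E).
  apply/measurable_EFinP; apply: measurable_funM => //; apply: measurableT_comp => //.
  exact: measurableT_comp mf _.
apply: (@le_trans _ _ (\int[hyp]_(z in F) (q1%:E * \int[hyp]_(w in H) c z w))%E).
  apply: ge0_le_integral => //.
  - by move=> z _; rewrite sqre_ge0.
  - apply: mfunF; rewrite (_ : (fun z => _ ^+ 2)%E = fun z => ((\int[hyp]_(w in H) (ka z w * `|f w|)%:E) * (\int[hyp]_(w in H) (ka z w * `|f w|)%:E))%E); last first.
      by apply/funext => z; rewrite expe2.
    by apply: emeasurable_funM; apply: (measurable_hyp_integral (k := fun z w => (ka z w * `|f w|)%:E)) => // z w;
      rewrite lee_fin mulr_ge0.
  - apply: mfunF; apply: emeasurable_funM => //; exact: measurable_hyp_integral.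
  move=> z Fz; have z0 := fundom_upper Fz; have az := al0 z z0.
  have := integral_cauchy_schwarz mH (mkz z) mal mf (k0 z) al0 (mulr_gt0 q10 az) (h1 z Fz).
  move/le_trans; apply; rewrite EFinM -muleA lee_wpmul2l ?lee_fin ?(ltW q10) //.
  rewrite -ge0_integralZl_EFin ?(ltW az) //; last 2 first.
  - by move=> w w0; rewrite lee_fin mulr_ge0 // divr_ge0 ?sqr_ge0 // ltW // al0.
  - apply: (@measurable_funS _ _ _ _ setT) => //; apply/measurable_EFinP; apply: measurable_funM => //.
    apply: measurable_funM; first exact: measurable_funX.
    by apply: measurableT_comp => //; exact: measurable_invr.
  rewrite le_eqVlt; apply/orP; left; apply/eqP; apply: eq_integral => w; rewrite inE => w0.
  by rewrite /c -EFinM mulrCA (gtr0_norm az) (gtr0_norm (al0 w w0)).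
rewrite ge0_integralZl_EFin ?(ltW q10) //; last 2 first.
- by move=> z _; apply: integral_ge0.
- by apply: mfunF; exact: measurable_hyp_integral.
rewrite (EFinM q1) -muleA lee_wpmul2l ?lee_fin ?(ltW q10) //.
rewrite (integral_transpose FG mc c0); last first.
  by move=> g z w Gg z0 w0; rewrite /c kG // !alG // fG.
rewrite -ge0_integralZl_EFin //; last 2 first.
- by move=> z _; rewrite lee_fin sqr_ge0.
- by apply: mfunF; apply/measurable_EFinP; exact: measurable_funX.
apply: ge0_le_integral => //.
- by move=> w _; apply: integral_ge0.
- apply: mfunF; apply: (measurable_hyp_integral (k := fun w z => c z w)) => //.
  apply: (measurableT_comp (f := fun p : (R * R) * (R * R) => c p.1 p.2) mc (g := fun p => (p.2, p.1))).
  exact: measurable_fun_pair.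
- by apply: mfunF; apply/measurable_EFinP; apply: measurable_funM => //; exact: measurable_funX.
move=> w Fw; have w0 := fundom_upper Fw; have aw := al0 w w0.
rewrite (eq_integral (fun z => ((f w ^+ 2 / al w)%:E * (ka z w * al z)%:E)%E)); last first.
  move=> z; rewrite inE => z0; rewrite /c -EFinM (gtr0_norm aw) (gtr0_norm (al0 z z0)); congr _%:E; ring.
rewrite ge0_integralZl_EFin //; last 3 first.
- by move=> z z0; rewrite lee_fin mulr_ge0 // ltW // al0.
- by apply: (@measurable_funS _ _ _ _ setT) => //; apply/measurable_EFinP; exact: measurable_funM.
- by rewrite divr_ge0 ?sqr_ge0 // ltW.
apply: (@le_trans _ _ ((f w ^+ 2 / al w)%:E * (q2 * al w)%:E)%E).
  by rewrite lee_wpmul2l ?h2 // lee_fin divr_ge0 ?sqr_ge0 // ltW.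
by rewrite -!EFinM lee_fin mulrCA divfK ?gt_eqF // mulrC.
Qed.
End Fixed.
End KernelOperators.

Section KernelInL2.
Variable R : realType.
Implicit Types (z w : R * R) (f g : R * R -> R) (k : R -> R).
Local Notation hyp := (@hyp_measure R).
Local Notation leb := (@lebesgue_measure R).
Local Notation H := (upper_half R).
Let mH : measurable H. Proof. exact: measurable_upper_half. Qed.

(** The factor [1 / (2 pi)] is the one of [integral_radial], so that [c] bounds the hyperbolic mass
    of the kernel about any point. *)
Definition mass_le k (c : R) : Prop :=
  (\int[leb]_(x in `]1%R, +oo[) (k x)%:E <= ((2 * pi)^-1 * c)%:E)%E.

Lemma mass_le_hyp k c z : rkernel k -> mass_le k c -> 0 < z.2 ->
  (\int[hyp]_(w in H) (k (hypu z w))%:E <= c%:E)%E.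
Proof.
move=> kk mk z0; have mk' := rkernel_measurable kk; have [_ k0 _] := kk.
have mE : measurable_fun setT (fun x => (k x)%:E) by apply/measurable_EFinP.
have kE x : (0 <= (k x)%:E)%E by rewrite lee_fin.
rewrite (integral_radial z0 mE kE).
have -> : c%:E = ((2 * pi)%:E * ((2 * pi)^-1 * c)%:E)%E.
  by rewrite -EFinM mulrA mulfV ?mul1r // gt_eqF // pi2_gt0.
by rewrite lee_wpmul2l // lee_fin ltW // pi2_gt0.
Qed.

Definition kint k f z : R := \int[hyp]_(w in H) (k (hypu z w) * f w).

Lemma measurable_kint k f : rkernel k -> measurable_fun setT f -> measurable_fun setT (kint k f).
Proof.
move=> kk mf; have mk := measurable_rkernel2 kk.
have mh : measurable_fun setT (fun p : (R * R) * (R * R) => (k (hypu p.1 p.2) * f p.2)%:E).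
  apply/measurable_EFinP; apply: measurable_funM => //; exact: measurableT_comp mf _.
rewrite /kint /Rintegral.
apply: (measurableT_comp (fine_measurable measurableT)).
under eq_fun => z do rewrite integralE.
apply: emeasurable_funB.
  apply: (measurable_hyp_integral (k := fun z w => ((fun w => (k (hypu z w) * f w)%:E)^\+ w)%E)) => //.
  have := measurable_funepos mh; congr (measurable_fun _ _).
  by apply/funext => p; rewrite !funeposE.
apply: (measurable_hyp_integral (k := fun z w => ((fun w => (k (hypu z w) * f w)%:E)^\- w)%E)) => //.
have := measurable_funeneg mh; congr (measurable_fun _ _).
by apply/funext => p; rewrite !funenegE.
Qed.

Section Fixed.
Variable G : set 'M[R]_2.
Hypothesis CG : cofinite_fuchsian G.
Let FG : fuchsian G. Proof. by case: CG. Qed.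
Let sG : SL2_subgroup G. Proof. by case: FG. Qed.
Local Notation F := (fundom G).
Local Notation sf := (stack_factor G).
Let mF : measurable F. Proof. exact: measurable_fundom. Qed.
Let sf0 : 0 < sf. Proof. exact: stack_factor_gt0. Qed.
Let mfunF (h : R * R -> \bar R) : measurable_fun setT h -> measurable_fun F h.
Proof. by move=> mh; apply: (@measurable_funS _ _ _ _ setT). Qed.
Let mfunH (h : R * R -> \bar R) : measurable_fun setT h -> measurable_fun H h.
Proof. by move=> mh; apply: (@measurable_funS _ _ _ _ setT). Qed.
Let hs := sip_L2r CG.

Lemma ipr_eq f f' g : (forall z, 0 < z.2 -> f z = f' z) -> ipr G f g = ipr G f' g.
Proof.
by move=> ff'; congr (_ * _); apply: eq_Rintegral => z; rewrite inE => /fundom_upper /ff' ->.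
Qed.

Lemma L2r_eq f f' : (forall z, 0 < z.2 -> f z = f' z) -> measurable_fun setT f' -> L2r G f -> L2r G f'.
Proof.
move=> ff' mf' [If _ Nf]; split=> //.
  move=> g z Gg z0; have [[Gd _ _ _] _] := FG.
  by rewrite -!ff' ?If //; apply: mobius_upper => //; exact: Gd.
apply: le_lt_trans Nf; rewrite le_eqVlt; apply/orP; left; apply/eqP.
by apply: eq_integral => z; rewrite inE => /fundom_upper /ff' ->.
Qed.

Lemma measurable_aut k z : rkernel k -> measurable_fun setT (aut G k z).
Proof.
move=> kk; apply: (measurableT_comp (fine_measurable measurableT)).
have [_ k0 _] := kk.
apply: measurable_esum => // [g|g w]; last by rewrite lee_fin.
apply/measurable_EFinP; exact: measurableT_comp (measurable_rkernel_hypu z kk) (measurable_mobius g).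
Qed.

Lemma aut_L2r k z : rkernel k -> 0 < z.2 -> L2r G (aut G k z).
Proof.
move=> kk z0; have [M hM] := aut_bounded FG kk z0.
apply: (L2r_bounded CG _ _ hM); last exact: measurable_aut.
by move=> g w Gg w0; exact: aut_invr.
Qed.

Lemma aut_integral k z f : rkernel k -> 0 < z.2 -> measurable_fun setT f ->
  mobius_invariant G f -> (forall w, 0 <= f w) ->
  (\int[hyp]_(w in F) (aut G k z w * f w)%:E =
   (ncenter G)%:R%:E * \int[hyp]_(w in H) (k (hypu z w) * f w)%:E)%E.
Proof.
move=> kk z0 mf If f0; have [_ k0 _] := kk.
rewrite -(integral_unfold (f := fun w => (k (hypu z w) * f w)%:E) FG); last 2 first.
- by apply/measurable_EFinP; apply: measurable_funM => //; exact: measurable_rkernel_hypu.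
- by move=> w; rewrite lee_fin mulr_ge0.
apply: eq_integral => w; rewrite inE => /fundom_upper w0.
rewrite EFinM -(aut_esum FG kk z0 w0).
have [e [P [eG _ eE]]] := fuchsian_enum FG.
rewrite !eE => [|g|g]; [|by rewrite lee_fin mulr_ge0|by rewrite lee_fin].
rewrite muleC -nneseriesZl; last by move=> n _; rewrite lee_fin.
by apply: eq_eseriesr => n Pn; rewrite (If _ _ (eG _ Pn) w0) -EFinM mulrC.
Qed.

Lemma sf_ncenter : sf * (ncenter G)%:R = 1.
Proof. by rewrite stack_factorE mulVf // pnatr_eq0 -lt0n ncenter_gt0. Qed.

(** Convolution over the half-plane is the inner product with the automorphic kernel: unfolding
    contributes the order of the centre, which the stack factor cancels. *)
Lemma ipr_aut_pos k z f : rkernel k -> 0 < z.2 -> L2r G f -> (forall w, 0 <= f w) ->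
  (\int[hyp]_(w in H) (k (hypu z w) * f w)%:E = (ipr G (aut G k z) f)%:E)%E.
Proof.
move=> kk z0 Lf f0; have [If mf _] := Lf.
have := aut_integral kk z0 mf If f0.
have := integrable_fin_num mF (L2r_integrable_mul CG (aut_L2r kk z0) Lf).
rewrite /ipr /qint /Rintegral; set I := (\int[hyp]_(w in F) _)%E; move=> fI.
rewrite EFinM fineK // => ->; rewrite muleA -EFinM sf_ncenter mul1e //.
Qed.

Definition fpos f z : R := Num.max (f z) 0.
Definition fneg f z : R := Num.max (- f z) 0.

Lemma fpos_ge0 f z : 0 <= fpos f z. Proof. by rewrite le_max lexx orbT. Qed.
Lemma fneg_ge0 f z : 0 <= fneg f z. Proof. by rewrite le_max lexx orbT. Qed.
Lemma fposneg f z : f z = fpos f z - fneg f z.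
Proof. by rewrite /fpos /fneg; case: (leP (f z) 0); case: (leP (- f z) 0); lra. Qed.

Lemma L2r_max f (c : R) : L2r G f -> L2r G (fun z => Num.max (c * f z) 0).
Proof.
move=> Lf; have [If mf _] := Lf; have [_ _ Nf] := sipZ hs c Lf; split.
- by move=> g z Gg z0; rewrite If.
- by apply: measurable_maxr => //; apply: measurable_funM.
apply: le_lt_trans Nf; apply: ge0_le_integral => //.
- by move=> z _; rewrite lee_fin sqr_ge0.
- by apply: mfunF; apply/measurable_EFinP; apply: measurable_funX; apply: measurable_maxr => //; apply: measurable_funM.
- by apply: mfunF; apply/measurable_EFinP; apply: measurable_funX; apply: measurable_funM.
move=> z _; rewrite lee_fin; change (Num.max (c * f z) 0 ^+ 2 <= (c * f z) ^+ 2).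
by case: (leP (c * f z) 0) => h; rewrite ?expr0n ?sqr_ge0.
Qed.

Lemma L2r_fpos f : L2r G f -> L2r G (fpos f).
Proof. by move=> /(L2r_max 1); congr L2r; apply/funext => z; rewrite mul1r. Qed.

Lemma L2r_fneg f : L2r G f -> L2r G (fneg f).
Proof. by move=> /(L2r_max (-1)); congr L2r; apply/funext => z; rewrite mulN1r. Qed.

Lemma fposneg_fun f : f = fpos f - fneg f.
Proof. by apply/funext => z; rewrite [LHS]fposneg. Qed.

Lemma integrable_kernel_pos k z f : rkernel k -> 0 < z.2 -> L2r G f -> (forall w, 0 <= f w) ->
  hyp.-integrable H (fun w => (k (hypu z w) * f w)%:E).
Proof.
move=> kk z0 Lf f0; have [_ k0 _] := kk; have [_ mf _] := Lf; apply/integrableP; split.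
  by apply: mfunH; apply/measurable_EFinP; apply: measurable_funM => //; exact: measurable_rkernel_hypu.
under eq_integral => w _ do rewrite gee0_abs ?lee_fin ?mulr_ge0 //.
by rewrite ipr_aut_pos // ltry.
Qed.

Lemma integrable_kernel k z f : rkernel k -> 0 < z.2 -> L2r G f ->
  hyp.-integrable H (fun w => (k (hypu z w) * f w)%:E).
Proof.
move=> kk z0 Lf.
have I1 := integrable_kernel_pos kk z0 (L2r_fpos Lf) (fpos_ge0 f).
have I2 := integrable_kernel_pos kk z0 (L2r_fneg Lf) (fneg_ge0 f).
apply: eq_integrable (integrableB mH I1 I2) => // w _.
by rewrite -EFinB -mulrBr -fposneg.
Qed.

Lemma kint_ipr k z f : rkernel k -> 0 < z.2 -> L2r G f -> kint k f z = ipr G (aut G k z) f.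
Proof.
move=> kk z0 Lf; have La := aut_L2r kk z0.
have pos g : L2r G g -> (forall w, 0 <= g w) -> kint k g z = ipr G (aut G k z) g.
  by move=> Lg g0; rewrite /kint /Rintegral ipr_aut_pos.
have Lp := L2r_fpos Lf; have Ln := L2r_fneg Lf.
rewrite {2}(fposneg_fun f) (ipBr hs) // -!pos //; try exact: fpos_ge0; try exact: fneg_ge0.
rewrite /kint -RintegralB //; last 2 first.
- by apply: integrable_kernel_pos => //; exact: fpos_ge0.
- by apply: integrable_kernel_pos => //; exact: fneg_ge0.
by apply: eq_Rintegral => w _; rewrite -mulrBr -fposneg.
Qed.

Lemma kint_inv k f : rkernel k -> L2r G f -> mobius_invariant G (kint k f).
Proof.
move=> kk Lf g z Gg z0; have [[Gd _ _ _] _] := FG; have gz := mobius_upper (Gd _ Gg) z0.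
rewrite !kint_ipr //; apply: ipr_eq => w w0; exact: aut_invl.
Qed.

Lemma kint_sq k f c : rkernel k -> mass_le k c -> 0 < c -> L2r G f ->
  (\int[hyp]_(z in F) (kint k f z ^+ 2)%:E <= (c * c)%:E * \int[hyp]_(z in F) (f z ^+ 2)%:E)%E.
Proof.
move=> kk mkc c0 Lf; have [_ k0 _] := kk; have [If mf _] := Lf.
have mk := measurable_rkernel2 kk.
have [[Gd _ _ _] _] := FG.
apply: (@le_trans _ _ (\int[hyp]_(z in F) ((\int[hyp]_(w in H) (k (hypu z w) * `|f w|)%:E) ^+ 2))%E); last first.
  apply: (schur CG (ka := fun z w => k (hypu z w)) (al := fun=> 1)) => //.
  - by move=> g z w Gg z0 w0; rewrite hypu_mobius //; exact: Gd.
  - exact: ltW.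
  - move=> z Fz; rewrite mulr1; under eq_integral => w _ do rewrite mulr1.
    exact: mass_le_hyp (fundom_upper Fz).
  - move=> z Fz; rewrite mulr1; under eq_integral => w _ do rewrite mulr1 hypuC.
    exact: mass_le_hyp (fundom_upper Fz).
apply: ge0_le_integral => //.
- by move=> z _; rewrite lee_fin sqr_ge0.
- by apply: mfunF; apply/measurable_EFinP; apply: measurable_funX; exact: measurable_kint.
- have mm : measurable_fun setT (fun z => \int[hyp]_(w in H) (k (hypu z w) * `|f w|)%:E)%E.
    apply: (measurable_hyp_integral (k := fun z w => (k (hypu z w) * `|f w|)%:E)) => //.
      apply/measurable_EFinP; apply: measurable_funM => //; apply: measurableT_comp => //.
      exact: measurableT_comp mf _.
    by move=> z w; rewrite lee_fin mulr_ge0.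
  apply: mfunF; rewrite (_ : (fun z => _ ^+ 2)%E = fun z => ((\int[hyp]_(w in H) (k (hypu z w) * `|f w|)%:E) * (\int[hyp]_(w in H) (k (hypu z w) * `|f w|)%:E))%E).
    exact: emeasurable_funM.
  by apply/funext => z; rewrite expe2.
move=> z Fz; have z0 := fundom_upper Fz.
have I := integrable_kernel kk z0 Lf.
have h : (`|(kint k f z)%:E| <= \int[hyp]_(w in H) (k (hypu z w) * `|f w|)%:E)%E.
  rewrite /kint /Rintegral fineK; last exact: integrable_fin_num.
  apply: le_trans (le_abse_integral hyp mH _) _; first by case/integrableP: I.
  rewrite le_eqVlt; apply/orP; left; apply/eqP; apply: eq_integral => w _.
  by rewrite abse_EFin normrM (ger0_norm (k0 _)).
rewrite EFin_expe -[X in (X <= _)%E]gee0_abs ?sqre_ge0 // expe2 abseM -expe2.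
by rewrite !expe2; apply: lee_pmul => //; exact: abse_ge0.
Qed.

Lemma L2r_kint k f c : rkernel k -> mass_le k c -> 0 < c -> L2r G f -> L2r G (kint k f).
Proof.
move=> kk mkc c0 Lf; split; [exact: kint_inv|by apply: measurable_kint => //; case: Lf|].
apply: le_lt_trans (kint_sq kk mkc c0 Lf) _.
by rewrite lte_mul_pinfty ?lee_fin ?mulr_ge0 ?(ltW c0) //; case: Lf.
Qed.

Lemma nrm_kint k f c : rkernel k -> mass_le k c -> 0 < c -> L2r G f ->
  nrm (ipr G) (kint k f) <= c * nrm (ipr G) f.
Proof.
move=> kk mkc c0 Lf; have Lk := L2r_kint kk mkc c0 Lf.
rewrite -(ler_pXn2r (n := 2)) ?nnegrE ?mulr_ge0 ?nrm_ge0 ?(ltW c0) //.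
rewrite exprMn !(nrm_sq hs); have := kint_sq kk mkc c0 Lf.
rewrite !(ipr_sq CG) // -EFinM lee_fin -expr2 mulrA ler_pM2r // invr_gt0 //.
Qed.

Lemma kintB k f g z : rkernel k -> L2r G f -> L2r G g -> 0 < z.2 ->
  kint k (f - g) z = kint k f z - kint k g z.
Proof.
move=> kk Lf Lg z0; rewrite !kint_ipr ?(ipBr hs) //; first exact: aut_L2r.
exact: sipB hs _ _ Lf Lg.
Qed.

Lemma kint_sym_pos k f g : rkernel k -> L2r G f -> L2r G g ->
  (forall z, 0 <= f z) -> (forall z, 0 <= g z) -> ipr G (kint k f) g = ipr G f (kint k g).
Proof.
move=> kk Lf Lg f0 g0; have [_ k0 _] := kk; have mk := measurable_rkernel2 kk.
have [If mf _] := Lf; have [Ig mg _] := Lg; have [[Gd _ _ _] _] := FG.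
rewrite /ipr /qint; congr (_ * _); rewrite /Rintegral; congr fine.
pose c z w : \bar R := (k (hypu z w) * (f w * g z))%:E.
have c0 z w : (0 <= c z w)%E by rewrite lee_fin mulr_ge0 // mulr_ge0.
have mc : measurable_fun setT (fun p => c p.1 p.2).
  apply/measurable_EFinP; apply: measurable_funM => //; apply: measurable_funM.
    exact: measurableT_comp mf _.
  exact: measurableT_comp mg _.
transitivity (\int[hyp]_(z in F) (\int[hyp]_(w in H) c z w))%E.
  apply: eq_integral => z; rewrite inE => /fundom_upper z0.
  rewrite EFinM kint_ipr // -ipr_aut_pos // muleC -ge0_integralZl_EFin //; last 2 first.
  - by move=> w _; rewrite lee_fin mulr_ge0.
  - by apply: mfunH; apply/measurable_EFinP; apply: measurable_funM => //; exact: measurable_rkernel_hypu.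
  by apply: eq_integral => w _; rewrite /c -EFinM; congr _%:E; ring.
rewrite (integral_transpose FG mc c0); last first.
  by move=> h z w Gh z0 w0; rewrite /c hypu_mobius ?If ?Ig //; exact: Gd.
apply: eq_integral => w; rewrite inE => /fundom_upper w0.
rewrite EFinM kint_ipr // -ipr_aut_pos // -ge0_integralZl_EFin //; last 2 first.
- by move=> z _; rewrite lee_fin mulr_ge0.
- by apply: mfunH; apply/measurable_EFinP; apply: measurable_funM => //; exact: measurable_rkernel_hypu.
by apply: eq_integral => z _; rewrite /c -EFinM hypuC; congr _%:E; ring.
Qed.

Lemma kint_sym k f g c : rkernel k -> mass_le k c -> 0 < c -> L2r G f -> L2r G g ->
  ipr G (kint k f) g = ipr G f (kint k g).
Proof.
move=> kk mkc c0 Lf Lg.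
have Lfp := L2r_fpos Lf; have Lfn := L2r_fneg Lf; have Lgp := L2r_fpos Lg; have Lgn := L2r_fneg Lg.
have K h : L2r G h -> L2r G (kint k h) by exact: (L2r_kint kk mkc c0).
have E1 : ipr G (kint k f) g = ipr G (kint k (fpos f) - kint k (fneg f)) g.
  by apply: ipr_eq => z z0; rewrite {1}(fposneg_fun f) kintB.
have E2 : ipr G f (kint k g) = ipr G f (kint k (fpos g) - kint k (fneg g)).
  rewrite (sipC hs) [RHS](sipC hs).
  by apply: ipr_eq => z z0; rewrite {1}(fposneg_fun g) kintB.
have hp h := fpos_ge0 h; have hn h := fneg_ge0 h.
rewrite E1 E2 (ipBl hs (K _ Lfp) (K _ Lfn) Lg) (ipBr hs (K _ Lgp) (K _ Lgn) Lf).
rewrite [in LHS](fposneg_fun g) [in RHS](fposneg_fun f).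
rewrite !(ipBr hs Lgp Lgn) ?(ipBl hs Lfp Lfn) //; try exact: K.
have P h1 h2 := @kint_sym_pos k h1 h2 kk.
rewrite (P _ _ Lfp Lgp (hp _) (hp _)) (P _ _ Lfp Lgn (hp _) (hn _)).
rewrite (P _ _ Lfn Lgp (hn _) (hp _)) (P _ _ Lfn Lgn (hn _) (hn _)).
move: (ipr _ _ _) (ipr _ _ _) (ipr _ _ _) (ipr _ _ _) => x1 x2 x3 x4; ring.
Qed.
End Fixed.
End KernelInL2.

(** * Uniqueness of measures on the plane *)

Section WeightedMeasure.
Variable R : realType.
Local Notation hyp := (@hyp_measure R).
Variable f : R * R -> \bar R.
Hypotheses (mf : measurable_fun setT f) (f0 : forall z, (0 <= f z)%E).

Definition wmeas (A : set (R * R)) : \bar R := (\int[hyp]_(z in A) f z)%E.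

Let wmeas0 : wmeas set0 = 0%E. Proof. exact: integral_set0. Qed.
Let wmeas_ge0 A : (0 <= wmeas A)%E. Proof. exact: integral_ge0. Qed.
Let wmeas_sigma_additive : semi_sigma_additive wmeas.
Proof. exact: (@semi_sigma_additive_nng_induced _ _ R hyp f mf f0). Qed.

HB.instance Definition _ := isMeasure.Build _ _ _ wmeas wmeas0 wmeas_ge0 wmeas_sigma_additive.

Definition wmeasure : {measure set (R * R) -> \bar R} := wmeas.
End WeightedMeasure.

Section PlaneMeasures.
Variable R : realType.

Lemma measurable_ocitvX :
  (measurable : set (set (R * R))) = <<s [set A `*` B | A in @ocitv R & B in @ocitv R] >>.
Proof.
set C := [set _ | _ in _ & _ in _].
have cov : \bigcup_n `](- n%:R), n%:R]%classic = [set: R].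
  apply/seteqP; split=> // x _; exists (Num.truncn `|x|).+1 => //=; rewrite in_itv /=.
  have : `|x| < (Num.truncn `|x|).+1%:R by exact: truncnS_gt.
  by rewrite ltr_norml => /andP[-> /ltW ->].
have ocn n : @ocitv R `](- n%:R), n%:R]%classic.
  apply/ocitvP; have [->|n0] := posnP n; first by left; rewrite oppr0 set_itv_ge // bnd_simp ltxx.
  by right; exists (- n%:R, n%:R) => //=; rewrite gtrN // ltr0n.
have mo : (measurable : set (set R)) = <<s @ocitv R >> by [].
apply/seteqP; split; last first.
  apply: smallest_sub; first exact: sigma_algebra_measurable.
  move=> _ [A oA [B oB <-]]; apply: measurableX; rewrite mo; exact: sub_sigma_algebra.
have sC := smallest_sigma_algebra [set: R * R] C.
have step (f : R * R -> R) : (forall A, @ocitv R A -> <<s C >> (f @^-1` A)) ->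
    preimage_set_system setT f measurable `<=` <<s C >>.
  move=> hf _ [A mA <-]; rewrite setTI.
  have : <<s @ocitv R >> `<=` image_set_system setT f <<s C >>.
    apply: smallest_sub; first exact: sigma_algebra_image.
    by move=> B oB; rewrite /image_set_system /= setTI; exact: hf.
  move/(_ A); rewrite -mo => /(_ mA); rewrite /image_set_system /= setTI; exact.
apply: smallest_sub => //; rewrite subUset; split; apply: step => A oA.
- have -> : fst @^-1` A = \bigcup_n (A `*` (`](- n%:R), n%:R]%classic : set R)).
    by rewrite -setX_bigcupr cov; apply/seteqP; split=> x //= [].
  apply: sigma_algebra_bigcup => n; apply: sub_sigma_algebra.
  by exists A => //; exists `](- n%:R), n%:R]%classic.
- have -> : snd @^-1` A = \bigcup_n ((`](- n%:R), n%:R]%classic : set R) `*` A).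
    by rewrite -setX_bigcupl cov; apply/seteqP; split=> x //= [].
  apply: sigma_algebra_bigcup => n; apply: sub_sigma_algebra.
  by exists `](- n%:R), n%:R]%classic => //; exists A.
Qed.

Lemma plane_measure_unique (m1 m2 : {measure set (R * R) -> \bar R}) :
  (m1 setT < +oo)%E ->
  (forall A B, @ocitv R A -> @ocitv R B -> m1 (A `*` B) = m2 (A `*` B)) ->
  forall A, measurable A -> m1 A = m2 A.
Proof.
move=> fin h.
pose I (n : nat) : set R := `](- n%:R), n%:R]%classic.
have ocn n : @ocitv R (I n).
  apply/ocitvP; have [->|n0] := posnP n; first by left; rewrite /I oppr0 set_itv_ge // bnd_simp ltxx.
  by right; exists (- n%:R, n%:R) => //=; rewrite gtrN // ltr0n.
apply: (@measure_unique _ R _ _ (fun n => I n `*` I n) measurable_ocitvX).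
- move=> _ _ [A oA [B oB <-]] [C oC [D oD <-]]; rewrite -setXI.
  by exists (A `&` C); [exact: ocitvI|exists (B `&` D) => //; exact: ocitvI].
- by move=> n; exists (I n) => //; exists (I n).
- apply/seteqP; split=> // -[x y] _; exists (Num.truncn (Num.max `|x| `|y|)).+1 => //.
  have : Num.max `|x| `|y| < (Num.truncn (Num.max `|x| `|y|)).+1%:R by exact: truncnS_gt.
  rewrite gt_max !ltr_norml => /andP[/andP[x1 x2] /andP[y1 y2]].
  by split; rewrite /I /= in_itv /= ?x1 ?y1 ltW.
- by move=> _ [A oA [B oB <-]]; exact: h.
- move=> n; apply: le_lt_trans fin; apply: le_measure; rewrite ?inE //.
  by apply: measurableX; exact: measurable_itv.
Qed.
End PlaneMeasures.

Section Averages.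
Variable R : realType.
Implicit Types (z w : R * R).
Local Notation hyp := (@hyp_measure R).
Local Notation H := (upper_half R).
Let mH : measurable H. Proof. exact: measurable_upper_half. Qed.

(** For [e <= 1/4] the height of z is at most twice that of w, which turns the bound on [u] into a
    Euclidean one depending on w alone. *)
Lemma hypu_close z w (e : R) : 0 < w.2 -> 0 < z.2 -> e <= 4^-1 -> hypu w z < 1 + e ->
  sqdist w z < 4 * w.2 ^+ 2 * e.
Proof.
move=> w0 z0 e4; rewrite /hypu ltrD2l ltr_pdivrMr ?mulr_gt0 // => h.
have s0 := sqdist_ge0 w z.
have e0 : 0 < e.
  rewrite ltNge; apply/negP => e0; have : e * (2 * w.2 * z.2) <= 0.
    by rewrite mulr_le0_ge0 // !mulr_ge0 // ltW.
  lra.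
have z2 : z.2 <= 2 * w.2.
  rewrite leNgt; apply/negP => zw.
  have h1 : (w.2 - z.2) ^+ 2 <= sqdist w z by rewrite /sqdist lerDr sqr_ge0.
  have h2 : e * (2 * w.2 * z.2) <= 4^-1 * (2 * w.2 * z.2) by rewrite ler_wpM2r // !mulr_ge0 // ltW.
  have h3 : 0 < z.2 * (z.2 - 2 * w.2) by rewrite mulr_gt0 // subr_gt0.
  have := sqr_ge0 w.2; have := sqr_ge0 (z.2 - w.2 * 2); nra.
apply: lt_le_trans h _; have : w.2 * z.2 <= w.2 * (2 * w.2) by rewrite ler_wpM2l // ltW.
move=> h4; have := ler_wpM2l (ltW e0) h4; nra.
Qed.

Lemma hypu_near w (U : set (R * R)) : 0 < w.2 -> nbhs w U -> exists N, forall n, (N <= n)%N ->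
  forall z, 0 < z.2 -> hypu w z < 1 + 2 / n%:R -> U z.
Proof.
move=> w0 /nbhs_ballP[d /= d0 hU].
pose N := (maxn 8 (Num.truncn (8 * w.2 ^+ 2 / d ^+ 2)).+1)%N.
exists N => n Nn z z0 hz; apply: hU.
have n8 : 8 <= n%:R :> R by rewrite (ler_nat R 8) (leq_trans _ Nn) // leq_maxl.
have nd : 8 * w.2 ^+ 2 / d ^+ 2 < n%:R.
  by apply: lt_le_trans (truncnS_gt _) _; rewrite ler_nat (leq_trans _ Nn) // leq_maxr.
have e4 : 2 / n%:R <= 4^-1 :> R by rewrite ler_pdivrMr; lra.
have := hypu_close w0 z0 e4 hz => h.
have : 4 * w.2 ^+ 2 * (2 / n%:R) < d ^+ 2.
  move: nd; rewrite ltr_pdivrMr ?exprn_gt0 // => nd.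
  by rewrite mulrA ltr_pdivrMr; lra.
move=> h2; have {h h2}h : sqdist w z < d ^+ 2 by exact: lt_trans h h2.
have s1 := sqr_ge0 (w.1 - z.1); have s2 := sqr_ge0 (w.2 - z.2).
split; rewrite /ball /= -(ltr_pXn2r (n := 2)) ?nnegrE ?(ltW d0) // real_normK ?num_real //;
  by apply: le_lt_trans h; rewrite /sqdist ?lerDl ?lerDr.
Qed.

Lemma mass_le_kn n : (1 < n)%N -> mass_le (@kn R n) 1.
Proof. by move=> n1; rewrite /mass_le mass_kn // mulr1. Qed.

Lemma hyp_mass_kn n w : (1 < n)%N -> 0 < w.2 ->
  (\int[hyp]_(z in H) (kn n (hypu w z))%:E = 1%:E)%E.
Proof.
move=> n1 w0; have kk : rkernel (@kn R n) by apply: rkernel_kn; exact: ltnW.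
have [_ k0 _] := kk.
have mE : measurable_fun setT (fun x => (@kn R n x)%:E) by apply/measurable_EFinP; exact: rkernel_measurable.
have kE x : (0 <= (@kn R n x)%:E)%E by rewrite lee_fin.
by rewrite (integral_radial w0 mE kE) mass_kn // -EFinM mulfV // gt_eqF // pi2_gt0.
Qed.

Lemma kint_near n (phi : R * R -> R) w (c e : R) : (1 < n)%N -> 0 < w.2 -> measurable_fun setT phi ->
  (forall z, 0 < z.2 -> hypu w z < 1 + 2 / n%:R -> `|phi z - c| <= e) ->
  hyp.-integrable H (fun z => (kn n (hypu w z) * phi z)%:E) /\ `|kint (kn n) phi w - c| <= e.
Proof.
move=> n1 w0 mphi hphi; have kk : rkernel (@kn R n) by apply: rkernel_kn; exact: ltnW.
have [_ k0 _] := kk.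
have e0 : 0 <= e.
  apply: le_trans (normr_ge0 _) (hphi w w0 _).
  by rewrite hypuxx // ltrDl divr_gt0 // ltr0n ltnW.
have mk : measurable_fun H (fun z => kn n (hypu w z)).
  by apply: (@measurable_funS _ _ _ _ setT) => //; exact: measurable_rkernel_hypu.
have Ik : hyp.-integrable H (fun z => (kn n (hypu w z))%:E).
  apply/integrableP; split; first exact/measurable_EFinP.
  by under eq_integral => z _ do rewrite gee0_abs ?lee_fin //; rewrite hyp_mass_kn // ltry.
have bd z : 0 < z.2 -> kn n (hypu w z) * `|phi z - c| <= kn n (hypu w z) * e.
  move=> z0; have [->|kz] := eqVneq (kn n (hypu w z)) 0; first by rewrite !mul0r.
  by rewrite ler_wpM2l // hphi //; have /andP[] := kn_supp (ltnW n1) kz.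
have mphiH : measurable_fun H phi by apply: (@measurable_funS _ _ _ _ setT).
have Id : hyp.-integrable H (fun z => (kn n (hypu w z) * (phi z - c))%:E).
  apply: (le_integrable mH _ _ (integrableZl mH e Ik)).
    by apply/measurable_EFinP; apply: measurable_funM => //; exact: measurable_funB.
  move=> z z0; change (`|(kn n (hypu w z) * (phi z - c))%:E| <= `|(e * kn n (hypu w z))%:E|)%E.
  rewrite !abse_EFin lee_fin normrM [leRHS]normrM (ger0_norm (k0 (hypu w z))) (ger0_norm e0).
  by rewrite [leRHS]mulrC bd.
have Ikc : hyp.-integrable H (fun z => (c * kn n (hypu w z))%:E).
  by have := integrableZl mH c Ik; apply: eq_integrable => // z _; rewrite /= EFinM.
have I : hyp.-integrable H (fun z => (kn n (hypu w z) * phi z)%:E).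
  have := integrableD mH Id Ikc; apply: eq_integrable => // z _.
  by rewrite /= -EFinD; congr _%:E; ring.
split=> //.
have c1 : \int[hyp]_(z in H) (c * kn n (hypu w z)) = c.
  by rewrite RintegralZl // /Rintegral hyp_mass_kn // mulr1.
have -> : kint (kn n) phi w - c = \int[hyp]_(z in H) (kn n (hypu w z) * (phi z - c)).
  rewrite -{1}c1 /kint -RintegralB //; apply: eq_Rintegral => z _; ring.
apply: le_trans (le_normr_Rintegral mH Id) _.
have Ike : hyp.-integrable H (fun z => (e * kn n (hypu w z))%:E).
  by have := integrableZl mH e Ik; apply: eq_integrable => // z _; rewrite /= EFinM.
have -> : e = \int[hyp]_(z in H) (e * kn n (hypu w z)).
  by rewrite RintegralZl // /Rintegral hyp_mass_kn // mulr1.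
apply: le_Rintegral => //.
  by have := integrable_abse Id; apply: eq_integrable => // z _; rewrite /= abse_EFin.
by move=> z z0; rewrite normrM (ger0_norm (k0 (hypu w z))) [leRHS]mulrC bd.
Qed.
End Averages.

(** * Functions orthogonal to the kernels vanish *)

Section Density.
Variable R : realType.
Implicit Types (z w : R * R).
Local Notation hyp := (@hyp_measure R).
Local Notation H := (upper_half R).
Let mH : measurable H. Proof. exact: measurable_upper_half. Qed.

Definition cutoff (a c u : R) : R := 1 - step (a * u + c).

Lemma cutoff_itv a c u : 0 <= cutoff a c u <= 1.
Proof. by rewrite /cutoff; have /andP[h1 h2] := step_itv (a * u + c); apply/andP; split; lra. Qed.

Lemma cutoff1 a c u : a * u + c <= 0 -> cutoff a c u = 1.
Proof. by move=> h; have [_ _ _ s0 _] := @stepP R; rewrite /cutoff s0 // subr0. Qed.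

Lemma cutoff0 a c u : 1 <= a * u + c -> cutoff a c u = 0.
Proof. by move=> h; have [_ _ _ _ s1] := @stepP R; rewrite /cutoff s1 // subrr. Qed.

Lemma rkernel_cutoff a c : 0 <= a -> 1 <= a * 3 + c -> rkernel (cutoff a c).
Proof.
move=> a0 h; split=> [n|u|u u3].
- have : Cn n (setT : set (GRing.regular R)) (fun u => 1 + -1 * step (a * u + c)).
    apply: CnD; [exact: openT|exact: Cn_cst|apply: CnZ; first exact: openT].
    exact: Cn_affine_comp (Cn_step R n).
  by apply: Cn_eq; [exact: openT|move=> u _; rewrite mulN1r].
- by have /andP[] := cutoff_itv a c u.
- by apply: cutoff0; have := ler_wpM2l a0 u3; lra.
Qed.

Variable G : set 'M[R]_2.
Hypothesis CG : cofinite_fuchsian G.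
Let FG : fuchsian G. Proof. by case: CG. Qed.
Local Notation F := (fundom G).
Let mF : measurable F. Proof. exact: measurable_fundom. Qed.
Let mfunH (h : R * R -> \bar R) : measurable_fun setT h -> measurable_fun H h.
Proof. by move=> mh; apply: (@measurable_funS _ _ _ _ setT). Qed.

Variable h : R * R -> R.
Hypotheses (Lh : L2r G h)
  (h0 : forall n z, (8 <= n)%N -> 0 < z.2 -> kint (kn n) h z = 0).
Let mh : measurable_fun setT h. Proof. by case: Lh. Qed.

Let rk n : (8 <= n)%N -> rkernel (@kn R n).
Proof. by move=> n8; apply: rkernel_kn; exact: leq_trans n8. Qed.

Section Local.
Variable z0 : R * R.
Hypothesis z00 : 0 < z0.2.
(** Equal to 1 for [u <= 9/8] and to 0 for [u >= 5/4]. The function [D] below is 1 for [u <= 5/2]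
    and 0 for [u >= 3], and dominates all averages of functions bounded by [p]. *)
Let p w := cutoff 8 (-9) (hypu z0 w).
Let D w := cutoff 2 (-5) (hypu z0 w).
Let rp : rkernel (cutoff 8 (-9)). Proof. by apply: rkernel_cutoff; lra. Qed.
Let rD : rkernel (cutoff 2 (-5)). Proof. by apply: rkernel_cutoff; lra. Qed.
Let mp : measurable_fun setT p. Proof. exact: measurable_rkernel_hypu. Qed.
Let mD : measurable_fun setT D. Proof. exact: measurable_rkernel_hypu. Qed.
Let p01 w : 0 <= p w <= 1. Proof. exact: cutoff_itv. Qed.

(** For [n >= 8] the kernel reaches only to [u < 5/4]; by the sharp triangle inequality an average
    of a function supported in [u <= 5/4] vanishes beyond [u - 1 = 2 (1/4 + 1/4 + 1/16) < 3/2],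
    hence where [u > 5/2]. *)
Lemma average_dominated n (phi : R * R -> R) w : (8 <= n)%N -> 0 < w.2 ->
  measurable_fun setT phi -> (forall z, 0 <= phi z <= p z) -> 0 <= kint (kn n) phi w <= D w.
Proof.
move=> n8 w0 mphi hphi; have n1 : (1 < n)%N by exact: leq_trans n8.
have [hw|hw] := leP (hypu z0 w) (5 / 2).
  have -> : D w = 1 by apply: cutoff1; lra.
  (* Values in [[0, 1]] are those within 1/2 of 1/2, and averaging preserves this. *)
  have [|_] := @kint_near _ n phi w (1 / 2) (1 / 2) n1 w0 mphi.
    by move=> z _ _; have /andP[a b] := hphi z; have /andP[_ c] := p01 z; rewrite ler_norml; apply/andP; split; lra.
  by rewrite ler_norml => /andP[a b]; apply/andP; split; lra.
have [|_] := @kint_near _ n phi w 0 0 n1 w0 mphi.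
  move=> z z_0 hz; have pz : p z = 0.
    apply: cutoff0; rewrite leNgt; apply/negP => pz.
    have n8' : 8 <= n%:R :> R by rewrite (ler_nat R 8).
    have e4 : 2 / n%:R <= 4^-1 :> R by rewrite ler_pdivrMr; lra.
    have := hypu_triangle_sharp z00 z_0 w0; rewrite [hypu z w]hypuC.
    have := hypu_ge1 z00 z_0; have := hypu_ge1 w0 z_0; nra.
  by have := hphi z; rewrite pz subr0 => /andP[a b]; rewrite ger0_norm.
by rewrite subr0 normr_le0 => /eqP ->; rewrite lexx /=; have /andP[] := cutoff_itv 2 (-5) (hypu z0 w).
Qed.

Lemma average_pairing n (phi hp : R * R -> R) : (8 <= n)%N -> measurable_fun setT phi ->
  (forall z, 0 <= phi z <= p z) -> L2r G hp -> (forall z, 0 <= hp z) ->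
  (\int[hyp]_(w in H) (hp w * kint (kn n) phi w)%:E =
   \int[hyp]_(z in H) (phi z * ipr G (aut G (kn n) z) hp)%:E)%E.
Proof.
move=> n8 mphi hphi Lhp hp0; have kk := rk n8; have [_ k0 _] := kk.
have n1 : (1 < n)%N by exact: leq_trans n8.
have mk := measurable_rkernel2 kk; have [_ mhp _] := Lhp.
pose c w z : \bar R := (kn n (hypu w z) * (hp w * phi z))%:E.
have c0 w z : (0 <= c w z)%E.
  by rewrite lee_fin mulr_ge0 // mulr_ge0 //; have /andP[] := hphi z.
have mc : measurable_fun setT (fun p => c p.1 p.2).
  apply/measurable_EFinP; apply: measurable_funM => //; apply: measurable_funM.
    exact: measurableT_comp mhp _.
  exact: measurableT_comp mphi _.
transitivity (\int[hyp]_(w in H) (\int[hyp]_(z in H) c w z))%E.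
  apply: eq_integral => w; rewrite inE => w0.
  have [|I _] := @kint_near _ n phi w (1 / 2) (1 / 2) n1 w0 mphi.
    by move=> z _ _; have /andP[a b] := hphi z; have /andP[_ d] := p01 z; rewrite ler_norml; apply/andP; split; lra.
  rewrite EFinM /kint /Rintegral fineK; last exact: integrable_fin_num.
  rewrite -ge0_integralZl_EFin //; last 2 first.
  - by move=> z _; rewrite lee_fin mulr_ge0 //; have /andP[] := hphi z.
  - by apply: mfunH; apply/measurable_EFinP; apply: measurable_funM => //; exact: measurable_rkernel_hypu.
  by apply: eq_integral => z _; rewrite /c -EFinM; congr _%:E; ring.
rewrite (hyp_tonelli mH mH mc c0).
apply: eq_integral => z; rewrite inE => z_0.
rewrite EFinM -(ipr_aut_pos CG kk z_0 Lhp hp0) -ge0_integralZl_EFin //; last 3 first.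
- by move=> w _; rewrite lee_fin mulr_ge0.
- by apply: mfunH; apply/measurable_EFinP; apply: measurable_funM => //; exact: measurable_rkernel_hypu.
- by have /andP[] := hphi z.
by apply: eq_integral => w _; rewrite /c -EFinM hypuC; congr _%:E; ring.
Qed.

Let Lp := L2r_fpos CG Lh.
Let Ln := L2r_fneg CG Lh.

(** Moving the kernel from [phi] to the positive and negative parts of [h] leaves their difference
    paired with the automorphic kernels, which is 0 by hypothesis. *)
Lemma averages_agree n (phi : R * R -> R) : (8 <= n)%N -> measurable_fun setT phi ->
  (forall z, 0 <= phi z <= p z) ->
  (\int[hyp]_(w in H) (fpos h w * kint (kn n) phi w)%:E =
   \int[hyp]_(w in H) (fneg h w * kint (kn n) phi w)%:E)%E.
Proof.
move=> n8 mphi hphi; have kk := rk n8; have hs := sip_L2r CG.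
rewrite (average_pairing n8 mphi hphi Lp (fpos_ge0 h)) (average_pairing n8 mphi hphi Ln (fneg_ge0 h)).
apply: eq_integral => z; rewrite inE => z_0; congr (_ * _)%:E; apply/eqP; rewrite -subr_eq0.
rewrite -(ipBr hs Lp Ln (aut_L2r CG kk z_0)) -fposneg_fun -(kint_ipr CG kk z_0 Lh) h0 //.
Qed.

Lemma average_limit (phi hp : R * R -> R) (N : set (R * R)) : measurable_fun setT phi ->
  (forall z, 0 <= phi z <= p z) -> L2r G hp -> (forall z, 0 <= hp z) ->
  measurable N -> hyp N = 0%E -> (forall w, 0 < w.2 -> ~ N w -> {for w, continuous phi}) ->
  ((\int[hyp]_(w in H) (hp w * kint (kn (n + 8)) phi w)%:E)%E @[n --> \oo] -->
   (\int[hyp]_(w in H) (hp w * phi w)%:E)%E).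
Proof.
move=> mphi hphi Lhp hp0 mN N0 cphi; have [_ mhp _] := Lhp.
have n8 n : (8 <= n + 8)%N by exact: leq_addl.
have mkp n : measurable_fun setT (kint (kn (n + 8)) phi) by apply: measurable_kint => //; exact: rk.
have mHN : measurable (H `\` N) by exact: measurableD.
have red (f : R * R -> R) : measurable_fun setT f -> (forall w, 0 <= f w) ->
    (\int[hyp]_(w in H) (f w)%:E = \int[hyp]_(w in H `\` N) (f w)%:E)%E.
  move=> mf f0; apply: ge0_negligible_integral => //.
    by apply: mfunH; apply/measurable_EFinP.
  by move=> w _; rewrite lee_fin.
have kint0 n w : 0 < w.2 -> 0 <= kint (kn (n + 8)) phi w <= D w.
  by move=> w0; exact: average_dominated.
have phi0 w : 0 <= phi w by have /andP[] := hphi w.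
pose cut f w : R := if 0 < w.2 then f w else 0.
have mcut f : measurable_fun setT f -> measurable_fun setT (cut f).
  move=> mf; apply: measurable_fun_ifT => //; exact: measurable_fun_ltr.
have redH (f : R * R -> R) : measurable_fun setT f -> (forall w, 0 < w.2 -> 0 <= f w) ->
    (\int[hyp]_(w in H) (f w)%:E = \int[hyp]_(w in H `\` N) (f w)%:E)%E.
  move=> mf f0; transitivity (\int[hyp]_(w in H) (cut f w)%:E)%E.
    by apply: eq_integral => w; rewrite inE => w0; rewrite /cut (w0 : 0 < w.2).
  rewrite red; last 2 first.
  - exact: mcut.
  - by move=> w; rewrite /cut; case: ifP => // w0; exact: f0.
  by apply: eq_integral => w; rewrite inE => -[w0 _]; rewrite /cut (w0 : 0 < w.2).
rewrite redH; last 2 first.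
- exact: measurable_funM.
- by move=> w _; rewrite mulr_ge0.
under eq_fun => n.
  rewrite redH; last 2 first.
  - by apply: measurable_funM.
  - by move=> w w0; rewrite mulr_ge0 //; have /andP[] := kint0 n w w0.
  over.
have ID := integrable_kernel_pos CG rD z00 Lhp hp0.
apply: (@dominated_cvg _ _ _ hyp (H `\` N) mHN (fun n w => (hp w * kint (kn (n + 8)) phi w)%:E)
  (fun w => (hp w * phi w)%:E) (fun w => (D w * hp w)%:E)).
- move=> n; apply: (@measurable_funS _ _ _ _ setT) => //; apply/measurable_EFinP; exact: measurable_funM.
- move=> w [w0 wN]; apply: cvg_EFin; first exact: nearW.
  apply: cvgM; first exact: cvg_cst.
  apply/cvgrPdist_le => e e0.
  have cw := cphi w w0 wN.
  have nU : nbhs w [set z | `|phi z - phi w| <= e].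
    have /cvgrPdist_le /(_ e e0) := cw.
    by apply: filterS => z; rewrite distrC.
  have [M hM] := hypu_near w0 nU.
  exists M => // n /= Mn; rewrite distrC.
  have Mn8 : (M <= n + 8)%N by exact: leq_trans Mn (leq_addr _ _).
  have n1 : (1 < n + 8)%N by exact: leq_trans (n8 n).
  have [|_ //] := @kint_near _ (n + 8) phi w (phi w) e n1 w0 mphi.
  by move=> z z_0 hz; exact: (hM _ Mn8).
- by move=> w _.
- by apply: integrableS ID => //; exact: subDsetl.
- move=> n w [w0 _]; rewrite abse_EFin lee_fin.
  have /andP[a b] := kint0 n w w0; rewrite ger0_norm ?mulr_ge0 // mulrC ler_wpM2r //.
Qed.

Lemma ocitv_boundary (A : set R) : ocitv A -> exists NA : set R,
  [/\ measurable NA, (@lebesgue_measure R) NA = 0%E &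
      forall x, ~ NA x -> \forall y \near x, (y \in A) = (x \in A)].
Proof.
move=> /ocitvP[->|[[a b] /= ab ->]].
  by exists set0; split=> // x _; apply: (@nearW _ (nbhs x)) => y; rewrite !in_set0.
exists ([set a] `|` [set b]); split.
- by apply: measurableU; exact: measurable_set1.
- apply/eqP; rewrite eq_le measure_ge0 andbT.
  apply: le_trans (measureU2 _ _ _) _; try exact: measurable_set1.
  by rewrite [X in (X + _)%E]lebesgue_measure_set1 add0e [X in (X <= _)%E]lebesgue_measure_set1.
- move=> x /not_orP[/= xa xb].
  have E (y : R) : (y \in (`]a, b]%classic : set R)) = (a < y) && (y <= b) by rewrite mem_setE in_itv.
  have [ax|xa'] := ltP a x; last first.
    have {xa'}xa' : x < a by rewrite lt_neqAle xa' andbT; apply/eqP.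
    near=> y; have ya : y < a by near: y; exact: lt_nbhsl.
    by rewrite !E (ltNge a y) (ltW ya) (ltNge a x) (ltW xa').
  have [xb'|bx] := leP x b; last first.
    near=> y; have yb : b < y by near: y; exact: lt_nbhsr.
    by rewrite !E (leNgt y) yb (leNgt x) bx /= !andbF.
  have {xb'}xb' : x < b by rewrite lt_neqAle xb' andbT; apply/eqP.
  near=> y; have ya : a < y by near: y; exact: lt_nbhsr.
  have yb : y < b by near: y; exact: lt_nbhsl.
  by rewrite !E ax ya !ltW.
Unshelve. all: by end_near. Qed.

Lemma hyp_stripes (NA NB : set R) : measurable NA -> measurable NB ->
  (@lebesgue_measure R) NA = 0%E -> (@lebesgue_measure R) NB = 0%E ->
  hyp (NA `*` setT `|` setT `*` NB) = 0%E.
Proof.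
move=> mNA mNB A0 B0; have m1 : measurable (NA `*` (setT : set R)) by exact: measurableX.
have m2 : measurable ((setT : set R) `*` NB) by exact: measurableX.
have z (N : set (R * R)) : measurable N -> ((@lebesgue_measure R) \x (@lebesgue_measure R))%E N = 0%E -> hyp N = 0%E.
  move=> mN N0; rewrite /= /hyp_measure null_set_integral //.
  by apply: (@measurable_funS _ _ _ _ setT) => //; exact: measurable_hyp_density.
apply/eqP; rewrite eq_le measure_ge0 andbT.
apply: le_trans (measureU2 _ m1 m2) _.
rewrite [X in (X + _)%E]z ?add0e //; last first.
  transitivity (lebesgue_measure NA * lebesgue_measure (setT : set R))%E; first exact: product_measure1E.
  by rewrite [X in (X * _)%E]A0 mul0e.
rewrite [X in (X <= _)%E]z //.
transitivity (lebesgue_measure (setT : set R) * lebesgue_measure NB)%E; first exact: product_measure1E.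
by rewrite [X in (_ * X)%E]B0 mule0.
Qed.

Let fp w : \bar R := (fpos h w * p w * \1_H w)%:E.
Let fm w : \bar R := (fneg h w * p w * \1_H w)%:E.
Let fp0 w : (0 <= fp w)%E.
Proof. by rewrite lee_fin mulr_ge0 // mulr_ge0 ?fpos_ge0 //; have /andP[] := p01 w. Qed.
Let fm0 w : (0 <= fm w)%E.
Proof. by rewrite lee_fin mulr_ge0 // mulr_ge0 ?fneg_ge0 //; have /andP[] := p01 w. Qed.
Let mfp : measurable_fun setT fp.
Proof.
apply/measurable_EFinP; apply: measurable_funM; last exact: measurable_indic.
by apply: measurable_funM => //; case: Lp.
Qed.
Let mfm : measurable_fun setT fm.
Proof.
apply/measurable_EFinP; apply: measurable_funM; last exact: measurable_indic.
by apply: measurable_funM => //; case: Ln.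
Qed.

(** The densities [fpos h] and [fneg h], cut off by [p], define finite measures. The averages of the
    indicator function of a box, cut off by [p], converge away from the boundary lines of the box, a
    null set; so the measures agree on boxes and hence on all measurable sets. *)
Lemma weighted_agree (A : set (R * R)) : measurable A ->
  (\int[hyp]_(w in A) fp w = \int[hyp]_(w in A) fm w)%E.
Proof.
suff : forall A, measurable A -> wmeasure mfp fp0 A = wmeasure mfm fm0 A by move=> H' mA; exact: H'.
have restr (B : set (R * R)) (f : R * R -> R) : measurable B ->
    (\int[hyp]_(w in B) (f w * p w * \1_H w)%:E = \int[hyp]_(w in H) (f w * (\1_B w * p w))%:E)%E.
  move=> mB; rewrite [LHS]integral_mkcond [RHS]integral_mkcond; apply: eq_integral => w _.
  rewrite !patchE !indicE; case: (w \in B); case: (w \in H); rewrite ?mulr1 ?mul1r ?mulr0 ?mul0r ?mulr0 //.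
apply: plane_measure_unique.
  rewrite /wmeasure /= /wmeas (restr setT) //.
  have /integrableP[_] := integrable_kernel_pos CG rp z00 Lp (fpos_ge0 h).
  apply: le_lt_trans; rewrite le_eqVlt; apply/orP; left; apply/eqP.
  apply: eq_integral => w _; rewrite indicT mul1r mulrC gee0_abs // lee_fin mulr_ge0 ?fpos_ge0 //.
  by have /andP[] := p01 w.
move=> A' B oA oB; rewrite /wmeasure /= /wmeas.
have mA : measurable A' by exact: sub_sigma_algebra.
have mB : measurable B by exact: sub_sigma_algebra.
have mAB : measurable (A' `*` B) by exact: measurableX.
rewrite !restr //.
have [NA [mNA NA0 hA]] := ocitv_boundary oA; have [NB [mNB NB0 hB]] := ocitv_boundary oB.
pose phi w : R := \1_(A' `*` B) w * p w.
have mphi : measurable_fun setT phi by apply: measurable_funM => //; exact: measurable_indic.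
have hphi z : 0 <= phi z <= p z.
  by rewrite /phi indicE; have /andP[a b] := p01 z; case: (z \in _); rewrite ?mul1r ?mul0r ?lexx ?a.
pose N : set (R * R) := NA `*` setT `|` setT `*` NB.
have mN : measurable N by apply: measurableU; exact: measurableX.
have cphi w : 0 < w.2 -> ~ N w -> {for w, continuous phi}.
  move=> w0 /not_orP[nA nB].
  have cp : {for w, continuous p}.
    by have [Cp _ _] := rp; have [/(_ w w0)] := smooth_radial z00 (Cp 0%N).
  have nw : \forall w' \near w, (w' \in A' `*` B) = (w \in A' `*` B).
    have h1 := hA w.1 (fun x => nA (conj x I)); have h2 := hB w.2 (fun x => nB (conj I x)).
    have c1 : (fst : R * R -> R) w' @[w' --> w] --> w.1 by exact: cvg_fst.
    have c2 : (snd : R * R -> R) w' @[w' --> w] --> w.2 by exact: cvg_snd.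
    have q1 : (\forall w' \near w, (w'.1 \in A') = (w.1 \in A')) by exact: c1 _ h1.
    have q2 : (\forall w' \near w, (w'.2 \in B) = (w.2 \in B)) by exact: c2 _ h2.
    apply: filterS2 q1 q2 => w' e1 e2.
    by rewrite !in_setX e1 e2.
  rewrite /prop_for /continuous_at /phi indicE.
  have c' : (\1_(A' `*` B) w : R) * p w' @[w' --> w] --> (w \in A' `*` B)%:R * p w.
    by rewrite indicE; apply: cvgM => //; exact: cvg_cst.
  apply: cvg_trans c'; apply: near_eq_cvg; apply: filterS nw => w' E.
  by rewrite !indicE E.
have N0 := hyp_stripes mNA mNB NA0 NB0.
have l1 := average_limit mphi hphi Lp (fpos_ge0 h) mN N0 cphi.
have l2 := average_limit mphi hphi Ln (fneg_ge0 h) mN N0 cphi.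
rewrite -(cvg_lim _ l1) // -(cvg_lim _ l2) //; congr (lim _).
congr (_ @ \oo); apply/funext => n; apply: averages_agree => //; exact: leq_addl.
Qed.

(** The set where [h] is positive is null for the measure given by the negative part, hence for the
    equal measure given by the positive part; so both densities vanish almost everywhere. *)
Lemma local_zero : {ae hyp, forall w, 0 < w.2 -> p w = 1 -> h w = 0}.
Proof.
pose A : set (R * R) := [set w | 0 < h w].
have mA : measurable A.
  have -> : A = setT `&` h @^-1` `]0, +oo[%classic.
    by rewrite setTI; apply/seteqP; split=> w; rewrite /A /= in_itv /= andbT.
  by apply: mh => //; exact: measurable_itv.
have z1 : (\int[hyp]_(w in A) fm w = 0)%E.
  apply: integral0_eq => w hw; rewrite /fm /fneg max_r ?mul0r ?mul0r //.
  by rewrite oppr_le0 ltW.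
have z2 : (\int[hyp]_w fp w = 0)%E.
  rewrite -z1 -weighted_agree // [RHS]integral_mkcond; apply: eq_integral => w _.
  rewrite patchE; case: ifPn => //; rewrite notin_setE /A /= => /negP; rewrite -leNgt => hw.
  by rewrite /fp /fpos max_r // !mul0r.
have z3 : (\int[hyp]_w fm w = 0)%E by rewrite -weighted_agree.
have a1 : ae_eq hyp setT fp (cst 0%E).
  apply/ae_eq_integral_abs => //.
  by rewrite -[RHS]z2; apply: eq_integral => w _; rewrite gee0_abs.
have a2 : ae_eq hyp setT fm (cst 0%E).
  apply/ae_eq_integral_abs => //.
  by rewrite -[RHS]z3; apply: eq_integral => w _; rewrite gee0_abs.
apply: filterS2 a1 a2 => w e1 e2 w0 p1.
have := e1 I; have := e2 I; rewrite /fp /fm /= p1 indicE mem_set // !mulr1 => -[E2] -[E1].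
by rewrite fposneg E1 E2 subrr.
Qed.
End Local.

(** A dense sequence in the half-plane; the default [(0, 1)] keeps every term inside. *)
Definition rat_point (n : nat) : R * R :=
  if @choice.unpickle (rat * rat)%type n is Some q then
    (if 0 < (ratr q.2 : R) then (ratr q.1, ratr q.2) else (0, 1)) else (0, 1).

Lemma rat_point_upper n : 0 < (rat_point n).2.
Proof. by rewrite /rat_point; case: choice.unpickle => [[a b]|] /=; [case: ifP|]. Qed.

Lemma rat_point_dense w (e : R) : 0 < w.2 -> 0 < e -> exists n, hypu (rat_point n) w < 1 + e.
Proof.
move=> w0 e0.
have c : {for w, continuous (hypu w)} by have [/(_ w w0)] := smooth_hypu 0 w0.
have n1 : (\forall q \near w, hypu w q < 1 + e).
  by apply: (c [set t : R | t < 1 + e]); apply: lt_nbhsl; rewrite hypuxx // ltrDl.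
have n2 : (\forall q \near w, 0 < q.2) by exact: (open_nbhs_nbhs (conj (@open_upper_half R) w0)).
have nn : nbhs w ([set q | hypu w q < 1 + e] `&` [set q | 0 < q.2]) by exact: filterI n1 n2.
have /nbhs_ballP[d /= d0 hd] := nn.
have [a] : exists q : rat, ratr q \in `]w.1 - d, w.1 + d[ by apply: rat_in_itvoo; lra.
have [b] : exists q : rat, ratr q \in `]w.2 - d, w.2 + d[ by apply: rat_in_itvoo; lra.
rewrite !in_itv /= => /andP[b1 b2] /andP[a1 a2].
have [h1 h2] : (hypu w (ratr a, ratr b) < 1 + e) /\ (0 < (ratr b : R)).
  by apply: (hd (ratr a, ratr b)); split; rewrite /ball /= ltr_norml; apply/andP; split; lra.
exists (@choice.pickle (rat * rat)%type (a, b)); rewrite /rat_point choice.pickleK /= h2 hypuC //.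
Qed.

Theorem orthogonal_kernels_zero : ipr G h h = 0.
Proof.
rewrite /ipr /qint /Rintegral.
rewrite (_ : (\int[hyp]_(z in F) (h z * h z)%:E)%E = 0%E) ?mulr0 //.
have mhh : measurable_fun F (fun z => (h z * h z)%:E).
  by apply: (@measurable_funS _ _ _ _ setT) => //; apply/measurable_EFinP; exact: measurable_funM.
rewrite (@ge0_ae_eq_integral _ _ _ hyp F _ (cst 0%E)) ?integral0 //.
  by move=> z _; rewrite lee_fin -expr2 sqr_ge0.
pose Nn n := ~` [set w | 0 < w.2 -> cutoff 8 (-9) (hypu (rat_point n) w) = 1 -> h w = 0].
have : hyp.-negligible (\bigcup_n Nn n).
  by apply: negligible_bigcup => n; exact: (local_zero (rat_point_upper n)).
apply: negligibleS => w hw; apply: contrapT => nN; apply: hw => Fw.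
have w0 := fundom_upper Fw.
have i8 : 0 < 8^-1 :> R by rewrite invr_gt0.
have [n hn] := rat_point_dense w0 i8.
suff -> : h w = 0 by rewrite mulr0.
apply: contrapT => hw0; apply: nN; exists n => // h'; apply: hw0; apply: h' => //.
by apply: cutoff1; lra.
Qed.
End Density.

(** * The Green operator *)

Section ComplexL2.
Variable R : realType.
Implicit Types (z w : R * R) (f g : R * R -> R) (u v : R * R -> R[i]).
Local Notation hyp := (@hyp_measure R).
Local Notation H := (upper_half R).
Let mH : measurable H. Proof. exact: measurable_upper_half. Qed.

(** The cut at the boundary is needed because [L2] gives measurability on the half-plane only, while
    [L2r] asks for it on the plane. *)
Definition re u z : R := if 0 < z.2 then complex.Re (u z) else 0.
Definition im u z : R := if 0 < z.2 then complex.Im (u z) else 0.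
Definition cplx f z : R[i] := Complex (f z) 0.

Lemma re_cplx f z : 0 < z.2 -> re (cplx f) z = f z.
Proof. by rewrite /re => ->. Qed.

Lemma im_cplx f z : im (cplx f) z = 0.
Proof. by rewrite /im; case: ifP. Qed.

Lemma measurable_cut f : measurable_fun H f -> measurable_fun setT (fun z => if 0 < z.2 then f z else 0).
Proof.
move=> mf; have -> : (fun z => if 0 < z.2 then f z else 0) = (f \_ H).
  apply/funext => z; rewrite patchE; case: ifPn => z0; first by rewrite mem_set.
  by rewrite memNset //; exact/negP.
exact/(measurable_restrictT _ mH).
Qed.

Section Fixed.
Variable G : set 'M[R]_2.
Hypothesis CG : cofinite_fuchsian G.
Let FG : fuchsian G. Proof. by case: CG. Qed.
Let sG : SL2_subgroup G. Proof. by case: FG. Qed.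
Local Notation F := (fundom G).
Local Notation sf := (stack_factor G).
Let mF : measurable F. Proof. exact: measurable_fundom. Qed.
Let sf0 : 0 < sf. Proof. exact: stack_factor_gt0. Qed.
Let mfunF (h : R * R -> \bar R) : measurable_fun setT h -> measurable_fun F h.
Proof. by move=> mh; apply: (@measurable_funS _ _ _ _ setT). Qed.
Let FH : F `<=` H. Proof. by move=> z /fundom_upper. Qed.

Lemma L2_sq_le u (f : R * R -> R) : L2 G u -> measurable_fun setT f -> mobius_invariant G f ->
  (forall z, 0 < z.2 -> f z ^+ 2 <= complex.Re (u z) ^+ 2 + complex.Im (u z) ^+ 2) -> L2r G f.
Proof.
move=> [_ mr mi Iu] mf If h; split=> //; apply: le_lt_trans Iu; apply: ge0_le_integral => //.
- by move=> z _; rewrite lee_fin sqr_ge0.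
- by apply: mfunF; apply/measurable_EFinP; exact: measurable_funX.
- apply: (@measurable_funS _ _ _ _ H) => //; apply/measurable_EFinP.
  by apply: measurable_funD; exact: measurable_funX.
- by move=> z /fundom_upper z0; rewrite lee_fin h.
Qed.

Lemma inv_upper (g : 'M[R]_2) z : G g -> 0 < z.2 -> 0 < (mobius g z).2.
Proof. by move=> Gg; apply: mobius_upper; case: sG => Gd _ _ _; exact: Gd. Qed.

Lemma L2_re u : L2 G u -> L2r G (re u).
Proof.
move=> Lu; have [Iu mr mi _] := Lu; apply: (L2_sq_le Lu); first exact: measurable_cut.
  by move=> g z Gg z0; rewrite /re inv_upper // (z0 : 0 < z.2) Iu.
by move=> z z0; rewrite /re z0 lerDl sqr_ge0.
Qed.

Lemma L2_im u : L2 G u -> L2r G (im u).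
Proof.
move=> Lu; have [Iu mr mi _] := Lu; apply: (L2_sq_le Lu); first exact: measurable_cut.
  by move=> g z Gg z0; rewrite /im inv_upper // (z0 : 0 < z.2) Iu.
by move=> z z0; rewrite /im z0 lerDr sqr_ge0.
Qed.

Lemma L2_parts u : mobius_invariant G u -> L2r G (re u) -> L2r G (im u) -> L2 G u.
Proof.
move=> Iu Lr Li; have [_ mr Nr] := Lr; have [_ mi Ni] := Li; split=> //.
- apply: (eq_measurable_fun (re u)); last by apply: (@measurable_funS _ _ _ _ setT).
  by move=> z; rewrite inE /re => ->.
- apply: (eq_measurable_fun (im u)); last by apply: (@measurable_funS _ _ _ _ setT).
  by move=> z; rewrite inE /im => ->.
rewrite (eq_integral (fun z => ((re u z ^+ 2)%:E + (im u z ^+ 2)%:E)%E)); last first.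
  by move=> z; rewrite inE => /fundom_upper z0; rewrite /re /im z0 EFinD.
rewrite ge0_integralD //.
- exact: lte_add_pinfty.
- by move=> z _; rewrite lee_fin sqr_ge0.
- by apply: mfunF; apply/measurable_EFinP; exact: measurable_funX.
- by move=> z _; rewrite lee_fin sqr_ge0.
- by apply: mfunF; apply/measurable_EFinP; exact: measurable_funX.
Qed.

Lemma L2_cplx f : L2r G f -> L2 G (cplx f).
Proof.
move=> Lf; have [If mf _] := Lf; apply: L2_parts.
- by move=> g z Gg z0; rewrite /cplx If.
- apply: (L2r_eq CG _ _ Lf) => [z z0|]; first by rewrite re_cplx.
  by apply: (@measurable_cut (fun z => f z)); apply: (@measurable_funS _ _ _ _ setT).
- rewrite (_ : im (cplx f) = fun=> 0); first exact: L2r_0.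
  by apply/funext => z; exact: im_cplx.
Qed.

Lemma qint_eq f g : (forall z, 0 < z.2 -> f z = g z) -> qint G f = qint G g.
Proof.
by move=> fg; congr (_ * _); apply: eq_Rintegral => z; rewrite inE => /fundom_upper /fg.
Qed.

Lemma qintD f g f' g' : L2r G f -> L2r G g -> L2r G f' -> L2r G g' ->
  qint G (fun z => f z * g z + f' z * g' z) = ipr G f g + ipr G f' g'.
Proof.
move=> L1 L2 L3 L4; rewrite /ipr /qint -mulrDr RintegralD //;
  by apply: L2r_integrable_mul.
Qed.

Lemma qintB f g f' g' : L2r G f -> L2r G g -> L2r G f' -> L2r G g' ->
  qint G (fun z => f z * g z - f' z * g' z) = ipr G f g - ipr G f' g'.
Proof.
move=> L1 L2 L3 L4; rewrite /ipr /qint -mulrBr RintegralB //;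
  by apply: L2r_integrable_mul.
Qed.

Lemma inner_re u v : L2 G u -> L2 G v ->
  complex.Re (inner G u v) = ipr G (re u) (re v) + ipr G (im u) (im v).
Proof.
move=> Lu Lv; rewrite -qintD; [|exact: L2_re|exact: L2_re|exact: L2_im|exact: L2_im].
rewrite /inner /qintC /=; apply: qint_eq => z z0; rewrite /re /im z0.
by case: (u z) => a b; case: (v z) => c d /=; rewrite mulrN opprK.
Qed.

Lemma inner_im u v : L2 G u -> L2 G v ->
  complex.Im (inner G u v) = ipr G (im u) (re v) - ipr G (re u) (im v).
Proof.
move=> Lu Lv; rewrite -qintB; [|exact: L2_im|exact: L2_re|exact: L2_re|exact: L2_im].
rewrite /inner /qintC /=; apply: qint_eq => z z0; rewrite /re /im z0.
by case: (u z) => a b; case: (v z) => c d /=; rewrite mulrN; ring.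
Qed.

Lemma L2r_1 : L2r G (fun=> 1).
Proof. by apply: (L2r_bounded CG (M := 1)) => // z _; rewrite normr1. Qed.

Lemma ipr_cst0 f : ipr G f (fun=> 0) = 0.
Proof.
rewrite /ipr /qint /Rintegral (_ : (\int[hyp]_(z in F) (f z * 0)%:E)%E = 0%E) ?mulr0 //.
by apply: integral0_eq => z _; rewrite mulr0.
Qed.

Lemma ipr_1 f : ipr G f (fun=> 1) = qint G f.
Proof. by apply: qint_eq => z _; rewrite mulr1. Qed.

Lemma vol_ipr : vol G = ipr G (fun=> 1) (fun=> 1).
Proof. by rewrite ipr_1. Qed.

Lemma ipr_ae f f' g : L2r G f -> L2r G f' -> L2r G g ->
  {ae hyp, forall z, F z -> f z = f' z} -> ipr G f g = ipr G f' g.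
Proof.
move=> [_ mf _] [_ mf' _] [_ mg _] ff'; congr (_ * _); rewrite /Rintegral; congr fine.
apply: ae_eq_integral => //.
- by apply: mfunF; apply/measurable_EFinP; exact: measurable_funM.
- by apply: mfunF; apply/measurable_EFinP; exact: measurable_funM.
- by apply: filterS ff' => z h Fz; rewrite h.
Qed.

Lemma smooth_bounded_aut k z : rkernel k -> 0 < z.2 -> smooth_bounded G (cplx (aut G k z)).
Proof.
move=> kk z0; split.
- by move=> g w Gg w0; rewrite /cplx aut_invr.
- exact: smooth_aut.
- by move=> n; exact: Cn_cst.
have [M hM] := aut_bounded FG kk z0; exists M => w w0.
rewrite /cplx normc_def /= expr0n addr0 sqrtr_sqr.
by rewrite lecE /= eqxx hM.
Qed.
End Fixed.
End ComplexL2.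

(** * The Green operator as inverse of the Laplacian *)

Section GreenOperator.
Variable R : realType.
Implicit Types (z w : R * R) (f g : R * R -> R) (u v : R * R -> R[i]).
Local Notation hyp := (@hyp_measure R).
Variable G : set 'M[R]_2.
Hypothesis CG : cofinite_fuchsian G.
Local Notation F := (fundom G).
Let hs := sip_L2r CG.
Local Notation ip := (ipr G).
Local Notation nr := (nrm (ipr G)).

Definition mean f : R := (vol G)^-1 * qint G f.
Definition mean0 f : R * R -> R := f - (fun=> mean f).

Lemma L2r_cst (c : R) : L2r G (fun=> c).
Proof. by apply: (L2r_bounded CG (M := `|c|)). Qed.

Lemma ipr_cst (c : R) f : L2r G f -> ip (fun=> c) f = c * qint G f.
Proof.
move=> Lf; have L1 := L2r_1 CG; have := ipZl hs c L1 Lf.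
rewrite [X in _ = c * X](sipC hs (fun=> 1) f) ipr_1 => <-.
by apply: ipr_eq => z _; change (c = c * 1); rewrite mulr1.
Qed.

Lemma L2r_mean0 f : L2r G f -> L2r G (mean0 f).
Proof. by move=> Lf; apply: (sipB hs) => //; exact: L2r_cst. Qed.

Lemma ipr_mean0 f g : L2r G f -> L2r G g -> ip (mean0 f) g = ip f g - (vol G)^-1 * qint G f * qint G g.
Proof. by move=> Lf Lg; rewrite /mean0 (ipBl hs Lf (L2r_cst _) Lg) ipr_cst. Qed.

Lemma ipr_mean0_sym f g : L2r G f -> L2r G g -> ip (mean0 f) g = ip f (mean0 g).
Proof.
move=> Lf Lg; rewrite (ipr_mean0 Lf Lg) (sipC hs f (mean0 g)) (ipr_mean0 Lg Lf) (sipC hs g f).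
by rewrite mulrAC.
Qed.

Lemma nrm_mean0 f : L2r G f -> nr (mean0 f) <= nr f.
Proof.
move=> Lf; have L0 := L2r_mean0 Lf; have L1 := L2r_1 CG.
rewrite -(ler_pXn2r (n := 2)) ?nnegrE ?nrm_ge0 // !(nrm_sq hs).
rewrite ipr_mean0 // (sipC hs) ipr_mean0 //.
have -> : qint G (mean0 f) = qint G f - (vol G)^-1 * qint G f * vol G.
  by rewrite -!(ipr_1 G) ipr_mean0 // ipr_1 (vol_ipr G) ipr_1.
have v0 : 0 <= vol G by rewrite (vol_ipr G) (sip_ge0 hs).
(* For volume 0 the convention [0^-1 = 0] makes the mean vanish. *)
have [->|vn] := eqVneq (vol G) 0; first by rewrite invr0 !mul0r !subr0.
rewrite (_ : (vol G)^-1 * qint G f * vol G = qint G f); last by rewrite mulrAC mulVf // mul1r.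
by rewrite subrr !mulr0 subr0 lerBlDr lerDl -mulrA mulr_ge0 ?invr_ge0 // -expr2 sqr_ge0.
Qed.

Lemma null_by_kernels h : L2r G h ->
  (forall n z, (8 <= n)%N -> 0 < z.2 -> ip (aut G (kn n) z) h = 0) -> ip h h = 0.
Proof.
move=> Lh h0; apply: (orthogonal_kernels_zero CG Lh) => n z n8 z0.
by rewrite (kint_ipr CG) ?h0 //; apply: rkernel_kn; exact: leq_trans n8.
Qed.

Lemma null_ipr f g : L2r G f -> L2r G g -> ip f f = 0 -> ip f g = 0.
Proof. by move=> Lf Lg f0; apply: (nrm0_ip hs) => //; rewrite /nrm f0 sqrtr0. Qed.

Lemma aut_kn_L2r n z : (8 <= n)%N -> 0 < z.2 -> L2r G (aut G (kn n) z).
Proof. by move=> n8 z0; apply: (aut_L2r CG) => //; apply: rkernel_kn; exact: leq_trans n8. Qed.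

Section Operator.
Variables (Delta : (R * R -> R[i]) -> (R * R -> R[i]) -> Prop)
  (S : (R * R -> R[i]) -> R * R -> R[i]) (gr : R * R -> R * R -> R).
Hypotheses (hD : laplacian G Delta) (hS : green_operator G Delta S) (hgr : green_function G S gr).

(** Taking the real part gives a symmetric bounded operator on real functions even where [S] is not
    known to preserve real functions; that is obtained from [gr], and for smooth bounded functions
    only. *)
Definition SR f : R * R -> R := re (S (cplx f)).

Let LS u : L2 G u -> L2 G (S u). Proof. by case: hS => -[+ _ _ _] _; apply. Qed.

Lemma L2r_SR f : L2r G f -> L2r G (SR f).
Proof. by move=> Lf; apply: (L2_re CG); apply: LS; exact: L2_cplx. Qed.

Lemma re_inner_cplx u f : L2 G u -> L2r G f -> complex.Re (inner G u (cplx f)) = ip (re u) f.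
Proof.
move=> Lu Lf; have Lc := L2_cplx CG Lf; rewrite (inner_re CG) //.
rewrite (_ : im (cplx f) = fun=> 0); last by apply/funext => z; exact: im_cplx.
rewrite ipr_cst0 addr0 (sipC hs) [RHS](sipC hs); apply: ipr_eq => z z0; exact: re_cplx.
Qed.

Lemma im_inner_cplx u f : L2 G u -> L2r G f -> complex.Im (inner G u (cplx f)) = ip (im u) f.
Proof.
move=> Lu Lf; have Lc := L2_cplx CG Lf; rewrite (inner_im CG) //.
rewrite (_ : im (cplx f) = fun=> 0); last by apply/funext => z; exact: im_cplx.
rewrite ipr_cst0 subr0 (sipC hs) [RHS](sipC hs); apply: ipr_eq => z z0; exact: re_cplx.
Qed.

Lemma re_inner_cplxl u f : L2 G u -> L2r G f -> complex.Re (inner G (cplx f) u) = ip f (re u).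
Proof.
move=> Lu Lf; have Lc := L2_cplx CG Lf; rewrite (inner_re CG) //.
rewrite (_ : im (cplx f) = fun=> 0); last by apply/funext => z; exact: im_cplx.
rewrite (sipC hs (fun=> 0)) ipr_cst0 addr0; apply: ipr_eq => z z0; exact: re_cplx.
Qed.

Lemma SR_sym f g : L2r G f -> L2r G g -> ip (SR f) g = ip f (SR g).
Proof.
move=> Lf Lg; have Cf := L2_cplx CG Lf; have Cg := L2_cplx CG Lg.
have [[_ _ _ sym] _] := hS.
by rewrite -re_inner_cplx ?sym ?re_inner_cplxl //; exact: LS.
Qed.

Lemma normsqE u : L2 G u -> normsq G u = ip (re u) (re u) + ip (im u) (im u).
Proof.
move=> Lu; rewrite -(qintD CG); [|exact: L2_re|exact: L2_re|exact: L2_im|exact: L2_im].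
by apply: qint_eq => z z0; rewrite /re /im z0 !expr2.
Qed.

Lemma SR_bounded : exists M, forall f, L2r G f -> nr (SR f) <= M * nr f.
Proof.
have [[_ _ [M hM] _] _] := hS; exists (Num.sqrt `|M|) => f Lf.
rewrite -(ler_pXn2r (n := 2)) ?nnegrE ?mulr_ge0 ?nrm_ge0 ?sqrtr_ge0 //.
rewrite exprMn !(nrm_sq hs) sqr_sqrtr //.
have Cf := L2_cplx CG Lf; have := hM _ Cf; rewrite !normsqE //; last exact: LS.
rewrite (_ : im (cplx f) = fun=> 0); last by apply/funext => z; exact: im_cplx.
rewrite ipr_cst0 addr0.
have -> : ip (re (cplx f)) (re (cplx f)) = ip f f.
  transitivity (ip f (re (cplx f))); first by apply: ipr_eq => z z0; exact: re_cplx.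
  by rewrite (sipC hs); apply: ipr_eq => z z0; exact: re_cplx.
have := sip_ge0 hs (im (S (cplx f))); have := ler_wpM2r (sip_ge0 hs f) (ler_norm M).
rewrite -/(SR f); lra.
Qed.

(** On smooth bounded functions [S] is given by the real kernel [gr]. *)
Lemma S_real f : L2r G f -> smooth_bounded G (cplx f) ->
  {ae hyp, forall z, F z -> im (S (cplx f)) z = 0}.
Proof.
move=> Lf sf; have [_ _ _ _ [_ hg]] := hgr; have h := hg _ sf.
apply: filterS h => z E Fz; rewrite /im (fundom_upper Fz) E /qintC /=.
rewrite -[RHS](mulr0 (stack_factor G)); congr (_ * _).
rewrite /Rintegral integral0_eq // => w _; by rewrite mulr0 mul0r addr0.
Qed.

Lemma qintC_cplx f : qintC G (cplx f) = Complex (qint G f) 0.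
Proof.
rewrite /qintC /=; congr Complex; rewrite /qint /Rintegral integral0_eq ?mulr0 //.
Qed.

Lemma qint_SR f : L2r G f -> smooth_bounded G (cplx f) -> qint G (SR f) = 0.
Proof.
move=> Lf sf; have [_ h] := hS; have [_] := h _ sf; case=> E _; rewrite -[RHS]E.
by apply: qint_eq => z z0; rewrite /SR /re z0.
Qed.

(** For smooth bounded [f], [S f] is in the domain of the Laplacian with image [f] minus its mean,
    so self-adjointness moves the Laplacian from u to [S f]. As [S f] is real almost everywhere, the
    real and imaginary parts separate. *)
Lemma graph_pairing u v f : Delta u v -> L2r G f -> smooth_bounded G (cplx f) ->
  [/\ L2 G u, L2 G v, ip (re v) (SR f) = ip (re u) (mean0 f) &
      ip (im v) (SR f) = ip (im u) (mean0 f)].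
Proof.
move=> uv Lf sf; have [[_ _ sa] _] := hD; have [_ h] := hS; have [T1 _] := h _ sf.
have [Lu Lv _] := (sa _ _).1 uv.
have [LSf Lm adj] := (sa _ _).1 T1.
have Lm0 := L2r_mean0 Lf.
have E : inner G v (S (cplx f)) = inner G u (cplx (mean0 f)).
  rewrite (adj _ _ uv); congr (inner G u _); apply/funext => z.
  rewrite qintC_cplx /cplx /mean0 !fctE /mean.
  by apply/eqP; rewrite eq_complex /= ?mulr0 ?mul0r ?subr0 ?addr0 ?subrr !eqxx.
have LSC := LS (L2_cplx CG Lf).
have im0 x : L2r G x -> ip x (im (S (cplx f))) = 0.
  move=> Lx; rewrite (sipC hs) (ipr_ae CG (f' := fun=> 0)) //; last exact: S_real.
  - by rewrite (sipC hs) ipr_cst0.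
  - exact: L2_im.
  - exact: L2r_0.
split=> //.
- rewrite -(re_inner_cplx Lu Lm0) -E (inner_re CG) // (im0 (im v)) ?addr0 //; exact: L2_im.
- rewrite -(im_inner_cplx Lu Lm0) -E (inner_im CG) // (im0 (re v)) ?subr0 //; exact: L2_re.
Qed.

(** The weak equation is tested with automorphic kernels; by [null_by_kernels] these detect every
    function that is not null, so the equation holds in norm. *)
Lemma SR_inverts (x y : R * R -> R) : L2r G x -> L2r G y ->
  (forall f, L2r G f -> smooth_bounded G (cplx f) -> ip y (SR f) = ip x (mean0 f)) ->
  ip (SR y - mean0 x) (SR y - mean0 x) = 0.
Proof.
move=> Lx Ly hxy; have Lm := L2r_mean0 Lx; have LSy := L2r_SR Ly.
apply: null_by_kernels; first exact: sipB hs _ _ LSy Lm.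
move=> n z n8 z0; have La := aut_kn_L2r n8 z0.
have sa : smooth_bounded G (cplx (aut G (kn n) z)).
  by apply: smooth_bounded_aut => //; apply: rkernel_kn; exact: leq_trans n8.
rewrite (ipBr hs LSy Lm La) -SR_sym // (sipC hs) hxy // -ipr_mean0_sym //.
by rewrite (sipC hs (aut _ _ _)) subrr.
Qed.

(** Membership in the domain of the Laplacian is obtained from its being its own adjoint: every pair
    (u, v) in the graph satisfies [<v, h> = l^-1 <u, h>], because [SR v] is u minus its mean and [h]
    has mean 0. *)
Lemma eigen_transfer h (l : R) : L2r G h -> 0 < ip h h -> l != 0 ->
  nr (SR h - l *: h) = 0 -> eigenvalue_opp Delta ((- l^-1)%:C)%C.
Proof.
move=> Lh h0 l0 hl; have LSh := L2r_SR Lh; have Llh := sipZ hs l Lh.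
have Ld := sipB hs LSh Llh.
have E x : L2r G x -> ip (SR h) x = l * ip h x.
  move=> Lx; apply/eqP; rewrite -subr_eq0 -(ipZl hs) // -(ipBl hs) //; apply/eqP.
  exact: (nrm0_ip hs).
(* The image of the constant 1 is null, since its pairing with a kernel is the integral of [SR] of
   that kernel, which is 0; so an eigenvector for [l != 0] is orthogonal to constants. *)
have qh : qint G h = 0.
  have s1 : smooth_bounded G (cplx (fun=> 1 : R)).
    split=> //; [by move=> n; exact: Cn_cst|by move=> n; exact: Cn_cst|].
    by exists 1 => z _; rewrite normc_def /= expr0n addr0 expr1n sqrtr1.
  have L1 := L2r_1 CG.
  have : l * qint G h = 0.
    rewrite -(ipr_1 G) -E // SR_sym //; apply/eqP.
    have : ip (SR (fun=> 1)) (SR (fun=> 1)) = 0.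
      apply: null_by_kernels; first exact: L2r_SR.
      move=> n z n8 z0; have La := aut_kn_L2r n8 z0; rewrite -SR_sym // ipr_1 qint_SR //.
      by apply: smooth_bounded_aut => //; apply: rkernel_kn; exact: leq_trans n8.
    by move=> n1; rewrite (sipC hs) null_ipr //; exact: L2r_SR.
  by move/eqP; rewrite mulf_eq0 (negbTE l0) => /eqP.
have key (x y : R * R -> R) : L2r G x -> L2r G y ->
  (forall f, L2r G f -> smooth_bounded G (cplx f) -> ip y (SR f) = ip x (mean0 f)) ->
  ip y h = l^-1 * ip x h.
  move=> Lx Ly hxy; have N := SR_inverts Lx Ly hxy.
  have Lm := L2r_mean0 Lx; have LSy := L2r_SR Ly.
  have : ip (SR y - mean0 x) h = 0 by apply: null_ipr => //; exact: sipB hs _ _ LSy Lm.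
  rewrite (ipBl hs) // SR_sym // (sipC hs y) E // ipr_mean0 // qh mulr0 subr0 (sipC hs h) => /eqP.
  by rewrite subr_eq0 => /eqP <-; rewrite mulrA mulVf // mul1r.
exists (cplx h); split; last first.
  move=> ae0; have : ip h h = 0.
    rewrite (ipr_ae CG Lh (L2r_0 G) Lh).
      by rewrite (sipC hs (fun=> 0)) ipr_cst0.
    by apply: filterS ae0 => z; rewrite /cplx => -[-> _].
  by move=> E0; rewrite E0 ltxx in h0.
have [[_ _ sa] _] := hD; apply/sa.
have LCh := L2_cplx CG Lh.
have -> : (fun z => - ((- l^-1)%:C)%C * cplx h z) = cplx (l^-1 *: h).
  apply/funext => z; rewrite /cplx (_ : (l^-1 *: h) z = l^-1 * h z) //; apply/eqP.
  by rewrite eq_complex /=; apply/andP; split; apply/eqP; ring.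
have Llh' := sipZ hs l^-1 Lh.
split=> //; first exact: L2_cplx.
move=> u v uv; have [Lu Lv _] := (sa _ _).1 uv.
have Lru := L2_re CG Lu; have Liu := L2_im CG Lu; have Lrv := L2_re CG Lv; have Liv := L2_im CG Lv.
have e1 := re_inner_cplx Lv Lh; have e2 := im_inner_cplx Lv Lh.
have e3 := re_inner_cplx Lu Llh'; have e4 := im_inner_cplx Lu Llh'.
rewrite (ipZr hs) // in e3; rewrite (ipZr hs) // in e4.
have k1 := key (re u) (re v) Lru Lrv (fun f Lf sf => let: And4 _ _ a _ := graph_pairing uv Lf sf in a).
have k2 := key (im u) (im v) Liu Liv (fun f Lf sf => let: And4 _ _ _ a := graph_pairing uv Lf sf in a).
apply/eqP; rewrite eq_complex e1 e2 e3 e4 k1 k2 !eqxx //.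
Qed.
End Operator.
End GreenOperator.

(** * The reproducing formula *)

Section Reproducing.
Variable R : realType.
Implicit Types (z w : R * R) (f g : R * R -> R) (u v : R * R -> R[i]).
Local Notation hyp := (@hyp_measure R).
Local Notation H := (upper_half R).
Let mH : measurable H. Proof. exact: measurable_upper_half. Qed.
Variable G : set 'M[R]_2.
Hypothesis CG : cofinite_fuchsian G.
Let FG : fuchsian G. Proof. by case: CG. Qed.
Local Notation F := (fundom G).
Let mF : measurable F. Proof. exact: measurable_fundom. Qed.
Let hs := sip_L2r CG.
Local Notation ip := (ipr G).
Local Notation nr := (nrm (ipr G)).
Let rkn n : (8 <= n)%N -> rkernel (@kn R n).
Proof. by move=> n8; apply: rkernel_kn; exact: leq_trans n8. Qed.
Let rbn n : (8 <= n)%N -> rkernel (@bn R n).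
Proof. by move=> n8; apply: rkernel_bn; exact: leq_trans n8. Qed.
Local Notation kk := (@kk R).
Let rkk := @rkernel_kk R.

Lemma mass_le_kk : mass_le kk 1.
Proof. by rewrite /mass_le mass_kk mulr1. Qed.

Lemma mass_le_bn n : (1 < n)%N -> mass_le (@bn R n) 1.
Proof. by move=> n1; rewrite /mass_le mulr1 mass_bn. Qed.

Lemma rkernel_bn_diff m n : (1 < n)%N -> (n <= m)%N -> rkernel (fun u : R => bn m u - bn n u).
Proof.
move=> n1 nm; have m1 := leq_trans n1 nm.
have [c1 _ s1] := @rkernel_bn R _ m1; have [c2 _ s2] := @rkernel_bn R _ n1; split.
- move=> k; apply: CnD => //; first exact: openT.
  have := @CnZ _ _ k _ (-1) _ openT (c2 k).
  by apply: Cn_eq; [exact: openT|move=> p _; rewrite mulN1r].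
- by move=> u; rewrite subr_ge0 bn_diff_ge0.
- by move=> u u3; rewrite s1 // s2 // subrr.
Qed.

Lemma kint_diff k1 k2 k3 f z : rkernel k1 -> rkernel k2 -> rkernel k3 ->
  (forall x : R, k1 x - k2 x = k3 x) -> L2r G f -> 0 < z.2 ->
  kint k1 f z - kint k2 f z = kint k3 f z.
Proof.
move=> r1 r2 r3 E Lf z0; rewrite /kint -(RintegralB mH (integrable_kernel CG r1 z0 Lf) (integrable_kernel CG r2 z0 Lf)).
by apply: eq_Rintegral => w _; rewrite -mulrBl E.
Qed.

(** Averages of a merely square-integrable function need not converge pointwise; by symmetry the
    average is moved to the continuous bounded kernel [tau], where dominated convergence applies. *)
Lemma kint_kn_limit f w n : L2r G f -> 0 < w.2 -> (8 <= n)%N ->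
  ip (kint (kn (m + 8)) f) (aut G (kn n) w) @[m --> \oo] --> ip f (aut G (kn n) w).
Proof.
move=> Lf w0 n8; pose tau := aut G (kn n) w; have Lt : L2r G tau by exact: (aut_kn_L2r CG).
have n8' m : (8 <= m + 8)%N by exact: leq_addl.
have n1 m : (1 < m + 8)%N by exact: leq_trans (n8' m).
have mt : measurable_fun setT tau by case: Lt.
have mf : measurable_fun setT f by case: Lf.
have [M hM] := aut_bounded FG (rkn n8) w0.
have ct z : 0 < z.2 -> {for z, continuous tau}.
  by move=> z0; have [c _] := smooth_aut FG (rkn n8) w0 0; exact: c.
have kM m z : 0 < z.2 -> `|kint (kn (m + 8)) tau z| <= M.
  move=> z0; have [|_ ] := @kint_near _ (m + 8) tau z 0 M (n1 m) z0 mt.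
    by move=> z' z'0 _; rewrite subr0 hM.
  by rewrite subr0.
have M0 : 0 <= M by apply: le_trans (hM w w0).
have E m : ip (kint (kn (m + 8)) f) tau = ip f (kint (kn (m + 8)) tau).
  by apply: (kint_sym CG (rkn (n8' m)) (mass_le_kn R (n1 m))).
have mk m : measurable_fun setT (kint (kn (m + 8)) tau) by apply: measurable_kint => //; exact: rkn.
under eq_fun => m do rewrite E.
apply: cvgM; first exact: cvg_cst.
have mm (g : R * R -> R) : measurable_fun setT g -> measurable_fun F (fun z => (g z)%:E).
  by move=> mg; apply/measurable_EFinP; apply: (@measurable_funS _ _ _ _ setT).
have Lc : L2r G (fun=> M) by exact: L2r_cst.
have If := L2r_integrable_mul CG Lf Lt.
rewrite /Rintegral; apply: fine_cvg; rewrite fineK; last exact: (integrable_fin_num mF If).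
apply: (@dominated_cvg _ _ _ hyp F mF (fun m z => (f z * kint (kn (m + 8)) tau z)%:E)
  (fun z => (f z * tau z)%:E) (fun z => `|(f z * M)%:E|)%E).
- by move=> m; apply: mm; exact: measurable_funM.
- move=> z /fundom_upper z0; apply: cvg_EFin; first exact: nearW.
  apply: cvgM; first exact: cvg_cst.
  apply/cvgrPdist_le => e e0.
  have nU : nbhs z [set y | `|tau y - tau z| <= e].
    have /cvgrPdist_le /(_ e e0) := ct z z0.
    by apply: filterS => y; rewrite distrC.
  have [N hN] := hypu_near z0 nU.
  exists N => // m /= Nm; rewrite distrC.
  have [|_ //] := @kint_near _ (m + 8) tau z (tau z) e (n1 m) z0 mt.
  by move=> y y0 hy; exact: (hN _ (leq_trans Nm (leq_addr _ _)) y y0 hy).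
- by move=> z _.
- by apply: integrable_abse; exact: (L2r_integrable_mul CG Lf Lc).
- move=> m z /fundom_upper z0; rewrite !abse_EFin lee_fin !normrM ler_wpM2l //.
  by rewrite (ger0_norm M0) kM.
Qed.

Variables (Delta : (R * R -> R[i]) -> (R * R -> R[i]) -> Prop)
  (S : (R * R -> R[i]) -> R * R -> R[i]) (gr : R * R -> R * R -> R).
Hypotheses (hD : laplacian G Delta) (hS : green_operator G Delta S) (hgr : green_function G S gr).
Local Notation SR := (SR S).
Let LSR f : L2r G f -> L2r G (SR f). Proof. exact: (L2r_SR CG hS). Qed.

Lemma lap_bn n z w : (8 <= n)%N -> 0 < z.2 -> 0 < w.2 ->
  lap (aut G (bn n) z) w = aut G kk z w - aut G (kn n) z w.
Proof.
move=> n8 z0 w0; have n1 : (1 < n)%N by exact: leq_trans n8.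
have [c' [dc hc]] := @radial_bn R _ n1.
by apply: (lap_aut FG (rbn n8) rkk (rkn n8) (fun x => is_derive_bn x n1) dc hc z0 w0).
Qed.

Lemma lap_cst (a : R) z : lap (fun=> a) z = 0.
Proof.
have E (v : R * R) : 'D_v (fun=> a : R^o) = (fun=> 0 : R^o) :> (R * R -> R^o).
  by apply/funext => y; rewrite derive_cst.
by rewrite /lap !E !derive_cst addr0 mulr0.
Qed.

(** The automorphic kernel of [bn n] is smooth and bounded and its Laplacian, the difference of two
    automorphic kernels, is square-integrable; so the pair lies in the graph of the Laplacian. *)
Lemma SR_kernel n z : (8 <= n)%N -> 0 < z.2 ->
  let d := SR (aut G kk z - aut G (kn n) z) - mean0 G (aut G (bn n) z) in ip d d = 0.
Proof.
move=> n8 z0 /=.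
have Lk : L2r G (aut G kk z) by exact: aut_L2r.
have Lkn : L2r G (aut G (kn n) z) by exact: (aut_kn_L2r CG).
have Lb : L2r G (aut G (bn n) z) by apply: aut_L2r => //; exact: rbn.
have Ld := sipB hs Lk Lkn.
apply: (SR_inverts CG hS) => // f Lf sf.
pose u := cplx (aut G (bn n) z); pose v := lapC u.
have vE y : v y = Complex (lap (aut G (bn n) z) y) 0.
  change (Complex (lap (aut G (bn n) z) y) (lap (fun=> 0) y) = Complex (lap (aut G (bn n) z) y) 0).
  by rewrite lap_cst.
have rv w : 0 < w.2 -> re v w = (aut G kk z - aut G (kn n) z) w.
  move=> w0; rewrite /re w0 vE /=; exact: lap_bn.
have iv w : im v w = 0 by rewrite /im; case: ifP => // w0; rewrite vE.
have Lv : L2 G v.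
  apply: (L2_parts CG).
  - move=> g w Gg w0; have gw0 := inv_upper CG Gg w0.
    by rewrite !vE !lap_bn // !(aut_invr FG) //; exact: rkn.
  - apply: (L2r_eq CG _ _ Ld) => [w w0|]; first by rewrite rv.
    rewrite (_ : re v = fun w => if 0 < w.2 then (aut G kk z - aut G (kn n) z) w else 0).
      apply: measurable_cut; apply: (@measurable_funS _ _ _ _ setT) => //.
      by case: Ld.
    apply/funext => w; case: ifP => w0; first by rewrite rv.
    by rewrite /re w0.
  - by rewrite (_ : im v = fun=> 0); [exact: L2r_0|apply/funext => w; exact: iv].
have su : smooth_bounded G u by apply: smooth_bounded_aut => //; exact: rbn.
have [_ _ E _] := graph_pairing CG hD hS hgr (hD.2 u su Lv) Lf sf.
transitivity (ip (re v) (SR f)); first by apply: ipr_eq => w w0; rewrite rv.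
by rewrite E; apply: ipr_eq => w w0; rewrite re_cplx.
Qed.

Lemma kint_reproducing n g z : (8 <= n)%N -> 0 < z.2 -> L2r G g ->
  kint kk (SR g) z - kint (kn n) (SR g) z = kint (bn n) (mean0 G g) z.
Proof.
move=> n8 z0 Lg; have LS := LSR Lg; have Lm := L2r_mean0 CG Lg.
have Lk : L2r G (aut G kk z) by exact: aut_L2r.
have Lkn : L2r G (aut G (kn n) z) by exact: (aut_kn_L2r CG).
have Lb : L2r G (aut G (bn n) z) by apply: aut_L2r => //; exact: rbn.
have Ld := sipB hs Lk Lkn; have Lmb := L2r_mean0 CG Lb.
rewrite (kint_ipr CG rkk z0 LS) (kint_ipr CG (rkn n8) z0 LS) (kint_ipr CG (rbn n8) z0 Lm).
rewrite -(ipBl hs) // -(SR_sym CG hS) // -(ipr_mean0_sym CG) //.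
apply/eqP; rewrite -subr_eq0 -(ipBl hs) //; last exact: LSR.
apply/eqP; apply: (null_ipr CG) => //; last exact: SR_kernel.
by apply: (sipB hs) => //; exact: LSR.
Qed.

(** By [kint_reproducing] the average of [f = SR g] is its convolution with [kk] minus a term of
    norm at most [|g|], as [bn n] has mass at most 1. These averages form a Cauchy sequence by
    [mass_bn_diff], and their limit is [f], because both have the same pairing with every kernel. *)
Theorem nrm_SR_le g : L2r G g -> nr (SR g) <= nr (kint kk (SR g)) + nr g.
Proof.
move=> Lg; have LS := LSR Lg; set f := SR g; set h := mean0 G g.
have Lh : L2r G h by exact: L2r_mean0.
have n8 m : (8 <= m + 8)%N by exact: leq_addl.
have n1 m : (1 < m + 8)%N by exact: leq_trans (n8 m).
pose u n := kint (kn (n + 8)) f.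
have Lu n : L2r G (u n) by apply: (L2r_kint CG (rkn (n8 n)) (mass_le_kn R (n1 n))).
have Lkk : L2r G (kint kk f) by apply: (L2r_kint CG rkk mass_le_kk).
have Lb n : L2r G (kint (bn (n + 8)) h) by apply: (L2r_kint CG (rbn (n8 n)) (mass_le_bn (n1 n))).
have un n z : 0 < z.2 -> u n z = kint kk f z - kint (bn (n + 8)) h z.
  by move=> z0; rewrite /u -(kint_reproducing (n8 n) z0 Lg) opprB addrC subrK.
have ipr_eq2 (a b : R * R -> R) : (forall z, 0 < z.2 -> a z = b z) -> ip a a = ip b b.
  by move=> ab; apply: qint_eq => z z0; rewrite ab.
have nu n : nr (u n) <= nr (kint kk f) + nr g.
  have -> : nr (u n) = nr (kint kk f - kint (bn (n + 8)) h).
    by rewrite /nrm; congr Num.sqrt; apply: ipr_eq2 => z z0; rewrite un.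
  apply: le_trans (nrmB hs Lkk (Lb n)) _; rewrite lerD2l.
  apply: le_trans (nrm_kint CG (rbn (n8 n)) (mass_le_bn (n1 n)) _ Lh) _ => //.
  by rewrite mul1r nrm_mean0.
have diff m n : (n <= m)%N -> nr (u m - u n) <= (n + 8)%:R^-1 * nr h.
  move=> nm; have nm8 : (n + 8 <= m + 8)%N by rewrite leq_add2r.
  have rd := rkernel_bn_diff (n1 n) nm8.
  have -> : nr (u m - u n) = nr (kint (fun x => bn (m + 8) x - bn (n + 8) x) h).
    rewrite -(nrmN hs); last exact: sipB hs _ _ (Lu m) (Lu n).
    rewrite /nrm; congr Num.sqrt; apply: ipr_eq2 => z z0.
    rewrite -(kint_diff (rbn (n8 m)) (rbn (n8 n)) rd) //.
    change (- (u m z - u n z) = kint (bn (m + 8)) h z - kint (bn (n + 8)) h z).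
    rewrite !un //; ring.
  apply: (nrm_kint CG rd) => //.
  exact: mass_bn_diff.
have diff2 N m n : (N <= m)%N -> (N <= n)%N -> nr (u m - u n) <= (N + 8)%:R^-1 * nr h.
  move=> Nm Nn; wlog nm : m n Nm Nn / (n <= m)%N.
    move=> W; case/orP: (leq_total n m) => nm; first exact: W.
    rewrite -(nrmN hs) ?opprB; first exact: W.
    exact: sipB hs _ _ (Lu m) (Lu n).
  apply: le_trans (diff m n nm) _; rewrite ler_wpM2r ?nrm_ge0 // lef_pV2 ?posrE ?ltr0n ?addn_gt0 ?orbT //.
  by rewrite ler_nat leq_add2r.
have [v Lv hv] : exists2 v, L2r G v & forall e, 0 < e -> exists N, forall n, (N <= n)%N ->
    ip (u n - v) (u n - v) < e.
  apply: (L2r_complete CG) => // e e0.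
  have [N hN] : exists N : nat, nr h ^+ 2 < e * N%:R.
    exists (Num.truncn (nr h ^+ 2 / e)).+1.
    by rewrite mulrC -ltr_pdivrMr // truncnS_gt.
  exists N => m n Nm Nn; rewrite -(nrm_sq hs).
  have d0 := nrm_ge0 (ipr G) (u m - u n).
  apply: le_lt_trans (_ : ((N + 8)%:R^-1 * nr h) ^+ 2 < _).
    by rewrite ler_pXn2r ?nnegrE ?mulr_ge0 ?nrm_ge0 ?invr_ge0 // diff2.
  have k0 : 0 < (N + 8)%:R :> R by rewrite ltr0n addn_gt0 orbT.
  have k1 : 1 <= (N + 8)%:R :> R by rewrite ler1n addn_gt0 orbT.
  have kN : N%:R <= (N + 8)%:R :> R by rewrite ler_nat leq_addr.
  rewrite exprMn exprVn mulrC ltr_pdivrMr ?exprn_gt0 //.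
  apply: lt_le_trans hN _; rewrite ler_pM2l // expr2.
  by apply: le_trans kN _; rewrite ler_peMl // ltW.
have Lvf : L2r G (v - f) by exact: sipB hs _ _ Lv LS.
have null : ip (v - f) (v - f) = 0.
  apply: (null_by_kernels CG) => // n w n8' w0.
  have Lt := aut_kn_L2r CG n8' w0; rewrite (sipC hs) (ipBl hs) //; apply/eqP; rewrite subr_eq0.
  have lim1 := kint_kn_limit LS w0 n8'.
  have lim2 : ip (u m) (aut G (kn n) w) @[m --> \oo] --> ip v (aut G (kn n) w).
    apply/cvgrPdist_lt => e e0; set t := nr (aut G (kn n) w).
    have t0 : 0 <= t by exact: nrm_ge0.
    have [N hN] := hv ((e / (t + 1)) ^+ 2) (exprn_gt0 _ (divr_gt0 e0 (ltr_wpDl t0 ltr01))).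
    exists N => // m /= Nm; rewrite distrC -(ipBl hs (Lu m) Lv Lt).
    apply: le_lt_trans (ip_le_nrm hs (sipB hs (Lu m) Lv) Lt) _.
    have := hN m Nm; rewrite -(nrm_sq hs) ltr_pXn2r ?nnegrE ?nrm_ge0 ?divr_ge0 ?ltW ?ltr_wpDl // => h1.
    rewrite -/t; apply: le_lt_trans (_ : nr (u m - v) * t <= nr (u m - v) * (t + 1)) _.
      by rewrite ler_wpM2l ?nrm_ge0 // lerDl.
    by rewrite -ltr_pdivlMr // ltr_wpDl.
  by apply/eqP; apply: (cvg_unique _ lim2 lim1); exact: Rhausdorff.
apply/ler_addgt0Pr => e e0.
have [N hN] := hv (e ^+ 2) (exprn_gt0 _ e0).
have h1 : nr (u N - v) <= e.
  have := hN N (leqnn _); rewrite -(nrm_sq hs) ltr_pXn2r ?nnegrE ?nrm_ge0 ?(ltW e0) //; exact: ltW.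
have nvf : nr (v - f) = 0 by rewrite /nrm null sqrtr0.
have Luv := sipB hs (Lu N) Lv.
have nfu : nr (u N - (u N - v)) <= nr (u N) + nr (u N - v) by exact: nrmB hs _ _ (Lu N) Luv.
have nf : nr f <= nr (u N - (u N - v)) + nr (v - f).
  rewrite [X in nr X <= _](_ : f = u N - (u N - v) - (v - f)).
    exact: nrmB hs _ _ (sipB hs (Lu N) Luv) Lvf.
  by apply/funext => z; rewrite !fctE; ring.
move: nf nfu (nu N) h1; rewrite nvf.
move: (nr f) (nr (u N - (u N - v))) (nr (u N)) (nr (u N - v)) (nr (kint kk f)) (nr g) => a b c d a' b'.
lra.
Qed.
End Reproducing.

(** * The thin part *)

Section ThinWeight.
Variable R : realType.
Implicit Types (z w v : R * R) (g h : 'M[R]_2).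

(* The squared norm of the trace-free part of g conjugated by an isometry that
   moves z to i. *)
Definition Qf g z : R := 2 * hypu z (mobius g z) - (\tr g) ^+ 2 / 2.

Lemma tr2E g : \tr g = g 0 0 + g 1 1.
Proof. by rewrite /mxtrace big_ord_recr big_ord1 /=; congr (_ + _); congr (g _ _); apply: val_inj. Qed.

Lemma tr_conjz z g : 0 < z.2 -> \tr (conjz z g) = \tr g.
Proof. by move=> z0; rewrite !tr2E /conjz !mx2E; ring. Qed.

Lemma Qf_conjz z g : 0 < z.2 -> SL2 g ->
  Qf g z = (conjz z g 0 0 - conjz z g 1 1) ^+ 2 / 2 + conjz z g 0 1 ^+ 2 + conjz z g 1 0 ^+ 2.
Proof.
move=> z0 sg; rewrite /Qf -frob_conjz // -(tr_conjz g z0) tr2E /frob; by field.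
Qed.

Lemma Qf_ge0 z g : 0 < z.2 -> SL2 g -> 0 <= Qf g z.
Proof. by move=> z0 sg; rewrite Qf_conjz // !addr_ge0 ?divr_ge0 ?sqr_ge0. Qed.

Lemma Qf_mobius g h z : SL2 g -> SL2 h -> 0 < z.2 ->
  Qf g (mobius h z) = Qf (invmx h *m g *m h) z.
Proof.
move=> sg sh z0; rewrite /Qf; congr (2 * _ - _ ^+ 2 / 2).
  have hz0 := mobius_upper sh z0; have sV := SL2V sh.
  rewrite -(hypu_mobius sV hz0 (mobius_upper sg hz0)) mobiusK // !mobiusM //; first exact: SL2M.
by rewrite mxtrace_mulC mulmxA mulmxV ?SL2_unit // mul1mx.
Qed.

(** The trace-free part of [g] is the sum of a skew part with coordinate [kap] and a symmetric part
    with coordinates [(hh, aa)]. At i, [Qf g] is [2 (kap^2 + hh^2 + aa^2)], and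
    [kap^2 - hh^2 - aa^2], the determinant of the trace-free part, is invariant under
    conjugation. *)
Definition kap g : R := (g 0 1 - g 1 0) / 2.
Definition hh g : R := (g 0 1 + g 1 0) / 2.
Definition aa g : R := (g 0 0 - g 1 1) / 2.

(** The skew coordinate of the conjugate of [g] at v is a linear form in the hyperboloid coordinates
    of v, and the invariant determinant gives the symmetric part from it. *)
Lemma Qf_formula g v : SL2 g -> 0 < v.2 ->
  Qf g v = 2 * (2 * (kap g * hypu (0, 1) v + (hh g * ((1 - v.1 ^+ 2 - v.2 ^+ 2) / (2 * v.2)) + aa g * (v.1 / v.2))) ^+ 2
     + (hh g ^+ 2 + aa g ^+ 2) - kap g ^+ 2).
Proof.
move=> sg v0; rewrite Qf_conjz // /conjz !mx2E /hypu /sqdist /kap /hh /aa /=.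
case: v v0 => x y /= y0; move: (g 0 0) (g 0 1) (g 1 0) (g 1 1) => a b c d; field.
by rewrite gt_eqF.
Qed.

(** The quarter turn of the half-plane about i. *)
Definition rot : 'M[R]_2 := let s := Num.sqrt 2^-1 in mx2 s s (- s) s.

Lemma sqrt_half : Num.sqrt (2^-1 : R) ^+ 2 = 2^-1.
Proof. by rewrite sqr_sqrtr. Qed.

Lemma rot_SL2 : SL2 rot.
Proof.
rewrite /SL2 det2E /rot !mx2E mulrN opprK -expr2 sqrt_half; by field.
Qed.

Lemma rot_conj g : let g' := invmx rot *m g *m rot in
  [/\ kap g' = kap g, hh g' = aa g & aa g' = - hh g].
Proof.
have E : Num.sqrt (2^-1 : R) * Num.sqrt 2^-1 = 2^-1 by rewrite -expr2 sqrt_half.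
rewrite /= (invmx2 rot_SL2) /kap /hh /aa !mulmx2E /rot !mx2E.
move: (Num.sqrt (2^-1 : R)) E (g 0 0) (g 0 1) (g 1 0) (g 1 1) => s E a b c d.
split; apply/eqP; rewrite -subr_eq0; apply/eqP.
- transitivity ((b - c) * (s * s - 2^-1)); first by field.
  by rewrite E; ring.
- transitivity ((a - d) * (s * s - 2^-1)); first by field.
  by rewrite E; ring.
- transitivity ((b + c) * (2^-1 - s * s)); first by field.
  by rewrite E; ring.
Qed.

Lemma rot_fix : mobius rot (0, 1) = (0, 1).
Proof.
rewrite mobiusE /rot !mx2E /mobden !mx2E /=.
have E := sqrt_half; move: (Num.sqrt (2^-1 : R)) E => s E.
have -> : (- s * 0 + s) ^+ 2 + (- s * 1) ^+ 2 = 1.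
  by rewrite mulr0 add0r mulr1 sqrrN E; field.
rewrite !divr1; congr (_, _); first by ring.
by transitivity (2 * s ^+ 2); [ring | rewrite E; field].
Qed.

Definition quad (k U r t : R) : R := 2 * (2 * (k * U + t) ^+ 2 + r - k ^+ 2).

(* The values of [Qf] at the vertices of a square centred at z: their geometric
   mean exceeds the value at z by a definite factor, so that a small negative
   power of [Qf] decreases on average. *)
Section FourPoints.
Variables (k U r t1 t2 : R).
Hypotheses (r0 : 0 <= r) (U23 : 2 <= U <= 3) (ht : t1 ^+ 2 + t2 ^+ 2 = r * (U ^+ 2 - 1)).
Let Q := 2 * (k ^+ 2 + r).

Let U2 : 4 <= U ^+ 2 <= 9.
Proof. by case/andP: U23 => a b; apply/andP; split; nra. Qed.

(** Opposite vertices of the square differ by the sign of [t], so the product of the two values is a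
    polynomial in [t^2]. *)
Lemma quad_pair (t P : R) : t ^+ 2 = P * (U ^+ 2 - 1) ->
  quad k U r t * quad k U r (- t) = Q ^+ 2 + 16 * ((U ^+ 2 - 1) * ((k ^+ 2 - P) ^+ 2 + (r - P) * (k ^+ 2 + P)))
     + 16 * (U ^+ 2 - 1) ^+ 2 * (k ^+ 2 - P) ^+ 2.
Proof.
move=> tP.
transitivity (4 * (4 * (k ^+ 2 * U ^+ 2 - t ^+ 2) ^+ 2 + 4 * (r - k ^+ 2) * (k ^+ 2 * U ^+ 2 + t ^+ 2) + (r - k ^+ 2) ^+ 2)).
  by rewrite /quad; ring.
by rewrite tP /Q; ring.
Qed.

Lemma quad_le (t : R) : t ^+ 2 <= r * (U ^+ 2 - 1) -> quad k U r t <= 36 * Q.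
Proof.
move=> h; rewrite /quad /Q; case/andP: U2 => a b.
have h1 : t ^+ 2 <= 8 * r by apply: le_trans h _; rewrite mulrC ler_wpM2r //; lra.
have h2 : (k * U) ^+ 2 <= 9 * k ^+ 2 by rewrite exprMn mulrC ler_wpM2r ?sqr_ge0.
have h3 : (k * U + t) ^+ 2 <= 2 * ((k * U) ^+ 2 + t ^+ 2) by have := sqr_ge0 (k * U - t); nra.
move: h1 h2 h3 r0 (sqr_ge0 k); move: ((k * U + t) ^+ 2) ((k * U) ^+ 2) (t ^+ 2) (k ^+ 2) => A B C D.
lra.
Qed.

Lemma four_points : 0 < Q -> let B := quad k U r in
  [/\ forall t, t \in [:: t1; - t1; t2; - t2] -> Q <= 36 * B t /\ B t <= 36 * Q &
      2 * Q ^+ 4 <= (B t1 * B (- t1)) * (B t2 * B (- t2))].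
Proof.
move=> Q0 B; case/andP: U2 => a b; pose s := U ^+ 2 - 1; have s3 : 3 <= s by rewrite /s; lra.
have s0 : s != 0 by apply: lt0r_neq0; lra.
pose P := t1 ^+ 2 / s; pose q := t2 ^+ 2 / s.
have tP : t1 ^+ 2 = P * s by rewrite /P divfK.
have tq : t2 ^+ 2 = q * s by rewrite /q divfK.
have P0 : 0 <= P by rewrite divr_ge0 ?sqr_ge0 //; lra.
have q0 : 0 <= q by rewrite divr_ge0 ?sqr_ge0 //; lra.
have Pq : P + q = r.
  by apply: (mulIf s0); rewrite mulrDl -tP -tq.
have qE : r - P = q by rewrite -Pq; ring.
have PE : r - q = P by rewrite -Pq; ring.
have k0 : 0 <= k ^+ 2 by exact: sqr_ge0.
have e1 := quad_pair tP; have e2 := quad_pair tq.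
rewrite -/s qE -/(B t1) -/(B (- t1)) in e1; rewrite -/s PE -/(B t2) -/(B (- t2)) in e2.
set x1 := (k ^+ 2 - P) ^+ 2 + q * (k ^+ 2 + P) in e1; set x2 := (k ^+ 2 - q) ^+ 2 + P * (k ^+ 2 + q) in e2.
have x10 : 0 <= x1 by apply: addr_ge0; [exact: sqr_ge0|apply: mulr_ge0 => //; exact: addr_ge0].
have x20 : 0 <= x2 by apply: addr_ge0; [exact: sqr_ge0|apply: mulr_ge0 => //; exact: addr_ge0].
have l1 : 48 * x1 + 144 * (k ^+ 2 - P) ^+ 2 <= B t1 * B (- t1) - Q ^+ 2.
  rewrite e1; have := sqr_ge0 (k ^+ 2 - P); move: (_ ^+ 2) => y y0.
  have : 0 <= (s - 3) * x1 by rewrite mulr_ge0 //; lra.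
  have : 0 <= (s ^+ 2 - 9) * y by rewrite mulr_ge0 //; nra.
  by lra.
have l2 : 48 * x2 + 144 * (k ^+ 2 - q) ^+ 2 <= B t2 * B (- t2) - Q ^+ 2.
  rewrite e2; have := sqr_ge0 (k ^+ 2 - q); move: (_ ^+ 2) => y y0.
  have : 0 <= (s - 3) * x2 by rewrite mulr_ge0 //; lra.
  have : 0 <= (s ^+ 2 - 9) * y by rewrite mulr_ge0 //; nra.
  by lra.
(* The gains of the two pairs of opposite vertices cannot both be small. *)
have L : Q ^+ 2 <= 48 * x1 + 144 * (k ^+ 2 - P) ^+ 2 + (48 * x2 + 144 * (k ^+ 2 - q) ^+ 2).
  rewrite /Q -Pq /x1 /x2; move: (k ^+ 2) k0 => y y0.
  have := sqr_ge0 (y - P - q); have := sqr_ge0 (P - q); have := sqr_ge0 (y - P); have := sqr_ge0 (y - q).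
  have := mulr_ge0 y0 P0; have := mulr_ge0 y0 q0; have := mulr_ge0 P0 q0; nra.
have y1 := sqr_ge0 (k ^+ 2 - P); have y2 := sqr_ge0 (k ^+ 2 - q).
have p1 : Q ^+ 2 <= B t1 * B (- t1) by lra.
have p2 : Q ^+ 2 <= B t2 * B (- t2) by lra.
have u1 : t1 ^+ 2 <= r * s by rewrite -ht; have := sqr_ge0 t2; lra.
have u2 : t2 ^+ 2 <= r * s by rewrite -ht; have := sqr_ge0 t1; lra.
have up t : t \in [:: t1; - t1; t2; - t2] -> B t <= 36 * Q.
  by rewrite !inE => /or4P[] /eqP ->; apply: quad_le; rewrite ?sqrrN.
have sum0 t : 0 <= B t + B (- t).
  have -> : B t + B (- t) = 4 * (2 * (k ^+ 2 * U ^+ 2) + 2 * t ^+ 2 + r - k ^+ 2) by rewrite /B /quad; ring.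
  have := sqr_ge0 t; have : 4 * k ^+ 2 <= k ^+ 2 * U ^+ 2 by rewrite mulrC ler_wpM2l.
  move: (t ^+ 2) (k ^+ 2 * U ^+ 2) (k ^+ 2) k0 => A C D; move: r0; lra.
(* The product of opposite values is at least [Q^2] and each value is at most [36 Q], so neither
   falls below [Q / 36]. *)
have low x y : 0 <= x + y -> Q ^+ 2 <= x * y -> x <= 36 * Q -> y <= 36 * Q -> Q <= 36 * y.
  move=> xy0 h hx hy; have x0 : 0 < x.
    rewrite ltNge; apply/negP => xn.
    have Q20 : 0 < Q ^+ 2 by rewrite exprn_gt0.
    have [y0|y0] := leP 0 y; first by have := mulr_ge0_le0 y0 xn; lra.
    lra.
  have y0 : 0 < y by rewrite -(pmulr_rgt0 _ x0); apply: lt_le_trans h; rewrite exprn_gt0.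
  rewrite -(ler_pM2l Q0) -expr2; apply: le_trans h _.
  by rewrite mulrA [Q * 36]mulrC ler_wpM2r // ltW.
split.
  move=> t tin; split; last exact: up.
  move: tin; rewrite !inE => /or4P[] /eqP ->.
  - by apply: (low (B (- t1))); rewrite 1?[B (- t1) * _]mulrC 1?[B (- t1) + _]addrC ?sum0 ?up ?inE ?eqxx ?orbT.
  - by apply: (low (B t1)) => //; rewrite ?sum0 ?up ?inE ?eqxx ?orbT.
  - by apply: (low (B (- t2))); rewrite 1?[B (- t2) * _]mulrC 1?[B (- t2) + _]addrC ?sum0 ?up ?inE ?eqxx ?orbT.
  - by apply: (low (B t2)) => //; rewrite ?sum0 ?up ?inE ?eqxx ?orbT.
move: p1 p2 l1 l2 L; move: (B t1 * B (- t1)) (B t2 * B (- t2)) => E1 E2 p1 p2 l1 l2 L.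
have Q2 : 0 < Q ^+ 2 by rewrite exprn_gt0.
have -> : Q ^+ 4 = Q ^+ 2 * Q ^+ 2 by ring.
move: (Q ^+ 2) Q2 p1 p2 l1 l2 L => y yy p1 p2 l1 l2 L.
(* Here [E1, E2 >= y] and [E1 + E2 >= 3 y] give [E1 E2 >= y (E1 + E2) - y^2 >= 2 y^2]. *)
have : 0 <= (E1 - y) * (E2 - y) by rewrite mulr_ge0 //; lra.
have : 3 * y <= E1 + E2 by lra.
nra.
Qed.
End FourPoints.

(** The product bound in [four_points] gains [sigma ln 2 / 4] in the mean of the four powers at
    first order, and the second-order error is at most [2 (sigma ln 36)^2]. This [sigma] makes the
    error a quarter of the gain, which leaves the 3/16 of [qthin]. *)
Definition sigma : R := ln 2 / (32 * ln 36 ^+ 2).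
Definition qthin : R := 1 - 3 / 16 * (sigma * ln 2).

Let ln2 : 0 < ln (2 : R). Proof. by rewrite ln_gt0 // ltr1n. Qed.
Let ln36 : ln (2 : R) <= ln 36. Proof. by rewrite ler_ln ?posrE ?ler_nat. Qed.

Lemma sigma_gt0 : 0 < sigma.
Proof. by rewrite divr_gt0 // mulr_gt0 // exprn_gt0 //; apply: lt_le_trans ln36. Qed.

Lemma sigma_ln36 : 32 * (sigma * ln 36) * ln 36 = ln 2.
Proof. by rewrite /sigma; field; apply: lt0r_neq0; apply: lt_le_trans ln36. Qed.

Lemma qthin_itv : 0 < qthin < 1.
Proof.
rewrite /qthin; have s0 := sigma_gt0; have e := sigma_ln36; move: ln2 ln36 => a b.
have c : 0 < sigma * ln 36 by rewrite mulr_gt0 //; apply: lt_le_trans b.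
have d : sigma * ln 2 <= sigma * ln 36 by rewrite ler_wpM2l // ltW.
have d0 : 0 < sigma * ln 2 by rewrite mulr_gt0.
have f : 32 * (sigma * ln 36) <= 1.
  by rewrite -(@ler_pM2r _ (ln 36)) ?mul1r ?e //; apply: lt_le_trans b.
by apply/andP; split; lra.
Qed.

Lemma expRN_le (y : R) : `|y| <= 2^-1 -> expR (- y) <= 1 - y + 2 * y ^+ 2.
Proof.
rewrite ler_norml => /andP[y1 y2]; rewrite expRN.
have h : 0 < 1 + y by lra.
have h1 := expR_ge1Dx y.
apply: le_trans (_ : (1 + y)^-1 <= _); first by rewrite lef_pV2 ?posrE ?expR_gt0.
rewrite -[leLHS]mul1r ler_pdivrMr //.
have : 0 <= y ^+ 2 * (1 + 2 * y) by rewrite mulr_ge0 ?sqr_ge0 //; lra.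
nra.
Qed.

Lemma powR_four (b1 b2 b3 b4 Q : R) : 0 < Q ->
  (forall b, b \in [:: b1; b2; b3; b4] -> Q <= 36 * b /\ b <= 36 * Q) ->
  2 * Q ^+ 4 <= (b1 * b2) * (b3 * b4) ->
  b1 `^ (- sigma) + b2 `^ (- sigma) + (b3 `^ (- sigma) + b4 `^ (- sigma)) <= 4 * qthin * Q `^ (- sigma).
Proof.
move=> Q0 hb hp; have s0 := sigma_gt0; have l36 : 0 < ln (36 : R) by apply: lt_le_trans ln36.
have b0 b : b \in [:: b1; b2; b3; b4] -> 0 < b by move=> /hb[]; lra.
have key b : b \in [:: b1; b2; b3; b4] ->
    b `^ (- sigma) <= Q `^ (- sigma) * (1 - sigma * (ln b - ln Q) + 2 * (sigma * ln 36) ^+ 2).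
  move=> bin; have bp := b0 b bin; have [h1 h2] := hb b bin.
  have hl : `|ln b - ln Q| <= ln 36.
    rewrite ler_distlC; apply/andP; split.
      by rewrite lerBlDr addrC -lnM ?posrE // ler_ln ?posrE // mulr_gt0.
    by rewrite addrC -lnM ?posrE // ler_ln ?posrE // mulr_gt0.
  rewrite /powR !gt_eqF // -subr_le0 -[ln b](subrK (ln Q)) mulrDr expRD addrAC subrK.
  rewrite subr_le0 mulrC ler_wpM2l ?expR_ge0 // mulNr.
  have y1 : `|sigma * (ln b - ln Q)| <= sigma * ln 36.
    by rewrite normrM (gtr0_norm s0) ler_wpM2l // ltW.
  apply: le_trans (expRN_le _) _.
    apply: le_trans y1 _; have := sigma_ln36; move: ln36 => a e.
    have f : 32 * (sigma * ln 36) <= 1 by rewrite -(@ler_pM2r _ (ln 36)) ?mul1r ?e.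
    lra.
  rewrite [leRHS]addrAC lerD2l ler_wpM2l // -real_normK ?num_real // ler_pXn2r ?nnegrE //.
  by rewrite mulr_ge0 // ltW.
have i1 : b1 \in [:: b1; b2; b3; b4] by rewrite !inE eqxx.
have i2 : b2 \in [:: b1; b2; b3; b4] by rewrite !inE eqxx orbT.
have i3 : b3 \in [:: b1; b2; b3; b4] by rewrite !inE eqxx !orbT.
have i4 : b4 \in [:: b1; b2; b3; b4] by rewrite !inE eqxx !orbT.
have := key _ i1; have := key _ i2; have := key _ i3; have := key _ i4.
have lsum : ln 2 + 4 * ln Q <= ln b1 + ln b2 + (ln b3 + ln b4).
  rewrite -!lnM ?posrE ?mulr_gt0 ?b0 //.
  have -> : 4 * ln Q = ln (Q ^+ 4) by rewrite lnXn // mulr_natl.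
  have pb : 0 < b1 * b2 * (b3 * b4) by rewrite !mulr_gt0 ?b0.
  have pQ : 0 < Q ^+ 4 by rewrite exprn_gt0.
  by rewrite -lnM ?posrE // ler_ln ?posrE // mulr_gt0.
move=> k4 k3 k2 k1; apply: le_trans (lerD (lerD k1 k2) (lerD k3 k4)) _.
rewrite -!mulrDr mulrC ler_wpM2r ?powR_ge0 //.
have e := sigma_ln36; rewrite /qthin.
have e2 : 8 * (sigma * ln 36) ^+ 2 = 4^-1 * (sigma * ln 2) by rewrite -e; field.
have : sigma * (ln 2 + 4 * ln Q) <= sigma * (ln b1 + ln b2 + (ln b3 + ln b4)) by rewrite ler_wpM2l // ltW.
lra.
Qed.
End ThinWeight.

(** * A power of Q as a strict supersolution *)

Section Contraction.
Variable R : realType.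
Implicit Types (z w v : R * R) (g h : 'M[R]_2).
Local Notation hyp := (@hyp_measure R).
Local Notation H := (upper_half R).
Local Notation i := ((0, 1) : R * R).
Local Notation sg := (@sigma R).
Local Notation q0 := (@qthin R).
Local Notation kk := (@kk R).
Local Notation rot := (@rot R).
Let mH : measurable H. Proof. exact: measurable_upper_half. Qed.
Let i0 : 0 < i.2. Proof. by []. Qed.
Let rs := @rot_SL2 R.

Lemma kk_supp (u : R) : kk u != 0 -> 2 <= u <= 3.
Proof.
rewrite /kk mulf_eq0 negb_or => /andP[_ h].
have [_ _ [_ hs] _ _] := @stepP R.
have : 0 < 1 * u - 2 < 1 by apply: contraR h => h; rewrite hs.
by move=> /andP[a b]; apply/andP; split; lra.
Qed.

Lemma measurable_Qf g : measurable_fun setT (Qf g).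
Proof.
apply: measurable_funB => //; apply: measurable_funM => //.
apply: (measurableT_comp (@measurable_hypu2 R) (g := fun w => (w, mobius g w))).
by apply: measurable_fun_pair => //; exact: measurable_mobius.
Qed.

Definition weighted g z w : R := kk (hypu z w) * Qf g w `^ (- sg).

Lemma measurable_weighted g z : measurable_fun setT (fun w => (weighted g z w)%:E).
Proof.
apply/measurable_EFinP; apply: measurable_funM.
  by apply: measurable_rkernel_hypu; exact: rkernel_kk.
by apply: (measurableT_comp (measurable_powR (- sg))); exact: measurable_Qf.
Qed.

Lemma weighted_ge0 g z w : (0 <= (weighted g z w)%:E)%E.
Proof. by rewrite lee_fin mulr_ge0 ?powR_ge0 //; case: (@rkernel_kk R). Qed.

Let tt1 g v : R := hh g * ((1 - v.1 ^+ 2 - v.2 ^+ 2) / (2 * v.2)) + aa g * (v.1 / v.2).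
Let tt2 g v : R := aa g * ((1 - v.1 ^+ 2 - v.2 ^+ 2) / (2 * v.2)) - hh g * (v.1 / v.2).

Lemma Qf_quad g v : SL2 g -> 0 < v.2 ->
  Qf g v = quad (kap g) (hypu i v) (hh g ^+ 2 + aa g ^+ 2) (tt1 g v).
Proof. exact: Qf_formula. Qed.

Lemma integral_four (f1 f2 f3 f4 : R * R -> R) (x : \bar R) :
  measurable_fun setT (EFin \o f1) -> measurable_fun setT (EFin \o f2) ->
  measurable_fun setT (EFin \o f3) -> measurable_fun setT (EFin \o f4) ->
  (forall w, 0 <= f1 w) -> (forall w, 0 <= f2 w) -> (forall w, 0 <= f3 w) -> (forall w, 0 <= f4 w) ->
  (\int[hyp]_(w in H) (f1 w)%:E = x)%E -> (\int[hyp]_(w in H) (f2 w)%:E = x)%E ->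
  (\int[hyp]_(w in H) (f3 w)%:E = x)%E -> (\int[hyp]_(w in H) (f4 w)%:E = x)%E ->
  (\int[hyp]_(w in H) (f1 w + f2 w + (f3 w + f4 w))%:E = 4%:E * x)%E.
Proof.
move=> m1 m2 m3 m4 p1 p2 p3 p4 e1 e2 e3 e4.
have mm f : measurable_fun setT (EFin \o f) -> measurable_fun H (fun w => (f w)%:E).
  by move=> mf; apply: (@measurable_funS _ _ _ _ setT).
have x0 : (0 <= x)%E by rewrite -e1; apply: integral_ge0 => w _; rewrite lee_fin.
under eq_integral => w _ do rewrite !EFinD.
rewrite ge0_integralD //; last 4 first.
- by move=> w _; rewrite -EFinD lee_fin addr_ge0.
- by apply: emeasurable_funD; exact: mm.
- by move=> w _; rewrite -EFinD lee_fin addr_ge0.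
- by apply: emeasurable_funD; exact: mm.
rewrite (@ge0_integralD _ _ _ hyp _ mH (EFin \o f1)) //; last 4 first.
- by move=> w _; rewrite lee_fin.
- exact: mm.
- by move=> w _; rewrite lee_fin.
- exact: mm.
rewrite (@ge0_integralD _ _ _ hyp _ mH (EFin \o f3)) //; last 4 first.
- by move=> w _; rewrite lee_fin.
- exact: mm.
- by move=> w _; rewrite lee_fin.
- exact: mm.
rewrite /comp e1 e2 e3 e4; case: x x0 {e1 e2 e3 e4} => [x| |] //= x0.
  by rewrite -!EFinD -EFinM; congr _%:E; ring.
by rewrite mulry gtr0_sg // mul1e.
Qed.

(** The integral is unchanged by the quarter turn about i, so it is the mean of the integrals at the
    four vertices of a square, and there [powR_four] holds pointwise on the support of [kk]. *)
Lemma contraction_i g : SL2 g -> 0 < Qf g i ->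
  (\int[hyp]_(w in H) (weighted g i w)%:E <= (q0 * Qf g i `^ (- sg))%:E)%E.
Proof.
move=> sgg Q0; have [_ kk0 _] := @rkernel_kk R.
have wm := measurable_weighted g i; have w0 := weighted_ge0 g i.
pose P (j : nat) v := iter j (mobius rot) v.
have mP j : measurable_fun setT (P j).
  by elim: j => [|j IH]; [exact: measurable_id|apply: (measurableT_comp (measurable_mobius rot) IH)].
have PH j v : 0 < v.2 -> 0 < (P j v).2.
  by move=> v0; elim: j => //= j IH; exact: mobius_upper.
have mw j : measurable_fun setT (fun v => (weighted g i (P j v))%:E) by apply: (measurableT_comp wm).
have I j : (\int[hyp]_(w in H) (weighted g i (P j w))%:E = \int[hyp]_(w in H) (weighted g i w)%:E)%E.
  rewrite (integral_hyp_upper (mw j) (fun v => w0 (P j v))) (integral_hyp_upper wm w0).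
  elim: j => [|j <-]; first by apply: eq_integral.
  rewrite -(integral_hyp_mobius rs (mw j) (fun v => w0 (P j v))); apply: eq_integral => w _.
  by rewrite /P -iterSr.
pose cj j := iter j (fun g => invmx rot *m g *m rot) g.
have cS j : SL2 (cj j).
  by elim: j => //= j IH; apply: SL2M => //; apply: SL2M => //; exact: SL2V.
have Qj j h v : SL2 h -> 0 < v.2 -> Qf h (P j v) = Qf (iter j (fun g => invmx rot *m g *m rot) h) v.
  move=> sh v0; elim: j h sh => // j IH h sh; rewrite /P iterS -/(P j v) Qf_mobius //; last exact: PH.
  by rewrite IH -?iterSr //; apply: SL2M => //; apply: SL2M => //; exact: SL2V.
have U v j : 0 < v.2 -> hypu i (P j v) = hypu i v.
  move=> v0; elim: j => // j IH; rewrite /P iterS -/(P j v) -{1}(@rot_fix R) hypu_mobius //.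
  exact: PH.
have Qq j v : 0 < v.2 -> Qf g (P j v) =
    quad (kap (cj j)) (hypu i v) (hh (cj j) ^+ 2 + aa (cj j) ^+ 2) (tt1 (cj j) v).
  by move=> v0; rewrite Qj // -/(cj j) Qf_quad.
have step j : [/\ kap (cj j.+1) = kap (cj j), hh (cj j.+1) = aa (cj j) & aa (cj j.+1) = - hh (cj j)].
  exact: rot_conj.
have [k1 h1 a1] := step 0; have [k2 h2 a2] := step 1; have [k3 h3 a3] := step 2.
have c0 : cj 0 = g by [].
rewrite c0 in k1 h1 a1.
(* The iterates 0 and 2 are opposite vertices, and so are 1 and 3; the order matches the pairs in
   [four_points]. *)
have ps v : 0 < v.2 -> weighted g i (P 0 v) + weighted g i (P 2 v) + (weighted g i (P 1 v) + weighted g i (P 3 v))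
   <= 4 * q0 * Qf g i `^ (- sg) * kk (hypu i v).
  move=> v0; rewrite /weighted !U // -!mulrDr.
  have [->|kn] := eqVneq (kk (hypu i v)) 0; first by rewrite mul0r mulr0.
  rewrite mulrC ler_wpM2r // !Qq // c0.
  have e2 : tt1 (cj 2) v = - tt1 g v by rewrite /tt1 h2 a2 h1 a1; ring.
  have e1 : tt1 (cj 1) v = tt2 g v by rewrite /tt1 /tt2 h1 a1; ring.
  have e3 : tt1 (cj 3) v = - tt2 g v by rewrite /tt1 /tt2 h3 a3 h2 a2 h1 a1; ring.
  have r1 : hh (cj 1) ^+ 2 + aa (cj 1) ^+ 2 = hh g ^+ 2 + aa g ^+ 2 by rewrite h1 a1; ring.
  have r2 : hh (cj 2) ^+ 2 + aa (cj 2) ^+ 2 = hh g ^+ 2 + aa g ^+ 2 by rewrite h2 a2 h1 a1; ring.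
  have r3 : hh (cj 3) ^+ 2 + aa (cj 3) ^+ 2 = hh g ^+ 2 + aa g ^+ 2 by rewrite h3 a3 h2 a2 h1 a1; ring.
  rewrite e1 e2 e3 r1 r2 r3 k3 k2 k1.
  have QE : 2 * (kap g ^+ 2 + (hh g ^+ 2 + aa g ^+ 2)) = Qf g i.
    by rewrite Qf_quad // hypuxx /quad /tt1 /=; field.
  have rho0 : 0 <= hh g ^+ 2 + aa g ^+ 2 by rewrite addr_ge0 ?sqr_ge0.
  have hU : tt1 g v ^+ 2 + tt2 g v ^+ 2 = (hh g ^+ 2 + aa g ^+ 2) * (hypu i v ^+ 2 - 1).
    rewrite /tt1 /tt2 /hypu /sqdist /=; case: v v0 {kn e1 e2 e3} => x y /= y0.
    by move: (hh g) (aa g) => a b; field; rewrite gt_eqF.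
  have Q0' := Q0; rewrite -QE in Q0' *.
  have [f1 f2] := four_points rho0 (kk_supp kn) hU Q0'.
  apply: powR_four => // b; rewrite !inE => /or4P[] /eqP ->; apply: f1; by rewrite !inE eqxx ?orbT.
rewrite -(@lee_pmul2l _ 4%:E) // ?lte_fin //.
have wr v : 0 <= weighted g i v by rewrite -lee_fin.
rewrite -(integral_four (mw 0) (mw 2) (mw 1) (mw 3) (fun v => wr (P 0 v)) (fun v => wr (P 2 v))
  (fun v => wr (P 1 v)) (fun v => wr (P 3 v)) (I 0) (I 2) (I 1) (I 3)).
apply: le_trans (_ : (\int[hyp]_(w in H) (4 * q0 * Qf g i `^ (- sg) * kk (hypu i w))%:E <= _)%E).
  apply: ge0_le_integral => //.
  - by move=> w _; rewrite lee_fin !addr_ge0 // -lee_fin.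
  - have mwR j : measurable_fun setT (fun v => weighted g i (P j v)) by apply/measurable_EFinP; exact: mw.
    apply: (@measurable_funS _ _ _ _ setT) => //; apply/measurable_EFinP.
    by apply: measurable_funD; apply: measurable_funD; exact: mwR.
  - apply: (@measurable_funS _ _ _ _ setT) => //; apply/measurable_EFinP; apply: measurable_funM => //.
    by apply: measurable_rkernel_hypu; exact: rkernel_kk.
have c4 : 0 <= 4 * q0 * Qf g i `^ (- sg).
  by have /andP[/ltW a _] := @qthin_itv R; rewrite mulr_ge0 ?powR_ge0 // mulr_ge0.
under eq_integral => w _ do rewrite EFinM.
rewrite ge0_integralZl //; last 2 first.
- apply: (@measurable_funS _ _ _ _ setT) => //; apply/measurable_EFinP.
  by apply: measurable_rkernel_hypu; exact: rkernel_kk.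
- by move=> w _; rewrite lee_fin.
have := mass_le_hyp (@rkernel_kk R) (@mass_le_kk R) i0 => hm.
apply: le_trans (lee_wpmul2l _ hm) _; first by rewrite lee_fin.
by rewrite mule1 -EFinM mulrA.
Qed.

Theorem contraction g z : SL2 g -> 0 < z.2 -> 0 < Qf g z ->
  (\int[hyp]_(w in H) (weighted g z w)%:E <= (q0 * Qf g z `^ (- sg))%:E)%E.
Proof.
move=> sgg z0 Q0; have A := aff_SL2 z0; pose g' := conjz z g.
have sg' : SL2 g' by exact: conjz_SL2.
have QE v : 0 < v.2 -> Qf g (mobius (aff z) v) = Qf g' v.
  by move=> v0; rewrite Qf_mobius // /g' conjz_aff.
have Qi : Qf g z = Qf g' i by rewrite -QE // mobius_aff_i.
rewrite Qi in Q0 *; apply: le_trans (contraction_i sg' Q0).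
rewrite (integral_hyp_upper (measurable_weighted g z) (weighted_ge0 g z)).
rewrite (integral_hyp_upper (measurable_weighted g' i) (weighted_ge0 g' i)).
rewrite -(integral_hyp_mobius A); [|exact: measurable_weighted|exact: weighted_ge0].
rewrite le_eqVlt; apply/orP; left; apply/eqP; apply: integral_hyp_eq => //.
- move=> v v0; rewrite /weighted QE // -{1}(mobius_aff_i z0) hypu_mobius //.
- by apply: (measurableT_comp (measurable_weighted g z)); exact: measurable_mobius.
- by move=> v; exact: weighted_ge0.
- exact: measurable_weighted.
- by move=> v; exact: weighted_ge0.
Qed.
End Contraction.

(** * Small elements of a discrete group commute *)

Section SmallElements.
Variable R : realType.
Implicit Types (z w v : R * R) (g h M N : 'M[R]_2).

Lemma frobN M : frob (- M) = frob M.
Proof. by rewrite /frob !mxE; ring. Qed.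

Lemma frobD M N : frob (M + N) <= 2 * (frob M + frob N).
Proof.
rewrite /frob !mxE; move: (M 0 0) (M 0 1) (M 1 0) (M 1 1) (N 0 0) (N 0 1) (N 1 0) (N 1 1) => a b c d a' b' c' d'.
have := sqr_ge0 (a - a'); have := sqr_ge0 (b - b'); have := sqr_ge0 (c - c'); have := sqr_ge0 (d - d'); nra.
Qed.

Lemma one2E : ((1%:M : 'M[R]_2) 0 0 = 1) * ((1%:M : 'M[R]_2) 0 1 = 0) * ((1%:M : 'M[R]_2) 1 0 = 0) * ((1%:M : 'M[R]_2) 1 1 = 1).
Proof. by rewrite !mxE. Qed.

Lemma frob_sub1 M : frob (M - 1%:M) = (M 0 0 - 1) ^+ 2 + M 0 1 ^+ 2 + M 1 0 ^+ 2 + (M 1 1 - 1) ^+ 2.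
Proof. by rewrite /frob !mxE /= ?mulr0n ?mulr1n !subr0. Qed.

Lemma frob_le6 M : frob (M - 1%:M) <= 1 -> frob M <= 6.
Proof.
move=> h; have := frobD (M - 1%:M) 1%:M; rewrite subrK => h1.
have h2 : frob (1%:M : 'M[R]_2) = 2 by rewrite /frob !one2E; ring.
by apply: le_trans h1 _; rewrite h2; lra.
Qed.

(** The identity [M N - N M = (M - 1) (N - 1) - (N - 1) (M - 1)] makes the commutator quadratically
    small. The constant is [4 * 36]: 4 from the difference of products, and [36 = 6 * 6] bounding
    the squared norm of [N M]. *)
Lemma commutator_small M N : SL2 M -> SL2 N -> frob (M - 1%:M) <= 1 -> frob (N - 1%:M) <= 1 ->
  frob (M *m N *m invmx (N *m M) - 1%:M) <= 144 * frob (M - 1%:M) * frob (N - 1%:M).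
Proof.
move=> sM sN hM hN; have sNM := SL2M sN sM.
have E : M *m N *m invmx (N *m M) - 1%:M =
  ((M - 1%:M) *m (N - 1%:M) - (N - 1%:M) *m (M - 1%:M)) *m invmx (N *m M).
  have -> : (M - 1%:M) *m (N - 1%:M) - (N - 1%:M) *m (M - 1%:M) = M *m N - N *m M.
    rewrite !mulmxBl !mulmxBr !mul1mx !mulmx1; move: (M *m N) (N *m M) => A B.
    by apply/matrixP => k l; rewrite !mxE; ring.
  by rewrite mulmxBl mulmxV ?SL2_unit.
have a0 := frob_ge0 (M - 1%:M); have b0 := frob_ge0 (N - 1%:M).
rewrite E; apply: le_trans (frobM _ _) _; rewrite frobV //.
have h1 : frob ((M - 1%:M) *m (N - 1%:M) - (N - 1%:M) *m (M - 1%:M)) <= 4 * (frob (M - 1%:M) * frob (N - 1%:M)).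
  apply: le_trans (frobD _ _) _; rewrite frobN.
  have := frobM (M - 1%:M) (N - 1%:M); have := frobM (N - 1%:M) (M - 1%:M).
  by rewrite [frob (N - _) * _]mulrC; lra.
have h2 : frob (N *m M) <= 36.
  apply: le_trans (frobM _ _) _; rewrite (_ : 36 = 6 * 6); last by ring.
  by apply: ler_pM => //; rewrite ?frob_ge0 // frob_le6.
apply: le_trans (ler_pM (frob_ge0 _) (frob_ge0 _) h1 h2) _.
by rewrite (_ : 4 * _ * 36 = 144 * frob (M - 1%:M) * frob (N - 1%:M)) //; ring.
Qed.

Lemma conjzN1 z : 0 < z.2 -> conjz z (- 1%:M) = - 1%:M.
Proof.
by move=> z0; apply: matrix2P; rewrite /conjz !mx2E !mxE /= ?mulr0n ?mulr1n; field; rewrite ?gt_eqF.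
Qed.

Lemma Qf_le_frob z g : 0 < z.2 -> SL2 g -> Qf g z <= frob (conjz z g - 1%:M).
Proof.
move=> z0 sg; rewrite Qf_conjz // frob_sub1.
move: (conjz z g 0 0) (conjz z g 0 1) (conjz z g 1 0) (conjz z g 1 1) => a b c d.
have := sqr_ge0 (a - 1 + (d - 1)); nra.
Qed.

(** Since [Qf] does not distinguish [g] from [- g], a sign condition is needed. With half-trace
    [t >= 0], determinant 1 gives [|t - 1| <= |t^2 - 1| <= Q / 2], so the scalar part is close to 1
    as well. *)
Lemma frob_conjz_le z g : 0 < z.2 -> SL2 g -> 0 <= \tr g -> Qf g z <= 1 ->
  frob (conjz z g - 1%:M) <= 2 * Qf g z.
Proof.
move=> z0 sg; rewrite -(tr_conjz g z0) tr2E Qf_conjz // frob_sub1.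
have := conjz_SL2 z0 sg; rewrite /SL2 det2E.
move: (conjz z g 0 0) (conjz z g 0 1) (conjz z g 1 0) (conjz z g 1 1) => a b c d dt t0 Q1.
pose t := (a + d) / 2; pose Q := (a - d) ^+ 2 / 2 + b ^+ 2 + c ^+ 2.
have t00 : 0 <= t by rewrite /t; lra.
have e : a * d = 1 + b * c by rewrite -dt; ring.
have tE : t ^+ 2 - 1 = (a - d) ^+ 2 / 4 + b * c.
  by rewrite /t; transitivity ((a - d) ^+ 2 / 4 + a * d - 1); [field|rewrite e; ring].
have h1 : `|t - 1| <= Q / 2.
  apply: le_trans (_ : `|t ^+ 2 - 1| <= _).
    rewrite (_ : t ^+ 2 - 1 = (t - 1) * (t + 1)); last by ring.
    by rewrite normrM ler_peMr // ger0_norm ?addr_ge0 // lerDr.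
  rewrite tE ler_norml /Q; have := sqr_ge0 (b - c); have := sqr_ge0 (b + c); have := sqr_ge0 (a - d).
  by move=> *; apply/andP; split; nra.
have h2 : (t - 1) ^+ 2 <= Q ^+ 2 / 4.
  have -> : Q ^+ 2 / 4 = (Q / 2) ^+ 2 by field.
  rewrite -real_normK ?num_real // ler_pXn2r ?nnegrE //.
  by apply: le_trans h1.
have Q0 : 0 <= Q by rewrite /Q !addr_ge0 ?divr_ge0 ?sqr_ge0.
have Q2 : Q ^+ 2 <= Q by rewrite expr2 -[leRHS]mul1r ler_wpM2r.
have -> : (a - 1) ^+ 2 + b ^+ 2 + c ^+ 2 + (d - 1) ^+ 2 = 2 * (t - 1) ^+ 2 + Q.
  by rewrite /t /Q; field.
rewrite -/Q; lra.
Qed.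

Lemma hypu_of_Qf z g : 0 < z.2 -> SL2 g -> hypu z (mobius g z) <= 1 + Qf g z.
Proof.
move=> z0 sg; suff : (\tr g) ^+ 2 / 2 <= 2 + Qf g z by rewrite /Qf; lra.
rewrite -(tr_conjz g z0) tr2E Qf_conjz //; have := conjz_SL2 z0 sg; rewrite /SL2 det2E.
move: (conjz z g 0 0) (conjz z g 0 1) (conjz z g 1 0) (conjz z g 1 1) => a b c d dt.
have e : a * d = 1 + b * c by rewrite -dt; ring.
have -> : (a + d) ^+ 2 / 2 = (a - d) ^+ 2 / 2 + 2 * (1 + b * c) by rewrite -e; field.
have := sqr_ge0 (b - c); nra.
Qed.

(** After moving z to i, the formula for [Qf] at a point with [u <= 3] is estimated as in [quad_le],
    with the same factor 36. *)
Lemma Qf_near z w g : 0 < z.2 -> 0 < w.2 -> SL2 g -> hypu z w <= 3 -> Qf g w <= 36 * Qf g z.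
Proof.
move=> z0 w0 sg u3; have A := aff_SL2 z0; have AV := SL2V A.
have [v v0 wE] : exists2 v : R * R, 0 < v.2 & w = mobius (aff z) v.
  by exists (mobius (invmx (aff z)) w); [exact: mobius_upper|rewrite mobiusVK].
pose g' := invmx (aff z) *m g *m aff z; have sg' : SL2 g' by apply: SL2M => //; exact: SL2M.
have i0 : 0 < ((0, 1) : R * R).2 by [].
have u3' : hypu (0, 1) v <= 3 by rewrite -(hypu_mobius A i0 v0) mobius_aff_i // -wE.
have u1 : 1 <= hypu (0, 1) v by exact: hypu_ge1.
rewrite wE Qf_mobius // -/g' -{1}(mobius_aff_i z0) Qf_mobius // -/g'.
rewrite !(Qf_formula sg') // hypuxx.
have sE : ((1 - v.1 ^+ 2 - v.2 ^+ 2) / (2 * v.2)) ^+ 2 + (v.1 / v.2) ^+ 2 = hypu (0, 1) v ^+ 2 - 1.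
  by rewrite /hypu /sqdist /=; move: v0; clear; case: v => x y /= y0; field; rewrite gt_eqF.
move: sE u1 u3'; move: (hypu (0, 1) v) ((1 - _ - _) / _) (v.1 / v.2) (kap g') (hh g') (aa g') => U p r k b a sE u1 u3' /=.
have -> : b * ((1 - 0 ^+ 2 - 1 ^+ 2) / (2 * 1)) + a * (0 / 1) = 0 by rewrite !expr1n; field.
have h1 : (b * p + a * r) ^+ 2 <= 8 * (b ^+ 2 + a ^+ 2).
  have e : (b * p + a * r) ^+ 2 + (b * r - a * p) ^+ 2 = (b ^+ 2 + a ^+ 2) * (p ^+ 2 + r ^+ 2) by ring.
  have := sqr_ge0 (b * r - a * p); have : (b ^+ 2 + a ^+ 2) * (p ^+ 2 + r ^+ 2) <= (b ^+ 2 + a ^+ 2) * 8.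
    by rewrite ler_wpM2l ?addr_ge0 ?sqr_ge0 // sE; nra.
  by rewrite -e; lra.
have h2 : (k * U) ^+ 2 <= 9 * k ^+ 2 by rewrite exprMn mulrC ler_wpM2r ?sqr_ge0 //; nra.
have := sqr_ge0 (k * U - (b * p + a * r)); rewrite mulr1 addr0.
move: h1 h2; move: (b * p + a * r) (k * U) => t x h1 h2 h3.
have h4 : (x + t) ^+ 2 <= 2 * (x ^+ 2 + t ^+ 2).
  have -> : 2 * (x ^+ 2 + t ^+ 2) = (x + t) ^+ 2 + (x - t) ^+ 2 by ring.
  by rewrite lerDl.
move: h1 h2 h4 (sqr_ge0 k) (sqr_ge0 a) (sqr_ge0 b); move: ((x + t) ^+ 2) (x ^+ 2) (t ^+ 2) (k ^+ 2) (a ^+ 2) (b ^+ 2) => *.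
lra.
Qed.

Definition noncentral (G : set 'M[R]_2) g : Prop := [/\ G g, g <> 1%:M & g <> - 1%:M].

Lemma Qf_gt0 G z g : SL2_subgroup G -> noncentral G g -> 0 < z.2 -> 0 < Qf g z.
Proof.
move=> [Gd _ _ _] [Gg n1 n2] z0; have sg : SL2 g by exact: Gd.
rewrite lt_neqAle Qf_ge0 // andbT; apply/eqP => /esym; rewrite Qf_conjz //.
have := conjz_SL2 z0 sg; rewrite /SL2 det2E.
set M := conjz z g => dM hQ.
have [e1 e2 e3] : [/\ M 0 0 = M 1 1, M 0 1 = 0 & M 1 0 = 0].
  have := sqr_ge0 (M 0 0 - M 1 1); have := sqr_ge0 (M 0 1); have := sqr_ge0 (M 1 0) => a b c.
  by split; [apply/eqP; rewrite -subr_eq0 -sqrf_eq0|apply/eqP; rewrite -sqrf_eq0|apply/eqP; rewrite -sqrf_eq0]; apply/eqP; lra.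
have : (M 1 1 - 1) * (M 1 1 + 1) = 0.
  transitivity (M 0 0 * M 1 1 - M 0 1 * M 1 0 - 1); first by rewrite e1 e2; ring.
  by rewrite dM subrr.
have one := conjz1 z0.
move/eqP; rewrite mulf_eq0 => /orP[]; rewrite ?subr_eq0 ?addr_eq0 => /eqP e4.
- apply: n1; apply: (conjz_inj z0); rewrite one -/M.
  by apply: matrix2P; rewrite !one2E ?e1 ?e2 ?e3 ?e4.
- apply: n2; apply: (conjz_inj z0); rewrite conjzN1 // -/M.
  by apply: matrix2P; rewrite ?e1 ?e2 ?e3 ?e4 !mxE /= ?mulr0n ?mulr1n ?oppr0.
Qed.

(** Small enough for [576 * eps0 < 1] in [thin_commute]; locked so that arithmetic treats it as an
    atom. *)
Definition eps0 : R := locked 1000^-1.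

Lemma eps0E : eps0 = 1000^-1.
Proof. by rewrite /eps0 -lock. Qed.

Lemma pos_trace g : exists s : bool, 0 <= \tr ((-1) ^+ s *: g).
Proof.
have [h|h] := leP 0 (\tr g); first by exists false; rewrite expr0 scale1r.
by exists true; rewrite expr1 mxtraceZ mulN1r oppr_ge0 ltW.
Qed.

(* The commutator of g and h is smaller than the minimal element g, hence central. *)
Lemma thin_commute (G : set 'M[R]_2) z g h : SL2_subgroup G -> 0 < z.2 -> noncentral G g -> G h ->
  (forall k, noncentral G k -> Qf g z <= Qf k z) ->
  Qf g z <= eps0 -> Qf h z <= eps0 -> h *m g = g *m h.
Proof.
move=> sG z0 ng Gh gmin Qg Qh; have [Gg _ _] := ng; have [Gd G1 GM GV] := sG.
have sg : SL2 g by exact: Gd. have sh : SL2 h by exact: Gd.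
have [s1 t1] := pos_trace g; have [s2 t2] := pos_trace h.
set g1 := _ *: g in t1; set h1 := _ *: h in t2.
have SZ (s : bool) (k : 'M[R]_2) : SL2 k -> SL2 ((-1) ^+ s *: k).
  by move=> sk; rewrite /SL2 detZ sk mulr1 sqrr_sign.
have QZ (s : bool) (k : 'M[R]_2) : Qf ((-1) ^+ s *: k) z = Qf k z.
  rewrite /Qf mxtraceZ exprMn sqrr_sign mul1r.
  by case: s; rewrite ?expr1 ?expr0 ?scale1r // scaleN1r mobiusN.
have sg1 : SL2 g1 by exact: SZ. have sh1 : SL2 h1 by exact: SZ.
have Q0 : 0 < Qf g z by exact: Qf_gt0 ng z0.
have e1 : eps0 <= 1 by rewrite eps0E; lra.
have fg : frob (conjz z g1 - 1%:M) <= 2 * Qf g z.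
  by rewrite -(QZ s1); apply: frob_conjz_le => //; rewrite QZ; exact: le_trans Qg _.
have fh : frob (conjz z h1 - 1%:M) <= 2 * Qf h z.
  by rewrite -(QZ s2); apply: frob_conjz_le => //; rewrite QZ; exact: le_trans Qh _.
pose c := h *m g *m invmx (g *m h).
have Gc : G c by exact: (GM _ _ (GM _ _ Gh Gg) (GV _ (GM _ _ Gg Gh))).
have sgh := SL2M sg sh.
have cgh : c *m (g *m h) = h *m g by rewrite /c -mulmxA mulVmx ?SL2_unit // mulmx1.
(* Signs cancel in a commutator, so both elements may be replaced by their multiples of non-negative
   trace, which are close to 1. *)
have cc : c = h1 *m g1 *m invmx (g1 *m h1).
  have u1 : g1 *m h1 \in unitmx by apply: SL2_unit; exact: SL2M.
  apply: (can_inj (mulmxK u1)); rewrite -[RHS]mulmxA mulVmx // mulmx1.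
  rewrite /g1 /h1 -!scalemxAl -!scalemxAr cgh !scalerA.
  by rewrite mulrC.
have Vz : conjz z c = conjz z h1 *m conjz z g1 *m invmx (conjz z g1 *m conjz z h1).
  have u1 : conjz z g1 *m conjz z h1 \in unitmx by apply: SL2_unit; apply: SL2M; exact: conjz_SL2.
  apply: (can_inj (mulmxK u1)); rewrite -[RHS]mulmxA mulVmx // mulmx1.
  rewrite -!conjzM //; congr conjz; rewrite cc -mulmxA mulVmx ?mulmx1 //.
  by apply: SL2_unit; exact: SL2M.
have bnd : frob (conjz z c - 1%:M) <= 576 * Qf h z * Qf g z.
  rewrite Vz; apply: le_trans (commutator_small _ _ _ _) _; try exact: conjz_SL2.
  - by apply: le_trans fh _; move: Qh; rewrite eps0E; clear; move: (Qf h z) => x; lra.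
  - by apply: le_trans fg _; move: Qg; rewrite eps0E; clear; move: (Qf g z) => x; lra.
  rewrite (_ : 576 * Qf h z * Qf g z = 144 * ((2 * Qf h z) * (2 * Qf g z))); last by ring.
  by rewrite -mulrA ler_wpM2l //; apply: ler_pM => //; exact: frob_ge0.
have lt1 : frob (conjz z c - 1%:M) < Qf g z.
  apply: (le_lt_trans bnd); move: Q0 Qh; clear; move: (Qf g z) => y y0 Qh; rewrite (gtr_pMl _ y0).
  move: Qh; rewrite eps0E; clear; move: (Qf h z) => x; lra.
have sc : SL2 c by exact: Gd.
suff c1 : c = 1%:M by rewrite -cgh c1 mul1mx.
apply: contrapT => nc1.
(* Minimality of [g] concerns noncentral elements only, so [c = - 1] is excluded by its squared
   distance 8 from 1. *)
have [cN|ncN] := pselect (c = - 1%:M).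
  have f8 : frob (- 1%:M - 1%:M : 'M[R]_2) = 8 by rewrite frob_sub1 !mxE /= ?mulr0n ?mulr1n; ring.
  move: lt1; rewrite cN conjzN1 // f8 => lt1.
  by move: Qg lt1; rewrite eps0E; clear; move: (Qf g z) => x; lra.
have := gmin c; have := Qf_le_frob z0 sc => a b.
by have := le_trans (b _) a; rewrite leNgt lt1 => /(_ (And3 Gc nc1 ncN)).
Qed.

(** Commuting matrices have proportional trace-free parts when one of them is not scalar, and [Qf]
    is a quadratic form in the trace-free part. *)
Lemma commute_Qf G g h : SL2_subgroup G -> noncentral G g -> G h -> h *m g = g *m h ->
  exists l : R, forall w, 0 < w.2 -> Qf h w = l ^+ 2 * Qf g w.
Proof.
move=> sG ng Gh hg; have [Gd _ _ _] := sG; have [Gg n1 n2] := ng.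
have sg : SL2 g by exact: Gd. have sh : SL2 h by exact: Gd.
pose a (k : 'M[R]_2) : R := k 0 0 - k 1 1.
suff [l [e1 e2 e3]] : exists l : R, [/\ a h = l * a g, h 0 1 = l * g 0 1 & h 1 0 = l * g 1 0].
  exists l => w w0; rewrite !Qf_conjz // /conjz !mx2E.
  rewrite (_ : h 0 0 - h 1 0 * w.1 - (h 1 1 + h 1 0 * w.1) = a h - 2 * h 1 0 * w.1); last by rewrite /a; ring.
  rewrite (_ : g 0 0 - g 1 0 * w.1 - (g 1 1 + g 1 0 * w.1) = a g - 2 * g 1 0 * w.1); last by rewrite /a; ring.
  rewrite -!/(a _) e1 e2 e3; field; by rewrite gt_eqF.
have c1 : h 0 1 * g 1 0 = g 0 1 * h 1 0.
  have := congr1 (fun M : 'M[R]_2 => M 0 0) hg; rewrite /= !mulmx2E => /eqP; rewrite -subr_eq0 => /eqP e.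
  by apply/eqP; rewrite -subr_eq0 -e; apply/eqP; ring.
have c2 : a h * g 0 1 = a g * h 0 1.
  have := congr1 (fun M : 'M[R]_2 => M 0 1) hg; rewrite /= !mulmx2E => /eqP; rewrite -subr_eq0 => /eqP e.
  by apply/eqP; rewrite -subr_eq0 -e /a; apply/eqP; ring.
have c3 : a h * g 1 0 = a g * h 1 0.
  have := congr1 (fun M : 'M[R]_2 => M 1 0) hg; rewrite /= !mulmx2E => /eqP; rewrite -subr_eq0 => /eqP e.
  by apply/eqP; rewrite -subr_eq0 -[X in _ == X]oppr0 -e /a; apply/eqP; ring.
have [b0|b0] := eqVneq (g 0 1) 0; last first.
  exists (h 0 1 / g 0 1); split; [|by rewrite divfK|].
    by rewrite mulrAC [h 0 1 * _]mulrC -c2 mulfK.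
  by rewrite mulrAC c1 mulrAC divff // mul1r.
have [d0|d0] := eqVneq (g 1 0) 0; last first.
  exists (h 1 0 / g 1 0); split; [| |by rewrite divfK].
    by rewrite mulrAC [h 1 0 * _]mulrC -c3 mulfK.
  by rewrite mulrAC [h 1 0 * _]mulrC -c1 mulfK.
have a0 : a g != 0.
  apply/eqP => a0; have dg := sg; rewrite /SL2 det2E b0 mul0r subr0 in dg.
  have e : g 0 0 = g 1 1 by apply/eqP; rewrite -subr_eq0; apply/eqP.
  have : (g 1 1 - 1) * (g 1 1 + 1) = 0 by rewrite e in dg; transitivity (g 1 1 * g 1 1 - 1); [ring|rewrite dg subrr].
  move/eqP; rewrite mulf_eq0 => /orP[]; rewrite ?subr_eq0 ?addr_eq0 => /eqP e4.
  - by apply: n1; apply: matrix2P; rewrite !one2E ?e ?b0 ?d0 ?e4.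
  - by apply: n2; apply: matrix2P; rewrite !mxE /= ?mulr0n ?mulr1n ?oppr0 ?e ?b0 ?d0 ?e4.
exists (a h / a g); split; first by rewrite divfK.
  by rewrite b0 mulr0; move/eqP: c2; rewrite b0 mulr0 eq_sym mulf_eq0 (negbTE a0) => /eqP.
by rewrite d0 mulr0; move/eqP: c3; rewrite d0 mulr0 eq_sym mulf_eq0 (negbTE a0) => /eqP.
Qed.

(** By commutation [Qf h] is a constant multiple of [Qf g] on the whole half-plane; minimality at z
    shows the factor to be at least 1. *)
Lemma thin_minimal (G : set 'M[R]_2) z g h w : SL2_subgroup G -> 0 < z.2 -> 0 < w.2 ->
  noncentral G g -> noncentral G h -> (forall k, noncentral G k -> Qf g z <= Qf k z) ->
  Qf h z <= eps0 -> Qf g w <= Qf h w.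
Proof.
move=> sG z0 w0 ng nh gmin Qh; have [Gh _ _] := nh; have [Gd _ _ _] := sG.
have Qgh := gmin h nh.
have [l hl] := commute_Qf sG ng Gh (thin_commute sG z0 ng Gh gmin (le_trans Qgh Qh) Qh).
have Q0 := Qf_gt0 sG ng z0.
have l1 : 1 <= l ^+ 2 by move: Qgh; rewrite hl // -{1}[Qf g z]mul1r ler_pM2r.
by rewrite hl // ler_peMl //; apply: ltW; apply: (Qf_gt0 sG ng).
Qed.
End SmallElements.

(** * The weight given by the minimal displacement *)

Section ThinPart.
Variable R : realType.
Implicit Types (z w v : R * R) (g h : 'M[R]_2).
Local Notation hyp := (@hyp_measure R).
Local Notation H := (upper_half R).
Local Notation sg := (@sigma R).
Local Notation q0 := (@qthin R).
Local Notation kk := (@kk R).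
Local Notation eps0 := (@eps0 R).
Let mH : measurable H. Proof. exact: measurable_upper_half. Qed.

Lemma seq_min (s : seq R) (x0 : R) : exists2 m, m \in x0 :: s & forall x, x \in x0 :: s -> m <= x.
Proof.
elim: s => [|y s [m mi hm]].
  by exists x0; rewrite ?mem_head // => x; rewrite inE => /eqP ->.
have [ym|my] := leP y m.
  exists y; first by rewrite !inE eqxx orbT.
  move=> x; rewrite !inE => /or3P[/eqP ->|/eqP -> //|xs].
    by apply: le_trans ym _; apply: hm; exact: mem_head.
  by apply: le_trans ym _; apply: hm; rewrite inE xs orbT.
exists m.
  by move: mi; rewrite !inE => /orP[->//|->]; rewrite !orbT.
move=> x; rewrite !inE => /or3P[/eqP ->|/eqP ->|xs]; [|exact: ltW|].
  by apply: hm; exact: mem_head.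
by apply: hm; rewrite inE xs orbT.
Qed.

(** The added value 1 makes the set non-empty and leaves only finitely many elements to compare, so
    that a minimum exists. *)
Definition qvalues (G : set 'M[R]_2) w : set R :=
  [set x | x = 1 \/ exists2 g, noncentral G g & x = Qf g w].

Definition minq G w : R := xget 1 [set m | qvalues G w m /\ forall x, qvalues G w x -> m <= x].

Section Fuchsian.
Variable G : set 'M[R]_2.
Hypothesis FG : fuchsian G.
Let sG : SL2_subgroup G. Proof. by case: FG. Qed.
Let Gd g : G g -> SL2 g. Proof. by case: sG => + _ _ _; apply. Qed.

Lemma minq_spec w : 0 < w.2 -> qvalues G w (minq G w) /\ forall x, qvalues G w x -> minq G w <= x.
Proof.
move=> w0; rewrite /minq.
have := @xgetPex _ 1 [set m | qvalues G w m /\ forall x, qvalues G w x -> m <= x].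
apply; have [N hN] := fuchsian_count 2 FG w0.
have /finite_seqP[s sE] : finite_set [set g | noncentral G g /\ Qf g w <= 1].
  apply: sub_finite_set (count_le_finite hN) => g [[Gg _ _] Q1]; split=> //.
  by apply: le_trans (hypu_of_Qf w0 (Gd Gg)) _; lra.
have [m mi hm] := seq_min [seq Qf g w | g <- s] 1; exists m; split.
  move: mi; rewrite inE => /orP[/eqP ->|/mapP[g gs ->]]; first by left.
  right; exists g => //.
  have : [set` s] g by [].
  by rewrite -sE => -[].
move=> x [->|[g ng ->]]; first by apply: hm; exact: mem_head.
have [Q1|Q1] := leP (Qf g w) 1; last by apply: le_trans (ltW Q1); apply: hm; exact: mem_head.
apply: hm; rewrite inE; apply/orP; right; apply/mapP; exists g => //.
have : [set g | noncentral G g /\ Qf g w <= 1] g by [].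
by rewrite sE.
Qed.

Lemma minq_le1 w : 0 < w.2 -> minq G w <= 1.
Proof. by move=> w0; apply: (minq_spec w0).2; left. Qed.

Lemma minq_le w g : 0 < w.2 -> noncentral G g -> minq G w <= Qf g w.
Proof. by move=> w0 ng; apply: (minq_spec w0).2; right; exists g. Qed.

Lemma minq_gt0 w : 0 < w.2 -> 0 < minq G w.
Proof. by move=> w0; case: (minq_spec w0).1 => [->|[g ng ->]] //; exact: (Qf_gt0 sG). Qed.

Lemma minq_attained w : 0 < w.2 -> minq G w < 1 ->
  exists g, [/\ noncentral G g, minq G w = Qf g w & forall k, noncentral G k -> Qf g w <= Qf k w].
Proof.
move=> w0 m1; case: (minq_spec w0) => -[E|[g ng E]] hm; first by rewrite E ltxx in m1.
by exists g; split=> // k nk; rewrite -E; apply: hm; right; exists k.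
Qed.

Lemma noncentral_conj g h : noncentral G g -> G h -> noncentral G (h *m g *m invmx h).
Proof.
move=> [Gg n1 n2] Gh; have [_ _ GM GV] := sG; have uh : h \in unitmx by apply: SL2_unit; exact: Gd.
have back (a : 'M[R]_2) : h *m g *m invmx h = a -> g = invmx h *m a *m h.
  by move=> <-; rewrite -!mulmxA mulVmx // mulmx1 mulKmx.
split.
- by apply: (GM _ _ (GM _ _ Gh Gg)); exact: GV.
- by move=> /back; rewrite mulmx1 mulVmx.
- by move=> /back; rewrite mulmxN mulmx1 mulNmx mulVmx.
Qed.

Lemma minq_inv_le w h : 0 < w.2 -> G h -> minq G (mobius h w) <= minq G w.
Proof.
move=> w0 Gh; have sh := Gd Gh; have hw0 := mobius_upper sh w0.
case: (minq_spec w0).1 => [->|[g ng ->]]; first exact: minq_le1.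
have ng' := noncentral_conj ng Gh; have [Gg _ _] := ng; have [Gg' _ _] := ng'.
have uh := SL2_unit sh.
apply: le_trans (minq_le hw0 ng') _; rewrite Qf_mobius //; last exact: Gd.
by rewrite !mulmxA mulVmx // mul1mx -mulmxA mulVmx // mulmx1.
Qed.

Lemma minq_inv w h : 0 < w.2 -> G h -> minq G (mobius h w) = minq G w.
Proof.
move=> w0 Gh; have sh := Gd Gh; apply/eqP; rewrite eq_le minq_inv_le //=.
have [_ _ _ GV] := sG.
by rewrite -{1}(mobiusK sh w0) minq_inv_le //; [exact: mobius_upper|exact: GV].
Qed.

Lemma minq_near z w : 0 < z.2 -> 0 < w.2 -> hypu z w <= 3 -> minq G w <= 36 * minq G z.
Proof.
move=> z0 w0 u3; case: (minq_spec z0).1 => [->|[g ng ->]].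
  by apply: le_trans (minq_le1 w0) _; rewrite mulr1 ler1n.
by apply: le_trans (minq_le w0 ng) _; apply: Qf_near => //; apply: Gd; case: ng.
Qed.

(** An element [h] with [Qf h w < Qf g w] satisfies [Qf h z <= 36 Qf h w <= 36 * 36 * Qf g z], hence
    is small at z, where [thin_minimal] excludes it. The same [g] thus governs a whole kernel step
    around z. *)
Lemma minq_persists z w g : 0 < z.2 -> 0 < w.2 -> hypu z w <= 3 -> noncentral G g ->
  minq G z = Qf g z -> (forall k, noncentral G k -> Qf g z <= Qf k z) ->
  36 * (36 * minq G z) <= eps0 -> Qf g w <= minq G w.
Proof.
move=> z0 w0 u3 ng E gmin small; have [Gg _ _] := ng.
have near := Qf_near z0 w0 (Gd Gg) u3.
have e1 : eps0 <= 1 by rewrite eps0E; lra.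
case: (minq_spec w0) => -[E1|[h nh E1]] hm.
  rewrite E1; apply: le_trans near _; rewrite -E; have := minq_gt0 z0.
  by move: small e1; clear; move: (minq G z) (eps0) => x e; lra.
have [Qle|Qlt] := leP (Qf g w) (Qf h w); first by rewrite E1.
have [Gh _ _] := nh; have u3' : hypu w z <= 3 by rewrite hypuC.
have nearh := Qf_near w0 z0 (Gd Gh) u3'.
rewrite E1; apply: (thin_minimal sG z0 w0 ng nh gmin).
rewrite E in small.
by move: small near nearh Qlt; clear; move: (Qf g z) (Qf g w) (Qf h w) (Qf h z) (eps0) => a b c d e; lra.
Qed.

Definition mq w : R := if 0 < w.2 then minq G w else 1.
Definition wt w : R := mq w `^ (- sg).

Lemma wt_gt0 w : 0 < wt w.
Proof.
rewrite /wt /mq; case: ifPn => w0; first by rewrite powR_gt0 // minq_gt0.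
by rewrite powR_gt0.
Qed.

(** At each point the minimum is reached after finitely many terms of an enumeration, so [mq] is a
    pointwise limit of finite minima. *)
Lemma measurable_mq : measurable_fun setT mq.
Proof.
have [e [P [Pe eP _]]] := fuchsian_enum FG.
pose nc g := `[< noncentral G g >].
pose f n w : R := if (0 < w.2) && P n && nc (e n) then Num.min 1 (Qf (e n) w) else 1.
pose m := fix m n := if n is k.+1 then (fun w : R * R => Num.min (m k w) (f k w)) else (fun=> 1).
have mf n : measurable_fun setT (f n).
  rewrite /f; apply: measurable_fun_ifT; last by exact: measurable_cst.
    apply: measurable_and; last exact: measurable_cst.
    apply: measurable_and; last exact: measurable_cst.
    exact: measurable_fun_ltr.
  by apply: measurable_minr => //; exact: measurable_Qf.
have mm n : measurable_fun setT (m n).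
  by elim: n => [|n IH] /=; [exact: measurable_cst|exact: measurable_minr].
have lim w : m n w @[n --> \oo] --> mq w.
  have up n : mq w <= m n w.
    elim: n => [|n IH] /=.
      by rewrite /mq; case: ifP => // w0; exact: minq_le1.
    rewrite le_min IH /= /f; case: ifPn => [|_].
      move=> /andP[/andP[w0 Pn] /asboolP ng]; rewrite le_min /mq w0 minq_le1 // minq_le //.
    by rewrite /mq; case: ifP => // w0; exact: minq_le1.
  have anti k l : (k <= l)%N -> m l w <= m k w.
    move=> /subnK <-; elim: (l - k)%N => // d IH; rewrite addSn /=.
    by apply: le_trans IH; rewrite ge_min lexx.
  have [n0 hn0] : exists n0, m n0 w <= mq w.
    rewrite /mq; case: ifPn => w0; last by exists 0%N.
    case: (minq_spec w0).1 => [->|[g ng E]]; first by exists 0%N.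
    have [Gg _ _] := ng; have [n Pn en] := eP g Gg.
    exists n.+1; rewrite /= ge_min; apply/orP; right.
    rewrite /f w0 Pn en /nc; have -> : `[< noncentral G g >] by exact/asboolP.
    by rewrite /= E ge_min lexx orbT.
  apply: cvg_near_cst; exists n0 => // n /= nn; apply/eqP; rewrite eq_le up andbT.
  exact: le_trans (anti _ _ nn) hn0.
by apply: (@measurable_fun_cvg _ _ _ setT m mq) => // w _; exact: lim.
Qed.

Lemma powR_anti (a b : R) : 0 < a -> a <= b -> b `^ (- sg) <= a `^ (- sg).
Proof.
move=> a0 ab; have b0 := lt_le_trans a0 ab; have s0 := @sigma_gt0 R.
by rewrite /powR !gt_eqF // ler_expR !mulNr lerN2 (ler_pM2l s0) ler_ln.
Qed.

(** Within reach of the kernel the weight is at most the power of [Qf g] for the element [g] that is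
    minimal at z, with equality at z; so [contraction] for this one element suffices. *)
Lemma wt_super z : 0 < z.2 -> 36 * (36 * mq z) < eps0 ->
  (\int[hyp]_(w in H) (kk (hypu z w) * wt w)%:E <= (q0 * wt z)%:E)%E.
Proof.
move=> z0; rewrite /wt /mq z0 => small; have m0 := minq_gt0 z0.
have [_ kk0 _] := @rkernel_kk R.
have e1 : eps0 <= 1 by rewrite eps0E; lra.
have m1 : minq G z < 1 by move: small e1 m0; clear; move: (minq G z) (eps0) => x e; lra.
have [g [ng E gmin]] := minq_attained z0 m1.
have [Gg _ _] := ng.
rewrite E; apply: le_trans (contraction (Gd Gg) z0 (Qf_gt0 sG ng z0)).
apply: ge0_le_integral => //.
- by move=> w _; rewrite lee_fin mulr_ge0 // ltW // wt_gt0.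
- apply: (@measurable_funS _ _ _ _ setT) => //; apply/measurable_EFinP; apply: measurable_funM.
    by apply: measurable_rkernel_hypu; exact: rkernel_kk.
  by apply: (measurableT_comp (measurable_powR (- sg))); exact: measurable_mq.
- by apply: (@measurable_funS _ _ _ _ setT) => //; exact: measurable_weighted.
- move=> w w0; rewrite /weighted lee_fin (w0 : 0 < w.2).
  have [->|kn] := eqVneq (kk (hypu z w)) 0; first by rewrite !mul0r.
  have /andP[_ u3] := kk_supp kn.
  rewrite ler_wpM2l // powR_anti //; first exact: (Qf_gt0 sG).
  by apply: (minq_persists z0 w0 u3 ng E gmin); exact: ltW.
Qed.

(* The factor 36^3 leaves room for steps of the kernel, each of which changes
   [mq] by a factor of at most 36. *)
Definition thin : set (R * R) := [set z | 0 < z.2 /\ 36 * (36 * (36 * mq z)) < eps0].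

Lemma measurable_thin : measurable thin.
Proof.
have -> : thin = H `&` [set z | 36 * (36 * (36 * mq z)) < eps0] by apply/seteqP; split=> z [].
apply: measurableI => //; rewrite -[X in measurable X]setTI.
have := @measurable_fun_ltr _ _ _ setT (fun z => 36 * (36 * (36 * mq z))) (fun=> eps0).
have mm : measurable_fun setT (fun z => 36 * (36 * (36 * mq z))).
  by do 3!apply: measurable_funM => //; exact: measurable_mq.
move=> /(_ mm (measurable_cst _)) h.
have := h measurableT [set true] I.
by rewrite setTI; congr measurable; apply/seteqP; split=> z /=.
Qed.
End Fuchsian.

Variable G : set 'M[R]_2.
Hypothesis CG : cofinite_fuchsian G.
Let FG : fuchsian G. Proof. by case: CG. Qed.
Let sG : SL2_subgroup G. Proof. by case: FG. Qed.
Let Gd g : G g -> SL2 g. Proof. by case: sG => + _ _ _; apply. Qed.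
Local Notation F := (fundom G).
Local Notation T := (thin G).

Lemma mq_inv h z : G h -> 0 < z.2 -> mq G (mobius h z) = mq G z.
Proof. by move=> Gh z0; rewrite /mq (mobius_upper (Gd Gh) z0) z0 (minq_inv FG). Qed.

(** Schur's test for the kernel cut off to thin points in its first variable. In the second variable
    a point counts only if a thin point lies within one kernel step, and there the weight is still a
    supersolution. *)
Theorem thin_bound f : L2r G f ->
  (\int[hyp]_(z in F `&` T) ((\int[hyp]_(w in H) (kk (hypu z w) * `|f w|)%:E) ^+ 2) <=
   (q0 * q0)%:E * \int[hyp]_(z in F) (f z ^+ 2)%:E)%E.
Proof.
move=> [If mf _]; have [_ kk0 _] := @rkernel_kk R.
have [q00 q01] := andP (@qthin_itv R).
pose ka z w : R := kk (hypu z w) * (if `[< T z >] then 1 else 0).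
have ka0 z w : 0 <= ka z w by rewrite mulr_ge0 //; case: ifP.
have mT : measurable_fun setT (fun z => if `[< T z >] then 1 else 0 : R).
  rewrite (_ : (fun z => if `[< T z >] then 1 else 0 : R) = \1_T).
    exact: measurable_indic (measurable_thin FG).
  apply/funext => z; rewrite indicE; case: asboolP => h; first by rewrite mem_set.
  by rewrite memNset.
have mka : measurable_fun setT (fun p : (R * R) * (R * R) => ka p.1 p.2).
  apply: measurable_funM; first by apply: measurable_rkernel2; exact: rkernel_kk.
  by apply: (measurableT_comp mT).
have Tinv g z : G g -> 0 < z.2 -> `[< T (mobius g z) >] = `[< T z >].
  move=> Gg z0; apply: asbool_equiv_eq; rewrite /thin /= mq_inv // z0.
  by rewrite (mobius_upper (Gd Gg) z0).
have sup z : 0 < z.2 -> 36 * (36 * mq G z) < eps0 ->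
    (\int[hyp]_(w in H) (kk (hypu z w) * wt G w)%:E <= (q0 * wt G z)%:E)%E by exact: wt_super.
have wt0 z : 0 < wt G z by exact: wt_gt0.
have mwt : measurable_fun setT (wt G).
  by apply: (measurableT_comp (measurable_powR (- sg))); exact: measurable_mq.
(* One kernel step costs a factor of 36, which the third factor in [thin] absorbs. *)
have cut (z : R * R) w : mq G w <= 36 * mq G z -> 36 * (36 * (36 * mq G z)) < eps0 -> 36 * (36 * mq G w) < eps0.
  by clear; move: (mq G z) (mq G w) (eps0) => a b e; lra.
have S1 z : F z -> (\int[hyp]_(w in H) (ka z w * wt G w)%:E <= (q0 * wt G z)%:E)%E.
  move=> /fundom_upper z0; rewrite /ka; case: asboolP => h.
    under eq_integral => w _ do rewrite mulr1.
    by apply: sup => //; case: h => _; apply: (cut z); rewrite -[leLHS]mul1r ler_wpM2r ?ler1n // /mq z0 ltW // minq_gt0.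
  rewrite integral0_eq => [|w _]; last by rewrite mulr0 mul0r.
  by rewrite lee_fin mulr_ge0 // ltW.
have S2 w : F w -> (\int[hyp]_(z in H) (ka z w * wt G z)%:E <= (q0 * wt G w)%:E)%E.
  move=> /fundom_upper w0; have [small|big] := ltP (36 * (36 * mq G w)) eps0.
    apply: le_trans (sup w w0 small); apply: ge0_le_integral => //.
    - by move=> z _; rewrite lee_fin mulr_ge0 // ltW.
    - apply: (@measurable_funS _ _ _ _ setT) => //; apply/measurable_EFinP; apply: measurable_funM => //.
      by apply: (measurableT_comp mka (g := fun z => (z, w))); exact: measurable_pair2.
    - apply: (@measurable_funS _ _ _ _ setT) => //; apply/measurable_EFinP; apply: measurable_funM => //.
      by apply: measurable_rkernel_hypu; exact: rkernel_kk.
    - move=> z z0; rewrite lee_fin ler_wpM2r //; first exact: ltW.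
      by rewrite /ka hypuC; case: ifP; rewrite ?mulr1 ?mulr0.
  rewrite integral0_eq => [|z z0]; first by rewrite lee_fin mulr_ge0 // ltW.
  rewrite /ka; case: asboolP => [[_ h]|_]; last by rewrite mulr0 mul0r.
  have [->|kn] := eqVneq (kk (hypu z w)) 0; first by rewrite !mul0r.
  have /andP[_ u3] := kk_supp kn.
  have := minq_near FG z0 w0 u3.
  by move=> h1; have := cut z w; rewrite /mq w0 (z0 : 0 < z.2) in big h * => /(_ h1 h); rewrite ltNge big.
have If' : mobius_invariant G f by [].
have Iw : mobius_invariant G (wt G) by move=> g z Gg z0; rewrite /wt mq_inv.
have ki (g : 'M[R]_2) z w : G g -> 0 < z.2 -> 0 < w.2 -> ka (mobius g z) (mobius g w) = ka z w.
  by move=> Gg z0 w0; rewrite /ka hypu_mobius ?Tinv //; exact: Gd.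
have := schur CG mka ka0 ki mwt Iw (fun z _ => wt0 z) mf If q00 (ltW q00) S1 S2.
apply: le_trans.
have mF : measurable F by exact: measurable_fundom.
have mI : measurable_fun setT (fun z => \int[hyp]_(w in H) (ka z w * `|f w|)%:E)%E.
  apply: (@measurable_hyp_integral _ _ _ _ (fun z w => (ka z w * `|f w|)%:E)) => //.
    apply/measurable_EFinP; apply: measurable_funM => //.
    by apply: (measurableT_comp (@normr_measurable R setT)); apply: (measurableT_comp mf).
  by move=> z w; rewrite lee_fin mulr_ge0.
rewrite -[X in (X <= _)%E](_ : \int[hyp]_(z in F `&` T) ((\int[hyp]_(w in H) (ka z w * `|f w|)%:E) ^+ 2) = _)%E.
  apply: ge0_subset_integral => //.
  - by apply: measurableI => //; exact: measurable_thin.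
  - by apply: (@measurable_funS _ _ _ _ setT) => //; under eq_fun do rewrite expe2; exact: emeasurable_funM.
  - by move=> z _; rewrite sqre_ge0.
apply: eq_integral => z; rewrite inE => -[_ Tz]; congr (_ ^+ 2)%E; apply: eq_integral => w _.
by rewrite /ka; case: asboolP => // _; rewrite mulr1.
Qed.
End ThinPart.

(** * The thick part *)

Section ThickPart.
Variable R : realType.
Implicit Types (z w v : R * R) (g h : 'M[R]_2).
Local Notation hyp := (@hyp_measure R).
Local Notation H := (upper_half R).
Local Notation q0 := (@qthin R).
Local Notation kk := (@kk R).
Local Notation eps0 := (@eps0 R).
Let mH : measurable H. Proof. exact: measurable_upper_half. Qed.
Let rk := @rkernel_kk R.

(** At a thick point every element other than 1 is at squared distance at least [eps0 / 36^3] from 1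
    after conjugation: noncentral elements by the definition of [thin], and -1 because its squared
    distance is 8. So the count is uniform over all groups. *)
Lemma thick_count : exists N, forall (G : set 'M[R]_2) z, fuchsian G -> 0 < z.2 -> ~ thin G z ->
  count_le [set g | G g /\ hypu z (mobius g z) <= 18] N.
Proof.
pose e : R := eps0 / 36 ^+ 3.
have e0 : 0 < eps0 by rewrite eps0E invr_gt0 ltr0n.
have [N hN] := count_conj_separated 18 (divr_gt0 e0 (exprn_gt0 3 (ltr0Sn R 35)) : 0 < e).
exists N => G z FG z0 nT; have [sG _] := FG; apply: hN => // g Gg small.
apply: contrapT => n1; apply: nT; split=> //; have sg : SL2 g by case: sG => Gd _ _ _; exact: Gd.
have h36 (x : R) : x < e -> 36 * (36 * (36 * x)) < eps0.
  rewrite /e ltr_pdivlMr ?exprn_gt0 // => h.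
  by rewrite (_ : 36 * _ = x * 36 ^+ 3) //; ring.
apply: h36; apply: le_lt_trans small; rewrite /mq z0.
have [gN|gN] := pselect (g = - 1%:M); last first.
  by apply: le_trans (Qf_le_frob z0 sg); apply: (minq_le FG).
apply: le_trans (minq_le1 FG z0) _; rewrite gN conjzN1 //.
by rewrite frob_sub1 !mxE /= ?mulr0n ?mulr1n; lra.
Qed.

Lemma count_near (G : set 'M[R]_2) z0 z (r c : R) : SL2_subgroup G -> 0 < z0.2 -> 0 < z.2 -> 0 <= c -> hypu z0 z <= r ->
  [set g | G g /\ hypu z (mobius g z) <= c] `<=` [set g | G g /\ hypu z0 (mobius g z0) <= 4 * r * r * c].
Proof.
move=> [Gd _ _ _] z00 zz0 c0 ur g [Gg h]; split=> //; have sg := Gd _ Gg.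
have gz := mobius_upper sg zz0; have gz0 := mobius_upper sg z00.
apply: le_trans (hypu_triangle z00 zz0 gz0) _.
have t2 := hypu_triangle zz0 gz gz0; rewrite (hypu_mobius sg zz0 z00) [hypu z z0]hypuC in t2.
have u1 := hypu_ge1 z00 zz0; have v1 := hypu_ge1 zz0 gz.
have p0 : 0 <= hypu z (mobius g z0) by apply: le_trans (hypu_ge1 zz0 gz0).
move: h ur t2 u1 v1 p0; move: (hypu z0 z) (hypu z _) (hypu z _) => x y t h ur t2 u1 v1 p0.
have tc : t * x <= c * r by apply: ler_pM => //; lra.
have y2 : y <= 2 * (c * r) by lra.
have : x * y <= r * (2 * (c * r)) by apply: ler_pM => //; lra.
lra.
Qed.

Section Fixed.
Variable G : set 'M[R]_2.
Hypothesis CG : cofinite_fuchsian G.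
Let FG : fuchsian G. Proof. by case: CG. Qed.
Let sG : SL2_subgroup G. Proof. by case: FG. Qed.
Local Notation F := (fundom G).
Let mF : measurable F. Proof. exact: measurable_fundom. Qed.
Local Notation sf := (stack_factor G).
Let sf0 : 0 < sf. Proof. exact: stack_factor_gt0. Qed.
Let hs := sip_L2r CG.
Local Notation ip := (ipr G).
Local Notation nr := (nrm (ipr G)).
Local Notation a z := (aut G kk z).

Lemma ipr_aut_le k c z f (M : R) : rkernel k -> mass_le k c -> 0 < z.2 -> 0 <= M -> L2r G f ->
  (forall w, 0 <= f w) -> (forall w, 0 < w.2 -> f w <= M) -> ip (aut G k z) f <= M * c.
Proof.
move=> kk mk z0 M0 Lf f0 fM; have [_ mf _] := Lf; have [_ k0 _] := kk.
rewrite -lee_fin -(ipr_aut_pos CG kk z0 Lf f0).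
apply: le_trans (_ : (\int[hyp]_(w in H) (M%:E * (k (hypu z w))%:E) <= _)%E).
  apply: ge0_le_integral => //.
  - by move=> w _; rewrite lee_fin mulr_ge0.
  - apply: (@measurable_funS _ _ _ _ setT) => //; apply/measurable_EFinP; apply: measurable_funM => //.
    exact: measurable_rkernel_hypu.
  - apply: (@measurable_funS _ _ _ _ setT) => //; apply/measurable_EFinP; apply: measurable_funM => //.
    exact: measurable_rkernel_hypu.
  - by move=> w w0; rewrite -EFinM lee_fin mulrC ler_wpM2r // fM.
rewrite ge0_integralZl_EFin //; last 2 first.
- by move=> w _; rewrite lee_fin.
- by apply: (@measurable_funS _ _ _ _ setT) => //; apply/measurable_EFinP; exact: measurable_rkernel_hypu.
by rewrite EFinM lee_wpmul2l ?lee_fin //; exact: mass_le_hyp.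
Qed.

(** If continuity failed along a sequence tending to [z0], the kernels would still converge
    pointwise, by symmetry and smoothness in the other variable, and stay uniformly bounded; on
    finite volume dominated convergence gives a contradiction. *)
Lemma aut_L2_continuous z0 (d : R) : 0 < z0.2 -> 0 < d -> exists2 n, (0 < n)%N &
  forall z, 0 < z.2 -> hypu z0 z < 1 + 2 / n%:R -> ip (a z - a z0) (a z - a z0) <= d.
Proof.
move=> z00 d0; apply: contrapT => nex.
(* The constant of [count_near] for centres with [u <= 2] and the displacement 18 of [aut_le]. *)
have [N hN] := fuchsian_count (4 * 2 * 2 * 18) FG z00.
have [M M0 hM] := rkernel_bounded rk.
have bad n : exists z, [/\ 0 < z.2, hypu z0 z < 1 + 2 / (n.+2)%:R & d < ip (a z - a z0) (a z - a z0)].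
  apply: contrapT => nz; apply: nex; exists n.+2 => // z zz0 hz.
  by rewrite leNgt; apply/negP => lt; apply: nz; exists z.
have [zs hzs] := choice bad.
have zs0 n : 0 < (zs n).2 by have [] := hzs n.
have zsn n : hypu z0 (zs n) <= 2.
  have [_ h _] := hzs n; apply: ltW; apply: lt_le_trans h _.
  rewrite -lerBrDl (_ : 2 - 1 = 1); last by ring.
  by rewrite ler_pdivrMr ?ltr0n // mul1r ler_nat.
have bd n w : 0 < w.2 -> a (zs n) w <= N%:R * M.
  move=> w0; apply: (aut_le FG rk) => //; exact: count_leS (count_near sG z00 (zs0 n) (ler0n _ 18) (zsn n)) hN.
have bd0 w : 0 < w.2 -> a z0 w <= N%:R * M.
  move=> w0; apply: (aut_le FG rk) => //; apply: count_leS (count_near sG z00 z00 (ler0n _ 18) _) hN.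
  by rewrite hypuxx ler1n.
set C := N%:R * M in bd bd0.
have C0 : 0 <= C by rewrite mulr_ge0.
have ga n w : 0 <= a (zs n) w by exact: aut_ge0.
have ga0 w : 0 <= a z0 w by exact: aut_ge0.
have Ld n : L2r G (a (zs n) - a z0) by apply: (sipB hs); exact: (aut_L2r CG rk).
have lim : (fun n => ip (a (zs n) - a z0) (a (zs n) - a z0)) n @[n --> \oo] --> (0 : R).
  rewrite -[X in _ --> X](mulr0 sf); apply: cvgM; first exact: cvg_cst.
  have LC : L2r G (fun=> C) by exact: L2r_cst.
  rewrite /Rintegral; apply: fine_cvg.
  rewrite [X in _ --> X](_ : 0%:E = (\int[hyp]_(w in F) (fun=> 0%E) w)%E); last by rewrite integral0_eq.
  apply: (@dominated_cvg _ _ _ hyp F mF (fun n w => ((a (zs n) w - a z0 w) * (a (zs n) w - a z0 w))%:E)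
    (fun w => 0%E) (fun w => (C * C)%:E)).
  - move=> n; apply: (@measurable_funS _ _ _ _ setT) => //; apply/measurable_EFinP.
    by have [_ m _] := Ld n; apply: measurable_funM; exact: m.
  - move=> w /fundom_upper w0; rewrite -[X in _ --> X](_ : ((0 * 0 : R)%:E = 0)%E); last by rewrite mulr0.
    apply: cvg_EFin; first exact: nearW.
    suff h : a (zs n) w - a z0 w @[n --> \oo] --> (0 : R) by exact: (cvgM h h).
    apply/cvgrPdist_le => e e0.
    have [c _] := smooth_aut FG rk w0 0; have cw := c z0 z00.
    have nU : nbhs z0 [set y | `|a w y - a w z0| <= e].
      by have /cvgrPdist_le /(_ e e0) := cw; apply: filterS => y; rewrite distrC.
    have [K hK] := hypu_near z00 nU; exists K => // n /= Kn.
    have [_ hz _] := hzs n; rewrite sub0r normrN (aut_sym FG rk (zs0 n) w0) (aut_sym FG rk z00 w0).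
    by apply: (hK n.+2) => //; apply: leq_trans Kn _; rewrite ltnW.
  - by move=> w _.
  - exact: (L2r_integrable_mul CG LC LC).
  - move=> n w /fundom_upper w0; rewrite abse_EFin lee_fin normrM.
    have h : `|a (zs n) w - a z0 w| <= C.
      have := bd n w w0; have := bd0 w w0; have := ga n w; have := ga0 w.
      by move=> x1 x2 x3 x4; rewrite ler_norml; apply/andP; split; lra.
    by apply: ler_pM.
have /cvgrPdist_lt /(_ d d0) [K _ hK] := lim.
have := hK K (leqnn _); have [_ _ hd] := hzs K.
rewrite /= sub0r normrN ger0_norm; last exact: (sip_ge0 hs).
by rewrite ltNge ltW.
Qed.

Definition rat_ball (j n : nat) : set (R * R) :=
  [set z | 0 < z.2 /\ hypu (rat_point R j) z < 1 + (3 * n%:R)^-1].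

Lemma measurable_rat_ball j n : measurable (rat_ball j n).
Proof.
have -> : rat_ball j n = H `&` [set z | hypu (rat_point R j) z < 1 + (3 * n%:R)^-1] by apply/seteqP; split=> z [].
apply: measurableI => //; rewrite -[X in measurable X]setTI.
have h := measurable_fun_ltr (measurable_hypu (rat_point R j)) (measurable_cst (1 + (3 * n%:R)^-1 : R)).
by have := h measurableT [set true] I; rewrite setTI; congr measurable; apply/seteqP; split=> z /=.
Qed.

Section Net.
Variable d : R.
Hypothesis d0 : 0 < d.

Definition good_ball (j n : nat) : Prop :=
  forall z, rat_ball j n z -> nr (a z - a (rat_point R j)) <= d.

Definition net_center (k : nat) : R * R :=
  if @choice.unpickle (nat * nat)%type k is Some jn then rat_point R jn.1 else (0, 1).

(** Pairs of a rational centre and a radius are enumerated; those on whose ball the automorphic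
    kernel varies too much in norm are replaced by the empty set. *)
Definition net (k : nat) : set (R * R) :=
  if @choice.unpickle (nat * nat)%type k is Some jn then
    (if `[< good_ball jn.1 jn.2 >] then rat_ball jn.1 jn.2 else set0) else set0.

Lemma net_center_upper k : 0 < (net_center k).2.
Proof. by rewrite /net_center; case: choice.unpickle => [jn|] //; exact: rat_point_upper. Qed.

Lemma measurable_net k : measurable (net k).
Proof.
rewrite /net; case: choice.unpickle => [jn|] //; case: ifP => // _; exact: measurable_rat_ball.
Qed.

Lemma net_near k z : net k z -> nr (a z - a (net_center k)) <= d.
Proof.
rewrite /net /net_center; case: choice.unpickle => [jn|] //.
by case: ifP => // /asboolP h hz; exact: h.
Qed.

Lemma net_cover z : 0 < z.2 -> exists k, net k z.
Proof.
move=> z0; have d2 : 0 < (d / 2) ^+ 2 by rewrite exprn_gt0 // divr_gt0.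
have [n n0 hn] := aut_L2_continuous z0 d2.
have n1 : 1 <= n%:R :> R by rewrite ler1n.
have t0 : 0 < (3 * n%:R)^-1 :> R by rewrite invr_gt0 mulr_gt0 // ltr0n.
have [j hj] := rat_point_dense z0 t0.
have p0 := rat_point_upper R j.
have tri w : rat_ball j n w -> hypu z w < 1 + 2 / n%:R.
  move=> [w0 hw]; have := hypu_triangle_sharp z0 p0 w0.
  have t1 : (3 * n%:R)^-1 <= 3^-1 :> R by rewrite lef_pV2 ?posrE ?mulr_gt0 ?ltr0n // ler_peMr.
  (* With [t = 1 / (3 n)], both steps have [u - 1 < t <= 1/3], so the sharp triangle inequality
     gives less than [2 (t + t + t) = 6 t]. *)
  have tn : 2 / n%:R = 6 * (3 * n%:R)^-1 :> R by field; rewrite gt_eqF // ltr0n.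
  rewrite tn; rewrite hypuC in hj.
  have := hypu_ge1 z0 p0; have := hypu_ge1 p0 w0.
  move: hj hw t1 t0; clear; move: (hypu z _) (hypu z _) (hypu _ w) (_^-1) => x y v t hx hv t1 t0 v1 x1 hy.
  have : (y - 1) * (v - 1) < t * 1.
    apply: le_lt_trans (_ : t * (v - 1) < _); first by rewrite ler_wpM2r //; lra.
    by rewrite ltr_pM2l //; lra.
  lra.
have close w : rat_ball j n w -> nr (a w - a z) <= d / 2.
  move=> hw; have w0 : 0 < w.2 by case: hw.
  rewrite -(ler_pXn2r (n := 2)) ?nnegrE ?nrm_ge0 ?divr_ge0 ?(ltW d0) // (nrm_sq hs).
  by apply: hn => //; exact: tri.
have La w : 0 < w.2 -> L2r G (a w) by exact: (aut_L2r CG rk).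
exists (choice.pickle (j, n)); rewrite /net choice.pickleK /=.
have -> : `[< good_ball j n >] = true.
  apply/asboolP => w hw; have w0 : 0 < w.2 by case: hw.
  have pj : rat_ball j n (rat_point R j) by split=> //; rewrite hypuxx ltrDl.
  have e : a w - a (rat_point R j) = (a w - a z) - (a (rat_point R j) - a z) by apply/funext => y; rewrite !fctE; ring.
  rewrite e; apply: le_trans (nrmB hs (sipB hs (La w w0) (La z z0)) (sipB hs (La _ p0) (La z z0))) _.
  have := close w hw; have := close _ pj; lra.
by split.
Qed.

(** The net covers the half-plane and the domain has finite volume, so the part missed by the first
    J sets has measure tending to 0. *)
Lemma net_exhausts (e : R) : 0 < e ->
  exists J, (hyp (F `\` \bigcup_(k in [set k | (k < J)%N]) net k) <= e%:E)%E.
Proof.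
move=> e0; pose E J := F `\` \bigcup_(k in [set k | (k < J)%N]) net k.
have mE J : measurable (E J) by apply: measurableD => //; apply: bigcup_measurable => k _; exact: measurable_net.
have cap0 : \bigcap_J E J = set0.
  apply/seteqP; split=> // z hz; have [Fz _] := hz 0%N I.
  have [k hk] := net_cover (fundom_upper Fz).
  by have [_] := hz k.+1 I; apply; exists k => /=.
have E0 : (hyp (E 0%N) < +oo)%E.
  have [_ h] := CG; apply: le_lt_trans h; apply: le_measure; rewrite ?inE //.
  exact: subDsetl.
have ni : {homo E : n m / (n <= m)%N >-> (m <= n)%O}.
  move=> n m nm; apply/subsetPset => z [Fz hz]; split=> // -[k /= kn nk]; apply: hz; exists k => //=.
  exact: leq_trans kn nm.
have mcap : measurable (\bigcap_J E J) by rewrite cap0.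
have := nonincreasing_cvg_mu E0 mE mcap ni; rewrite cap0 measure0.
move/fine_cvgP => [fin /cvgrPdist_le /(_ e e0)] lim.
have [J _ hJ] := filterI fin lim; have [/= f1 f2] := hJ J (leqnn _).
exists J; rewrite -/(E J) -(fineK f1) lee_fin.
by move: f2; rewrite sub0r normrN /comp; apply: le_trans; exact: ler_norm.
Qed.
End Net.

Lemma kint_le_abs f z : 0 < z.2 -> L2r G f ->
  (((kint kk f z) ^+ 2)%:E <= (\int[hyp]_(w in H) (kk (hypu z w) * `|f w|)%:E) ^+ 2)%E.
Proof.
move=> z0 Lf; have [_ kk0 _] := rk; have If := integrable_kernel CG rk z0 Lf.
have h := le_normr_Rintegral mH If.
have e : (\int[hyp]_(w in H) (kk (hypu z w) * `|f w|)%:E)%E =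
    (\int[hyp]_(w in H) `|kk (hypu z w) * f w|)%:E.
  rewrite /Rintegral fineK.
    by apply: eq_integral => w _; rewrite normrM (ger0_norm (kk0 _)).
  apply: integrable_fin_num => //; have := integrable_abse If.
  by apply: eq_integrable => // w _; rewrite /= abse_EFin.
rewrite e -EFin_expe lee_fin -[leLHS]real_normK ?num_real // ler_pXn2r ?nnegrE //.
exact: le_trans (normr_ge0 _) h.
Qed.

Lemma kint_sq_measurable f : L2r G f -> measurable_fun setT (fun z => (kint kk f z ^+ 2)%:E).
Proof.
by move=> [_ mf _]; apply/measurable_EFinP; apply: measurable_funX; exact: measurable_kint.
Qed.

Lemma integral_le_cst (D : set (R * R)) f (c m : R) : L2r G f -> measurable D -> 0 <= c ->
  (forall z, D z -> kint kk f z ^+ 2 <= c) -> (hyp D <= m%:E)%E ->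
  (\int[hyp]_(z in D) (kint kk f z ^+ 2)%:E <= (c * m)%:E)%E.
Proof.
move=> Lf mD c0 h Dm; apply: le_trans (_ : (\int[hyp]_(z in D) (cst c%:E) z <= _)%E).
  apply: ge0_le_integral => //.
  - by move=> z _; rewrite lee_fin sqr_ge0.
  - by apply: (@measurable_funS _ _ _ _ setT) => //; exact: kint_sq_measurable.
by rewrite integral_cst // EFinM lee_wpmul2l ?lee_fin.
Qed.

(** The domain is covered by three pieces: the thin part, where [thin_bound] applies; finitely many
    sets of the net, where the convolution is close to its value at a centre, which is one of the
    functionals; and a thick remainder of small volume, where it is bounded pointwise by the norm of
    [f]. *)
Lemma compact_modulo_thin (q1 : R) : q0 < q1 -> exists (n : nat) (v : 'I_n -> R * R -> R) (C : R),
  [/\ forall j, L2r G (v j), 0 <= C &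
      forall f, L2r G f -> nr (kint kk f) <= q1 * nr f + C * \sum_j `|ip (v j) f|].
Proof.
move=> q01; have /andP[q00 _] := @qthin_itv R.
have [N hN] := thick_count; have [M M0 hM] := rkernel_bounded rk.
pose B0 := N%:R * M; have B00 : 0 <= B0 by rewrite mulr_ge0.
have Bz z : 0 < z.2 -> ~ thin G z -> ip (a z) (a z) <= B0.
  move=> z0 nT; rewrite -[B0]mulr1.
  apply: (ipr_aut_le rk (mass_le_kk R) z0 B00 (aut_L2r CG rk z0)) => w; first exact: aut_ge0.
  move=> w0; exact: (aut_le FG rk z0 w0 (hN G z FG z0 nT) hM).
have [_ FV] := CG; pose mu := fine (hyp F).
have muE : hyp F = mu%:E by rewrite /mu fineK // ge0_fin_numE.
have mu0 : 0 <= mu by rewrite fine_ge0.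
pose s := sf; have s0 : 0 < s by [].
(* The available gap; the mesh [d] of the net and the volume [e] of the remainder use up at most
   half of it each. *)
pose eta := q1 ^+ 2 - q0 ^+ 2.
have eta0 : 0 < eta by rewrite subr_gt0 ltr_pXn2r ?nnegrE ?ltW // (lt_trans q00).
pose d2 := eta / (4 * (s * mu + 1)).
have sm : 0 < s * mu + 1 by rewrite ltr_wpDl // mulr_ge0 // ltW.
have d20 : 0 < d2 by rewrite divr_gt0 // mulr_gt0.
pose d := Num.sqrt d2; have d0 : 0 < d by rewrite sqrtr_gt0.
have dd : d ^+ 2 = d2 by rewrite sqr_sqrtr // ltW.
pose e := eta / (2 * (s * B0 + 1)).
have sB : 0 < s * B0 + 1 by rewrite ltr_wpDl // mulr_ge0 // ltW.
have e0 : 0 < e by rewrite divr_gt0 // mulr_gt0.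
have [J hJ] := net_exhausts d0 e0.
pose v (k : 'I_J) := a (net_center k).
have Lv k : L2r G (v k) by apply: (aut_L2r CG rk); exact: net_center_upper.
exists J, v, (Num.sqrt (2 * (s * mu))); split=> // f Lf.
set U := \bigcup_(k in _) _ in hJ.
have mU : measurable U by apply: bigcup_measurable => k _; exact: measurable_net.
have mT := measurable_thin FG.
set Sg := \sum_j _; set n := nr f; have n0 : 0 <= n by exact: nrm_ge0.
have S0 : 0 <= Sg by apply: sumr_ge0.
have nE : ip f f = n ^+ 2 by rewrite (nrm_sq hs).
have LK := L2r_kint CG rk (mass_le_kk R) ltr01 Lf.
pose Q z : \bar R := (kint kk f z ^+ 2)%:E.
have Q0 z : (0 <= Q z)%E by rewrite lee_fin sqr_ge0.
have mQ : measurable_fun setT Q by exact: kint_sq_measurable.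
have mQD D : measurable_fun D Q by apply: (@measurable_funS _ _ _ _ setT).
have mFT : measurable (F `&` thin G) by exact: measurableI.
have mFU : measurable (F `&` U) by exact: measurableI.
have mFDU : measurable (F `\` U) by exact: measurableD.
have mR : measurable ((F `\` U) `\` thin G) by exact: measurableD.
have I1 : (\int[hyp]_(z in F `&` thin G) Q z <= (q0 ^+ 2 * (n ^+ 2 / s))%:E)%E.
  apply: le_trans (_ : (\int[hyp]_(z in F `&` thin G) ((\int[hyp]_(w in H) (kk (hypu z w) * `|f w|)%:E) ^+ 2) <= _)%E).
    apply: ge0_le_integral => //; last by move=> z [/fundom_upper z0 _]; exact: kint_le_abs.
    have [_ mf _] := Lf; have [_ kk0 _] := rk.
    have mI : measurable_fun setT (fun z => \int[hyp]_(w in H) (kk (hypu z w) * `|f w|)%:E)%E.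
      apply: (@measurable_hyp_integral _ _ _ _ (fun z w => (kk (hypu z w) * `|f w|)%:E)) => //.
        apply/measurable_EFinP; apply: measurable_funM; first exact: measurable_rkernel2.
        by apply: (measurableT_comp (@normr_measurable R setT)); apply: (measurableT_comp mf).
      by move=> z w; rewrite lee_fin mulr_ge0.
    apply: (@measurable_funS _ _ _ _ setT) => //; under eq_fun do rewrite expe2.
    exact: emeasurable_funM.
  by apply: le_trans (thin_bound CG Lf) _; rewrite (ipr_sq CG Lf) nE -EFinM lee_fin expr2.
have I2 : (\int[hyp]_(z in (F `\` U) `\` thin G) Q z <= (B0 * n ^+ 2 * e)%:E)%E.
  apply: integral_le_cst => //; first by rewrite mulr_ge0 // sqr_ge0.
    move=> z [[/fundom_upper z0 _] nT]; rewrite (kint_ipr CG rk z0 Lf).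
    apply: le_trans (cauchy_schwarz hs (aut_L2r CG rk z0) Lf) _.
    by rewrite nE ler_wpM2r ?sqr_ge0 // Bz.
  by apply: le_trans hJ; apply: le_measure; rewrite ?inE //; exact: subDsetl.
have I3 : (\int[hyp]_(z in F `&` U) Q z <= ((Sg + d * n) ^+ 2 * mu)%:E)%E.
  apply: integral_le_cst => //; first by rewrite sqr_ge0.
    move=> z [/fundom_upper z0 [k /= kJ hk]]; have La := aut_L2r CG rk z0.
    have Lk : L2r G (a (net_center k)) by apply: (aut_L2r CG rk); exact: net_center_upper.
    rewrite -[leLHS]real_normK ?num_real // ler_pXn2r ?nnegrE ?addr_ge0 ?mulr_ge0 ?(ltW d0) //.
    rewrite (kint_ipr CG rk z0 Lf) -[ip _ f](subrK (ip (a (net_center k)) f)) -(ipBl hs) //.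
    rewrite addrC; apply: le_trans (ler_normD _ _) _; apply: lerD.
      rewrite /Sg (bigD1 (Ordinal kJ)) //= lerDl; exact: sumr_ge0.
    apply: le_trans (ip_le_nrm hs (sipB hs La Lk) Lf) _.
    by rewrite ler_wpM2r // net_near.
  by rewrite -muE; apply: le_measure; rewrite ?inE //; exact: subIsetl.
have cover : (\int[hyp]_(z in F) Q z <= \int[hyp]_(z in F `&` thin G) Q z +
   (\int[hyp]_(z in (F `\` U) `\` thin G) Q z + \int[hyp]_(z in F `&` U) Q z))%E.
  have sub : F `<=` (F `&` thin G) `|` (((F `\` U) `\` thin G) `|` (F `&` U)).
    move=> z Fz; have [Tz|nT] := pselect (thin G z); first by left.
    by have [Uz|nU] := pselect (U z); [right; right|right; left].
  have mRU := measurableU _ _ mR mFU.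
  apply: le_trans (ge0_subset_integral _ mF (measurableU _ _ mFT mRU) (mQD _) (fun z _ => Q0 z) sub) _.
  have union A B : measurable A -> measurable B ->
      (\int[hyp]_(z in A `|` B) Q z <= \int[hyp]_(z in A) Q z + \int[hyp]_(z in B) Q z)%E.
    move=> mA mB; have -> : A `|` B = A `|` (B `\` A) by rewrite setDE setUIr setUCr setIT.
    rewrite ge0_integral_setU //; last 2 first.
    - exact: measurableD.
    - by rewrite disj_set2E setDE setICA setICr setI0.
    by rewrite leeD2l //; apply: ge0_subset_integral => //; exact: measurableD.
  apply: le_trans (union _ _ mFT mRU) _; rewrite leeD2l //; exact: union.
have tot : nr (kint kk f) ^+ 2 <= q0 ^+ 2 * n ^+ 2 + s * B0 * n ^+ 2 * e + s * mu * (Sg + d * n) ^+ 2.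
  rewrite (nrm_sq hs); have eqK := ipr_sq CG LK.
  have : ((ip (kint kk f) (kint kk f) / s)%:E <=
     (q0 ^+ 2 * (n ^+ 2 / s) + (B0 * n ^+ 2 * e + (Sg + d * n) ^+ 2 * mu))%:E)%E.
    by rewrite -eqK !EFinD; apply: le_trans cover _; apply: leeD => //; exact: leeD.
  rewrite lee_fin ler_pdivrMr // => /le_trans; apply.
  rewrite le_eqVlt; apply/orP; left; apply/eqP; field; exact: lt0r_neq0.
have hd : s * mu * (2 * d ^+ 2) <= eta / 2.
  rewrite dd /d2 (_ : s * mu * (2 * (eta / (4 * (s * mu + 1)))) = eta / 2 * ((s * mu) / (s * mu + 1))).
    by rewrite ger_pMr ?divr_gt0 // ler_pdivrMr // mul1r lerDl.
  by field; exact: lt0r_neq0.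
have he : s * B0 * e <= eta / 2.
  rewrite /e (_ : s * B0 * (eta / (2 * (s * B0 + 1))) = eta / 2 * ((s * B0) / (s * B0 + 1))).
    by rewrite ger_pMr ?divr_gt0 // ler_pdivrMr // mul1r lerDl.
  by field; exact: lt0r_neq0.
set C := Num.sqrt _; have C0 : 0 <= C by exact: sqrtr_ge0.
have smu : 0 <= s * mu by rewrite mulr_ge0 // ltW.
have CE : C ^+ 2 = 2 * (s * mu) by rewrite sqr_sqrtr // mulr_ge0.
have q10 : 0 <= q1 by apply: ltW; exact: lt_trans q01.
rewrite -(ler_pXn2r (n := 2)) ?nnegrE ?nrm_ge0 ?addr_ge0 ?mulr_ge0 //.
apply: le_trans tot _.
have h1 : (Sg + d * n) ^+ 2 <= 2 * Sg ^+ 2 + 2 * d ^+ 2 * n ^+ 2 by have := sqr_ge0 (Sg - d * n); nra.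
have h2 := ler_wpM2l smu h1.
have n20 : 0 <= n ^+ 2 by exact: sqr_ge0.
have h3 := ler_wpM2r n20 hd; have h4 := ler_wpM2r n20 he.
have h5 : 0 <= q1 * n * (C * Sg) by rewrite !mulr_ge0.
have -> : (q1 * n + C * Sg) ^+ 2 = q1 ^+ 2 * n ^+ 2 + 2 * (q1 * n * (C * Sg)) + 2 * (s * mu) * Sg ^+ 2.
  by rewrite -CE; ring.
move: h2 h3 h4; rewrite /eta; move: (s * mu) (s * B0) => x y h2 h3 h4.
have e1 : y * n ^+ 2 * e = y * e * n ^+ 2 by ring.
have e2 : x * (2 * Sg ^+ 2 + 2 * d ^+ 2 * n ^+ 2) = 2 * x * Sg ^+ 2 + x * (2 * d ^+ 2) * n ^+ 2 by ring.
rewrite e1; rewrite e2 in h2; lra.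
Qed.
End Fixed.
End ThickPart.

(** * The bound for the Green operator *)

Section OperatorNorm.
Variable R : realType.
Implicit Types (z w : R * R) (f g : R * R -> R) (u v : R * R -> R[i]).
Local Notation q0 := (@qthin R).
Variable G : set 'M[R]_2.
Hypothesis CG : cofinite_fuchsian G.
Let hs := sip_L2r CG.
Local Notation ip := (ipr G).
Local Notation nr := (nrm (ipr G)).
Variables (Delta : (R * R -> R[i]) -> (R * R -> R[i]) -> Prop)
  (S : (R * R -> R[i]) -> R * R -> R[i]) (gr : R * R -> R * R -> R).
Hypotheses (hD : laplacian G Delta) (hS : green_operator G Delta S) (hgr : green_function G S gr).
Local Notation SR := (SR S).

(** With [q1 = (1 + qthin) / 2], strictly between [qthin] and 1, the first entry is [1 / (1 - q1)].
    The group does not enter. *)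
Definition green_bound (eta : R) : R := Num.max (1 - (1 + q0) / 2)^-1 eta^-1.

Lemma green_bound_gt0 eta : 0 < eta -> 0 < green_bound eta.
Proof. by move=> e0; rewrite /green_bound lt_max [X in _ || X]invr_gt0 e0 orbT. Qed.

(** Inserting [compact_modulo_thin] into [nrm_SR_le] leaves [q1 |f|] on the right; absorbing it
    costs the factor [1 / (1 - q1)], and symmetry turns the functionals of [f = SR g] into
    functionals of [g]. The spectral alternative then applies, and an eigenvalue of [SR] above the
    bound would contradict the hypothesis on [eta]. *)
Theorem nrm_SR_bound (eta : R) : 0 < eta ->
  (forall l : R[i], eigenvalue_opp Delta l -> l <> 0 -> (eta%:C)%C <= l) ->
  forall g, L2r G g -> nr (SR g) <= green_bound eta * nr g.
Proof.
move=> eta0 heta; have /andP[q00 q01] := @qthin_itv R.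
have LS g : L2r G g -> L2r G (SR g) by exact: (L2r_SR CG hS).
pose q1 := (1 + q0) / 2; have q1q : q0 < q1 by rewrite /q1; lra.
have q11 : q1 < 1 by rewrite /q1; lra.
have r0 : 0 < 1 - q1 by lra.
have [n [v [C [Lv C0 hC]]]] := compact_modulo_thin CG q1q.
pose beta := (1 - q1)^-1; have b0 : 0 < beta by rewrite invr_gt0.
pose v' j := SR (v j).
have [M0 hM0] := SR_bounded CG hS.
have Lv' j : L2r G (v' j) by exact: LS.
have key g : L2r G g -> nr (SR g) <= beta * nr g + beta * C * \sum_j `|ip (v' j) g|.
  move=> Lg; have h1 := nrm_SR_le CG hD hS hgr Lg; have h2 := hC _ (LS _ Lg).
  have e : \sum_j `|ip (v j) (SR g)| = \sum_j `|ip (v' j) g|.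
    by apply: eq_bigr => j _; rewrite /v' (SR_sym CG hS (Lv j) Lg).
  rewrite e in h2; rewrite -mulrA -mulrDr /beta mulrC ler_pdivlMr // mulrC.
  move: h1 h2; move: (nr (SR g)) (nr (kint _ _)) (nr g) (C * _) => x y t s; nra.
have bB : 0 <= beta <= green_bound eta by rewrite ltW //= /green_bound le_max lexx.
have Cb : 0 <= beta * C by rewrite mulr_ge0 // ltW.
have [//|[h [l [Lh h0 Bl hl]]]] := spectral_alternative hs LS (fun f g => @SR_sym R G CG Delta S hS f g) hM0
  (L2r_complete CG) Lv' bB Cb key.
have B0 := green_bound_gt0 eta0.
have l0 : l != 0 by rewrite -normr_gt0; exact: lt_trans Bl.
have ev := eigen_transfer CG hD hS hgr Lh h0 l0 hl.
have ne : ((- l^-1)%:C)%C <> 0 :> R[i].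
  move=> /(congr1 (@complex.Re R)) /= /eqP; rewrite oppr_eq0 invr_eq0; exact/negP.
have := heta _ ev ne; rewrite lecE /= => /andP[_ le].
have l1 : eta <= `|l|^-1.
  by rewrite -normfV -normrN; apply: le_trans le (ler_norm _).
have : `|l| <= eta^-1 by rewrite -[ `|l| ]invrK lef_pV2 ?posrE ?invr_gt0 ?normr_gt0.
move=> l2; have : `|l| <= green_bound eta by rewrite /green_bound le_max l2 orbT.
by rewrite leNgt Bl.
Qed.
End OperatorNorm.

(** * The Green function *)

Section Pairing.
Variable R : realType.
Implicit Types (z w : R * R) (f : R * R -> R) (g h : 'M[R]_2).
Local Notation hyp := (@hyp_measure R).
Local Notation H := (upper_half R).
Local Notation kk := (@kk R).
Let rk := @rkernel_kk R.
Let rkn n : (8 <= n)%N -> rkernel (@kn R n).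
Proof. by move=> n8; apply: rkernel_kn; exact: leq_trans n8. Qed.
Let rbn n : (8 <= n)%N -> rkernel (@bn R n).
Proof. by move=> n8; apply: rkernel_bn; exact: leq_trans n8. Qed.
Variable G : set 'M[R]_2.
Hypothesis CG : cofinite_fuchsian G.
Let FG : fuchsian G. Proof. by case: CG. Qed.
Let sG : SL2_subgroup G. Proof. by case: FG. Qed.
Local Notation F := (fundom G).
Let mF : measurable F. Proof. exact: measurable_fundom. Qed.
Local Notation sf := (stack_factor G).
Let sf0 : 0 < sf. Proof. exact: stack_factor_gt0. Qed.
Let hs := sip_L2r CG.
Local Notation ip := (ipr G).
Local Notation nr := (nrm (ipr G)).
Let L1 : L2r G (fun=> 1). Proof. exact: L2r_1. Qed.

Lemma qint_aut k z (c : R) : rkernel k -> 0 < z.2 ->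
  (\int[hyp]_(w in H) (k (hypu z w))%:E = c%:E)%E -> qint G (aut G k z) = c.
Proof.
move=> kk z0 h; rewrite -(ipr_1 G); have := ipr_aut_pos CG kk z0 L1 (fun=> ler01).
under eq_integral => w _ do rewrite mulr1.
by rewrite h => -[].
Qed.

Lemma qint_aut_kk z : 0 < z.2 -> qint G (aut G kk z) = 1.
Proof.
move=> z0; apply: qint_aut => //.
have [_ kk0 _] := rk.
rewrite (@integral_radial R z (fun u => (kk u)%:E)) //; last first.
  by apply/measurable_EFinP; exact: rkernel_measurable.
by rewrite mass_kk -EFinM; congr _%:E; rewrite divff // gt_eqF // mulr_gt0 // pi_gt0.
Qed.

Lemma qint_aut_kn n z : (8 <= n)%N -> 0 < z.2 -> qint G (aut G (kn n) z) = 1.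
Proof.
by move=> n8 z0; apply: (qint_aut (rkn n8) z0); exact: (hyp_mass_kn (leq_trans (isT : (1 < 8)%N) n8) z0).
Qed.

Lemma qint_aut_bn n z : (8 <= n)%N -> 0 < z.2 -> 0 <= qint G (aut G (bn n) z) <= 1.
Proof.
move=> n8 z0; have n1 : (1 < n)%N by exact: leq_trans n8.
rewrite -(ipr_1 G); apply/andP; split.
  have [_ b0 _] := rbn n8.
  rewrite -lee_fin -(ipr_aut_pos CG (rbn n8) z0 L1 (fun=> ler01)).
  by apply: integral_ge0 => w _; rewrite lee_fin mulr1.
rewrite -[leRHS]mulr1; exact: (ipr_aut_le CG (rbn n8) (mass_le_bn R n1) z0 ler01 L1).
Qed.

(** The automorphic kernel of [kk] has total mass 1 and is at most [M], so [1 <= M vol]. *)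
Lemma vol_lower z (M : R) : 0 < z.2 -> (forall w, 0 < w.2 -> aut G kk z w <= M) ->
  0 < vol G /\ (vol G)^-1 <= M.
Proof.
move=> z0 aM; have M0 : 0 <= M by apply: le_trans (aM z z0); exact: aut_ge0.
have La := aut_L2r CG rk z0; have Lc := L2r_cst CG M.
have h : 1 <= M * vol G.
  rewrite -(qint_aut_kk z0) -subr_ge0 -(ipr_1 G) (vol_ipr G) (ipr_1 G) -(ipr_cst CG M L1) -(ipBl hs) //.
  rewrite ipr_1; apply: mulr_ge0; first exact: ltW.
  by apply: fine_ge0; apply: integral_ge0 => w /fundom_upper w0; rewrite lee_fin subr_ge0 aM.
have v0 : 0 < vol G.
  rewrite lt_neqAle (vol_ipr G) (sip_ge0 hs) andbT -(vol_ipr G).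
  by apply/eqP => v; move: h; rewrite -v mulr0 ler10.
by split=> //; rewrite -[leLHS]mul1r ler_pdivrMr.
Qed.

Lemma integrable_L2r f : L2r G f -> hyp.-integrable F (fun z => (f z)%:E).
Proof.
move=> Lf; have := L2r_integrable_mul CG Lf L1.
by apply: eq_integrable => // z _; rewrite mulr1.
Qed.

(* [aut G (kn n) z] has mass 1 and is supported near the orbit of z. *)
Lemma aut_kn_average n z f (c e : R) : (8 <= n)%N -> 0 < z.2 -> 0 <= e ->
  hyp.-integrable F (fun w => (f w)%:E) ->
  {ae hyp, forall w, F w -> forall g, G g -> hypu z (mobius g w) < 1 + 2 / n%:R -> `|f w - c| <= e} ->
  `|qint G (fun w => aut G (kn n) z w * f w) - c| <= e.
Proof.
move=> n8 z0 e0 If near; have kz := rkn n8; pose phi := aut G (kn n) z.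
have Lp : L2r G phi by exact: (aut_L2r CG kz).
have [_ mp _] := Lp; have p0 w : 0 <= phi w by exact: aut_ge0.
have [M hM] := aut_bounded FG kz z0.
have M0 : 0 <= M by apply: le_trans (hM z z0).
have mpF : measurable_fun F phi by apply: (@measurable_funS _ _ _ _ setT).
have mfF : measurable_fun F f by apply/measurable_EFinP; case/integrableP: If.
have Ipc : hyp.-integrable F (fun w => (phi w * c)%:E).
  by have := L2r_integrable_mul CG Lp (L2r_cst CG c).
have Ipf : hyp.-integrable F (fun w => (phi w * f w)%:E).
  apply: (le_integrable mF _ _ (integrableZl mF M If)).
    by apply/measurable_EFinP; exact: measurable_funM.
  move=> w /fundom_upper w0; rewrite -[(M%:E * _)%E]EFinM !abse_EFin lee_fin !normrM.
  by rewrite ler_wpM2r // (ger0_norm M0) hM.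
have E : qint G (fun w => phi w * f w) - c = sf * \int[hyp]_(w in F) (phi w * f w - phi w * c).
  rewrite RintegralB // mulrBr; congr (_ - _).
  have := ipr_cst CG c Lp; rewrite (qint_aut_kn n8 z0) mulr1 => {1}<-.
  by congr (_ * _); apply: eq_Rintegral => w _; rewrite mulrC.
rewrite E normrM (gtr0_norm sf0).
have Id := integrableB mF Ipf Ipc.
have h := le_normr_Rintegral mF Id.
have -> : e = sf * \int[hyp]_(w in F) (phi w * e).
  have := ipr_cst CG e Lp; rewrite (qint_aut_kn n8 z0) mulr1 => {1}<-.
  by congr (_ * _); apply: eq_Rintegral => w _; rewrite mulrC.
rewrite ler_pM2l //; apply: le_trans h _.
have Ie := L2r_integrable_mul CG Lp (L2r_cst CG e).
have Ia : hyp.-integrable F (fun w => (`|phi w * f w - phi w * c|)%:E).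
  by have := integrable_abse Id; apply: eq_integrable => // w _; rewrite /= abse_EFin.
rewrite /Rintegral fine_le ?(integrable_fin_num mF Ia) ?(integrable_fin_num mF Ie) //.
apply: ae_ge0_le_integral => //.
- by case/integrableP: Ia.
- by move=> w _; rewrite lee_fin mulr_ge0.
- by case/integrableP: Ie.
apply: filterS near => w hw Fw; have w0 := fundom_upper Fw.
rewrite lee_fin -mulrBr normrM (ger0_norm (p0 w)).
have [[g [Gg hg]]|no] := pselect (exists g, G g /\ kn n (hypu z (mobius g w)) != 0).
  rewrite ler_wpM2l // (hw Fw g Gg) //.
  by have /andP[] := kn_supp (leq_trans (isT : (0 < 8)%N) n8) hg.
suff -> : phi w = 0 by rewrite !mul0r.
rewrite /phi /aut esum1 // => g Gg; congr _%:E; apply/eqP; apply: contrapT => /negP hg.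
by apply: no; exists g.
Qed.

Variables (Delta : (R * R -> R[i]) -> (R * R -> R[i]) -> Prop)
  (S : (R * R -> R[i]) -> R * R -> R[i]) (gr : R * R -> R * R -> R).
Hypotheses (hD : laplacian G Delta) (hS : green_operator G Delta S) (hgr : green_function G S gr).
Local Notation SR := (SR S).
Variable B : R.
Hypotheses (B0 : 0 <= B) (hB : forall f, L2r G f -> nr (SR f) <= B * nr f).

Lemma kernel_pairing n z w : (8 <= n)%N -> 0 < z.2 -> 0 < w.2 ->
  ip (aut G (kn n) z) (SR (aut G (kn n) w)) + ip (aut G (kn n) z) (aut G (bn n) w) =
  ip (aut G kk z) (SR (aut G kk w)) - ip (aut G (bn n) z) (aut G kk w) +
  (mean G (aut G (bn n) z) + mean G (aut G (bn n) w)).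
Proof.
move=> n8 z0 w0.
have Lk x : 0 < x.2 -> L2r G (aut G kk x) by exact: aut_L2r.
have Ln x : 0 < x.2 -> L2r G (aut G (kn n) x) by apply: aut_L2r => //; exact: rkn.
have Lb x : 0 < x.2 -> L2r G (aut G (bn n) x) by apply: aut_L2r => //; exact: rbn.
have key x f : 0 < x.2 -> L2r G f -> ip (aut G kk x) (SR f) - ip (aut G (kn n) x) (SR f) =
    ip (aut G (bn n) x) f - mean G (aut G (bn n) x) * qint G f.
  move=> x0 Lf; have LS := L2r_SR CG hS Lf.
  have Ld := sipB hs (Lk x x0) (Ln x x0); have Lm := L2r_mean0 CG (Lb x x0).
  have LSd := L2r_SR CG hS Ld.
  rewrite -(ipBl hs (Lk x x0) (Ln x x0) LS) -(SR_sym CG hS Ld Lf).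
  have N := null_ipr CG (sipB hs LSd Lm) Lf (SR_kernel CG hD hS hgr n8 x0).
  move: N; rewrite (ipBl hs LSd Lm Lf) => /eqP; rewrite subr_eq0 => /eqP ->.
  by rewrite (ipr_mean0 CG (Lb x x0) Lf).
have k1 := key w _ w0 (Ln z z0); have k2 := key z _ z0 (Lk w w0).
rewrite (qint_aut_kn n8 z0) mulr1 in k1; rewrite (qint_aut_kk w0) mulr1 in k2.
rewrite -(SR_sym CG hS (Lk w w0) (Ln z z0)) -(SR_sym CG hS (Ln w w0) (Ln z z0)) in k1.
rewrite (sipC hs (SR (aut G kk w))) (sipC hs (SR (aut G (kn n) w))) (sipC hs (aut G (bn n) w)) in k1.
move: k1 k2; move: (ip _ _) (ip _ _) (ip _ _) (ip _ _) (mean _ _) (ip _ _) (mean _ _) => *; lra.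
Qed.

(** The automorphic kernel of [kk] has mass 1 and is at most [M], so its squared norm is at most
    [M], and the term with [SR] contributes [B M]. The pairing with [bn n] and the two means,
    bounded through the volume, contribute at most [M] each. Nothing depends on [n]. *)
Lemma kernel_pairing_bound n z w (M : R) : (8 <= n)%N -> 0 < z.2 -> 0 < w.2 ->
  (forall x, 0 < x.2 -> aut G kk z x <= M) -> (forall x, 0 < x.2 -> aut G kk w x <= M) ->
  `|ip (aut G (kn n) z) (SR (aut G (kn n) w)) + ip (aut G (kn n) z) (aut G (bn n) w)| <= (B + 3) * M.
Proof.
move=> n8 z0 w0 Mz Mw; have n1 : (1 < n)%N by exact: leq_trans n8.
have M0 : 0 <= M by apply: le_trans (Mz z z0); exact: aut_ge0.
have Lk x : 0 < x.2 -> L2r G (aut G kk x) by exact: aut_L2r.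
have a0 x y : 0 <= aut G kk x y by exact: aut_ge0.
have nk x : 0 < x.2 -> (forall y, 0 < y.2 -> aut G kk x y <= M) -> nr (aut G kk x) ^+ 2 <= M.
  move=> x0 xM; rewrite (nrm_sq hs) -[leRHS]mulr1.
  by apply: (ipr_aut_le CG rk (mass_le_kk R) x0 M0 (Lk x x0)).
rewrite (kernel_pairing n8 z0 w0).
have [v0 vM] := vol_lower z0 Mz.
have mb x : 0 < x.2 -> 0 <= mean G (aut G (bn n) x) <= M.
  move=> x0; have /andP[q0 q1] := qint_aut_bn n8 x0; have vi : 0 <= (vol G)^-1 by rewrite invr_ge0 ltW.
  rewrite /mean mulr_ge0 //=; apply: le_trans vM.
  by rewrite -[leRHS]mulr1 ler_wpM2l.
have /andP[m1 m2] := mb z z0; have /andP[m3 m4] := mb w w0.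
have p1 : 0 <= ip (aut G (bn n) z) (aut G kk w).
  rewrite -lee_fin -(ipr_aut_pos CG (rbn n8) z0 (Lk w w0) (a0 w)).
  have [_ b0 _] := rbn n8; by apply: integral_ge0 => x _; rewrite lee_fin mulr_ge0.
have p2 : ip (aut G (bn n) z) (aut G kk w) <= M.
  by rewrite -[leRHS]mulr1; apply: (ipr_aut_le CG (rbn n8) (mass_le_bn R n1) z0 M0 (Lk w w0)).
have p3 : `|ip (aut G kk z) (SR (aut G kk w))| <= B * M.
  apply: le_trans (ip_le_nrm hs (Lk z z0) (L2r_SR CG hS (Lk w w0))) _.
  apply: le_trans (_ : nr (aut G kk z) * (B * nr (aut G kk w)) <= _).
    by rewrite ler_wpM2l ?nrm_ge0 // hB //; exact: Lk.
  rewrite mulrCA ler_wpM2l //.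
  have := nk z z0 Mz; have := nk w w0 Mw; have := sqr_ge0 (nr (aut G kk z) - nr (aut G kk w)).
  by move: (nr _) (nr _) => x y; nra.
move: p3; rewrite !ler_norml; move: (ip _ _) (ip _ _) (mean _ _) (mean _ _) m1 m2 m3 m4 p1 p2 => x y a b m1 m2 m3 m4 p1 p2.
by move=> /andP[h1 h2]; apply/andP; split; lra.
Qed.
End Pairing.

(** * Recovering the Green function from averages *)

Section OffDiagonal.
Variable R : realType.
Implicit Types (z w : R * R) (f : R * R -> R) (g h : 'M[R]_2).
Local Notation kk := (@kk R).

Lemma orbit_separated (G : set 'M[R]_2) z w : fuchsian G -> 0 < z.2 -> 0 < w.2 ->
  exists2 t : R, 0 < t & forall g, G g -> mobius g z = w \/ 1 + t <= hypu w (mobius g z).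
Proof.
move=> FG z0 w0; have [[Gd _ _ _] _] := FG.
have [N hN] := fuchsian_count2 2 FG w0 z0.
have /finite_seqP[s sE] := count_le_finite hN.
pose v g := hypu w (mobius g z) - 1.
have [t ti ht] := seq_min [seq v g | g <- s & v g > 0] 1; exists t.
  move: ti; rewrite inE => /orP[/eqP ->|/mapP[g]] //.
  by rewrite mem_filter => /andP[v0 _] ->.
move=> g Gg; have gz := mobius_upper (Gd _ Gg) z0.
have [e|ne] := eqVneq (mobius g z) w; [by left|right].
have v0 : 0 < v g by rewrite subr_gt0 hypu_gt1 // eq_sym.
rewrite -lerBrDl -/(v g); have [u2|u2] := leP (hypu w (mobius g z)) 2; last first.
  apply: le_trans (ht 1 (mem_head _ _)) _; rewrite /v; lra.
apply: ht; rewrite inE; apply/orP; right; apply/mapP; exists g => //; rewrite mem_filter v0 /=.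
have : [set g | G g /\ hypu w (mobius g z) <= 2] g by [].
by rewrite sE.
Qed.

Lemma separated_near (G : set 'M[R]_2) z w z' w' (t : R) n : SL2_subgroup G -> 0 < z.2 -> 0 < w.2 ->
  0 < z'.2 -> 0 < w'.2 -> (8 <= n)%N -> 16 / n%:R <= t ->
  (forall g, G g -> 1 + t <= hypu w (mobius g z)) ->
  hypu z z' < 1 + 2 / n%:R -> hypu w w' < 1 + 2 / n%:R ->
  forall g, G g -> mobius g z' <> w' /\ 1 + 2 / n%:R <= hypu w (mobius g z').
Proof.
move=> [Gd _ _ _] z0 w0 z'0 w'0 n8 nt sep hz hw g Gg; have sg := Gd _ Gg.
have gz := mobius_upper sg z0; have gz' := mobius_upper sg z'0.
have k0 : 0 < 2 / n%:R :> R by rewrite divr_gt0 // ltr0n (leq_trans _ n8).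
have k1 : 2 / n%:R <= 1 :> R.
  by rewrite ler_pdivrMr ?ltr0n ?(leq_trans _ n8) // mul1r ler_nat (leq_trans _ n8).
have far : 1 + 2 / n%:R <= hypu w (mobius g z').
  rewrite leNgt; apply/negP => lt.
  have := hypu_triangle_sharp w0 gz' gz; rewrite (hypu_mobius sg z'0 z0) [hypu z' z]hypuC.
  have := sep g Gg; have := hypu_ge1 w0 gz'; have := hypu_ge1 z0 z'0.
  (* With [k = 2 / n <= 1] the sharp triangle inequality bounds [u - 1] by [6 k], below the
     separation [8 k]. *)
  have e : 16 / n%:R = 8 * (2 / n%:R) :> R by rewrite mulrA -natrM.
  rewrite e in nt.
  move: nt k0 k1 lt hz; move: (hypu _ _) (hypu _ _) (hypu _ _) (_ / _) => a b c k nt k0 k1 lt hz a1 b1 s h.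
  have : (c - 1) * (b - 1) <= k * 1 by apply: ler_pM; lra.
  lra.
split=> // e; by move: hw; rewrite -e ltNge far.
Qed.
Variable G : set 'M[R]_2.
Hypothesis CG : cofinite_fuchsian G.
Let FG : fuchsian G. Proof. by case: CG. Qed.
Let sG : SL2_subgroup G. Proof. by case: FG. Qed.
Let Gd g : G g -> SL2 g. Proof. by case: sG => + _ _ _; apply. Qed.
Local Notation ip := (ipr G).
Local Notation nr := (nrm (ipr G)).
Variables (Delta : (R * R -> R[i]) -> (R * R -> R[i]) -> Prop)
  (S : (R * R -> R[i]) -> R * R -> R[i]) (gr : R * R -> R * R -> R).
Hypotheses (hD : laplacian G Delta) (hS : green_operator G Delta S) (hgr : green_function G S gr).
Local Notation SR := (SR S).
Variable B : R.
Hypotheses (B0 : 0 <= B) (hB : forall f, L2r G f -> nr (SR f) <= B * nr f).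

Lemma off_diagonal_inv g h z w : G g -> G h -> 0 < z.2 -> 0 < w.2 ->
  off_diagonal G (mobius g z, mobius h w) -> off_diagonal G (z, w).
Proof.
have [_ _ GM GV] := sG.
move=> Gg Gh z0 w0 [/= _ _ nd]; split=> // -[k Gk kE]; apply: nd.
exists (g *m k *m invmx h); first by apply: (GM _ _ (GM _ _ Gg Gk)); exact: GV.
rewrite !mobiusM ?mobiusK ?kE //; try exact: Gd; try exact: SL2V (Gd _); try exact: mobius_upper (Gd _) _.
- by apply: SL2M; exact: Gd.
Qed.

Lemma gr_inv g h z w : G g -> G h -> 0 < z.2 -> 0 < w.2 ->
  off_diagonal G (mobius g z, mobius h w) -> gr z w = gr (mobius g z) (mobius h w).
Proof.
move=> Gg Gh z0 w0 od; have [inv _ _ _ _] := hgr.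
have o1 := off_diagonal_inv Gg Gh z0 w0 od.
have gz0 := mobius_upper (Gd Gg) z0; have [_ G1 _ _] := sG.
have o2 : off_diagonal G (mobius g z, w).
  apply: (@off_diagonal_inv 1%:M h) => //; by rewrite mobius1.
by have [_ ->] := inv h _ _ Gh o2; have [-> _] := inv g _ _ Gg o1.
Qed.

(** For suitable [n] the two terms on the left of [kernel_pairing] differ by at most 1 each from
    [gr z w] and from the automorphic kernel of [bn], whence the summand 2. *)
Lemma green_near z w (M : R) : off_diagonal G (z, w) ->
  (forall x, 0 < x.2 -> aut G kk z x <= M) -> (forall x, 0 < x.2 -> aut G kk w x <= M) ->
  exists n, [/\ (8 <= n)%N, forall g, G g -> 1 + 2 / n%:R <= hypu z (mobius g w) &
    `|gr z w + aut G (bn n) z w| <= (B + 3) * M + 2].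
Proof.
move=> od Mz Mw; have [/= z0 w0 nd] := od.
have [_ G1 GM GV] := sG.
have [t t0 sep'] := orbit_separated FG z0 w0.
have sep g : G g -> 1 + t <= hypu w (mobius g z).
  move=> Gg; case: (sep' g Gg) => // e; exfalso; apply: nd; exists (invmx g); first exact: GV.
  by rewrite -e mobiusK //; exact: Gd.
have big (x : R) : exists N : nat, forall n, (N <= n)%N -> x <= n%:R.
  exists (Num.truncn x).+1 => n hn; apply: le_trans (ltW (truncnS_gt x)) _; by rewrite ler_nat.
have [N0 hN0] := big (16 / t).
(* This index is fixed before the averaging index [n]: the averaged function itself depends on [n],
   but near z, which is separated from the orbit of w, it coincides with the one for [n1]. *)
pose n1 := (N0 + 8)%N; have n18 : (8 <= n1)%N by rewrite leq_addl.
have small n : (n1 <= n)%N -> 16 / n%:R <= t.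
  move=> hn; have np : 0 < n%:R :> R by rewrite ltr0n (leq_trans _ (leq_trans n18 hn)).
  rewrite ler_pdivrMr // mulrC -ler_pdivrMr //; apply: hN0; apply: leq_trans hn; exact: leq_addr.
have near n z' w' : (n1 <= n)%N -> 0 < z'.2 -> 0 < w'.2 -> hypu z z' < 1 + 2 / n%:R ->
    hypu w w' < 1 + 2 / n%:R -> forall g, G g -> mobius g z' <> w' /\ 1 + 2 / n%:R <= hypu w (mobius g z').
  move=> hn z'0 w'0; exact: (separated_near sG z0 w0 z'0 w'0 (leq_trans n18 hn) (small _ hn) sep).
have two n : (n1 <= n)%N -> 0 < 2 / n%:R :> R.
  by move=> hn; rewrite divr_gt0 // ltr0n (leq_trans _ (leq_trans n18 hn)).
have [_ _ smo _ [Igr Sgr]] := hgr.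
have [c0 _] := smo 0%N; have cgr := c0 _ od.
have /= [[A1 A2] /= [nA1 nA2] hA] : nbhs (z, w) [set p | `|gr p.1 p.2 - gr z w| <= 1].
  have /cvgrPdist_le /(_ 1 ltr01) := cgr; by apply: filterS => p; rewrite distrC.
have [N1 hN1] := hypu_near z0 nA1; have [N2 hN2] := hypu_near w0 nA2.
have rb n : (8 <= n)%N -> rkernel (@bn R n) by move=> n8; apply: rkernel_bn; exact: leq_trans n8.
have rn n : (8 <= n)%N -> rkernel (@kn R n) by move=> n8; apply: rkernel_kn; exact: leq_trans n8.
pose psi n := aut G (bn n) w.
have [N3 hN3] : exists N, forall n, (N <= n)%N -> forall x, 0 < x.2 -> hypu z x < 1 + 2 / n%:R ->
    [set y | `|psi n1 y - psi n1 z| <= 1] x.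
  apply: hypu_near => //; have [c _] := smooth_aut FG (rb _ n18) w0 0.
  by have /cvgrPdist_le /(_ 1 ltr01) := c z z0; apply: filterS => y; rewrite distrC.
have [n [nn1 nN1 nN2 nN3]] : exists n, [/\ (n1 <= n)%N, (N1 <= n)%N, (N2 <= n)%N & (N3 <= n)%N].
  by exists (maxn (maxn n1 N1) (maxn N2 N3)); rewrite !leq_max !leqnn ?orbT.
have n8 : (8 <= n)%N by exact: leq_trans nn1.
have Ln x : 0 < x.2 -> L2r G (aut G (kn n) x) by apply: (aut_L2r CG); exact: rn.
(* A double average of [gr]. The representation of [S] by [gr] holds for almost every [z'] only,
   which [aut_kn_average] allows; the inner average in [w'] is then taken for such a [z']. *)
have T1 : `|ip (aut G (kn n) z) (SR (aut G (kn n) w)) - gr z w| <= 1.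
  have LS := L2r_SR CG hS (Ln w w0).
  apply: (aut_kn_average CG n8 z0 ler01 (integrable_L2r CG LS)).
  have sb := smooth_bounded_aut CG (rn _ n8) w0.
  apply: filterS (Sgr _ sb) => z' hz' Fz' g Gg hgz.
  have z'0 := fundom_upper Fz'; have gz0 := mobius_upper (Gd Gg) z'0.
  have -> : SR (aut G (kn n) w) z' = qint G (fun w' => aut G (kn n) w w' * gr z' w').
    rewrite /SR /re z'0 hz' /qintC /=; congr (_ * _); apply: eq_Rintegral => w' _.
    by rewrite mulr0 subr0 mulrC.
  apply: (aut_kn_average CG n8 w0 ler01 (Igr _ z'0)); apply: aeW => w' Fw' h Gh hhw.
  have w'0 := fundom_upper Fw'; have hw0 := mobius_upper (Gd Gh) w'0.
  have od' : off_diagonal G (mobius g z', mobius h w').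
    split=> //= -[k Gk kE]; have [ne _] := near n _ _ nn1 gz0 hw0 hgz hhw (invmx k) (GV _ Gk).
    by apply: ne; rewrite -kE mobiusK //; exact: Gd.
  rewrite (gr_inv Gg Gh z'0 w'0 od').
  by apply: (hA (mobius g z', mobius h w')); split=> /=; [exact: (hN1 n)|exact: (hN2 n)].
(* Near z the kernels for [n] and [n1] agree by [bn_far], so continuity of the fixed function
   [psi n1] suffices. *)
have T2 : `|ip (aut G (kn n) z) (psi n) - psi n1 z| <= 1.
  have Lp : L2r G (psi n) by apply: (aut_L2r CG) => //; exact: rb.
  apply: (aut_kn_average CG n8 z0 ler01 (integrable_L2r CG Lp)); apply: aeW => z' Fz' g Gg hgz.
  have z'0 := fundom_upper Fz'; have gz0 := mobius_upper (Gd Gg) z'0.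
  have -> : psi n z' = psi n1 (mobius g z').
    rewrite -[LHS](aut_invr FG w (rb _ n8) Gg z'0) /psi /aut; congr fine; apply: eq_esum => h Gh.
    congr _%:E; apply: bn_far => //; first exact: leq_trans n18.
    have hz1 : hypu z (mobius g z') < 1 + 2 / n1%:R.
      apply: lt_le_trans hgz _.
      have p0 : 0 < n%:R :> R by rewrite ltr0n (leq_trans _ n8).
      have p1 : 0 < n1%:R :> R by rewrite ltr0n (leq_trans _ n18).
      by rewrite lerD2l ler_wpM2l // lef_pV2 ?posrE // ler_nat.
    have hw1 : hypu w w < 1 + 2 / n1%:R by rewrite hypuxx ltrDl two.
    by have [] := near n1 _ _ (leqnn _) gz0 w0 hz1 hw1 h Gh.
  exact: hN3 nN3 _ gz0 hgz.
exists n1; split=> //.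
  move=> g Gg; have hz1 : hypu z z < 1 + 2 / n1%:R by rewrite hypuxx ltrDl two.
  have hw1 : hypu w w < 1 + 2 / n1%:R by rewrite hypuxx ltrDl two.
  have [_] := near n1 _ _ (leqnn _) z0 w0 hz1 hw1 (invmx g) (GV _ Gg).
  have sg := Gd Gg; have gw0 := mobius_upper sg w0.
  by rewrite -(hypu_mobius sg w0 (mobius_upper (SL2V sg) z0)) mobiusVK // hypuC.
have T3 := kernel_pairing_bound CG hD hS hgr B0 hB n8 z0 w0 Mz Mw.
rewrite (aut_sym FG (rb _ n18) z0 w0) -/(psi n1) -/(psi n) in T3 *.
move: T1 T2 T3; rewrite -/(psi n); move: (ip _ _) (ip _ _) (psi n1 z) (gr z w) ((B + 3) * M) => a b c d e.
by rewrite !ler_norml => /andP[? ?] /andP[? ?] /andP[? ?]; apply/andP; split; lra.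
Qed.
End OffDiagonal.

(** * Compact sets and the extension to the diagonal *)

Section GreenSum.
Variable R : realType.
Implicit Types (z w : R * R) (f : R * R -> R) (g h : 'M[R]_2).
Local Notation i := ((0, 1) : R * R).

Lemma open_disc z (c : R) : 0 < z.2 -> open [set w | 0 < w.2 /\ hypu z w < c].
Proof.
move=> z0; rewrite openE => w [w0 wc]; have [cont _] := smooth_hypu 0 z0.
have /cvgrPdist_lt /(_ (c - hypu z w)) := cont w w0; rewrite subr_gt0 => /(_ wc) near.
have nH : \forall y \near w, upper_half R y by exact: (open_nbhs_nbhs (conj (@open_upper_half R) w0)).
apply: filterS (filterI near nH) => y [h1 h2]; split=> //.
by have := ler_norm (- (hypu z w - hypu z y)); rewrite normrN => /le_lt_trans /(_ h1); lra.
Qed.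

(** The images of the discs about i are open, increase and cover the orbit space, so one of them
    contains the compact set. *)
Lemma compact_lift (G0 : set 'M[R]_2) (Y0 : set (orbit_space G0)) : SL2_subgroup G0 -> compact Y0 ->
  exists r : R, forall z : upper_half R, Y0 (to_orbit_space G0 z) ->
    exists2 g, G0 g & hypu i (mobius g (\val z)) <= r.
Proof.
move=> [Gd G1 GM GV] cY; apply: contrapT => nex.
pose V (k : nat) : set (upper_half R) := [set z | exists2 g, G0 g & hypu i (mobius g (\val z)) < k%:R].
pose U k : set (orbit_space G0) := [set to_orbit_space G0 z | z in V k].
have up (z : upper_half R) : 0 < (\val z).2 by have := set_valP z; rewrite /upper_half.
have pre k : to_orbit_space G0 @^-1` U k = V k.
  apply/seteqP; split=> z; last by exists z.
  move=> [z' [g Gg hg] /eqmodP /asboolP E].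
  have : mobius_orbit G0 (\val z') (\val z') by exists 1%:M; rewrite ?mobius1.
  rewrite E => -[h Gh hE]; exists (g *m h); first exact: GM.
  by rewrite mobiusM ?hE //; exact: Gd.
have oV k : open (V k).
  pose W : set (R * R) := \bigcup_(g in G0) [set z | 0 < z.2 /\ hypu (mobius (invmx g) i) z < k%:R].
  have oW : open W.
    apply: bigcup_open => g Gg; apply: open_disc; apply: mobius_upper => //.
    by apply: SL2V; exact: Gd.
  have -> : V k = (set_val : upper_half R -> R * R) @^-1` W.
    have e g z : G0 g -> 0 < z.2 -> hypu (mobius (invmx g) i) z = hypu i (mobius g z).
      move=> Gg z0; have sg := Gd _ Gg.
      by rewrite -(hypu_mobius sg (mobius_upper (SL2V sg) (ltr01 : 0 < i.2)) z0) mobiusVK.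
    apply/seteqP; split=> z [g Gg].
      move=> hg; exists g => //; split; first exact: (up z).
      by have := hg; rewrite -(e g _ Gg (up z)).
    by move=> [_ hg]; exists g => //; rewrite -(e g _ Gg (up z)).
  by apply: open_comp => // z _; exact: initial_continuous.
have oU k : open (U k) by rewrite /open /= /quotient_open pre.
(* If no image contains [Y0], the complements generate a proper filter on [Y0]; a cluster point of
   it would lie in none of the open sets. *)
pose Fi : set_system (orbit_space G0) := [set A | exists k, Y0 `\` U k `<=` A].
have mono k l : (k <= l)%N -> U k `<=` U l.
  move=> kl q [z [g Gg hg] <-]; exists z => //; exists g => //.
  by apply: lt_le_trans hg _; rewrite ler_nat.
have FF : ProperFilter Fi.
  split.
    move=> [k hk]; apply: nex; exists k%:R => z Yz.
    have [|nU] := pselect (U k (to_orbit_space G0 z)); last by case: (hk _ (conj Yz nU)).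
    move=> Uz; have : (to_orbit_space G0 @^-1` U k) z by [].
    by rewrite pre => -[g Gg /ltW]; exists g.
  split; first by exists 0%N.
    move=> A A' [k hk] [l hl]; exists (maxn k l) => q [Yq nU]; split.
      by apply: hk; split=> // /(mono _ _ (leq_maxl k l)).
    by apply: hl; split=> // /(mono _ _ (leq_maxr k l)).
  by move=> A A' AA' [k hk]; exists k; exact: subset_trans AA'.
have FY : Fi Y0 by exists 0%N => q [].
have [q [Yq cq]] := cY Fi FF FY.
have [z Ez] : exists z : upper_half R, to_orbit_space G0 z = q by exists (repr q); rewrite /to_orbit_space reprK.
pose k := (Num.truncn (hypu i (\val z))).+1.
have Uq : U k q.
  by exists z => //; exists 1%:M => //; rewrite mobius1 truncnS_gt.
have [] := cq (Y0 `\` U k) (U k); [by exists k|exact: open_nbhs_nbhs|].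
by move=> q' [[_ nU] Uq'].
Qed.

Section Fixed.
Variable G : set 'M[R]_2.
Hypothesis FG : fuchsian G.

(** A comparison term by term. The maximum of 3 and [delta] covers both the support of [bn n] and
    the range of the sum, so at most [N] terms contribute. *)
Lemma aut_bn_green (delta C : R) n z w N : 0 < z.2 -> 0 < w.2 -> (8 <= n)%N ->
  (forall n u, (1 < n)%N -> 1 + 2 / n%:R <= u -> 1 < u ->
     `|bn n u - (if u <= delta then hypL u - hypL delta else 0)| <= C) -> 0 <= C ->
  (forall g, G g -> 1 + 2 / n%:R <= hypu z (mobius g w)) ->
  count_le [set g | G g /\ hypu z (mobius g w) <= Num.max 3 delta] N ->
  `|aut G (bn n) z w - \sum_(g \in [set g | G g /\ hypu z (mobius g w) <= delta])
      (hypL (hypu z (mobius g w)) - hypL delta)| <= N%:R * C.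
Proof.
move=> z0 w0 n8 hC C0 far hN; have n1 : (1 < n)%N by exact: leq_trans n8.
have [_ b0 _] := @rkernel_bn R _ n1.
set A := [set g | _] in hN; have fA := count_le_finite hN.
pose s := fset_set A; have sA g : (g \in s) = (g \in A) by rewrite in_fset_set.
pose D (u : R) := if u <= delta then hypL u - hypL delta else 0.
have -> : aut G (bn n) z w = \sum_(g <- s) bn n (hypu z (mobius g w)).
  rewrite /aut (@esum_seq _ _ G s) //.
  - by rewrite sumEFin.
  - by move=> g; rewrite sA inE => -[].
  - move=> g Gg; rewrite sA => /negP nA; congr _%:E; apply: bn_supp => //.
    rewrite leNgt; apply/negP => lt; apply: nA; rewrite inE; split=> //.
    by rewrite le_max (ltW lt).
  - by move=> g; rewrite lee_fin.
have -> : \sum_(g \in [set g | G g /\ hypu z (mobius g w) <= delta]) (hypL (hypu z (mobius g w)) - hypL delta)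
    = \sum_(g <- s) D (hypu z (mobius g w)).
  rewrite (eq_fsbigr (fun g => D (hypu z (mobius g w)))); last first.
    by move=> g; rewrite inE => -[_ h]; rewrite /D h.
  rewrite (fsbig_widen _ A); first exact: fsbig_finite.
    by move=> g [Gg h]; split=> //; rewrite le_max h orbT.
  move=> g [[Gg _] nh]; rewrite /= /D; case: ifP => // h; by case: nh.
rewrite -sumrB; apply: le_trans (ler_norm_sum _ _ _) _.
apply: le_trans (_ : \sum_(g <- s) C <= _).
  rewrite big_seq [leRHS]big_seq; apply: ler_sum => g; rewrite sA inE => -[Gg _].
  apply: hC => //; first exact: far.
  apply: lt_le_trans (far g Gg); rewrite ltrDl divr_gt0 // ltr0n; exact: leq_trans n8.
rewrite big_const_seq count_predT iter_addr_0 -[C *+ _]mulr_natl ler_wpM2r // ler_nat.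
exact: count_le_fset.
Qed.

(** A small horizontal shift of z leaves the orbit of w, whose points other than z stay at a
    definite distance. This makes the filter in [green_sum_ext] proper. *)
Lemma off_diagonal_closure z w : 0 < z.2 -> 0 < w.2 -> closure (off_diagonal G) (z, w).
Proof.
move=> z0 w0 U nU; have [[A1 A2] /= [nA1 nA2] hA] := nU.
have [N hN] := hypu_near z0 nA1.
have [t t0 ht] := orbit_separated FG w0 z0.
have k0 : 0 < 2 / N.+1%:R :> R by rewrite divr_gt0.
pose x : R := Num.min 1 (Num.min (2 / N.+1%:R) t).
have x0 : 0 < x by rewrite !lt_min ltr01 k0 t0.
have x1 : x <= 1 by rewrite ge_min lexx.
have xk : x <= 2 / N.+1%:R by rewrite !ge_min lexx orbT.
have xt : x <= t by rewrite !ge_min lexx !orbT.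
pose z' : R * R := (z.1 + z.2 * x, z.2).
have uE : hypu z z' = 1 + x ^+ 2 / 2 by rewrite /hypu /sqdist /=; field; rewrite gt_eqF.
have ux : x ^+ 2 / 2 < x.
  have : x ^+ 2 <= x by rewrite expr2 ger_pMl.
  by lra.
have u0 : 0 < x ^+ 2 / 2 by rewrite divr_gt0 // exprn_gt0.
exists (z', w); split.
  split=> //= -[g Gg gE]; case: (ht g Gg); rewrite gE.
    by move=> e; move: uE; rewrite e hypuxx; lra.
  by rewrite uE; lra.
apply: hA; split=> /=; last exact: nbhs_singleton.
apply: (hN N.+1) => //; rewrite uE; move: xk; move: (2 / _) => k; lra.
Qed.
End Fixed.
End GreenSum.

Lemma green_sum_bound (R : realType) (G : set 'M[R]_2) (Delta : (R * R -> R[i]) -> (R * R -> R[i]) -> Prop)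
    (S : (R * R -> R[i]) -> R * R -> R[i]) (gr : R * R -> R * R -> R) (delta B C M : R) (N : nat) (z w : R * R) :
  cofinite_fuchsian G -> laplacian G Delta -> green_operator G Delta S -> green_function G S gr ->
  0 <= B -> (forall f, L2r G f -> nrm (ipr G) (SR S f) <= B * nrm (ipr G) f) ->
  (forall n (u : R), (1 < n)%N -> 1 + 2 / n%:R <= u -> 1 < u ->
     `|bn n u - (if u <= delta then hypL u - hypL delta else 0)| <= C) -> 0 <= C ->
  (forall u : R, 0 <= u -> kk u <= M) -> off_diagonal G (z, w) ->
  (forall x, x = z \/ x = w -> count_le [set g | G g /\
     hypu x (mobius g x) <= 2 * Num.max 3 delta * Num.max 3 delta] N) ->
  `|green_sum G gr delta (z, w)| <= (B + 3) * (N%:R * M) + 2 + N%:R * C.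
Proof.
move=> CG hD hS hgr B0 hB hC C0 hM od hN; have [FG _] := CG; have [sG _] := FG.
have [/= z0 w0 _] := od; have m3 : 3 <= Num.max 3 delta by rewrite le_max lexx.
have aM x : x = z \/ x = w -> 0 < x.2 -> forall y, 0 < y.2 -> aut G (@kk R) x y <= N%:R * M.
  move=> xzw x0 y y0; apply: (aut_le FG (rkernel_kk R) x0 y0 _ hM).
  apply: count_leS (hN x xzw) => g [Gg h]; split=> //; apply: le_trans h _.
  have : 3 * 3 <= Num.max 3 delta * Num.max 3 delta by apply: ler_pM.
  by rewrite -mulrA; move: (_ * Num.max _ _) => y1; lra.
have [n [n8 far near]] := green_near CG hD hS hgr B0 hB od (aM z (or_introl erefl) z0) (aM w (or_intror erefl) w0).
have h := aut_bn_green z0 w0 n8 hC C0 far (count_translate sG z0 w0 (hN z (or_introl erefl))).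
have tri (x a s e1 e2 : R) : `|x + a| <= e1 -> `|a - s| <= e2 -> `|x + s| <= e1 + e2.
  move=> h1 h2; have -> : x + s = (x + a) - (a - s) by ring.
  by apply: le_trans (ler_normB _ _) _; exact: lerD.
exact: tri near h.
Qed.

(** Conjugation by an element of [G0] that brings z near i maps the elements to be counted
    injectively into [G0], so one count for [G0] at i serves all subgroups. Points with [u <= 2]
    from z are included because the extension to the diagonal is a limit over nearby points. *)
Lemma uniform_count (R : realType) (G0 : set 'M[R]_2) (Y0 : set (orbit_space G0)) (c : R) :
  fuchsian G0 -> compact Y0 -> 0 <= c -> exists N, forall (G : set 'M[R]_2) (z : upper_half R) z',
  SL2_subgroup G -> G `<=` G0 -> Y0 (to_orbit_space G0 z) -> 0 < z'.2 -> hypu (\val z) z' <= 2 ->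
  count_le [set g | G g /\ hypu z' (mobius g z') <= c] N.
Proof.
move=> FG0 cY c0; have [sG0 _] := FG0; have [Gd _ GM GV] := sG0.
have [r hr] := compact_lift sG0 cY.
have i0 : 0 < ((0, 1) : R * R).2 by [].
(* Two uses of [count_near]: from [z'] to z with [u <= 2], and from the translate of z to i with
   [u <= r]. *)
have [N hN] := fuchsian_count (4 * r * r * (4 * 2 * 2 * c)) FG0 i0.
exists N => G z z' sG GG0 Yz z'0 hz'; have z0 : 0 < (\val z).2 by have := set_valP z.
have FG : fuchsian G by exact: fuchsian_sub GG0.
apply: count_leS (count_near sG z0 z'0 c0 hz') _.
have [k G0k hk] := hr z Yz; have sk := Gd _ G0k; have kz := mobius_upper sk z0.
have uk := SL2_unit sk.
have c16 : 0 <= 4 * 2 * 2 * c by rewrite !mulr_ge0.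
have near := count_leS (count_near sG0 i0 kz c16 hk) hN.
apply: (count_le_inj (f := fun g => k *m g *m invmx k)) near.
  move=> g [Gg h]; have G0g := GG0 _ Gg; have sg := Gd _ G0g; split.
    by apply: (GM _ _ (GM _ _ G0k G0g)); exact: GV.
  rewrite !mobiusM ?mobiusK ?hypu_mobius //; try exact: SL2V; try exact: SL2M.
  exact: mobius_upper.
move=> g g' _ _ /= /(congr1 (fun x => invmx k *m x *m k)).
by rewrite !mulmxA mulVmx // !mul1mx -!mulmxA mulVmx // !mulmx1.
Qed.

Local Open Scope complex_scope.

Theorem theorem1p1 (R : realType) (G0 : set 'M[R]_2)
  (Y0 : set (orbit_space G0)) (delta eta : R) :
  cofinite_fuchsian G0 -> compact Y0 -> 1 < delta -> 0 < eta ->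
  exists A B : R,
    forall (G : set 'M[R]_2)
      (Delta : (R * R -> R[i]) -> (R * R -> R[i]) -> Prop)
      (S : (R * R -> R[i]) -> R * R -> R[i])
      (gr : R * R -> R * R -> R),
    SL2_subgroup G -> finite_index_in G0 G ->
    laplacian G Delta ->
    (forall l : R[i], eigenvalue_opp Delta l -> l <> 0 -> eta%:C <= l) ->
    green_operator G Delta S ->
    green_function G S gr ->
    forall z w : upper_half R,
      Y0 (to_orbit_space G0 z) -> Y0 (to_orbit_space G0 w) ->
      A <= green_sum_ext G gr delta (\val z) (\val w) <= B.
Proof.
move=> CG0 cY d1 eta0; have [FG0 _] := CG0.
have [M _ hM] := rkernel_bounded (rkernel_kk R).
have [C hC] := bn_hypL d1.
pose c := 2 * Num.max 3 delta * Num.max 3 delta.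
have m0 : 0 <= Num.max 3 delta by rewrite le_max ler0n.
have c0 : 0 <= c by rewrite !mulr_ge0.
have [N hN] := uniform_count FG0 cY c0.
have B0 := green_bound_gt0 eta0.
pose K := (green_bound eta + 3) * (N%:R * M) + 2 + N%:R * `|C|.
(* The interval is enlarged to contain [point], the default value of [lim], so that it covers both
   cases for the limit at the diagonal. *)
exists (Num.min (- K) point), (Num.max K point).
move=> G Delta S gr sG ix hD heta hS hgr z w Yz Yw.
have [GG0 _] := ix; have FG := fuchsian_sub FG0 sG GG0.
have CG := cofinite_sub CG0 sG ix FG.
have hB := nrm_SR_bound CG hD hS hgr eta0 heta.
have z0 : 0 < (\val z).2 by have := set_valP z.
have w0 : 0 < (\val w).2 by have := set_valP w.
(* The bound is stated in a neighbourhood of the given pair, so that it passes to the limit at the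
   diagonal. *)
have key z' w' : hypu (\val z) z' <= 2 -> hypu (\val w) w' <= 2 -> off_diagonal G (z', w') ->
    `|green_sum G gr delta (z', w')| <= K.
  move=> hz hw od; have [/= z'0 w'0 _] := od.
  apply: (green_sum_bound CG hD hS hgr (ltW B0) hB _ (normr_ge0 C) hM od).
    by move=> n u n1 u1 u2; apply: le_trans (hC n u n1 u1 u2) (ler_norm _).
  by move=> x [->|->]; [exact: (hN G z)|exact: (hN G w)].
rewrite /green_sum_ext; case: asboolP => od.
  have : `|green_sum G gr delta (\val z, \val w)| <= K by apply: key; rewrite ?hypuxx ?ler1n.
  by rewrite ler_norml => /andP[h1 h2]; rewrite ge_min le_max h1 h2.
have pf := within_nbhs_proper (off_diagonal_closure FG z0 w0).
set Fi := within _ _ in pf *.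
have near : \forall p \near Fi, - K <= green_sum G gr delta p <= K.
  have nU : nbhs (\val z, \val w) (disc2 (\val z) `*` disc2 (\val w)).
    have nd (x : R * R) : 0 < x.2 -> nbhs x (disc2 x).
      by move=> x0; apply: open_nbhs_nbhs; split; [exact: open_disc2|split=> //=; rewrite hypuxx ltr1n].
    by exists (disc2 (\val z), disc2 (\val w)) => //; split; exact: nd.
  apply: filterS nU => -[z' w'] /= [[_ hz] [_ hw]] od'.
  by rewrite -ler_norml; apply: key => //; exact: ltW.
have [cv|ncv] := pselect (cvg (green_sum G gr delta @ Fi)); last first.
  (* Without a limit, [lim] is the junk value [point]. *)
  by rewrite (dvgP ncv) ge_min le_max lexx !orbT.
apply/andP; split.
  rewrite ge_min; apply/orP; left; apply: (cvgr_to_ge cv).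
  by apply: filterS near => p /andP[].
rewrite le_max; apply/orP; left; apply: (cvgr_to_le cv).
by apply: filterS near => p /andP[].
Qed.
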